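(* Let $p>2$ and $\alpha\in\mathbb{R}$. Then: (i) for $\omega\in\mathbb{R}$, a minimizer of the action at frequency $\omega$, i.e. a function $u\in N_\omega$ such that $S_\omega(u)=d(\omega)$, exists if and only if $\omega>\omega_0:=4e^{-4\pi\alpha-2\gamma}$; (ii) if $u$ is a minimizer of the action at frequency $\omega>\omega_0$, written as $u=\phi_\lambda+q\mathcal{G}_\lambda$ for $\lambda>0$, then: (a) for any $\lambda>0$ both $\phi_\lambda$ and $q$ are not identically zero; (b) up to multiplication by a constant phase factor, $u$ is positive, radially symmetric, and decreasing along the radial direction; in particular (with the same choice of phase), $\phi_\lambda$ is nonnegative if $\lambda=\omega$, and positive if $\lambda>\omega$.
   Context: Functions on $\mathbb{R}^2$ are complex valued and $\|\cdot\|_p$ is the norm of $L^p(\mathbb{R}^2)$. For $\lambda>0$, $\mathcal{G}_\lambda(\mathbf{x})=\frac{1}{2\pi}K_0(\sqrt{\lambda}|\mathbf{x}|)$ is the Green's function of $-\Delta+\lambda$ on $\mathbb{R}^2$ ($K_0$ is the modified Bessel function of the second kind of order $0$; $\mathcal{G}_\lambda$ is singular at the origin, so pointwise statements refer to $\mathbb{R}^2\setminus\{0\}$), and $$\theta_\lambda:=\frac{\log\left(\frac{\sqrt{\lambda}}{2}\right)+\gamma}{2\pi},$$ with $\gamma$ the Euler-Mascheroni constant. The energy space is $$D:=\{v\in L^2(\mathbb{R}^2):\exists q\in\mathbb{C},\ \lambda>0 \text{ such that } v-q\mathcal{G}_\lambda=:\phi_\lambda\in H^1(\mathbb{R}^2)\}.$$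 For $v\in D$ the charge $q$ is uniquely determined by $v$ and does not depend on $\lambda$, and the decomposition $v=\phi_\lambda+q\mathcal{G}_\lambda$ with $\phi_\lambda\in H^1(\mathbb{R}^2)$ is available for every $\lambda>0$. The quadratic form $$Q(v):=\|\nabla\phi_\lambda\|_2^2+\lambda\big(\|\phi_\lambda\|_2^2-\|v\|_2^2\big)+(\alpha+\theta_\lambda)|q|^2,\qquad v\in D,$$ is independent of the choice of $\lambda>0$. For $v\in D$ and $\omega\in\mathbb{R}$: the energy is $E(v):=\frac12Q(v)-\frac1p\|v\|_p^p$, the action is $S_\omega(v):=E(v)+\frac{\omega}{2}\|v\|_2^2$, and $I_\omega(v):=Q(v)+\omega\|v\|_2^2-\|v\|_p^p$. The Nehari manifold is $N_\omega:=\{v\in D\setminus\{0\}:I_\omega(v)=0\}$ and $d(\omega):=\inf_{v\in N_\omega}S_\omega(v)$. *)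

(* Defs.v *)
From HB Require Import structures.
From mathcomp Require Import all_boot all_order all_algebra.
From mathcomp Require Import complex.
From mathcomp Require Import all_classical all_reals all_analysis.

Set Implicit Arguments.
Unset Strict Implicit.
Unset Printing Implicit Defensive.

Import Order.TTheory GRing.Theory Num.Theory.
Import numFieldNormedType.Exports.
Import ComplexField.

Local Open Scope classical_set_scope.
Local Open Scope complex_scope.
Local Open Scope ring_scope.

(* An element of a space of classes of functions on the plane is handled through
   its Borel representatives [R * R -> R[i]], and the notions below that concern
   classes are invariant under almost everywhere equality. *)

Section Plane.
Variable R : realType.

Definition leb2 :
    {measure set (measurableTypeR R * measurableTypeR R) -> \bar R} :=
  (@lebesgue_measure R \x @lebesgue_measure R)%E.

(* The norm of the product [R * R] in the library is the sup norm. *)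
Definition enorm (x : R * R) : R := Num.sqrt (x.1 ^+ 2 + x.2 ^+ 2).

Definition cabs (z : R[i]) : R := Normc.normc z.

Definition eq_ae (f g : R * R -> R[i]) : Prop :=
  {ae leb2, forall x, f x = g x}.

Definition cmeasurable (f : R * R -> R[i]) : Prop :=
  measurable_fun [set: measurableTypeR R * measurableTypeR R]
    (fun x => complex.Re (f x) : measurableTypeR R) /\
  measurable_fun [set: measurableTypeR R * measurableTypeR R]
    (fun x => complex.Im (f x) : measurableTypeR R).

Definition Lpnorm (p : R) (f : R * R -> R[i]) : R :=
  fine ('N[leb2]_(p%:E) [EFin \o (fun x => cabs (f x))])%E.

Definition L2 (f : R * R -> R[i]) : Prop :=
  cmeasurable f /\ finite_norm leb2 2%:E (fun x => cabs (f x)).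

Definition cintegral (f : R * R -> R[i]) : R[i] :=
  (\int[leb2]_x complex.Re (f x)) +i* (\int[leb2]_x complex.Im (f x)).

Definition e1 : R * R := (1, 0).
Definition e2 : R * R := (0, 1).

Fixpoint Ck (k : nat) (f : R * R -> R) : Prop :=
  continuous f /\
  if k is m.+1 then
    [/\ forall x, derivable f x e1, forall x, derivable f x e2,
        Ck m (fun x => 'D_e1 f x) & Ck m (fun x => 'D_e2 f x)]
  else True.

(* Real-valued test functions suffice, by linearity. *)
Definition test_function (psi : R * R -> R) : Prop :=
  (forall k, Ck k psi) /\ compact (closure [set x | psi x != 0]).

Definition weak_partial (e : R * R) (f g : R * R -> R[i]) : Prop :=
  forall psi, test_function psi ->
    cintegral (fun x => f x * ('D_e psi x)%:C) =
    - cintegral (fun x => g x * (psi x)%:C).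

Definition H1_gradient (f g1 g2 : R * R -> R[i]) : Prop :=
  [/\ L2 f, L2 g1, L2 g2, weak_partial e1 f g1 & weak_partial e2 f g2].

Definition H1 (f : R * R -> R[i]) : Prop := exists g1 g2, H1_gradient f g1 g2.

(* The classical integral representation
   K_0(z) = int_0^oo exp (- z cosh t) dt, valid for z > 0.
   The integral diverges at z = 0, where K0 therefore takes the value 0. *)
Definition K0 (z : R) : R :=
  \int[@lebesgue_measure R]_(t in `[0, +oo[)
    expR (- z * ((expR t + expR (- t)) / 2)).

Definition Green (lambda : R) (x : R * R) : R :=
  K0 (Num.sqrt lambda * enorm x) / (2 * pi).

Definition euler_gamma : R :=
  limn (fun n : nat => \sum_(1 <= k < n.+1) k%:R^-1 - ln (n%:R : R)).

Definition theta (lambda : R) : R :=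
  (ln (Num.sqrt lambda / 2) + euler_gamma) / (2 * pi).

Definition regular_part (lambda : R) (q : R[i]) (v : R * R -> R[i])
    (x : R * R) : R[i] :=
  v x - q * (Green lambda x)%:C.

Definition energy_space (v : R * R -> R[i]) : Prop :=
  L2 v /\ exists q lambda, 0 < lambda /\ H1 (regular_part lambda q v).

Definition form_value (alpha : R) (v : R * R -> R[i]) (r : R) : Prop :=
  exists lambda q g1 g2,
    [/\ 0 < lambda, H1_gradient (regular_part lambda q v) g1 g2 &
      r = (Lpnorm 2 g1 ^+ 2 + Lpnorm 2 g2 ^+ 2)
          + lambda * (Lpnorm 2 (regular_part lambda q v) ^+ 2
                      - Lpnorm 2 v ^+ 2)
          + (alpha + theta lambda) * cabs q ^+ 2].

(* For v in the energy space the value r does not depend on lambda (nor on the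
   choice of representatives of the gradient), and Q v is that value. *)
Definition Q (alpha : R) (v : R * R -> R[i]) : R :=
  xget 0 [set r | form_value alpha v r].

Definition energy (p alpha : R) (v : R * R -> R[i]) : R :=
  Q alpha v / 2 - (Lpnorm p v `^ p) / p.

Definition action (p alpha omega : R) (v : R * R -> R[i]) : R :=
  energy p alpha v + omega / 2 * Lpnorm 2 v ^+ 2.

Definition nehari_functional (p alpha omega : R) (v : R * R -> R[i]) : R :=
  Q alpha v + omega * Lpnorm 2 v ^+ 2 - Lpnorm p v `^ p.

Definition nehari_manifold (p alpha omega : R) : set (R * R -> R[i]) :=
  [set v | [/\ energy_space v, ~ eq_ae v (fun=> 0) &
               nehari_functional p alpha omega v = 0]].

(* The infimum is taken in \bar R, so that it is +oo on an empty manifold. *)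
Definition action_level (p alpha omega : R) : \bar R :=
  ereal_inf [set (action p alpha omega v)%:E
            | v in nehari_manifold p alpha omega].

Definition action_minimizer (p alpha omega : R) (u : R * R -> R[i]) : Prop :=
  nehari_manifold p alpha omega u /\
  (action p alpha omega u)%:E = action_level p alpha omega.

Definition omega0 (alpha : R) : R :=
  4 * expR (- 4 * pi * alpha - 2 * euler_gamma).

(* On R[i], [0 < z] and [0 <= z] include that z is real, and [z < z'] that
   z and z' have the same imaginary part. *)
Definition positive_off0 (f : R * R -> R[i]) : Prop :=
  forall x, x != 0 -> 0 < f x.

Definition nonnegative_off0 (f : R * R -> R[i]) : Prop :=
  forall x, x != 0 -> 0 <= f x.

Definition radial (f : R * R -> R[i]) : Prop :=
  forall x y, enorm x = enorm y -> f x = f y.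

Definition radially_decreasing (f : R * R -> R[i]) : Prop :=
  forall x y, x != 0 -> enorm x < enorm y -> f y < f x.

End Plane.

(* Main.v *)
Require Import Defs.
From HB Require Import structures.
From mathcomp Require Import all_boot all_order all_algebra.
From mathcomp Require Import complex.
From mathcomp Require Import all_classical all_reals all_analysis.
From mathcomp Require Import measurable_realfun.
From mathcomp Require Import ring lra.

(* Let G be the Green function at frequency w, kappa = alpha + theta_w, and
   T f = G * f + kappa^-1 (int f G) G, the inverse of the operator of the form
   Q + w |.|^2. The charge term makes this form positive exactly when kappa > 0,
   that is when w > omega_0, and then J f = int f T f is the dual form, so that
   |v|_p^2 <= M (Q v + w |v|_2^2) with M the supremum of J over the unit ball of
   L^r, r = p / (p - 1). Minimizers of the action are the extremals of this
   inequality, up to scaling.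

   Existence: the potentials G * f_n of a maximizing sequence are bounded and
   equicontinuous, hence converge pointwise along a subsequence, and so do the dual
   functions (T f_n / |T f_n|_p)^(p-1), which are again maximizing. Their limit does
   not vanish: comparing f_n with its translates bounds sup G * f_n by int f_n G,
   because the charge term favours the origin.

   Shape: an extremal is u = T (|u|^(p-2) u), and J decreases strictly if |u| is
   replaced in the kernel by u, unless the phase is constant. A reflection across
   a line missing the origin rearranges f = |u|^(p-1) by moving the larger value to
   the side of the origin; this increases J, strictly through int f G, so f is
   larger on that side for every line, and so is u = T f, strictly because G is.

   If w <= omega_0, the form is nonpositive at the Green function of frequency
   omega_0 and positive at one of high frequency; along the segment joining them it
   takes arbitrarily small positive values while the L^p norm stays bounded below,
   so the level is zero. *)

Set Implicit Arguments.
Unset Strict Implicit.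
Unset Printing Implicit Defensive.

Import Order.TTheory GRing.Theory Num.Theory.
Import numFieldNormedType.Exports.

Local Open Scope classical_set_scope.
Local Open Scope complex_scope.
Local Open Scope ring_scope.

(** No Fourier transform is used: the Green function, its gradient and the resolvent identities are
    time integrals of heat kernels. Since H^1 is given by weak derivatives alone, the link with
    these kernels is the formula [f = l G * f - sum_i (d_i G) * g_i] for a function [f] with
    gradient [g], obtained by testing on Gaussians. It makes [G * s] the Riesz representative of
    [v |-> \int v s] for the energy, and the inequalities for the form become completions of
    squares.

    Two obstacles shape the duality argument. Convolutions are paired in L^2 while r < 2, so the
    dual ball asks for both L^r and L^2. And an element of the energy space is not known in advance
    to be in L^p, so its nonlinearity is truncated until the Sobolev inequality is available. The
    same completed square, evaluated at an extremal, gives the Euler-Lagrange equation without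
    differentiating the action.

    The pointwise claims need a distinguished representative. The operator T does not see null sets
    and its values are defined everywhere, so replacing the dual density by [(T f)^(p-1)] makes
    [f = (T f)^(p-1)] true at every point. *)

(** * Real-valued integration: integrability, square integrability, limit theorems *)

Section Toolkit.
Context d (T : measurableType d) (R : realType) (mu : {measure set T -> \bar R}).
Implicit Types f g h : T -> R.

Definition L1 f := mu.-integrable setT (EFin \o f).

Lemma L1_meas f : L1 f -> measurable_fun setT f.
Proof. by move=> /integrableP[/measurable_EFinP]. Qed.

Lemma L1_ge0 f : measurable_fun setT f -> (forall x, 0 <= f x) ->
  (\int[mu]_x (f x)%:E < +oo)%E -> L1 f.
Proof.
move=> mf f0 fi; apply/integrableP; split; first exact/measurable_EFinP.
by under eq_integral do rewrite /= ger0_norm//.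
Qed.

Lemma L1_fin f : L1 f -> (\int[mu]_x (f x)%:E = (\int[mu]_x f x)%R%:E)%E.
Proof. by move=> fi; rewrite /Rintegral fineK// integrable_fin_num. Qed.

Lemma L1_lty f : L1 f -> (forall x, 0 <= f x) -> (\int[mu]_x (f x)%:E < +oo)%E.
Proof. by move=> fi f0; rewrite L1_fin// ltry. Qed.

Lemma L1_le f g : measurable_fun setT f -> (forall x, `|f x| <= g x) ->
  L1 g -> L1 f.
Proof.
move=> mf fg; apply: le_integrable => //; first exact/measurable_EFinP.
by move=> x _ /=; rewrite lee_fin (le_trans (fg x))// ler_norm.
Qed.

Lemma L1D f g : L1 f -> L1 g -> L1 (fun x => f x + g x).
Proof. by move=> fi gi; have := integrableD measurableT fi gi. Qed.

Lemma L1B f g : L1 f -> L1 g -> L1 (fun x => f x - g x).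
Proof. by move=> fi gi; have := integrableB measurableT fi gi. Qed.

Lemma L1Z k f : L1 f -> L1 (fun x => k * f x).
Proof. by move=> fi; have := integrableZl measurableT k fi. Qed.

Lemma L1_norm f : L1 f -> L1 (fun x => `|f x|).
Proof. by move=> fi; have := integrable_norm fi. Qed.

Lemma L1_eq f g : (forall x, f x = g x) -> L1 f -> L1 g.
Proof. by move=> /funext ->. Qed.

Lemma IntD f g : L1 f -> L1 g ->
  \int[mu]_x (f x + g x) = \int[mu]_x f x + \int[mu]_x g x.
Proof. by move=> fi gi; rewrite RintegralD. Qed.

Lemma IntB f g : L1 f -> L1 g ->
  \int[mu]_x (f x - g x) = \int[mu]_x f x - \int[mu]_x g x.
Proof. by move=> fi gi; rewrite RintegralB. Qed.

Lemma IntZ k f : L1 f -> \int[mu]_x (k * f x) = k * \int[mu]_x f x.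
Proof. by move=> fi; rewrite RintegralZl. Qed.

Lemma IntN f : L1 f -> \int[mu]_x (- f x) = - \int[mu]_x f x.
Proof.
by move=> fi; rewrite -mulN1r -IntZ//; under eq_fun do rewrite -mulN1r.
Qed.

Lemma Int_ge0 f : (forall x, 0 <= f x) -> 0 <= \int[mu]_x f x.
Proof. by move=> f0; apply: Rintegral_ge0. Qed.

Lemma Int_le f g : L1 f -> L1 g -> (forall x, f x <= g x) ->
  \int[mu]_x f x <= \int[mu]_x g x.
Proof. by move=> fi gi fg; apply: le_Rintegral. Qed.

Lemma Int_norm f : L1 f -> `|\int[mu]_x f x| <= \int[mu]_x `|f x|.
Proof. by move=> fi; apply: le_normr_Rintegral. Qed.

Lemma Int_ae f g : measurable_fun setT f -> measurable_fun setT g ->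
  {ae mu, forall x, f x = g x} -> \int[mu]_x f x = \int[mu]_x g x.
Proof.
move=> mf mg fg; congr fine; apply: ae_eq_integral => //.
- exact/measurable_EFinP.
- exact/measurable_EFinP.
- by apply: filterS fg => x -> _.
Qed.

Lemma L1_ae f g : measurable_fun setT g -> {ae mu, forall x, f x = g x} ->
  L1 f -> L1 g.
Proof.
move=> mg fg fi; have mf := L1_meas fi.
apply/integrableP; split; first exact/measurable_EFinP.
move/integrableP : fi => [_].
rewrite (_ : (\int[mu]_x `|(EFin \o f) x| = \int[mu]_x `|(EFin \o g) x|)%E)//.
apply: ge0_ae_eq_integral => //.
- by apply: measurableT_comp => //; exact/measurable_EFinP.
- by apply: measurableT_comp => //; exact/measurable_EFinP.
- by apply: filterS fg => x /= -> _.
Qed.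

Lemma Int_eq0_ae f : L1 f -> (forall x, 0 <= f x) -> \int[mu]_x f x = 0 ->
  {ae mu, forall x, f x = 0}.
Proof.
move=> fi f0 If; have mf := L1_meas fi.
have mf' : measurable_fun setT (EFin \o f) by exact/measurable_EFinP.
have /(ae_eq_integral_abs mu measurableT mf') : (\int[mu]_x `|(f x)%:E| = 0)%E.
  under eq_integral do rewrite /= ger0_norm//.
  by rewrite L1_fin// If.
by apply: filterS => x /(_ I) [].
Qed.

(** Measurability of [f] is listed apart because it does not follow from that of its square. *)
Definition sq f := measurable_fun setT f /\ L1 (fun x => f x ^+ 2).

Lemma sq_mul f g : sq f -> sq g -> L1 (fun x => f x * g x).
Proof.
move=> [mf fi] [mg gi]; apply: (L1_le _ _ (L1D fi gi)).
  exact: measurable_funM.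
move=> x; rewrite normrM -(real_normK (num_real (f x))) -(real_normK (num_real (g x))).
have := sqr_ge0 (`|f x| - `|g x|); have := normr_ge0 (f x); have := normr_ge0 (g x).
nra.
Qed.

Lemma sqD f g : sq f -> sq g -> sq (fun x => f x + g x).
Proof.
move=> fs gs; split; first by apply: measurable_funD; [case: fs|case: gs].
have fg := sq_mul fs gs; have := L1D (L1D fs.2 gs.2) (L1Z 2 fg).
apply: L1_eq => x; ring.
Qed.

Lemma sqZ k f : sq f -> sq (fun x => k * f x).
Proof.
move=> [mf fi]; split; first exact: measurable_funM.
by have := L1Z (k ^+ 2) fi; apply: L1_eq => x; rewrite exprMn.
Qed.

Lemma sqB f g : sq f -> sq g -> sq (fun x => f x - g x).
Proof.
move=> fs gs; have := sqD fs (sqZ (-1) gs).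
by under [X in sq X -> _]eq_fun do rewrite mulN1r.
Qed.

Lemma sq_norm f : sq f -> sq (fun x => `|f x|).
Proof.
move=> [mf fi]; split; first exact: measurableT_comp.
by apply: L1_eq fi => x; rewrite real_normK// num_real.
Qed.

Lemma sq_le f g : measurable_fun setT f -> (forall x, `|f x| <= g x) ->
  sq g -> sq f.
Proof.
move=> mf fg [mg gi]; split => //; apply: L1_le gi.
  exact: measurable_funX.
move=> x; rewrite normrX; have := fg x; have := normr_ge0 (f x); nra.
Qed.

Lemma sq_ae f g : measurable_fun setT g -> {ae mu, forall x, f x = g x} ->
  sq f -> sq g.
Proof.
move=> mg fg [mf fi]; split => //; apply: L1_ae fi; first exact: measurable_funX.
by apply: filterS fg => x ->.
Qed.

(** The common core of all the Cauchy-Schwarz inequalities below: the polynomial is the value of a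
    nonnegative quadratic form along a line. *)
Lemma quad_discr (a b c : R) : 0 <= a -> (forall t, 0 <= c - 2 * t * b + t ^+ 2 * a) ->
  b ^+ 2 <= a * c.
Proof.
move=> a0 H; have [a00|an0] := eqVneq a 0.
  have [->|b0] := eqVneq b 0; first by rewrite a00 expr0n mul0r.
  (* With [a = 0] the polynomial is affine in [t], and this [t] gives it the value -1. *)
  have := H ((c + 1) / (2 * b)); rewrite a00 mulr0 addr0.
  rewrite (_ : 2 * ((c + 1) / (2 * b)) * b = c + 1); last by field.
  lra.
have ap : 0 < a by rewrite lt_def an0.
have := H (b / a).
rewrite (_ : c - 2 * (b / a) * b + (b / a) ^+ 2 * a = (a * c - b ^+ 2) / a); last by field.
by rewrite pmulr_lge0 ?invr_gt0// subr_ge0.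
Qed.

Lemma Int_CS f g : sq f -> sq g ->
  (\int[mu]_x (f x * g x)) ^+ 2 <= \int[mu]_x f x ^+ 2 * \int[mu]_x g x ^+ 2.
Proof.
move=> fs gs; apply: quad_discr; first by apply: Int_ge0 => x; exact: sqr_ge0.
move=> t; have fg := sq_mul fs gs.
rewrite -IntZ// -[in X in _ + X]IntZ; last exact: fs.2.
rewrite -IntB; [|exact: gs.2|exact: L1Z].
rewrite -IntD; [|by apply: L1B; [exact: gs.2|exact: L1Z]|by apply: L1Z; exact: fs.2].
apply: Int_ge0 => x; have := sqr_ge0 (g x - t * f x); nra.
Qed.

Lemma cvg_toE (u : nat -> R) (l : R) : u n @[n --> \oo] --> l ->
  (u n)%:E @[n --> \oo] --> l%:E.
Proof. by move=> ul; apply: cvg_EFin; [exact: nearW|]. Qed.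

Lemma dct (F : nat -> T -> R) f g : (forall n, measurable_fun setT (F n)) ->
  measurable_fun setT f -> L1 g -> (forall n x, `|F n x| <= g x) ->
  {ae mu, forall x, F n x @[n --> \oo] --> f x} ->
  L1 f /\ \int[mu]_x F n x @[n --> \oo] --> \int[mu]_x f x.
Proof.
move=> mF mf gi Fg Ff.
have [] := @dominated_convergence _ T R mu setT measurableT
  (fun n x => (F n x)%:E) (EFin \o f) (EFin \o g).
- by move=> n; apply/measurable_EFinP.
- exact/measurable_EFinP.
- by apply: filterS Ff => x Fx _; exact: cvg_toE.
- exact: gi.
- by apply: aeW => x n _; rewrite /= lee_fin.
move=> fi _ Fi; split => //.
have Fi' n : L1 (F n) by apply: L1_le gi.
have : (\int[mu]_x (F n x)%:E)%E @[n --> \oo] --> (\int[mu]_x f x)%:E.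
  by rewrite -L1_fin.
by move/fine_cvgP => [_].
Qed.

(** Bounds are stated in [\bar R] so that the integrability of the limit is a consequence and not an
    assumption. *)
Lemma fatou_le (F : nat -> T -> R) f (c : R) : (forall n, measurable_fun setT (F n)) ->
  measurable_fun setT f -> (forall n x, 0 <= F n x) -> (forall x, 0 <= f x) ->
  {ae mu, forall x, F n x @[n --> \oo] --> f x} ->
  (forall n, (\int[mu]_x (F n x)%:E <= c%:E)%E) ->
  (\int[mu]_x (f x)%:E <= c%:E)%E.
Proof.
move=> mF mf F0 f0 Ff Fc.
have mE n : measurable_fun setT (fun x => (F n x)%:E) by exact/measurable_EFinP.
have := fatou mu measurableT mE (fun n x _ => F0 n x).
have -> : (\int[mu]_x limn_einf (fun n => (F n x)%:E) = \int[mu]_x (f x)%:E)%E.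
  apply: ge0_ae_eq_integral => //.
  - apply: (emeasurable_fun_cvg (fun n x => einfs (fun k => (F k x)%:E) n)).
      exact: measurable_fun_einfs.
    by move=> x _; rewrite limn_einf_lim; exact: is_cvg_einfs.
  - exact/measurable_EFinP.
  - move=> x _; rewrite limn_einf_lim; apply: lime_ge; first exact: is_cvg_einfs.
    by apply: nearW => n; apply: le_ereal_inf_tmp => _ [k _ <-]; rewrite lee_fin.
  - by move=> x _; rewrite lee_fin.
  - apply: filterS Ff => x Fx _; apply: (cvg_limn_einf_sup _).1.
    exact: cvg_toE.
move=> /le_trans; apply; rewrite limn_einf_lim; apply: lime_le; first exact: is_cvg_einfs.
by apply: nearW => n; apply: le_trans (Fc n); apply: ereal_inf_lbound; exists n => /=.
Qed.

End Toolkit.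

(** * Fubini's theorem for real-valued integrals *)

Section RFubini.
Context d1 d2 (T1 : measurableType d1) (T2 : measurableType d2) (R : realType).
Variables (m1 : {sigma_finite_measure set T1 -> \bar R})
          (m2 : {sigma_finite_measure set T2 -> \bar R}).
Implicit Types f : T1 * T2 -> R.

Lemma L1_prod12 f : measurable_fun setT f ->
  (\int[m1]_x \int[m2]_y `|f (x, y)|%:E < +oo)%E -> L1 (m1 \x m2)%E f.
Proof.
by move=> mf fi; apply/integrable12ltyP => //; exact/measurable_EFinP.
Qed.

(** The inner integral in Fubini's theorem has values in [\bar R]; being integrable it is finite
    almost everywhere, so [fine] alters it on a null set only. *)
Lemma fine_L1 d (T : measurableType d) (mu : {measure set T -> \bar R})
    (F : T -> \bar R) : mu.-integrable setT F ->
  L1 mu (fine \o F) /\ (\int[mu]_x F x = (\int[mu]_x (fine (F x)))%R%:E)%E.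
Proof.
move=> Fi; have mF := measurable_int _ Fi.
have mF' : measurable_fun setT (fine \o F) by apply: measurableT_comp.
have ae : {ae mu, forall x, setT x -> F x = (fine (F x))%:E}.
  by apply: filterS (integrable_ae measurableT Fi) => x /(_ I) fx _; rewrite fineK.
have L : L1 mu (fine \o F).
  apply: (le_integrable measurableT _ _ Fi); first exact/measurable_EFinP.
  by move=> x _ /=; case: (F x) => [r| |] //=; rewrite normr0 leey.
split => //; rewrite -L1_fin//.
by apply: ae_eq_integral => //; exact/measurable_EFinP.
Qed.

Lemma RFubini1 f : L1 (m1 \x m2)%E f ->
  [/\ L1 m1 (fun x => \int[m2]_y f (x, y)),
   {ae m1, forall x, L1 m2 (fun y => f (x, y))} &
   (\int[m1]_x \int[m2]_y (f (x, y))%:E = (\int[m1]_x \int[m2]_y f (x, y))%R%:E)%E].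
Proof.
move=> fi; have [LF eF] := fine_L1 (integrable_fubini_F fi).
by split => //; exact: ae_integrable1 fi.
Qed.

End RFubini.

Section RFubini2.
Context d1 d2 (T1 : measurableType d1) (T2 : measurableType d2) (R : realType).
Variables (m1 : {sigma_finite_measure set T1 -> \bar R})
          (m2 : {sigma_finite_measure set T2 -> \bar R}).

Lemma L1_swap (f : T1 * T2 -> R) : L1 (m1 \x m2)%E f ->
  L1 (m2 \x m1)%E (fun z => f (z.2, z.1)).
Proof.
move=> fi; have mf := L1_meas fi; apply: L1_prod12.
  by apply: (measurableT_comp mf); exact: measurable_fun_pair.
by move/(integrable21ltyP _ _ _).1 : fi; apply; exact/measurable_EFinP.
Qed.

Lemma RFubini (f : T1 * T2 -> R) : L1 (m1 \x m2)%E f ->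
  [/\ L1 m1 (fun x => \int[m2]_y f (x, y)), L1 m2 (fun y => \int[m1]_x f (x, y)),
   {ae m1, forall x, L1 m2 (fun y => f (x, y))},
   {ae m2, forall y, L1 m1 (fun x => f (x, y))} &
   \int[m1]_x \int[m2]_y f (x, y) = \int[m2]_y \int[m1]_x f (x, y)].
Proof.
move=> fi; have [A1 B1 C1] := RFubini1 fi.
have [A2 B2 C2] := RFubini1 (L1_swap fi).
split => //; apply: EFin_inj; rewrite -C1 -C2; exact: Fubini fi.
Qed.

End RFubini2.

(** * Measure-preserving maps *)

Section MeasurePreserving.
Context d (T : measurableType d) (R : realType) (mu : {measure set T -> \bar R}).

(** Preservation is expressed by integrals instead of measures of preimages: this form composes
    directly and can be checked fiber by fiber with Tonelli's theorem. *)
Definition mpres (phi : T -> T) := measurable_fun setT phi /\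
  forall f : T -> \bar R, measurable_fun setT f -> (forall x, 0 <= f x)%E ->
    (\int[mu]_x f (phi x) = \int[mu]_x f x)%E.

Lemma mpres_comp phi psi : mpres phi -> mpres psi -> mpres (phi \o psi).
Proof.
move=> [mphi hphi] [mpsi hpsi]; split; first exact: measurableT_comp.
move=> f mf f0; rewrite -(hphi _ mf f0); apply: (hpsi (f \o phi)) => [|x]; last exact: f0.
exact: measurableT_comp.
Qed.

Lemma mpres_int phi (f : T -> \bar R) : mpres phi -> measurable_fun setT f ->
  (\int[mu]_x f (phi x) = \int[mu]_x f x)%E.
Proof.
move=> hphi mf; rewrite integralE [RHS]integralE; congr (_ - _)%E.
- rewrite (funepos_comp f phi).
  by apply: (hphi.2 f^\+%E) => //; exact: measurable_funepos.
- rewrite (funeneg_comp f phi).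
  by apply: (hphi.2 f^\-%E) => //; exact: measurable_funeneg.
Qed.

Lemma mpres_L1 phi (f : T -> R) : mpres phi -> L1 mu f -> L1 mu (f \o phi).
Proof.
move=> hphi /[dup] fi /integrableP[mf ff]; apply/integrableP; split.
  exact: (measurableT_comp mf hphi.1).
rewrite (mpres_int (f := fun x => `|(f x)%:E|)%E hphi)//.
exact: measurableT_comp.
Qed.

Lemma mpres_Int phi (f : T -> R) : mpres phi -> measurable_fun setT f ->
  \int[mu]_x f (phi x) = \int[mu]_x f x.
Proof.
move=> hphi mf; rewrite /Rintegral (mpres_int (f := EFin \o f) hphi)//.
exact/measurable_EFinP.
Qed.

Lemma mpres_ae phi (P : T -> Prop) : mpres phi -> {ae mu, forall x, P x} ->
  {ae mu, forall x, P (phi x)}.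
Proof.
move=> [mphi hphi] [N [mN N0 PN]]; exists (phi @^-1` N); split.
- by rewrite -[X in measurable X]setTI; exact: mphi.
- have mN' : measurable (phi @^-1` N).
    by rewrite -[X in measurable X]setTI; exact: mphi.
  have := hphi (EFin \o \1_N); rewrite [RHS]integral_indic// setIT N0 => <- //.
  - by rewrite -[RHS]/(\int[mu]_x (\1_(phi @^-1` N) x)%:E)%E integral_indic// setIT.
  - exact/measurable_EFinP/measurable_indic.
  - by move=> x /=; rewrite lee_fin.
- by move=> x /= nP; apply: PN.
Qed.

End MeasurePreserving.

Section ProductSigmaFinite.
Context d1 d2 (T1 : measurableType d1) (T2 : measurableType d2) (R : realType).
Variables (m1 : {sigma_finite_measure set T1 -> \bar R})
          (m2 : {sigma_finite_measure set T2 -> \bar R}).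

Lemma product_sigma_finite : sigma_finite setT (m1 \x m2)%E.
Proof.
have /sigma_finiteP[F [TF ndF Foo]] := sigma_finiteT m1.
have /sigma_finiteP[G [TG ndG Goo]] := sigma_finiteT m2.
exists (fun n => F n `*` G n).
  rewrite -setXTT TF TG predeqE => -[x y]; split.
    move=> [/= [n _ Fnx] [k _ Gky]]; exists (maxn n k) => //; split.
    - by move: x Fnx; exact/subsetPset/ndF/leq_maxl.
    - by move: y Gky; exact/subsetPset/ndG/leq_maxr.
  by move=> [n _ []/= ? ?]; split; exists n.
move=> k; have [mF Fk] := Foo k; have [mG Gk] := Goo k; split; first exact: measurableX.
by rewrite product_measure1E// lte_mul_pinfty// ge0_fin_numE.
Qed.

End ProductSigmaFinite.

(* [leb2] with its sigma-finite structure, which Fubini's theorem requires. *)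
Definition sleb2 (R : realType) :
    set (measurableTypeR R * measurableTypeR R) -> \bar R :=
  (@lebesgue_measure R \x @lebesgue_measure R)%E.

HB.instance Definition _ (R : realType) := Measure.copy (@sleb2 R)
  (@lebesgue_measure R \x @lebesgue_measure R)%E.

HB.instance Definition _ (R : realType) := @Measure_isSigmaFinite.Build _ _ R
  (@sleb2 R) (product_sigma_finite (@lebesgue_measure R) (@lebesgue_measure R)).

(** * Translations, shears and reflections of the plane *)

Section Plane.
Variable R : realType.
Notation mu1 := (@lebesgue_measure R).
Notation mu2 := (@sleb2 R).
Notation pl := (measurableTypeR R * measurableTypeR R)%type.

Lemma leb2E : @leb2 R = mu2. Proof. by []. Qed.

(** The pushforward gives each interval ]b, c] its length, and this characterizes Lebesgue
    measure. *)
Lemma mpres_add (a : R) : mpres mu1 (fun x => x + a).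
Proof.
have ma : measurable_fun setT (fun x : measurableTypeR R => x + a : measurableTypeR R).
  by apply: measurable_funD.
split => // f mf f0.
pose m' := pushforward mu1 (fun x : measurableTypeR R => x + a : measurableTypeR R).
have -> : (\int[mu1]_x f (x + a)%R = \int[m']_x f x)%E.
  by rewrite (ge0_integral_pushforward ma mu1).
apply: eq_measure_integral => A mA _; apply/esym.
have := @lebesgue_measure_unique R (pushforward mu1 (fun x : measurableTypeR R => x + a : measurableTypeR R)).
apply => //= _ [[b c]] _ <-.
rewrite /pushforward.
rewrite (_ : _ @^-1` _ = `](b - a), (c - a)]%classic); last first.
  by apply/seteqP; split => x /=; rewrite !in_itv/= ltrBlDr lerBrDr.
rewrite /= !lebesgue_measure_itv/= !lte_fin ltrD2r; case: ifP => // _.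
by rewrite -!EFinB; congr _%:E; ring.
Qed.

Lemma mpres_opp : mpres mu1 -%R.
Proof.
have ma : measurable_fun setT (-%R : measurableTypeR R -> measurableTypeR R).
  by [].
split => // f mf f0.
rewrite -(ge0_integral_pushforward ma mu1 measurableT)//.
by apply: eq_measure_integral => A mA _; exact: lebesgue_measureN.
Qed.

Lemma int2_xy (f : pl -> \bar R) : measurable_fun setT f -> (forall z, 0 <= f z)%E ->
  (\int[mu2]_z f z = \int[mu1]_x \int[mu1]_y f (x, y))%E.
Proof. by move=> mf f0; rewrite /sleb2 fubini_tonelli1. Qed.

Lemma int2_yx (f : pl -> \bar R) : measurable_fun setT f -> (forall z, 0 <= f z)%E ->
  (\int[mu2]_z f z = \int[mu1]_y \int[mu1]_x f (x, y))%E.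
Proof. by move=> mf f0; rewrite (int2_xy mf f0); exact: fubini_tonelli. Qed.

Lemma mpres_fiber1 (psi : R -> R -> R) :
  measurable_fun setT (fun z : pl => psi z.2 z.1 : measurableTypeR R) ->
  (forall y, mpres mu1 (psi y)) -> mpres mu2 (fun z => (psi z.2 z.1, z.2)).
Proof.
move=> mpsi hpsi.
have m : measurable_fun setT (fun z : pl => (psi z.2 z.1, z.2) : pl).
  exact: measurable_fun_pair.
split => // f mf f0.
rewrite (@int2_yx (fun z => f (psi z.2 z.1, z.2)) (measurableT_comp mf m) (fun z => f0 _)) (int2_yx mf f0).
apply: eq_integral => y _.
apply: ((hpsi y).2 (fun x => f (x, y))) => //.
by apply: (measurableT_comp mf); exact: measurable_fun_pair.
Qed.

Lemma mpres_fiber2 (psi : R -> R -> R) :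
  measurable_fun setT (fun z : pl => psi z.1 z.2 : measurableTypeR R) ->
  (forall y, mpres mu1 (psi y)) -> mpres mu2 (fun z => (z.1, psi z.1 z.2)).
Proof.
move=> mpsi hpsi.
have m : measurable_fun setT (fun z : pl => (z.1, psi z.1 z.2) : pl).
  exact: measurable_fun_pair.
split => // f mf f0.
rewrite (@int2_xy (fun z => f (z.1, psi z.1 z.2)) (measurableT_comp mf m) (fun z => f0 _)) (int2_xy mf f0).
apply: eq_integral => y _.
apply: ((hpsi y).2 (fun x => f (y, x))) => //.
by apply: (measurableT_comp mf); exact: measurable_fun_pair.
Qed.

Lemma mpres_shear1 (t : R) : mpres mu2 (fun z => (z.1 + t * z.2, z.2)).
Proof.
apply: (@mpres_fiber1 (fun y x => x + t * y)) => [|y]; last exact: mpres_add.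
by apply: measurable_funD => //; exact: measurable_funM.
Qed.

Lemma mpres_shear2 (t : R) : mpres mu2 (fun z => (z.1, z.2 + t * z.1)).
Proof.
apply: (@mpres_fiber2 (fun x y => y + t * x)) => [|y]; last exact: mpres_add.
by apply: measurable_funD => //; exact: measurable_funM.
Qed.

Lemma mpres_opp1 : mpres mu2 (fun z => (- z.1, z.2)).
Proof.
apply: (@mpres_fiber1 (fun y x => - x)) => [|y]; last exact: mpres_opp.
exact: measurableT_comp.
Qed.

Lemma mpres_opp2 : mpres mu2 (fun z => (z.1, - z.2)).
Proof.
apply: (@mpres_fiber2 (fun y x => - x)) => [|y]; last exact: mpres_opp.
exact: measurableT_comp.
Qed.

Lemma mpres_trans (a : R * R) : mpres mu2 (fun z => (z.1 + a.1, z.2 + a.2)).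
Proof.
have h1 : mpres mu2 (fun z => (z.1 + a.1, z.2)).
  apply: (@mpres_fiber1 (fun y x => x + a.1)) => [|y]; last exact: mpres_add.
  exact: measurable_funD.
have h2 : mpres mu2 (fun z => (z.1, z.2 + a.2)).
  apply: (@mpres_fiber2 (fun y x => x + a.2)) => [|y]; last exact: mpres_add.
  exact: measurable_funD.
exact: mpres_comp h1 h2.
Qed.

Lemma mpres_addl (a : R * R) : mpres mu2 (fun z : R * R => a + z).
Proof.
have := mpres_trans a; rewrite (_ : (fun z => _) = (fun z : R * R => a + z))//.
by apply/funext => -[x y]; rewrite [RHS]addrC.
Qed.

Lemma mpres_neg : mpres mu2 (fun z : R * R => - z).
Proof. exact: mpres_comp mpres_opp1 mpres_opp2. Qed.

Lemma mpres_subl (a : R * R) : mpres mu2 (fun z : R * R => a - z).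
Proof. exact: mpres_comp (mpres_addl a) mpres_neg. Qed.

Lemma mpres_subr (a : R * R) : mpres mu2 (fun z : R * R => z - a).
Proof.
have := mpres_addl (- a); rewrite (_ : (fun z => _) = (fun z : R * R => z - a))//.
by apply/funext => z; rewrite addrC.
Qed.

(* Reflection across the line {z | a z.1 + b z.2 = c}, with (a, b) a unit vector. *)
Definition refl (a b c : R) (z : R * R) : R * R :=
  (z.1 - 2 * (a * z.1 + b * z.2 - c) * a, z.2 - 2 * (a * z.1 + b * z.2 - c) * b).

Lemma mpres_refl (a b c : R) : a ^+ 2 + b ^+ 2 = 1 -> mpres mu2 (refl a b c).
Proof.
(* The shear factor [a / b] used below needs [b != 0]. When [b = 0] the first coordinate is sent to
   [2 * c * a - z.1] and the second is fixed. *)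
move=> ab1; have [b0|b0] := eqVneq b 0.
  have a1 : a ^+ 2 = 1 by rewrite -ab1 b0 expr0n addr0.
  have := mpres_comp (mpres_trans (2 * c * a, 0)) mpres_opp1.
  congr (mpres _ _); apply/funext => -[x y]; rewrite /refl /= b0; congr (_, _); last by ring.
  have -> : x - 2 * (a * x + 0 * y - c) * a = x - 2 * a ^+ 2 * x + 2 * c * a by ring.
  by rewrite a1; ring.
(* a reflection is a product of three shears and a coordinate reflection *)
pose t := a / b; pose s := - 2 * a * b.
have h := mpres_comp (mpres_trans (2 * c * a, 2 * c * b))
  (mpres_comp (mpres_shear1 t) (mpres_comp (mpres_shear2 s) (mpres_comp (mpres_shear1 t) mpres_opp2))).
move: h; congr (mpres _ _); apply/funext => -[x y]; rewrite /refl /= /t /s.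
have ea : a ^+ 2 = 1 - b ^+ 2 by rewrite -ab1; ring.
have e1 : a / b * (-2 * a * b) = - 2 * a ^+ 2 by field.
have e2 : - 2 * a * b * (a / b) = - 2 * a ^+ 2 by field.
have e3 : a / b * (2 * a ^+ 2 - 2) = - 2 * a * b by rewrite ea; field.
congr (_, _).
- rewrite (_ : x + a / b * - y + a / b * (- y + -2 * a * b * (x + a / b * - y)) + 2 * c * a =
    x + (a / b * (-2 * a * b)) * x + (a / b * (- 2 - (- 2 * a * b * (a / b)))) * y + 2 * c * a); last by ring.
  by rewrite e1 e2 (_ : - 2 - - 2 * a ^+ 2 = 2 * a ^+ 2 - 2); [rewrite e3|]; ring.
- rewrite (_ : - y + -2 * a * b * (x + a / b * - y) + 2 * c * b =
    - y - 2 * a * b * x - (- 2 * a * b * (a / b)) * y + 2 * c * b); last by ring.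
  by rewrite e2 ea; ring.
Qed.

End Plane.

(** * Derivatives, the fundamental theorem and improper integrals on the line *)

Section Calculus1.
Variable R : realType.
Notation mu1 := (@lebesgue_measure R).
Implicit Types (f g F : R -> R) (a b c k l m x t : R).

Lemma dvM f g x a b : is_derive x 1 f a -> is_derive x 1 g b ->
  is_derive x 1 (fun t => f t * g t) (a * g x + f x * b).
Proof.
move=> df dg; apply: (is_derive_eq (is_deriveM df dg)).
by rewrite addrC; congr (_ + _); exact: mulrC.
Qed.

Lemma dvD f g x a b : is_derive x 1 f a -> is_derive x 1 g b ->
  is_derive x 1 (fun t => f t + g t) (a + b).
Proof. by move=> df dg; exact: is_deriveD. Qed.

Lemma dvN f x a : is_derive x 1 f a -> is_derive x 1 (fun t => - f t) (- a).
Proof. by move=> df; exact: is_deriveN. Qed.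

Lemma dvZ k f x a : is_derive x 1 f a -> is_derive x 1 (fun t => k * f t) (k * a).
Proof. by move=> df; exact: is_deriveZ. Qed.

Lemma dvexp f x a : is_derive x 1 f a ->
  is_derive x 1 (fun t => expR (f t)) (a * expR (f x)).
Proof.
by move=> df; rewrite mulrC; exact: (is_derive1_comp (is_derive_expR (f x)) df).
Qed.

Lemma dvV f x a : f x != 0 -> is_derive x 1 f a ->
  is_derive x 1 (fun t => (f t)^-1) (- a / f x ^+ 2).
Proof.
move=> fx df; apply: (is_derive_eq (is_deriveV fx df)).
by rewrite -[_ *: _]/(_ * _); field.
Qed.

Lemma dv_id x : is_derive x 1 (fun t : R => t) 1.
Proof. exact: is_derive_id. Qed.

Lemma dv_cst k x : is_derive x 1 (fun=> k : R) 0.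
Proof. exact: is_derive_cst. Qed.

(** The inverse is discontinuous at 0, so it is written piecewise with [expR] and [ln], the value at
    0 being [0^-1 = 0]. *)
Lemma measurable_inv : measurable_fun setT (fun x : R => x^-1).
Proof.
have -> : (fun x : R => x^-1) = (fun x => if 0 < x then expR (- ln x) else
    if x < 0 then - expR (- ln (- x)) else 0).
  apply/funext => x; case: ifPn => [x0|]; first by rewrite expRN lnK.
  rewrite -leNgt le_eqVlt => /predU1P[->|x0]; first by rewrite ltxx invr0.
  by rewrite x0 expRN lnK ?posrE ?oppr_gt0// invrN opprK.
have ml : measurable_fun setT (fun x : R => expR (- ln x)).
  by apply: measurableT_comp => //; apply: measurableT_comp => //; exact: measurable_ln.
apply: measurable_fun_ifT; [exact: measurable_fun_ltr|exact: ml|].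
apply: measurable_fun_ifT; [exact: measurable_fun_ltr| |exact: measurable_cst].
by apply: measurableT_comp => //; apply: (measurableT_comp ml).
Qed.

Lemma measurable_sqrt : measurable_fun setT (@Num.sqrt R).
Proof. exact: continuous_measurable_fun (@sqrt_continuous R). Qed.

(* Rectified integrands: integrating over R a function cut off at 0. *)
Definition pos f t := if 0 < t then f t else 0.

Lemma measurable_pos f : measurable_fun setT f -> measurable_fun setT (pos f).
Proof.
by move=> mf; apply: measurable_fun_ifT => //; exact: measurable_fun_ltr.
Qed.

Lemma int_pos f : measurable_fun setT f ->
  (\int[mu1]_t (pos f t)%:E = \int[mu1]_(t in `[0%R, +oo[) (f t)%:E)%E.
Proof.
move=> mf; rewrite -integral_itv_obnd_cbnd; last first.
  by apply: measurable_funTS; exact/measurable_EFinP.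
rewrite [RHS]integral_mkcond; apply: eq_integral => t _.
rewrite /pos patchE; case: ifPn => t0.
  by rewrite ifT// inE/= in_itv/= t0.
by rewrite ifF//; apply/negbTE; rewrite notin_setE/= in_itv/= andbT; exact/negP.
Qed.

Lemma FTC2 F f a b : a < b -> (forall x, a <= x <= b -> is_derive x 1 F (f x)) ->
  (forall x, a <= x <= b -> {for x, continuous f}) ->
  (\int[mu1]_(x in `[a, b]) (f x)%:E = (F b - F a)%:E)%E.
Proof.
move=> ab dF cf; have cF x : a <= x <= b -> {for x, continuous F}.
  by move=> /dF[? _]; exact/differentiable_continuous/derivable1_diffP.
rewrite (@continuous_FTC2 R f F a b)//.
- by apply: continuous_in_subspaceT => x /set_mem/=; rewrite in_itv/=; exact: cf.
- split.
  + by move=> x; rewrite in_itv/= => /andP[/ltW ax /ltW xb]; case: (dF x _) => //; rewrite ax.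
  + by apply: cvg_at_right_filter; apply: cF; rewrite lexx ltW.
  + by apply: cvg_at_left_filter; apply: cF; rewrite lexx ltW.
- move=> x; rewrite in_itv/= => /andP[/ltW ax /ltW xb].
  by have := dF x; rewrite ax xb => /(_ isT) h; rewrite derive1E derive_val.
Qed.

Lemma FTC2y F f a l : (forall x, a <= x -> 0 <= f x) ->
  (forall x, a <= x -> is_derive x 1 F (f x)) ->
  (forall x, a <= x -> {for x, continuous f}) -> F x @[x --> +oo] --> l ->
  (\int[mu1]_(x in `[a, +oo[) (f x)%:E = (l - F a)%:E)%E.
Proof.
move=> f0 dF cf Fl; have cF x : a <= x -> {for x, continuous F}.
  by move=> /dF[? _]; exact/differentiable_continuous/derivable1_diffP.
rewrite (@ge0_continuous_FTC2y R f F a l) ?EFinB//.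
- by apply: continuous_in_subspaceT => x /set_mem/=; rewrite in_itv/= andbT; exact: cf.
- by move=> x /ltW/dF[].
- by apply: cvg_at_right_filter; exact: cF.
- move=> x; rewrite in_itv/= andbT => /ltW ax.
  by have h := dF _ ax; rewrite derive1E derive_val.
Qed.

Lemma cvgyMl (m : R) : 0 < m -> m * x @[x --> +oo] --> +oo.
Proof. by move=> m0; exact: gt0_cvgMry. Qed.

Lemma int_expR m : 0 < m ->
  (\int[mu1]_(t in `[0%R, +oo[) (expR (- (m * t)))%:E = m^-1%:E)%E.
Proof.
move=> m0; have dF x : 0 <= x ->
    is_derive x 1 (fun t => - m^-1 * expR (- (m * t))) (expR (- (m * x))).
  move=> _; apply: is_derive_eq.
  by rewrite /GRing.scale /=; field; rewrite gt_eqF.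
rewrite (FTC2y (l := 0) _ dF).
- by rewrite sub0r mulr0 oppr0 expR0 mulr1 opprK.
- by move=> x _; exact: expR_ge0.
- by move=> x _; apply: continuous_comp; [apply: continuousN; exact: mulrl_continuous|exact: continuous_expR].
- rewrite -[X in _ --> X](mulr0 (- m^-1)); apply: cvgMr.
  apply: (@cvg_comp _ _ _ (fun x => m * x) (fun y => expR (- y))); first exact: cvgyMl.
  exact: cvgr_expR.
Qed.

(** The model of an integrable singularity. It dominates the time integral of the gradient of the
    heat kernel, and in each coordinate the powers of the Green function. *)
Definition isq c t := pos (fun t => (Num.sqrt t)^-1 * expR (- (c * t))) t.

Lemma measurable_isq c : measurable_fun setT (isq c).
Proof.
apply: measurable_pos; apply: measurable_funM.
  by apply: (measurableT_comp measurable_inv); exact: measurable_sqrt.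
by apply: measurableT_comp => //; apply: measurableT_comp => //; exact: measurable_funM.
Qed.

Lemma L1_isq c : 0 < c -> L1 mu1 (isq c).
Proof.
move=> c0; apply: L1_ge0; first exact: measurable_isq.
  move=> x; rewrite /isq /pos; case: ifPn => [_|//].
  by rewrite mulr_ge0 ?expR_ge0// invr_ge0 sqrtr_ge0.
pose g1 t := if (0 < t) && (t <= 1) then (Num.sqrt t)^-1 else 0.
pose g2 := pos (fun t => expR (- (c * t))).
have mg2' : measurable_fun setT (fun t : R => expR (- (c * t))).
  by apply: measurableT_comp => //; apply: measurableT_comp => //; exact: measurable_funM.
have mg2 : measurable_fun setT g2 by exact: measurable_pos.
have ms : measurable_fun setT (fun t : R => (Num.sqrt t)^-1).
  by apply: (measurableT_comp measurable_inv); exact: measurable_sqrt.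
have mg1 : measurable_fun setT g1.
  apply: measurable_fun_ifT => //; apply: measurable_and.
    exact: measurable_fun_ltr.
  exact: measurable_fun_ler.
have g10 t : 0 <= g1 t by rewrite /g1; case: ifPn => // _; rewrite invr_ge0 sqrtr_ge0.
have g20 t : 0 <= g2 t by rewrite /g2 /pos; case: ifPn => // _; exact: expR_ge0.
apply: (@le_lt_trans _ _ (\int[mu1]_x ((g1 x)%:E + (g2 x)%:E))%E).
  apply: ge0_le_integral => //.
  - move=> x _; rewrite lee_fin /isq /pos; case: ifPn => [_|//].
    by rewrite mulr_ge0 ?expR_ge0// invr_ge0 sqrtr_ge0.
  - by apply/measurable_EFinP; exact: measurable_isq.
  - by apply: emeasurable_funD; apply/measurable_EFinP.
  - move=> x _; rewrite -EFinD lee_fin /isq /g1 /g2 /pos.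
    have [x0|x0] /= := ltP 0 x; last by rewrite addr0.
    have sx : 0 < Num.sqrt x by rewrite sqrtr_gt0.
    have [x1|x1] := leP x 1.
      apply: (@le_trans _ _ (Num.sqrt x)^-1); last by rewrite lerDl expR_ge0.
      rewrite ler_piMr ?invr_ge0 ?ltW//.
      by rewrite expR_lt1 oppr_lt0 mulr_gt0.
    rewrite add0r ler_piMl ?expR_ge0// invf_le1// -sqrtr1 ler_sqrt// ltW//.
rewrite ge0_integralD//; last 4 first.
- by move=> x _; rewrite lee_fin.
- exact/measurable_EFinP.
- by move=> x _; rewrite lee_fin.
- exact/measurable_EFinP.
rewrite int_pos// int_expR// lte_add_pinfty ?ltry//.
(* The primitive [2 * Num.sqrt t] is not differentiable at 0, so ]0, 1] is exhausted by intervals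
   that stay away from 0. *)
pose I n : set (measurableTypeR R) := `[(n.+1%:R : R)^-1, 1]%classic.
have mI n : measurable (I n) by exact: measurable_itv.
have ndI : nondecreasing_seq I.
  move=> n m nm; apply/subsetPset => x; rewrite /I /= !in_itv/= => /andP[h ->]; rewrite andbT.
  by apply: le_trans h; rewrite lef_pV2 ?posrE// ler_nat.
have h := @ge0_nondecreasing_set_cvg_integral _ (measurableTypeR R) R I (fun t => ((Num.sqrt t)^-1)%:E) mu1 ndI mI
  (fun i => measurable_funTS ((measurable_EFinP _ _).2 ms)).
apply: (@le_lt_trans _ _ 2%:E); last exact: ltry.
have -> : (\int[mu1]_x (g1 x)%:E = \int[mu1]_(t in \bigcup_i I i) ((Num.sqrt t)^-1)%:E)%E.
  rewrite [RHS]integral_mkcond; apply: eq_integral => t _; rewrite /g1 patchE.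
  case: ifPn => [/andP[t0 t1]|ht].
    rewrite ifT// inE; near \oo => n; exists n => //; rewrite /I /= in_itv/= t1 andbT ltW//.
    by near: n; exact: (near_infty_natSinv_lt (PosNum t0)).
  rewrite ifF//; apply/negbTE; rewrite notin_setE => -[n _]; rewrite /I /= in_itv/= => /andP[h1 t1].
  by move: ht; rewrite t1 andbT (lt_le_trans _ h1)// invr_gt0.
have s0 i x : I i x -> (0 <= ((Num.sqrt x)^-1)%:E)%E.
  by move=> _; rewrite lee_fin invr_ge0 sqrtr_ge0.
have {}h := h s0; rewrite -(cvg_lim _ h)//.
apply: lime_le.
  by apply/cvg_ex; eexists; exact: h.
(* For [n = 0] the interval is the single point 1, which [FTC2] excludes by asking for [a < b]. *)
apply: nearW => -[|n].
  rewrite /I invr1 set_itv1 integral_set1 //.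
have dF x : n.+2%:R^-1 <= x <= 1 -> is_derive x 1 (fun t => 2 * Num.sqrt t) (Num.sqrt x)^-1.
  move=> /andP[x0 _]; have {}x0 : 0 < x by apply: lt_le_trans x0; rewrite invr_gt0.
  apply: (is_derive_eq (dvZ 2 (is_derive1_sqrt x0))).
  by field; rewrite gt_eqF// sqrtr_gt0.
rewrite (FTC2 _ dF).
- by rewrite lee_fin sqrtr1 mulr1 gerBl mulr_ge0// sqrtr_ge0.
- by rewrite invf_lt1// ltr1n.
- move=> x /andP[x0 _]; have {}x0 : 0 < x by apply: lt_le_trans x0; rewrite invr_gt0.
  by apply: continuousV; [rewrite gt_eqF// sqrtr_gt0|exact: sqrt_continuous].
Unshelve. all: by end_near. Qed.

End Calculus1.

(** * Logarithmic substitution, the heat integral for [K0], Frullani's integral *)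

Section Calculus2.
Variable R : realType.
Notation mu1 := (@lebesgue_measure R).
Implicit Types (f g phi : R -> R) (a b c k l m x t : R).

Lemma cvg_ln_pinfty : ln x @[x --> +oo] --> (+oo : set_system R).
Proof.
apply/cvgryPge => A; near=> x.
have x0 : expR A <= x by near: x; exact: nbhs_pinfty_ge.
by rewrite -(expRK A) ler_ln// ?posrE ?expR_gt0// (lt_le_trans _ x0)// expR_gt0.
Unshelve. all: by end_near. Qed.

Lemma ln_substitution_from phi a : 0 < a -> continuous phi -> (forall x, 0 <= phi x) ->
  (\int[mu1]_(s in `[ln a, +oo[) (phi s)%:E =
   \int[mu1]_(t in `[a, +oo[) (phi (ln t) / t)%:E)%E.
Proof.
move=> a0 cphi phi0.
have near_inv x : 0 < x -> \forall y \near x, y^-1 = derive1 (@ln R) y.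
  move=> x0; near=> y; have y0 : 0 < y by near: y; exact: lt_nbhsr.
  by have h := is_derive1_ln y0; rewrite derive1E derive_val.
have cinv x : 0 < x -> {for x, continuous (derive1 (@ln R))}.
  move=> x0; have h := near_inv _ x0.
  have := @inv_continuous _ x (lt0r_neq0 x0).
  rewrite /prop_for /continuous_at (nbhs_singleton h) => c; apply: cvg_trans c.
  exact: near_eq_cvg h.
rewrite (@increasing_ge0_integration_by_substitutiony R (@ln R) phi a).
- apply: eq_integral => t /[!inE]/=; rewrite in_itv/= andbT => at_.
  by have e := nbhs_singleton (near_inv t (lt_le_trans a0 at_)); rewrite -[((_ * _) t)]/(phi (ln t) * derive1 (@ln R) t) -e.
- move=> x y; rewrite !in_itv/= !andbT => ax ay.
  by rewrite ltr_ln// posrE (lt_le_trans a0).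
- by move=> x; rewrite in_itv/= andbT => ax; apply: cinv; exact: lt_trans ax.
- by apply/cvg_ex; exists (derive1 (@ln R) a); apply: cvg_at_right_filter; exact: cinv.
- apply/cvg_ex; exists 0.
  apply: (@cvg_trans _ (x^-1 @[x --> +oo])).
    by apply: near_eq_cvg; near=> x; apply: (nbhs_singleton (near_inv x _)); near: x; exact: nbhs_pinfty_gt.
  have p : \forall x \near +oo, 0 < (@idfun R) x by exact: nbhs_pinfty_gt.
  exact: (gtr0_cvgV0 p).2 (@cvg_id _ _).
- split.
  + move=> x; rewrite in_itv/= andbT => ax; have x0 := lt_trans a0 ax.
    by case: (is_derive1_ln x0).
  + by apply: cvg_at_right_filter; exact: continuous_ln.
- exact: cvg_ln_pinfty.
- exact: continuous_subspaceT.
- by move=> x _; exact: phi0.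
Unshelve. all: by end_near. Qed.

(** Substitution is available on half-lines, so the two sides are exhausted by [[-n, +oo[] and its
    image [[expR (- n), +oo[] under the exponential. *)
Lemma ln_substitution phi : continuous phi -> (forall x, 0 <= phi x) ->
  (\int[mu1]_s (phi s)%:E = \int[mu1]_t (pos (fun t => phi (ln t) / t) t)%:E)%E.
Proof.
move=> cphi phi0.
have mphi : measurable_fun setT (fun t => phi (ln t) / t).
  apply: measurable_funM; last exact: measurable_inv.
  by apply: measurableT_comp; [exact: continuous_measurable_fun|exact: measurable_ln].
pose I n : set (measurableTypeR R) := `[- n%:R, +oo[%classic.
pose J n : set (measurableTypeR R) := `[expR (- n%:R), +oo[%classic.
have mI n : measurable (I n) by exact: measurable_itv.
have mJ n : measurable (J n) by exact: measurable_itv.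
have ndI : nondecreasing_seq I.
  move=> n m nm; apply/subsetPset => x; rewrite /I /= !in_itv/= !andbT.
  by apply: le_trans; rewrite lerN2 ler_nat.
have ndJ : nondecreasing_seq J.
  move=> n m nm; apply/subsetPset => x; rewrite /J /= !in_itv/= !andbT.
  by apply: le_trans; rewrite ler_expR lerN2 ler_nat.
have hI := @ge0_nondecreasing_set_cvg_integral _ (measurableTypeR R) R I
  (fun t => (phi t)%:E) mu1 ndI mI.
have hJ := @ge0_nondecreasing_set_cvg_integral _ (measurableTypeR R) R J
  (fun t => (phi (ln t) / t)%:E) mu1 ndJ mJ.
have {hI} hI := hI (fun i => measurable_funTS ((measurable_EFinP _ _).2 (continuous_measurable_fun cphi))) (fun i x _ => phi0 x).
have {hJ} hJ := hJ (fun i => measurable_funTS ((measurable_EFinP _ _).2 mphi)).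
have {}hJ := hJ _.
have J0 i x : J i x -> (0 <= (phi (ln x) / x)%:E)%E.
  rewrite /J /= in_itv/= andbT => h.
  by rewrite lee_fin mulr_ge0// invr_ge0 (le_trans _ h)// expR_ge0.
have {}hJ := hJ J0.
have IJ : (fun i => \int[mu1]_(x in I i) (phi x)%:E)%E =
          (fun i => \int[mu1]_(x in J i) (phi (ln x) / x)%:E)%E.
  apply/funext => n; transitivity (\int[mu1]_(x in `[ln (expR (- n%:R)), +oo[) (phi x)%:E)%E.
    by rewrite expRK.
  by rewrite ln_substitution_from// expR_gt0.
rewrite IJ in hI.
have UI : \bigcup_i I i = setT.
  apply/seteqP; split => // x _; near \oo => n; exists n => //.
  rewrite /I /= in_itv/= andbT lerNl; near: n; exact: nbhs_infty_ger.
rewrite UI in hI; rewrite (cvg_unique _ hI hJ).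
rewrite integral_mkcond; apply: eq_integral => t _; rewrite /pos patchE.
case: ifPn => [/set_mem [n _]|].
  by rewrite /J /= in_itv/= andbT => h; rewrite (lt_le_trans _ h)// expR_gt0.
case: ifPn => // t0 /negP; rewrite inE => -[].
near \oo => n; exists n => //; rewrite /J /= in_itv/= andbT -[leRHS]lnK ?posrE// ler_expR.
rewrite lerNl; near: n; exact: nbhs_infty_ger.
Unshelve. all: by end_near. Qed.

(** The integrand of [K0] is even, so the integral runs over the whole line after halving.
    Translating by [ln b] with [b = 2 * Num.sqrt l / r] and setting t = exp s turns [z cosh] into
    [l t + r^2 / (4 t)]. *)
Lemma K0_heat (l r : R) : 0 < l -> 0 < r ->
  ((K0 (Num.sqrt l * r))%:E = 2^-1%:E *
   \int[mu1]_t (pos (fun t => expR (- (l * t) - r ^+ 2 / (4 * t)) / t) t)%:E)%E.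
Proof.
move=> l0 r0; pose z := Num.sqrt l * r; have z0 : 0 < z by rewrite mulr_gt0// sqrtr_gt0.
pose f s := expR (- z * ((expR s + expR (- s)) / 2)).
have cf : continuous f.
  move=> x; apply: continuous_comp; last exact: continuous_expR.
  apply: continuousM; first exact: cst_continuous.
  apply: continuousM; last exact: cst_continuous.
  apply: continuousD; first exact: continuous_expR.
  by apply: continuous_comp; [exact: opp_continuous|exact: continuous_expR].
have f0 x : 0 <= f x by exact: expR_ge0.
have mf : measurable_fun setT f by exact: continuous_measurable_fun.
have finf : (\int[mu1]_(s in `[0%R, +oo[) (f s)%:E < +oo)%E.
  apply: (@le_lt_trans _ _ (\int[mu1]_(s in `[0%R, +oo[) (expR (- (z / 2 * s)))%:E)%E).
    apply: ge0_le_integral => //.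
    - by move=> x _; rewrite lee_fin.
    - by apply/measurable_EFinP; exact: measurable_funTS.
    - by apply/measurable_EFinP; apply: measurable_funTS; do 2 apply: measurableT_comp => //; exact: measurable_funM.
    - move=> x; rewrite /= in_itv/= andbT => x0; rewrite lee_fin ler_expR.
      have := expR_ge1Dx x; have := expR_gt0 (- x) => h1 h2.
      rewrite mulNr lerN2 -mulrA ler_pM2l// mulrC ler_pdivrMr//; lra.
  by rewrite int_expR ?divr_gt0// ltry.
have even : (\int[mu1]_s (f s)%:E = 2%:E * \int[mu1]_(s in `[0%R, +oo[) (f s)%:E)%E.
  rewrite ge0_symfun_integralT//; last by move=> x; rewrite /f /= opprK addrC.
  congr (_ * _)%E; congr (integral _ _ _).
  by apply/seteqP; split => x /=; rewrite in_itv/= andbT.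
have -> : (K0 (Num.sqrt l * r))%:E = (2^-1%:E * \int[mu1]_s (f s)%:E)%E.
  rewrite even muleA -EFinM mulVf// mul1e /K0 /Rintegral fineK// ge0_fin_numE//.
  by apply: integral_ge0 => s _; rewrite lee_fin.
congr (_ * _)%E.
pose b := 2 * Num.sqrt l / r.
have b0 : 0 < b by rewrite !mulr_gt0 ?invr_gt0 ?sqrtr_gt0.
have s2 : Num.sqrt l ^+ 2 = l by rewrite sqr_sqrtr// ltW.
have sl : Num.sqrt l != 0 by rewrite gt_eqF// sqrtr_gt0.
have rn : r != 0 by rewrite gt_eqF.
pose phi s := expR (- (l * expR s) - r ^+ 2 / 4 * expR (- s)).
have cphi : continuous phi.
  move=> x; apply: continuous_comp; last exact: continuous_expR.
  apply: continuousB.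
    by apply: continuousN; apply: continuousM; [exact: cst_continuous|exact: continuous_expR].
  apply: continuousM; first exact: cst_continuous.
  by apply: continuous_comp; [exact: opp_continuous|exact: continuous_expR].
have hphi s : phi s = f (s + ln b).
  rewrite /phi /f; congr expR; rewrite opprD !expRD expRN (expRN (ln b)) lnK// /b -/z.
  rewrite /z; have : Num.sqrt l * Num.sqrt l = l by rewrite -expr2.
  move=> ss; rewrite -{1}ss; field.
  by rewrite sl rn gt_eqF// expR_gt0.
rewrite -((mpres_add (ln b)).2 (EFin \o f)); last 2 first.
- exact/measurable_EFinP.
- by move=> x; rewrite lee_fin.
transitivity (\int[mu1]_s (phi s)%:E)%E; first by apply: eq_integral => s _; rewrite hphi.
rewrite (ln_substitution cphi (fun x => expR_ge0 _)).
apply: eq_integral => t _; rewrite /pos; case: ifPn => // t0.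
rewrite /phi expRN lnK//; congr (expR _ / _)%:E; field.
by rewrite gt_eqF.
Qed.

(* Frullani's integral, by integrating exp (- x t) over l <= x <= m and t > 0. *)
Lemma frullani l m : 0 < l -> l < m ->
  (\int[mu1]_t (pos (fun t => (expR (- (l * t)) - expR (- (m * t))) / t) t)%:E =
   (ln (m / l))%:E)%E.
Proof.
move=> l0 lm; have m0 := lt_trans l0 lm.
pose F (z : measurableTypeR R * measurableTypeR R) : R :=
  if (0 < z.1) && ((l <= z.2) && (z.2 <= m)) then expR (- (z.2 * z.1)) else 0.
have mF : measurable_fun setT F.
  apply: measurable_fun_ifT => //.
    apply: measurable_and; first exact: measurable_fun_ltr.
    by apply: measurable_and; exact: measurable_fun_ler.
  by do 2 apply: measurableT_comp => //; exact: measurable_funM.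
have F0 z : (0 <= (F z)%:E)%E by rewrite lee_fin /F; case: ifPn => // _; exact: expR_ge0.
transitivity (\int[mu1]_t \int[mu1]_x (F (t, x))%:E)%E.
  apply: eq_integral => t _; rewrite /pos /F /=.
  case: ifPn => t0; last by under eq_integral do rewrite /=; rewrite integral0.
  have dF x : l <= x <= m -> is_derive x 1 (fun x => - t^-1 * expR (- (t * x))) (expR (- (x * t))).
    move=> _; apply: is_derive_eq.
    by rewrite /GRing.scale /= (mulrC x); field; rewrite gt_eqF.
  transitivity (\int[mu1]_(x in `[l, m]) (expR (- (x * t)))%:E)%E.
    rewrite (FTC2 lm dF); last first.
      move=> x _; apply: continuous_comp; last exact: continuous_expR.
      by apply: continuousN; exact: mulrr_continuous.
    by congr _%:E; rewrite (mulrC l) (mulrC m); ring.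
  rewrite integral_mkcond; apply: eq_integral => x _; rewrite patchE /=.
  case: ifPn => [/set_mem|]; first by rewrite /= in_itv/= => ->.
  by rewrite notin_setE/= in_itv/= => /negP/negbTE ->.
rewrite (@fubini_tonelli _ _ _ _ _ mu1 mu1 (EFin \o F))//; last by apply/measurable_EFinP.
transitivity (\int[mu1]_(x in `[l, m]) (x^-1)%:E)%E.
  rewrite [RHS]integral_mkcond; apply: eq_integral => x _; rewrite patchE /F /=.
  case: ifPn => [/set_mem|]; rewrite ?notin_setE /= in_itv/=; last first.
    move=> /negP/negbTE ->; under eq_integral do rewrite andbF.
    by rewrite integral0.
  move=> /[dup] lxm -> /=; have x0 : 0 < x by case/andP: lxm => /(lt_le_trans l0).
  rewrite -int_expR// -int_pos.
    by apply: eq_integral => t _; rewrite /pos andbT.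
  by do 2 apply: measurableT_comp => //; exact: measurable_funM.
have dF x : l <= x <= m -> is_derive x 1 (@ln R) x^-1.
  by move=> /andP[lx _]; apply: is_derive1_ln; exact: lt_le_trans lx.
rewrite (FTC2 lm dF) ?ln_div//.
by move=> x /andP[lx _]; apply: inv_continuous; rewrite gt_eqF// (lt_le_trans l0).
Qed.

End Calculus2.

(** * Bounds, monotonicity and continuity of [K0] *)

Section BesselK0.
Variable R : realType.
Notation mu1 := (@lebesgue_measure R).
Implicit Types (z w a : R).

Definition cosh (t : R) := (expR t + expR (- t)) / 2.
Definition fK z t := pos (fun t => expR (- z * cosh t)) t.

Lemma cosh_ge t : 1 <= cosh t.
Proof.
rewrite /cosh ler_pdivlMr// mul1r; have := expRxMexpNx_1 t.
have := expR_gt0 t; have := expR_gt0 (- t); have := sqr_ge0 (expR t - expR (- t)).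
nra.
Qed.

Lemma cosh_geR t : expR t / 2 <= cosh t.
Proof. by rewrite /cosh ler_pM2r// lerDl expR_ge0. Qed.

Lemma continuous_cosh : continuous cosh.
Proof.
move=> x; apply: (@continuousM _ _ (fun t => expR t + expR (- t)) (fun=> 2^-1)).
  apply: continuousD; first exact: continuous_expR.
  by apply: continuous_comp; [exact: opp_continuous|exact: continuous_expR].
exact: cst_continuous.
Qed.

Lemma measurable_cosh : measurable_fun setT cosh.
Proof. exact: continuous_measurable_fun continuous_cosh. Qed.

Lemma fK_ge0 z t : 0 <= fK z t.
Proof. by rewrite /fK /pos; case: ifPn => // _; exact: expR_ge0. Qed.

Lemma measurable_expMcosh z : measurable_fun setT (fun t => expR (- z * cosh t)).
Proof.
apply: measurableT_comp => //; apply: measurable_funM => //; exact: measurable_cosh.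
Qed.

Lemma measurable_fK z : measurable_fun setT (fK z).
Proof. by apply: measurable_pos; exact: measurable_expMcosh. Qed.

Lemma expR_powR_le (u a : R) : 0 < u -> 0 < a <= 1 -> expR (- u) <= u `^ (- a).
Proof.
move=> u0 /andP[a0 a1]; rewrite powRN expRN lef_pV2 ?posrE ?expR_gt0 ?powR_gt0//.
apply: (@le_trans _ _ (1 + u)); last exact: expR_ge1Dx.
have [u1|u1] := leP u 1.
  apply: (@le_trans _ _ (1 `^ a)); last by rewrite powR1 lerDl ltW.
  by apply: ge0_ler_powR; rewrite ?nnegrE//; exact: ltW.
apply: (@le_trans _ _ (u `^ 1)); last by rewrite powRr1 ?lerDr// ltW.
by apply: ler_powR => //; exact: ltW.
Qed.

Lemma fK_bound z a : 0 < z -> 0 < a <= 1 -> forall t,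
  fK z t <= expR (- (z / 2)) * (z / 4) `^ (- a) * pos (fun t => expR (- (a * t))) t.
Proof.
move=> z0 /[dup] a01 /andP[a0 a1] t; rewrite /fK /pos; case: ifPn => t0; last by rewrite mulr0.
apply: (@le_trans _ _ (expR (- (z / 2)) * expR (- (z / 4 * expR t)))).
  rewrite -expRD ler_expR; have := cosh_ge t; have := cosh_geR t; nra.
rewrite -[leRHS]mulrA ler_pM2l ?expR_gt0//.
apply: le_trans (expR_powR_le (a := a) _ _) _ => //.
  by rewrite mulr_gt0 ?expR_gt0 ?divr_gt0.
rewrite powRM; [|by rewrite divr_ge0// ltW|exact: expR_ge0].
by rewrite -expRM mulrN (mulrC t).
Qed.

Lemma K0_int z : (\int[mu1]_(t in `[0%R, +oo[) (expR (- z * cosh t))%:E =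
  \int[mu1]_t (fK z t)%:E)%E.
Proof. by rewrite -int_pos//; exact: measurable_expMcosh. Qed.

Lemma K0E z : K0 z = \int[mu1]_t fK z t.
Proof. by rewrite /K0 /Rintegral K0_int. Qed.

Lemma L1_pos_expR m : 0 < m -> L1 mu1 (pos (fun t => expR (- (m * t)))).
Proof.
move=> m0.
have me : measurable_fun setT (fun t => expR (- (m * t))).
  by do 2 apply: measurableT_comp => //; exact: measurable_funM.
apply: L1_ge0; first exact: measurable_pos.
  by move=> x; rewrite /pos; case: ifPn => // _; exact: expR_ge0.
by rewrite int_pos// int_expR// ltry.
Qed.

Lemma L1_fK z : 0 < z -> L1 mu1 (fK z).
Proof.
move=> z0; have := L1Z (expR (- (z / 2)) * (z / 4) `^ (- 1)) (L1_pos_expR ltr01).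
by move=> h; apply: L1_le h => [|t]; [exact: measurable_fK|]; rewrite ger0_norm ?fK_ge0//; apply: fK_bound => //; rewrite ltr01 lexx.
Qed.

(** The singularity at 0 is logarithmic, but a power with a free exponent [a] is enough: taking [a]
    to be the inverse of an exponent makes the corresponding power of the Green function
    integrable. *)
Lemma K0_bound z a : 0 < z -> 0 < a <= 1 ->
  K0 z <= expR (- (z / 2)) * (z / 4) `^ (- a) / a.
Proof.
move=> z0 a01; have a0 : 0 < a by case/andP: a01.
rewrite K0E; apply: le_trans (Int_le (L1_fK z0) (L1Z _ (L1_pos_expR a0)) (fK_bound z0 a01)) _.
rewrite IntZ; last exact: L1_pos_expR.
rewrite (_ : \int[mu1]_x _ = a^-1)// /Rintegral int_pos ?int_expR//.
by do 2 apply: measurableT_comp => //; exact: measurable_funM.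
Qed.

(** The integrand decreases strictly at every [t > 0], so equality of the integrals would make the
    interval ]0, 1[ a null set. *)
Lemma K0_dec z w : 0 < z -> z < w -> K0 w < K0 z.
Proof.
move=> z0 zw; have w0 := lt_trans z0 zw.
rewrite -subr_gt0 !K0E -IntB; [|exact: L1_fK|exact: L1_fK].
pose h t := fK z t - fK w t.
have hge t : 0 <= h t.
  rewrite subr_ge0 /fK /pos; case: ifPn => // _; rewrite ler_expR.
  by have := cosh_ge t; nra.
have hL : L1 mu1 h by apply: L1B; exact: L1_fK.
rewrite lt_def Int_ge0// andbT; apply/negP => /eqP /(Int_eq0_ae hL hge).
case => N [mN N0 hN]; have : (mu1 `]0%R, 1%R[ <= mu1 N)%E.
  apply: le_measure; rewrite ?inE//.
  move=> t /=; rewrite in_itv/= => /andP[t0 _]; apply: hN => /= h0.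
  have : fK z t = fK w t by apply/eqP; rewrite -subr_eq0; exact/eqP.
  by rewrite /fK /pos t0 => /expR_inj; have := cosh_ge t; nra.
by rewrite N0 lebesgue_measure_itv/= lte01 oppr0 adde0 leNgt lte01.
Qed.

Lemma K0_gt0 z : 0 < z -> 0 < K0 z.
Proof.
move=> z0; apply: (@le_lt_trans _ _ (K0 (z + 1))).
  by rewrite K0E; apply: Int_ge0 => t; exact: fK_ge0.
by apply: K0_dec => //; rewrite ltrDl.
Qed.

Lemma K00 : K0 (0 : R) = 0.
Proof.
rewrite /K0 /Rintegral (eq_integral (cst 1%E)); last first.
  by move=> t _; rewrite oppr0 mul0r expR0.
by rewrite integral_cst//= mul1e lebesgue_measure_itv/= ltry addye.
Qed.

Lemma K0_cvg (u : nat -> R) z : 0 < z -> u n @[n --> \oo] --> z ->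
  K0 (u n) @[n --> \oo] --> K0 z.
Proof.
move=> z0 uz.
(* The modified sequence agrees with [u] eventually and never drops below [z / 2], so that
   [fK (z / 2)] dominates every term. *)
pose v n := Num.max (u n) (z / 2).
have z2 : z / 2 < z by rewrite ltr_pdivrMr// ltr_pMr// ltr1n.
have vz n : z / 2 <= v n by rewrite le_max lexx orbT.
have uv : \forall n \near \oo, u n = v n.
  near=> n; rewrite /v max_l//; near: n.
  exact: (cvgr_ge z uz).
have vcvg : v n @[n --> \oo] --> z.
  by apply: cvg_trans uz; apply: near_eq_cvg.
suff : K0 (v n) @[n --> \oo] --> K0 z.
  apply: cvg_trans; apply: near_eq_cvg.
  by apply: filterS uv => n ->.
rewrite (_ : (fun n => K0 (v n)) = (fun n => \int[mu1]_t fK (v n) t)); last first.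
  by apply/funext => n; rewrite K0E.
rewrite K0E; apply: (proj2 (@dct _ _ R mu1 (fun n => fK (v n)) (fK z) (fK (z / 2)) _ _ _ _ _)) => //.
- by move=> n; exact: measurable_fK.
- exact: measurable_fK.
- by apply: L1_fK; rewrite divr_gt0.
- move=> n t; rewrite ger0_norm ?fK_ge0// /fK /pos; case: ifPn => // _.
  by rewrite ler_expR; have := cosh_ge t; have := vz n; nra.
- apply: aeW => t; rewrite /fK /pos; case: ifPn => _; last exact: cvg_cst.
  apply: (@cvg_comp _ _ _ (fun n => - v n * cosh t) expR); last exact: continuous_expR.
  by apply: cvgMl; apply: cvgN.
Unshelve. all: by end_near. Qed.

End BesselK0.

(** * The heat kernel and its semigroup law *)

Section Gauss.
Variable R : realType.
Notation mu1 := (@lebesgue_measure R).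
Notation mu2 := (@sleb2 R).
Notation pl := (measurableTypeR R * measurableTypeR R)%type.

(** The normal density of variance [2 t], which is the heat kernel of the line. It vanishes for
    [t <= 0], so that time integrals can run over the whole line. *)
Definition gauss1 (t s : R) := pos (fun t => expR (- (s ^+ 2 / (4 * t))) / Num.sqrt (4 * pi * t)) t.

Lemma gauss1_ge0 t s : 0 <= gauss1 t s.
Proof.
by rewrite /gauss1 /pos; case: ifPn => // _; rewrite mulr_ge0 ?expR_ge0// invr_ge0 sqrtr_ge0.
Qed.

Lemma measurable_gauss1 d (T : measurableType d) (f g : T -> R) :
  measurable_fun setT f -> measurable_fun setT g ->
  measurable_fun setT (fun x => gauss1 (f x) (g x)).
Proof.
move=> mf mg; apply: measurable_fun_ifT => //; first exact: measurable_fun_ltr.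
apply: measurable_funM.
  apply: measurableT_comp => //; apply: measurableT_comp => //; apply: measurable_funM.
    exact: measurable_funX.
  by apply: (measurableT_comp (@measurable_inv R)); exact: measurable_funM.
apply: (measurableT_comp (@measurable_inv R)).
by apply: (measurableT_comp (@measurable_sqrt R)); exact: measurable_funM.
Qed.

Lemma int_gauss1 t : 0 < t -> (\int[mu1]_s (gauss1 t s)%:E = 1)%E.
Proof.
move=> t0; have s0 : Num.sqrt (2 * t) != 0 by rewrite gt_eqF// sqrtr_gt0 mulr_gt0.
rewrite -(integral_normal_pdf 0 (Num.sqrt (2 * t))); apply: eq_integral => s _.
rewrite normal_pdfE// /gauss1 /pos t0 /normal_peak /normal_fun subr0 mulrC.
rewrite sqr_sqrtr; last by rewrite mulr_ge0// ltW.
congr (_ ^-1 * _)%:E.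
  by congr Num.sqrt; rewrite -mulr_natr; ring.
by congr expR; rewrite -mulr_natr; field; rewrite gt_eqF.
Qed.

(** Completing the square in [y]: the product is [gauss1 (t + u) x] times a Gaussian in [y] of time
    [v = t u / (t + u)] centred at [x u / (t + u)], which has mass 1. *)
Lemma gauss1_conv t u x : 0 < t -> 0 < u ->
  (\int[mu1]_y (gauss1 t (x - y) * gauss1 u y)%:E = (gauss1 (t + u) x)%:E)%E.
Proof.
move=> t0 u0; have tu0 : 0 < t + u by exact: addr_gt0.
pose v := t * u / (t + u); have v0 : 0 < v by rewrite divr_gt0// mulr_gt0.
have vt : (t != 0) * (u != 0) * (t + u != 0) by rewrite !gt_eqF.
have p0 := @pi_gt0 R.
have E y : gauss1 t (x - y) * gauss1 u y = gauss1 (t + u) x * gauss1 v (y - x * u / (t + u)).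
  rewrite /gauss1 /pos t0 u0 tu0 v0 !mulf_div -!expRD -!sqrtrM; [|by rewrite !mulr_ge0// ltW..].
  congr (expR _ / Num.sqrt _); rewrite /v; field; by rewrite !vt.
under eq_integral do rewrite E EFinM.
have m : measurable_fun setT (fun y => gauss1 v y).
  by apply: measurable_gauss1.
rewrite ge0_integralZl_EFin//; last 3 first.
- by move=> y _; rewrite lee_fin gauss1_ge0.
- by apply/measurable_EFinP; apply: measurable_gauss1 => //; exact: measurable_funB.
- exact: gauss1_ge0.
have := (mpres_add (- (x * u / (t + u)))).2 (fun y => (gauss1 v y)%:E).
move=> ->; rewrite ?int_gauss1 ?mule1//; first exact/measurable_EFinP.
by move=> y; rewrite lee_fin gauss1_ge0.
Qed.

Definition heat (t : R) (x : R * R) := gauss1 t x.1 * gauss1 t x.2.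

Lemma heat_ge0 t x : 0 <= heat t x.
Proof. by rewrite mulr_ge0// gauss1_ge0. Qed.

Lemma measurable_heat d (T : measurableType d) (f : T -> R) (g : T -> pl) :
  measurable_fun setT f -> measurable_fun setT g ->
  measurable_fun setT (fun x => heat (f x) (g x)).
Proof.
move=> mf mg; apply: measurable_funM; apply: measurable_gauss1 => //.
  exact: measurableT_comp measurable_fst mg.
exact: measurableT_comp measurable_snd mg.
Qed.

Lemma heatE t x : heat t x =
  pos (fun t => expR (- ((x.1 ^+ 2 + x.2 ^+ 2) / (4 * t))) / (4 * pi * t)) t.
Proof.
rewrite /heat /gauss1 /pos; case: ifPn => t0; last by rewrite mul0r.
rewrite mulf_div -expRD -expr2 sqr_sqrtr.
  by rewrite [in RHS]mulrDl opprD.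
by rewrite !mulr_ge0 ?pi_ge0// ltW.
Qed.

Lemma int2_prod (f g : R -> R) : measurable_fun setT f -> measurable_fun setT g ->
  (forall x, 0 <= f x) -> (forall x, 0 <= g x) ->
  (\int[mu2]_z (f z.1 * g z.2)%:E = \int[mu1]_x (f x)%:E * \int[mu1]_x (g x)%:E)%E.
Proof.
move=> mf mg f0 g0; rewrite int2_xy; last 2 first.
- apply/measurable_EFinP; apply: measurable_funM.
    exact: measurableT_comp mf measurable_fst.
  exact: measurableT_comp mg measurable_snd.
- by move=> z; rewrite lee_fin mulr_ge0.
rewrite -ge0_integralZr//; last 3 first.
- exact/measurable_EFinP.
- by move=> x _; rewrite lee_fin.
- by apply: integral_ge0 => x _; rewrite lee_fin.
apply: eq_integral => x _ /=; under eq_integral do rewrite EFinM.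
rewrite ge0_integralZl_EFin//; last exact/measurable_EFinP.
by move=> y _; rewrite lee_fin.
Qed.

Lemma int_heat t : 0 < t -> (\int[mu2]_x (heat t x)%:E = 1)%E.
Proof.
move=> t0; rewrite (int2_prod (f := gauss1 t) (g := gauss1 t)).
- by rewrite int_gauss1// mule1.
- exact: measurable_gauss1.
- exact: measurable_gauss1.
- exact: gauss1_ge0.
- exact: gauss1_ge0.
Qed.

Lemma heat_conv (t u : R) (x : R * R) : 0 < t -> 0 < u ->
  (\int[mu2]_y (heat t (x - y) * heat u y)%:E = (heat (t + u) x)%:E)%E.
Proof.
move=> t0 u0; have m (v : R) : measurable_fun setT (fun y : R => gauss1 t (v - y) * gauss1 u y).
  apply: measurable_funM; apply: measurable_gauss1 => //; exact: measurable_funB.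
have g0 v y : 0 <= gauss1 t (v - y) * gauss1 u y by rewrite mulr_ge0// gauss1_ge0.
transitivity (\int[mu2]_y ((gauss1 t (x.1 - y.1) * gauss1 u y.1) *
    (gauss1 t (x.2 - y.2) * gauss1 u y.2))%:E)%E.
  by apply: eq_integral => y _; rewrite /heat /=; congr _%:E; ring.
rewrite (int2_prod (m x.1) (m x.2))// !gauss1_conv// -EFinM.
Qed.

Lemma gauss1_sym t s : gauss1 t (- s) = gauss1 t s.
Proof. by rewrite /gauss1 sqrrN. Qed.

End Gauss.

Section Ge0Int.
Context d (T : measurableType d) (R : realType) (mu : {measure set T -> \bar R}).

Lemma ge0_intZ (k : R) (f : T -> R) : 0 <= k -> measurable_fun setT f ->
  (forall x, 0 <= f x) -> (\int[mu]_x (k * f x)%:E = k%:E * \int[mu]_x (f x)%:E)%E.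
Proof.
move=> k0 mf f0; rewrite -ge0_integralZl_EFin//; last exact/measurable_EFinP.
by move=> x _; rewrite lee_fin.
Qed.

Lemma ge0_int_le (f g : T -> R) : measurable_fun setT f -> measurable_fun setT g ->
  (forall x, 0 <= f x) -> (forall x, f x <= g x) ->
  (\int[mu]_x (f x)%:E <= \int[mu]_x (g x)%:E)%E.
Proof.
move=> mf mg f0 fg; apply: ge0_le_integral => //.
- by move=> x _; rewrite lee_fin.
- exact/measurable_EFinP.
- exact/measurable_EFinP.
- by move=> x _; rewrite lee_fin.
Qed.

End Ge0Int.

(** * The Green function as a time integral of heat kernels *)

Section GreenFunction.
Variable R : realType.
Notation mu1 := (@lebesgue_measure R).
Notation mu2 := (@sleb2 R).
Notation pl := (measurableTypeR R * measurableTypeR R)%type.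
Implicit Types (l m r t k : R).

Lemma enorm_sq (x : R * R) : enorm x ^+ 2 = x.1 ^+ 2 + x.2 ^+ 2.
Proof. by rewrite /enorm sqr_sqrtr// addr_ge0// sqr_ge0. Qed.

Lemma enorm_ge0 (x : R * R) : 0 <= enorm x. Proof. exact: sqrtr_ge0. Qed.

Lemma enorm_eq0 (x : R * R) : (enorm x == 0) = (x == 0).
Proof.
rewrite -sqrf_eq0 enorm_sq paddr_eq0 ?sqr_ge0// !sqrf_eq0.
by case: x => a b /=; rewrite -pair_eqE.
Qed.

Lemma enorm_gt0 (x : R * R) : (0 < enorm x) = (x != 0).
Proof. by rewrite lt_def enorm_ge0 andbT enorm_eq0. Qed.

Lemma enorm0 : enorm (0 : R * R) = 0.
Proof. by apply/eqP; rewrite enorm_eq0. Qed.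

Lemma enormN (x : R * R) : enorm (- x) = enorm x.
Proof. by rewrite /enorm /= !sqrrN. Qed.

(* A sealed copy of the Green function: unification would otherwise unfold it
   down to the integral defining K0. *)
Fact Gr_key : {G : R -> R * R -> R | G = @Green R}.
Proof. by exists (@Green R). Qed.

Definition Gr : R -> R * R -> R := sval Gr_key.

Lemma GrE : Gr = @Green R. Proof. exact: svalP Gr_key. Qed.

Lemma Green_K0 l (x : R * R) : Gr l x = K0 (Num.sqrt l * enorm x) / (2 * pi).
Proof. by rewrite GrE. Qed.

Lemma Green0 l : Gr l (0 : R * R) = 0.
Proof. by rewrite Green_K0 enorm0 mulr0 K00 mul0r. Qed.

Lemma Green_gt0 l (x : R * R) : 0 < l -> x != 0 -> 0 < Gr l x.
Proof.
move=> l0 x0; rewrite Green_K0 divr_gt0 ?mulr_gt0 ?pi_gt0//; apply: K0_gt0; apply: mulr_gt0.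
  by rewrite sqrtr_gt0.
by rewrite enorm_gt0.
Qed.

Lemma Green_ge0 l (x : R * R) : 0 < l -> 0 <= Gr l x.
Proof.
move=> l0; have [->|x0] := eqVneq x 0; first by rewrite Green0.
by rewrite ltW// Green_gt0.
Qed.

Lemma Green_radial l (x y : R * R) : enorm x = enorm y -> Gr l x = Gr l y.
Proof. by rewrite !Green_K0 => ->. Qed.

Lemma GreenN l (x : R * R) : Gr l (- x) = Gr l x.
Proof. by apply: Green_radial; rewrite enormN. Qed.

Lemma Green_dec l (x y : R * R) : 0 < l -> x != 0 -> enorm x < enorm y -> Gr l y < Gr l x.
Proof.
move=> l0 x0 xy; rewrite !Green_K0 ltr_pM2r ?invr_gt0 ?mulr_gt0 ?pi_gt0//.
apply: K0_dec; last by rewrite ltr_pM2l// sqrtr_gt0.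
by apply: mulr_gt0; [rewrite sqrtr_gt0|rewrite enorm_gt0].
Qed.

Lemma Green_decl l m (x : R * R) : 0 < l -> l < m -> x != 0 -> Gr m x < Gr l x.
Proof.
move=> l0 lm x0; rewrite !Green_K0 ltr_pM2r ?invr_gt0 ?mulr_gt0 ?pi_gt0//.
apply: K0_dec; first by apply: mulr_gt0; [rewrite sqrtr_gt0|rewrite enorm_gt0].
by rewrite ltr_pM2r ?enorm_gt0// ltr_sqrt// (lt_trans l0).
Qed.

Definition eheat l t (x : R * R) := expR (- (l * t)) * heat t x.

Lemma eheat_ge0 l t (x : R * R) : 0 <= eheat l t x.
Proof. by rewrite mulr_ge0 ?expR_ge0 ?heat_ge0. Qed.

Lemma measurable_eheat d (T : measurableType d) l (f : T -> R) (g : T -> pl) :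
  measurable_fun setT f -> measurable_fun setT g ->
  measurable_fun setT (fun x => eheat l (f x) (g x)).
Proof.
move=> mf mg; apply: measurable_funM; last exact: measurable_heat.
by do 2 apply: measurableT_comp => //; exact: measurable_funM.
Qed.

(** The origin is excluded because there the left-hand side has the default value 0 while the time
    integral diverges. *)
Lemma Green_heat l (x : R * R) : 0 < l -> x != 0 ->
  (Gr l x)%:E = (\int[mu1]_t (eheat l t x)%:E)%E.
Proof.
move=> l0 x0; rewrite Green_K0 EFinM K0_heat ?enorm_gt0// muleC muleA -EFinM.
rewrite -ge0_integralZl_EFin//; last 3 first.
- move=> t _; rewrite lee_fin /pos; case: ifPn => // t0.
  by rewrite divr_ge0 ?expR_ge0// ltW.
- apply/measurable_EFinP; apply: measurable_pos; apply: measurable_funM; last exact: measurable_inv.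
  apply: measurableT_comp => //; apply: measurable_funB.
    by apply: measurableT_comp => //; exact: measurable_funM.
  apply: measurable_funM => //; apply: (measurableT_comp (@measurable_inv R)).
  exact: measurable_funM.
- by rewrite mulr_ge0// invr_ge0 mulr_ge0// pi_ge0.
apply: eq_integral => t _; rewrite -EFinM /eheat heatE /pos; case: ifPn => t0; last by rewrite !mulr0.
congr _%:E; rewrite mulrA -expRD enorm_sq.
have p0 := pi_gt0 R; move: (pi : R) p0 => P p0.
by field; rewrite !gt_eqF.
Qed.

Lemma ae_coord1 : {ae mu2, forall x : pl, x.1 != 0}.
Proof.
exists ([set (0 : measurableTypeR R)] `*` setT); split.
- by apply: measurableX => //; exact: measurable_set1.
- transitivity ((mu1 \x mu1)%E ([set (0 : measurableTypeR R)] `*` setT)); first by [].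
  rewrite product_measure1E//.
  by rewrite [X in (X * _)%E](_ : _ = 0%E) ?mul0e//; exact: lebesgue_measure_set1.
- by move=> x /= /negP; rewrite negbK => /eqP.
Qed.

Lemma ae_coord2 : {ae mu2, forall x : pl, x.2 != 0}.
Proof.
exists (setT `*` [set (0 : measurableTypeR R)]); split.
- by apply: measurableX => //; exact: measurable_set1.
- transitivity ((mu1 \x mu1)%E (setT `*` [set (0 : measurableTypeR R)])); first by [].
  rewrite product_measure1E//.
  by rewrite [X in (_ * X)%E](_ : _ = 0%E) ?mule0//; exact: lebesgue_measure_set1.
- by move=> x /= /negP; rewrite negbK => /eqP.
Qed.

Lemma ae_neq0 : {ae mu2, forall x : pl, (x : R * R) != 0}.
Proof. by apply: filterS ae_coord1 => x; apply: contraNneq => ->. Qed.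

Lemma ae_neq (a : R * R) : {ae mu2, forall x : pl, (x : R * R) != a}.
Proof. by apply: filterS (mpres_ae (mpres_subr a) ae_neq0) => x; rewrite subr_eq0. Qed.

(** Away from the origin the heat representation is a parametric integral, measurable by Tonelli's
    theorem; the value at the origin is patched in. *)
Lemma measurable_Green0 l : 0 < l -> measurable_fun setT (fun x : pl => Gr l x).
Proof.
move=> l0.
have mI : measurable_fun setT (fun x : pl => (\int[mu1]_t (eheat l t x)%:E)%E).
  apply: (@measurable_fun_fubini_tonelli_F _ _ _ _ _ mu1 (fun z : pl * measurableTypeR R => (eheat l z.2 z.1)%:E)).
  - by apply/measurable_EFinP; exact: measurable_eheat.
  - by move=> z; rewrite lee_fin eheat_ge0.
rewrite (_ : (fun x => _) = (fun x : pl => if (x.1 == 0) && (x.2 == 0) then 0 else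
    fine (\int[mu1]_t (eheat l t x)%:E)%E)).
  apply: measurable_fun_ifT => //; last exact: measurableT_comp.
  by apply: measurable_and; apply: measurable_fun_eqr.
apply/funext => -[a b] /=; have [/andP[/eqP-> /eqP->]|ab] := ifPn; first exact: Green0.
by rewrite -Green_heat//; rewrite -pair_eqE.
Qed.

Lemma measurable_Green d (T : measurableType d) l (g : T -> pl) : 0 < l ->
  measurable_fun setT g -> measurable_fun setT (fun x => Gr l (g x)).
Proof. by move=> l0 mg; exact: measurableT_comp (measurable_Green0 l0) mg. Qed.

Lemma int_Green l (F : pl -> R) : 0 < l -> measurable_fun setT F -> (forall y, 0 <= F y) ->
  (\int[mu2]_y (Gr l y * F y)%:E = \int[mu1]_t \int[mu2]_y (eheat l t y * F y)%:E)%E.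
Proof.
move=> l0 mF F0.
have mE : measurable_fun setT (fun z : pl * measurableTypeR R => (eheat l z.2 z.1 * F z.1)%:E).
  apply/measurable_EFinP; apply: measurable_funM; first exact: measurable_eheat.
  exact: measurableT_comp mF measurable_fst.
have E0 z : (0 <= (eheat l z.2 z.1 * F z.1)%:E)%E by rewrite lee_fin mulr_ge0// eheat_ge0.
rewrite -(@fubini_tonelli _ _ _ _ _ mu2 mu1 (fun z => (eheat l z.2 z.1 * F z.1)%:E))//.
apply: ge0_ae_eq_integral => //.
- by apply/measurable_EFinP; apply: measurable_funM => //; exact: measurable_Green.
- exact: (@measurable_fun_fubini_tonelli_F _ _ _ _ _ mu1 (fun z => (eheat l z.2 z.1 * F z.1)%:E)).
- by move=> y _; rewrite lee_fin mulr_ge0// Green_ge0.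
- by move=> y _; apply: integral_ge0 => t _; rewrite lee_fin mulr_ge0// eheat_ge0.
apply: filterS ae_neq0 => y y0 _; rewrite EFinM Green_heat// -ge0_integralZr//.
- by apply/measurable_EFinP; exact: measurable_eheat.
- by move=> t _; rewrite lee_fin eheat_ge0.
- by rewrite lee_fin.
Qed.

Lemma int_exp_segment (k r : R) : 0 < k ->
  (\int[mu1]_s (if (0 < s) && (s < r) then expR (k * s) else 0)%:E =
   (pos (fun r => (expR (k * r) - 1) / k) r)%:E)%E.
Proof.
move=> k0; rewrite /pos; case: ifPn => r0; last first.
  rewrite integral0_eq// => s _; rewrite ifF//; apply/negbTE/negP => /andP[s0 sr].
  by move: r0; rewrite (lt_trans s0).
have dF (x : R) : 0 <= x <= r -> is_derive x 1 (fun x => k^-1 * expR (k * x)) (expR (k * x)).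
  by move=> _; apply: is_derive_eq; rewrite /GRing.scale /=; field; rewrite gt_eqF.
have -> : (((expR (k * r) - 1) / k)%:E = \int[mu1]_(x in `[0%R, r]) (expR (k * x))%:E)%E.
  rewrite (FTC2 r0 dF); last first.
    by move=> x _; apply: continuous_comp; [exact: mulrl_continuous|exact: continuous_expR].
  by rewrite mulr0 expR0; congr _%:E; field; rewrite gt_eqF.
have me : measurable_fun setT (fun x : R => (expR (k * x))%:E).
  by apply/measurable_EFinP; apply: measurableT_comp => //; exact: measurable_funM.
rewrite (@integral_itv_bndoo R 0 r _ true false); last exact: measurable_funTS.
rewrite [RHS]integral_mkcond; apply: eq_integral => s _; rewrite patchE.
case: ifPn => sr; first by rewrite ifT// inE/= in_itv/= sr.
by rewrite ifF//; apply/negbTE; rewrite notin_setE/= in_itv/=; exact/negP.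
Qed.

(** Writing both factors as time integrals at times [s] and [r - s], the semigroup law merges the
    heat kernels into [heat r x], and the integral of the exponential weights over 0 < s < r gives
    the last factor. This remains true at [x = 0], where [Green_ip] uses it. *)
Lemma Green_conv_heat l m (x : R * R) : 0 < l -> l < m ->
  (\int[mu2]_y (Gr l (x - y) * Gr m y)%:E =
   \int[mu1]_r (heat r x * ((expR (- (l * r)) - expR (- (m * r))) / (m - l)))%:E)%E.
Proof.
move=> l0 lm; have m0 := lt_trans l0 lm; have ml0 : 0 < m - l by rewrite subr_gt0.
have mG k : 0 < k -> measurable_fun setT (fun y : pl => Gr k (x - y)).
  by move=> k0; apply: measurable_Green => //; exact: (mpres_subl x).1.
rewrite -((mpres_subl x).2 (fun y => (Gr l (x - y) * Gr m y)%:E)); last 2 first.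
- by apply/measurable_EFinP; apply: measurable_funM; [exact: mG|exact: measurable_Green].
- by move=> y; rewrite lee_fin mulr_ge0// Green_ge0.
under eq_integral do rewrite subKr.
rewrite int_Green//; [|exact: mG|by move=> y; exact: Green_ge0].
pose H (z : measurableTypeR R * measurableTypeR R) : R :=
  if (0 < z.1) && (z.1 < z.2) then expR (- (l * z.1)) * expR (- (m * (z.2 - z.1))) * heat z.2 x else 0.
have mH : measurable_fun setT H.
  apply: measurable_fun_ifT => //; first by apply: measurable_and; exact: measurable_fun_ltr.
  apply: measurable_funM; last exact: measurable_heat.
  apply: measurable_funM; do 2 apply: measurableT_comp => //; apply: measurable_funM => //.
  exact: measurable_funB.
have H0 z : (0 <= (H z)%:E)%E.
  by rewrite lee_fin /H; case: ifPn => [_|//]; apply: mulr_ge0; [apply: mulr_ge0; exact: expR_ge0|exact: heat_ge0].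
transitivity (\int[mu1]_s \int[mu1]_r (H (s, r))%:E)%E.
  apply: eq_integral => s _.
  have [s0|s0] := ltP 0 s; last first.
    rewrite integral0_eq; last by move=> y _; rewrite /eheat /heat /gauss1 /pos ltNge s0 !(mul0r, mulr0).
    by rewrite integral0_eq// => r _; rewrite /H /= ltNge s0.
  rewrite -((mpres_subl x).2 (fun y => (eheat l s y * Gr m (x - y))%:E)); last 2 first.
  - apply/measurable_EFinP; apply: measurable_funM; last exact: mG.
    exact: measurable_eheat.
  - by move=> y; rewrite lee_fin mulr_ge0// ?Green_ge0 ?eheat_ge0.
  under eq_integral do rewrite subKr mulrC.
  rewrite int_Green//; last 2 first.
  - by apply: measurable_eheat => //; exact: (mpres_subl x).1.
  - by move=> y; exact: eheat_ge0.
  (* The second time is translated by [s], so that [r] becomes the total time. *)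
  rewrite -((mpres_add (- s)).2 (fun r => \int[mu2]_y (eheat m r y * eheat l s (x - y))%:E)%E); last 2 first.
  - apply: (@measurable_fun_fubini_tonelli_F _ _ _ _ _ mu2 (fun z : measurableTypeR R * pl => (eheat m z.1 z.2 * eheat l s (x - z.2))%:E)).
    + apply/measurable_EFinP; apply: measurable_funM; first exact: measurable_eheat.
      by apply: measurable_eheat => //; exact: (measurableT_comp (mpres_subl x).1).
    + by move=> z; rewrite lee_fin mulr_ge0// eheat_ge0.
  - by move=> r; apply: integral_ge0 => y _; rewrite lee_fin mulr_ge0// eheat_ge0.
  apply: eq_integral => r _; rewrite /H /= s0 /=.
  have [sr|sr] := ltP s r; last first.
    rewrite integral0_eq// => y _.
    by rewrite /eheat /heat /gauss1 /pos subr_gt0 ltNge sr !(mul0r, mulr0).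
  transitivity (\int[mu2]_y ((expR (- (l * s)) * expR (- (m * (r - s)))) *
      (heat s (x - y) * heat (r - s) y))%:E)%E.
    by apply: eq_integral => y _; rewrite /eheat; congr _%:E; ring.
  rewrite ge0_intZ; first last.
  - by move=> y; rewrite mulr_ge0// heat_ge0.
  - apply: measurable_funM; apply: measurable_heat => //.
    exact: (mpres_subl x).1.
  - by rewrite mulr_ge0 ?expR_ge0.
  by rewrite heat_conv// ?subr_gt0// subrKC -EFinM.
rewrite (@fubini_tonelli _ _ _ _ _ mu1 mu1 (EFin \o H))//; last exact/measurable_EFinP.
apply: eq_integral => r _ /=.
transitivity (\int[mu1]_s ((heat r x * expR (- (m * r))) *
   (if (0 < s) && (s < r) then expR ((m - l) * s) else 0))%:E)%E.
  apply: eq_integral => s _; rewrite /H /=; congr _%:E; case: ifPn => _; last by rewrite mulr0.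
  rewrite mulrC -mulrA -!expRD; congr (_ * expR _); ring.
rewrite ge0_intZ; first last.
- by move=> s; case: ifPn => // _; exact: expR_ge0.
- apply: measurable_fun_ifT => //.
    by apply: measurable_and; exact: measurable_fun_ltr.
  by apply: measurableT_comp => //; exact: measurable_funM.
- by rewrite mulr_ge0 ?expR_ge0 ?heat_ge0.
rewrite int_exp_segment// -EFinM; congr _%:E; rewrite /pos; case: ifPn => r0; last first.
  by rewrite /heat /gauss1 /pos (negbTE r0) !mul0r.
rewrite -mulrA; congr (_ * _); rewrite mulrA mulrBr mulr1 -expRD; congr ((expR _ - _) / _); ring.
Qed.

End GreenFunction.

(** * Resolvent identity, scalar products and powers of Green functions *)

Section GreenIntegrals.
Variable R : realType.
Notation mu1 := (@lebesgue_measure R).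
Notation mu2 := (@sleb2 R).
Notation pl := (measurableTypeR R * measurableTypeR R)%type.
Implicit Types (l m r t k : R).

Lemma L1_eheat l (x : R * R) : 0 < l -> x != 0 -> L1 mu1 (fun t => eheat l t x).
Proof.
move=> l0 x0; apply: L1_ge0; first exact: measurable_eheat.
  by move=> t; exact: eheat_ge0.
by rewrite -Green_heat// ltry.
Qed.

Lemma Green_resolvent l m (x : R * R) : 0 < l -> l < m -> x != 0 ->
  (\int[mu2]_y (Gr l (x - y) * Gr m y)%:E = ((Gr l x - Gr m x) / (m - l))%:E)%E.
Proof.
move=> l0 lm x0; have m0 := lt_trans l0 lm; rewrite Green_conv_heat//.
have L := L1Z (m - l)^-1 (L1B (L1_eheat l0 x0) (L1_eheat m0 x0)).
transitivity (\int[mu1]_t ((m - l)^-1 * (eheat l t x - eheat m t x))%:E)%E.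
  by apply: eq_integral => t _; rewrite /eheat; congr _%:E; ring.
rewrite L1_fin// IntZ; last by apply: L1B; exact: L1_eheat.
rewrite (IntB (L1_eheat l0 x0) (L1_eheat m0 x0)).
rewrite mulrC; congr ((_ - _) / _)%:E.
  by rewrite /Rintegral -Green_heat.
by rewrite /Rintegral -Green_heat.
Qed.

(** At the origin [heat r 0 = 1 / (4 pi r)], which leaves Frullani's integral. This logarithm is the
    increment of [theta], hence the reason why the form does not depend on the frequency. *)
Lemma Green_ip l m : 0 < l -> l < m ->
  (\int[mu2]_y (Gr l y * Gr m y)%:E = (ln (m / l) / (4 * pi * (m - l)))%:E)%E.
Proof.
move=> l0 lm; have ml0 : 0 < m - l by rewrite subr_gt0.
transitivity (\int[mu2]_y (Gr l (0 - y) * Gr m y)%:E)%E.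
  by apply: eq_integral => y _; rewrite sub0r GreenN.
rewrite Green_conv_heat//.
transitivity (\int[mu1]_t ((4 * pi * (m - l))^-1 *
   pos (fun t => (expR (- (l * t)) - expR (- (m * t))) / t) t)%:E)%E.
  apply: eq_integral => t _; rewrite heatE /pos /=; case: ifPn => t0; last by rewrite mul0r mulr0.
  rewrite expr0n addr0 mul0r oppr0 expR0; congr _%:E.
  have p0 := pi_gt0 R; move: (pi : R) p0 => P p0.
  by field; rewrite !gt_eqF.
rewrite ge0_intZ.
- by rewrite frullani// -EFinM mulrC.
- by rewrite invr_ge0 !mulr_ge0 ?pi_ge0// ltW.
- apply: measurable_pos; apply: measurable_funM; last exact: measurable_inv.
  by apply: measurable_funB; do 2 apply: measurableT_comp => //; exact: measurable_funM.
- move=> t; rewrite /pos; case: ifPn => // t0; rewrite divr_ge0 ?ltW// subr_gt0 ltr_expR.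
  by rewrite ltrN2 ltr_pM2r.
Qed.

Lemma L1_isq_abs c : 0 < c -> L1 mu1 (fun s => isq c `|s|).
Proof.
move=> c0; have L := L1_isq c0; have LN := mpres_L1 (mpres_opp R) L.
apply: L1_eq (L1D L LN) => s /=; rewrite /isq /pos oppr_gt0 normr_gt0.
have [s0|s0|->] := ltgtP s 0; rewrite ?ltxx ?addr0 ?add0r ?eqxx//.
  by rewrite ltr0_norm// oppr_eq0 lt_eqF.
by rewrite gtr0_norm// gt_eqF.
Qed.

Lemma enorm_ge_coord (x : R * R) : `|x.1| <= enorm x /\ `|x.2| <= enorm x.
Proof.
by split; rewrite -sqrtr_sqr /enorm ler_wsqrtr// ?lerDl ?lerDr sqr_ge0.
Qed.

(** [K0_bound] with exponent [r^-1] leaves a singularity of order [1 / |x|] in the power. Since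
    |x|^2 is at least |x.1| |x.2|, it is bounded by a product of one-variable functions, so no polar
    coordinates are needed. *)
Lemma Green_pow_bound l r : 0 < l -> 1 <= r -> exists C, 0 <= C /\
  forall x : R * R, x.1 != 0 -> x.2 != 0 ->
    Gr l x `^ r <= C * (isq (Num.sqrt l / 4) `|x.1| * isq (Num.sqrt l / 4) `|x.2|).
Proof.
move=> l0 r1; have r0 : 0 < r := lt_le_trans ltr01 r1.
have a01 : 0 < r^-1 <= 1 by rewrite invr_gt0 r0 invf_le1.
have sl0 : 0 < Num.sqrt l by rewrite sqrtr_gt0.
pose D := (r / (2 * pi)) `^ r * (4 / Num.sqrt l).
have D0 : 0 <= D by rewrite mulr_ge0 ?powR_ge0// divr_ge0// ltW.
exists D; split => // x x1 x2.
have x0 : x != 0 by apply: contraNneq x1 => ->.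
have nx0 : 0 < enorm x by rewrite enorm_gt0.
pose z := Num.sqrt l * enorm x; have z0 : 0 < z by rewrite mulr_gt0.
have rp : 0 <= r / (2 * pi) by rewrite divr_ge0 ?mulr_ge0 ?pi_ge0// ltW.
have h : Gr l x <= r / (2 * pi) * (expR (- (z / 2)) * (z / 4) `^ (- r^-1)).
  rewrite Green_K0 -/z (_ : r / (2 * pi) * _ = expR (- (z / 2)) * (z / 4) `^ (- r^-1) / r^-1 / (2 * pi)).
    by rewrite ler_pM2r ?invr_gt0 ?mulr_gt0 ?pi_gt0//; exact: K0_bound.
  by rewrite invrK; ring.
apply: le_trans (ge0_ler_powR (ltW r0) _ _ h) _; rewrite ?nnegrE ?Green_ge0//.
  by rewrite !mulr_ge0 ?expR_ge0 ?powR_ge0// ?invr_ge0 ?pi_ge0 ?mulr_ge0 ?pi_ge0// ltW.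
rewrite powRM//; last by rewrite mulr_ge0 ?expR_ge0 ?powR_ge0.
have -> : (expR (- (z / 2)) * (z / 4) `^ (- r^-1)) `^ r = expR (- (z / 2) * r) * (z / 4)^-1.
  rewrite powRM; [|exact: expR_ge0|exact: powR_ge0].
  have e : - r^-1 * r = - 1 by rewrite mulNr mulVf ?gt_eqF.
  by rewrite -expRM -powRrM e powR_inv1// divr_ge0// ltW.
rewrite /D -!mulrA; apply: ler_wpM2l; first exact: powR_ge0.
have [n1 n2] := enorm_ge_coord x.
have E1 : expR (- (z / 2) * r) <= expR (- (Num.sqrt l / 4 * `|x.1|)) * expR (- (Num.sqrt l / 4 * `|x.2|)).
  rewrite -expRD ler_expR /z -opprD mulNr lerN2 -mulrDr.
  apply: (@le_trans _ _ (Num.sqrt l * enorm x / 2)); last by rewrite ler_peMr// divr_ge0// ltW.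
  rewrite -mulrA mulrAC -!mulrA ler_pM2l//; lra.
have E2 : (enorm x)^-1 <= (Num.sqrt `|x.1|)^-1 * (Num.sqrt `|x.2|)^-1.
  rewrite -invfM lef_pV2 ?posrE//; last by rewrite mulr_gt0 ?sqrtr_gt0 ?normr_gt0.
  rewrite -sqrtrM// -normrM; apply: (@le_trans _ _ (Num.sqrt (enorm x ^+ 2))); last by rewrite sqrtr_sqr ger0_norm// ltW.
  apply: ler_wsqrtr; rewrite normrM expr2; exact: ler_pM.
have -> : isq (Num.sqrt l / 4) `|x.1| * isq (Num.sqrt l / 4) `|x.2| =
   ((Num.sqrt `|x.1|)^-1 * (Num.sqrt `|x.2|)^-1) *
   (expR (- (Num.sqrt l / 4 * `|x.1|)) * expR (- (Num.sqrt l / 4 * `|x.2|))).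
  by rewrite /isq /pos !normr_gt0 x1 x2; ring.
rewrite [leLHS](_ : _ = 4 / Num.sqrt l * ((enorm x)^-1 * expR (- (z / 2) * r))).
  rewrite [leRHS]mulrA ler_pM2l ?divr_gt0//.
  by apply: ler_pM => //; rewrite invr_ge0 ltW.
rewrite /z (_ : - (Num.sqrt l * enorm x / 2) * r = - (Num.sqrt l * (enorm x / 2)) * r); last by ring.
by field; rewrite !gt_eqF.
Qed.

Lemma L1_Green_pow l r : 0 < l -> 1 <= r -> L1 mu2 (fun x : pl => Gr l x `^ r).
Proof.
move=> l0 r1; have [C [C0 hC]] := Green_pow_bound l0 r1.
pose c := Num.sqrt l / 4; have c0 : 0 < c by rewrite divr_gt0 ?sqrtr_gt0.
have mG : measurable_fun setT (fun x : pl => Gr l x `^ r).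
  by apply: (measurableT_comp (measurable_powR _)); exact: measurable_Green.
have mi : measurable_fun setT (fun s : R => isq c `|s|) := L1_meas (L1_isq_abs c0).
have i0 s : 0 <= isq c `|s|.
  by rewrite /isq /pos; case: ifPn => // _; rewrite mulr_ge0 ?expR_ge0// invr_ge0 sqrtr_ge0.
have mii : measurable_fun setT (fun x : pl => isq c `|x.1| * isq c `|x.2|).
  apply: measurable_funM.
    exact: measurableT_comp mi measurable_fst.
  exact: measurableT_comp mi measurable_snd.
have Lii : L1 mu2 (fun x : pl => isq c `|x.1| * isq c `|x.2|).
  apply: L1_ge0 => //; first by move=> x; rewrite mulr_ge0.
  rewrite (int2_prod mi mi)// lte_mul_pinfty//.
  - by apply: integral_ge0 => s _; rewrite lee_fin.
  - by rewrite ge0_fin_numE ?L1_lty//; [exact: L1_isq_abs|apply: integral_ge0 => s _; rewrite lee_fin].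
  - by apply: L1_lty => //; exact: L1_isq_abs.
pose g (x : pl) := if (x.1 != 0) && (x.2 != 0) then Gr l x `^ r else 0.
have mg : measurable_fun setT g.
  apply: measurable_fun_ifT => //; apply: measurable_and; apply: measurable_neg;
    exact: measurable_fun_eqr.
have Lg : L1 mu2 g.
  apply: (L1_le mg _ (L1Z C Lii)) => x; rewrite /g; case: ifPn => [/andP[x1 x2]|_].
    by rewrite ger0_norm ?powR_ge0//; exact: hC.
  by rewrite normr0 !mulr_ge0.
apply: (L1_ae mG _ Lg).
apply: filterS2 (ae_coord1 R) (ae_coord2 R) => x x1 x2.
by rewrite /g x1 x2.
Qed.

Lemma L1_Green l : 0 < l -> L1 mu2 (fun x : pl => Gr l x).
Proof.
move=> l0; apply: L1_eq (L1_Green_pow l0 (lexx 1)) => x.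
by rewrite powRr1// Green_ge0.
Qed.

Lemma sq_Green l : 0 < l -> sq mu2 (fun x : pl => Gr l x).
Proof.
move=> l0; split; first exact: measurable_Green.
have h : 1 <= 2 :> R by rewrite ler1n.
by apply: L1_eq (L1_Green_pow l0 h) => x; rewrite powR_mulrn// Green_ge0.
Qed.

End GreenIntegrals.

(** * Smooth functions of one variable and a cutoff *)

Section SmoothLine.
Variable R : realType.
Implicit Types (f g a b : R -> R) (k n : nat).

(** The one-variable counterpart of [Ck], shaped so that tensor products inherit smoothness by
    induction on [k]. *)
Fixpoint Sm k f : Prop := continuous f /\
  if k is m.+1 then (forall x : R, derivable f x 1) /\ Sm m (derive1 f) else True.

Lemma dv_eq f (x p q : R) : is_derive x 1 f p -> p = q -> is_derive x 1 f q.
Proof. by move=> df <-. Qed.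

Lemma dv_comp f g (x p q : R) : is_derive (g x) 1 f p -> is_derive x 1 g q ->
  is_derive x 1 (fun t => f (g t)) (p * q).
Proof. by move=> df dg; exact: (@is_derive1_comp _ f g x p q df dg). Qed.

Lemma dvX f n (x p : R) : is_derive x 1 f p ->
  is_derive x 1 (fun t => f t ^+ n) (n%:R * f x ^+ n.-1 * p).
Proof.
move=> df; rewrite (_ : (fun t => f t ^+ n) = f ^+ n); last by apply/funext => t; rewrite exprfctE.
exact: (@is_deriveX _ _ f n x 1 p df).
Qed.

Lemma Sm_cont k f : Sm k f -> continuous f.
Proof. by case: k => [|k] []. Qed.

Lemma Sm_le k f : Sm k.+1 f -> Sm k f.
Proof.
elim: k f => [|k IH] f; first by case.
by move=> [cf [df sf]]; split => //; split => //; exact: IH.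
Qed.

Lemma SmS k f g : (forall x : R, is_derive x 1 f (g x)) -> Sm k g -> Sm k.+1 f.
Proof.
move=> df sg; have fg : derive1 f = g.
  by apply/funext => x; have h := df x; rewrite derive1E derive_val.
split; last by split; [by move=> x; case: (df x)|rewrite fg].
by move=> x; case: (df x) => dx _; exact/differentiable_continuous/derivable1_diffP.
Qed.

Lemma Sm_is_derive k f : Sm k.+1 f -> forall x : R, is_derive x 1 f (derive1 f x).
Proof. by move=> [_ [df _]] x; apply: (DeriveDef (df x)); rewrite derive1E. Qed.

Lemma Sm_cst k (c : R) : Sm k (fun=> c).
Proof.
elim: k c => [|k IH] c; first by split => //; exact: cst_continuous.
by apply: SmS (IH 0) => x; exact: dv_cst.
Qed.

Lemma SmD k f g : Sm k f -> Sm k g -> Sm k (fun x => f x + g x).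
Proof.
elim: k f g => [|k IH] f g sf sg.
  by split => // x; apply: continuousD; [exact: (Sm_cont sf)|exact: (Sm_cont sg)].
have h (x : R) := dvD (Sm_is_derive sf x) (Sm_is_derive sg x).
by apply: (SmS h); apply: IH; [case: sf => _ []|case: sg => _ []].
Qed.

Lemma SmM k f g : Sm k f -> Sm k g -> Sm k (fun x => f x * g x).
Proof.
elim: k f g => [|k IH] f g sf sg.
  by split => // x; apply: continuousM; [exact: (Sm_cont sf)|exact: (Sm_cont sg)].
have h (x : R) := dvM (Sm_is_derive sf x) (Sm_is_derive sg x).
apply: (SmS h); apply: SmD; apply: IH; try exact: Sm_le; by [case: sf => _ []|case: sg => _ []].
Qed.

Lemma Sm_affine k f (c e : R) : Sm k f -> Sm k (fun x => f (c * x + e)).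
Proof.
elim: k f => [|k IH] f sf.
  split => // x; apply: continuous_comp; last exact: (Sm_cont sf).
  by apply: continuousD; [exact: mulrl_continuous|exact: cst_continuous].
have d (x : R) : is_derive x 1 (fun x => f (c * x + e)) (derive1 f (c * x + e) * c).
  have h : is_derive x 1 (fun x => c * x + e) c.
    apply: (dv_eq (dvD (dvZ c (dv_id x)) (dv_cst e x))).
    by rewrite mulr1 addr0.
  exact: (@dv_comp f (fun x => c * x + e) x _ _ (Sm_is_derive sf (c * x + e)) h).
by apply: (SmS d); apply: SmM; [apply: IH; case: sf => _ []|exact: Sm_cst].
Qed.

(** Bootstrap: if [f] is of class [k], so is [a f = f']. It makes Gaussians smooth without any
    formula for their higher derivatives. *)
Lemma Sm_ode f a : (forall k, Sm k a) -> (forall x : R, is_derive x 1 f (a x * f x)) ->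
  forall k, Sm k f.
Proof.
move=> sa df; elim=> [|k IH].
  split => // x; case: (df x) => dx _; exact/differentiable_continuous/derivable1_diffP.
by apply: SmS df _; exact: SmM.
Qed.

Lemma Sm_lin k (c e : R) : Sm k (fun x => c * x + e).
Proof.
case: k => [|k].
  by split => // x; apply: continuousD; [exact: mulrl_continuous|exact: cst_continuous].
have d (x : R) : is_derive x 1 (fun x => c * x + e) c; last exact: (SmS d (Sm_cst _ _)).
apply: (dv_eq (dvD (dvZ c (dv_id x)) (dv_cst e x))).
by rewrite mulr1 addr0.
Qed.

(** The derivative of [flat n] is a combination of [flat n.+1] and [flat n.+2]; the whole family is
    introduced so that smoothness of exp(-1/u) at 0 follows by induction. *)
Definition flat n (u : R) := pos (fun u => u^-1 ^+ n * expR (- u^-1)) u.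

(** Both bounds come from [x ^+ m <= m! * exp x] at [x = u^-1]. The second one, linear in [u],
    controls the difference quotients at 0. *)
Lemma flat_bound n (u : R) : 0 <= flat n u <= (n.+1)`!%:R /\ flat n u <= (n.+1)`!%:R * `|u|.
Proof.
rewrite /flat /pos; case: ifPn => [u0|_]; last by rewrite lexx ler0n mulr_ge0.
have ui : 0 < u^-1 by rewrite invr_gt0.
have F0 : 0 < (n.+1)`!%:R :> R by rewrite ltr0n fact_gt0.
have h m : (m <= n.+1)%N -> u^-1 ^+ m * expR (- u^-1) <= (n.+1)`!%:R.
  move=> mn; rewrite expRN ler_pdivrMr ?expR_gt0//.
  have Fm : 0 < m`!%:R :> R by rewrite ltr0n fact_gt0.
  apply: (@le_trans _ _ (m`!%:R * expR u^-1)); last first.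
    by rewrite ler_pM2r ?expR_gt0// ler_nat leq_fact.
  rewrite -ler_pdivrMl// mulrC.
  case: m {mn} Fm => [|m] Fm; first by rewrite expr0 fact0 invr1 mulr1 ltW// expR_gt1.
  by have := expR_ge1Dxn m (ltW ui); apply: le_trans; rewrite lerDr.
split.
  apply/andP; split; last exact: h.
  by rewrite mulr_ge0 ?expR_ge0// exprn_ge0// ltW.
rewrite gtr0_norm// -ler_pdivrMr// mulrAC -exprSr; exact: h.
Qed.

Lemma flat_derive n (u : R) : is_derive u 1 (flat n) (flat n.+2 u - n%:R * flat n.+1 u).
Proof.
have [u0|u0|u0] := ltgtP u 0.
- have -> : flat n.+2 u - n%:R * flat n.+1 u = 0.
    by rewrite /flat /pos ltNge (ltW u0)/= mulr0 subr0.
  apply: near_eq_is_derive (dv_cst 0 u); near=> y.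
  have y0 : y < 0 by near: y; exact: lt_nbhsl.
  by rewrite /flat /pos ltNge (ltW y0).
- pose f (u : R) := u^-1 ^+ n * expR (- u^-1).
  have df : is_derive u 1 f (flat n.+2 u - n%:R * flat n.+1 u).
    have dV := dvV (lt0r_neq0 u0) (dv_id u).
    have dX := @dvX (fun t => t^-1) n u _ dV.
    apply: (dv_eq (dvM dX (dvexp (dvN dV)))).
    rewrite /flat /pos u0 /GRing.scale /=.
    have -> : u^-1 ^+ n.+2 = u^-1 ^+ n * u^-1 ^+ 2 by rewrite -exprD addn2.
    case: n {f dX} => [|n]; first by rewrite !mul0r add0r subr0 expr0; field; rewrite gt_eqF.
    rewrite /= !exprS; field; rewrite gt_eqF//.
  apply: near_eq_is_derive df; near=> y.
  have y0 : 0 < y by near: y; exact: lt_nbhsr.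
  by rewrite /flat /pos y0.
- rewrite u0 /flat {2 3}/pos ltxx mulr0 subr0 -/(flat n).
  have fl0 : flat n 0 = 0 by rewrite /flat /pos ltxx.
  have lim : h^-1 *: (flat n (h *: 1 + 0) - flat n 0) @[h --> 0^'] --> (0 : R).
    apply/cvgrPdist_le => e e0; near=> h.
    have h0 : h != 0 by near: h; exact: nbhs_dnbhs_neq.
    rewrite sub0r normrN fl0 subr0 addr0 /GRing.scale /= mulr1.
    have [/andP[f0 _] fb] := flat_bound n.+1 h.
    have -> : h^-1 * flat n h = flat n.+1 h.
      rewrite /flat /pos; case: ifPn => hp; last by rewrite mulr0.
      by rewrite exprS mulrA.
    rewrite ger0_norm//; apply: le_trans fb _.
    rewrite mulrC -ler_pdivlMr ?ltr0n ?fact_gt0//.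
    by near: h; apply: dnbhs0_le; rewrite divr_gt0// ltr0n fact_gt0.
  apply: DeriveDef; first by apply/cvg_ex; exists 0; exact: lim.
  exact: cvg_lim lim.
Unshelve. all: by end_near. Qed.

Lemma Sm_flat k n : Sm k (flat n).
Proof.
elim: k n => [|k IH] n.
  split => // x; case: (flat_derive n x) => dx _; exact/differentiable_continuous/derivable1_diffP.
apply: SmS (flat_derive n) _; apply: (SmD (IH n.+2)).
have := SmM (Sm_cst k (- n%:R)) (IH n.+1).
by congr (Sm k _); apply/funext => x; rewrite mulNr.
Qed.

(* A smooth cutoff supported in [-1, 1], equal to 1 at the origin. *)
Definition bump (s : R) := expR 2 * (flat 0 (1 + s) * flat 0 (1 - s)).

Lemma Sm_bump k : Sm k bump.
Proof.
have h1 := Sm_affine 1 1 (Sm_flat k 0).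
have h2 := Sm_affine (-1) 1 (Sm_flat k 0).
have := SmM (Sm_cst k (expR 2)) (SmM h1 h2).
by congr (Sm k _); apply/funext => x; rewrite /bump mul1r mulN1r addrC (addrC (- x)).
Qed.

Lemma bump0 : bump 0 = 1.
Proof.
rewrite /bump addr0 subr0 /flat /pos ltr01 expr0 mul1r invr1 -!expRD.
by rewrite (_ : 2 + (- 1 + - 1) = 0) ?expR0//; ring.
Qed.

Lemma bump_bound : exists C, forall s, `|bump s| <= C /\ `|derive1 bump s| <= C.
Proof.
have hf n u : `|flat n u| <= (n.+1)`!%:R.
  by have [/andP[f0 f1] _] := flat_bound n u; rewrite ger0_norm.
have d1 (s : R) : is_derive s 1 (fun s => flat 0 (1 + s)) (flat 2 (1 + s)).
  have h : is_derive s 1 (fun s : R => 1 + s) 1.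
    by apply: (dv_eq (dvD (dv_cst 1 s) (dv_id s))); rewrite add0r.
  apply: (dv_eq (is_derive1_comp (flat_derive 0 (1 + s)) h)).
  by rewrite mul0r subr0 mulr1.
have d2 (s : R) : is_derive s 1 (fun s => flat 0 (1 - s)) (- flat 2 (1 - s)).
  have h : is_derive s 1 (fun s : R => 1 - s) (-1).
    by apply: (dv_eq (dvD (dv_cst 1 s) (dvN (dv_id s)))); rewrite add0r.
  apply: (dv_eq (@dv_comp (flat 0) (fun s => 1 - s) s _ _ (flat_derive 0 (1 - s)) h)).
  by rewrite mul0r subr0 mulrN1.
have db s : derive1 bump s = expR 2 * (flat 2 (1 + s) * flat 0 (1 - s) + flat 0 (1 + s) * - flat 2 (1 - s)).
  by have h := dvZ (expR 2) (dvM (d1 s) (d2 s)); rewrite derive1E derive_val.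
(* [flat 0] is at most 1! = 1 and [flat 2] at most 3! = 6, and the derivative of the product has two
   terms. *)
exists (expR 2 * 12) => s; have e0 := expR_ge0 (2 : R).
have := hf 0 (1 + s); have := hf 0 (1 - s); have := hf 2 (1 + s); have := hf 2 (1 - s).
rewrite (_ : 3`! = 6)// (_ : 1`! = 1)// => a1 a2 a3 a4.
split; first by rewrite /bump normrM (ger0_norm e0) ler_wpM2l// normrM;
  have := normr_ge0 (flat 0 (1 + s)); have := normr_ge0 (flat 0 (1 - s)); nra.
rewrite db normrM (ger0_norm e0) ler_wpM2l//; apply: le_trans (ler_normD _ _) _.
rewrite !normrM normrN; have := normr_ge0 (flat 0 (1 + s)); have := normr_ge0 (flat 0 (1 - s)).
have := normr_ge0 (flat 2 (1 + s)); have := normr_ge0 (flat 2 (1 - s)); nra.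
Qed.

Lemma bump_supp s : 1 < `|s| -> bump s = 0.
Proof.
move=> s1; rewrite /bump /flat /pos; move: s1; rewrite lter_normr => /orP[s1|s1].
  by rewrite [0 < 1 - s]ltNge subr_le0 ltW// !mulr0.
by rewrite ltNge (_ : 1 + s <= 0) ?mul0r ?mulr0//; lra.
Qed.

End SmoothLine.

(** * Weak derivatives tested on tensor products *)

Section TensorTest.
Variable R : realType.
Notation mu1 := (@lebesgue_measure R).
Notation mu2 := (@sleb2 R).
Notation pl := (measurableTypeR R * measurableTypeR R)%type.
Implicit Types (f g a b : R -> R) (k n : nat).

Definition tens a b (x : R * R) := a x.1 * b x.2.

Lemma derive_tens1 a b (x : R * R) : derivable a x.1 1 ->
  derivable (tens a b) x (e1 R) /\ 'D_(e1 R) (tens a b) x = derive1 a x.1 * b x.2.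
Proof.
move=> da; have h := dvM (derivableP da) (dv_cst (b x.2) x.1).
have E : (fun h : R => h^-1 *: ((tens a b \o shift x) (h *: e1 R) - tens a b x)) =
    (fun h : R => h^-1 *: (((fun s => a s * b x.2) \o shift x.1) (h *: 1) - a x.1 * b x.2)).
  by apply/funext => u; rewrite /tens /= /e1 /= scaler0 add0r.
case: h => h1 h2; split; first by rewrite /derivable E.
by rewrite /derive E -/(derive _ _ _) h2 mulr0 addr0 derive1E.
Qed.

Lemma derive_tens2 a b (x : R * R) : derivable b x.2 1 ->
  derivable (tens a b) x (e2 R) /\ 'D_(e2 R) (tens a b) x = a x.1 * derive1 b x.2.
Proof.
move=> db; have h := dvM (dv_cst (a x.1) x.2) (derivableP db).
have E : (fun h : R => h^-1 *: ((tens a b \o shift x) (h *: e2 R) - tens a b x)) =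
    (fun h : R => h^-1 *: (((fun s => a x.1 * b s) \o shift x.2) (h *: 1) - a x.1 * b x.2)).
  by apply/funext => u; rewrite /tens /= /e2 /= scaler0 add0r.
case: h => h1 h2; split; first by rewrite /derivable E.
by rewrite /derive E -/(derive _ _ _) h2 mul0r add0r derive1E.
Qed.

Lemma continuous_tens a b : continuous a -> continuous b -> continuous (tens a b).
Proof.
move=> ca cb x; apply: (@cvgM _ _ _ _ (fun z : R * R => a z.1) (fun z : R * R => b z.2)).
  by apply: (@cvg_comp _ _ _ (fun z : R * R => z.1) a _ (nbhs x.1)); [exact: cvg_fst|exact: ca].
by apply: (@cvg_comp _ _ _ (fun z : R * R => z.2) b _ (nbhs x.2)); [exact: cvg_snd|exact: cb].
Qed.

Lemma Ck_tens k a b : Sm k a -> Sm k b -> Ck k (tens a b).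
Proof.
elim: k a b => [|k IH] a b sa sb.
  by split => //; exact: continuous_tens (Sm_cont sa) (Sm_cont sb).
split; first exact: continuous_tens (Sm_cont sa) (Sm_cont sb).
have da (s : R) : derivable a s 1 by case: sa => _ [].
have db (s : R) : derivable b s 1 by case: sb => _ [].
split.
- by move=> x; case: (derive_tens1 b (da x.1)).
- by move=> x; case: (derive_tens2 a (db x.2)).
- rewrite (_ : (fun x => _) = tens (derive1 a) b); last first.
    by apply/funext => x; case: (derive_tens1 b (da x.1)).
  by apply: IH; [case: sa => _ []|exact: Sm_le].
- rewrite (_ : (fun x => _) = tens a (derive1 b)); last first.
    by apply/funext => x; case: (derive_tens2 a (db x.2)).
  by apply: IH; [exact: Sm_le|case: sb => _ []].
Qed.

Lemma Sm_derive a : (forall k, Sm k a) -> forall k, Sm k (derive1 a).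
Proof. by move=> sa k; case: (sa k.+1) => _ []. Qed.

Lemma measurable_Sm a : (forall k, Sm k a) -> measurable_fun setT a.
Proof. by move=> sa; apply: continuous_measurable_fun; exact: (Sm_cont (sa 0%N)). Qed.

Definition csupp a := exists B : R, forall s : R, B < `|s| -> a s = 0.

Lemma csupp_derive a : (forall k, Sm k a) -> csupp a -> csupp (derive1 a).
Proof.
move=> sa [B hB]; exists B => s Bs.
rewrite derive1E (_ : 'D_1 a s = 'D_1 (fun=> 0) s); first exact: derive_cst.
apply: near_eq_derive => //; near=> t; apply: hB; near: t.
by apply: (cvgr_gt _ (cvg_norm cvg_id)).
Unshelve. all: by end_near. Qed.

Lemma test_tens a b : (forall k, Sm k a) -> (forall k, Sm k b) -> csupp a -> csupp b ->
  test_function (tens a b).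
Proof.
move=> sa sb [A hA] [B hB]; split; first by move=> k; exact: Ck_tens.
have cA : compact (`[- A, A]%classic `*` `[- B, B]%classic).
  by apply: compact_setX; exact: segment_compact.
apply: (subclosed_compact _ cA); first exact: closed_closure.
rewrite (_ : `[- A, A]%classic `*` `[- B, B]%classic =
   closure (`[- A, A]%classic `*` `[- B, B]%classic)); last first.
  apply/closure_id; apply: compact_closed cA; exact: norm_hausdorff.
apply: closure_subset => x /= hx; split; rewrite /= in_itv /= -ler_norml leNgt; apply/negP.
  by move=> /hA h; move: hx; rewrite /tens h mul0r eqxx.
by move=> /hB h; move: hx; rewrite /tens h mulr0 eqxx.
Qed.

(* Weak derivatives, tested on tensor products only. *)
Definition wd1 (f g : pl -> R) := forall a b, (forall k, Sm k a) -> (forall k, Sm k b) ->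
  csupp a -> csupp b ->
  \int[mu2]_x (f x * (derive1 a x.1 * b x.2)) = - \int[mu2]_x (g x * (a x.1 * b x.2)).
Definition wd2 (f g : pl -> R) := forall a b, (forall k, Sm k a) -> (forall k, Sm k b) ->
  csupp a -> csupp b ->
  \int[mu2]_x (f x * (a x.1 * derive1 b x.2)) = - \int[mu2]_x (g x * (a x.1 * b x.2)).

Lemma cintegral_real (f : pl -> R[i]) (r : pl -> R) :
  cintegral (fun x => f x * (r x)%:C) =
  (\int[mu2]_x (complex.Re (f x) * r x)) +i* (\int[mu2]_x (complex.Im (f x) * r x)).
Proof.
rewrite /cintegral leb2E; congr (_ +i* _); apply: eq_Rintegral => x _;
  case: (f x) => u v /=; ring.
Qed.

(** The boolean [i] selects the coordinate, [true] being the first; the convention is kept below so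
    that both partial derivatives share their proofs. *)
Lemma weak_partial_wd (f g : R * R -> R[i]) (i : bool) :
  weak_partial (if i then e1 R else e2 R) f g ->
  (if i then wd1 else wd2) (fun x => complex.Re (f x)) (fun x => complex.Re (g x)) /\
  (if i then wd1 else wd2) (fun x => complex.Im (f x)) (fun x => complex.Im (g x)).
Proof.
move=> w; suff key a b : (forall k, Sm k a) -> (forall k, Sm k b) -> csupp a -> csupp b ->
    cintegral (fun x : pl => f x * (if i then derive1 a x.1 * b x.2 else a x.1 * derive1 b x.2)%:C) =
    - cintegral (fun x : pl => g x * (a x.1 * b x.2)%:C).
  case: i w key => w key; split => a b sa sb ca cb; have := key a b sa sb ca cb;
    by rewrite !cintegral_real => -[re im].
move=> sa sb ca cb; rewrite -[RHS](w _ (test_tens sa sb ca cb)); congr cintegral.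
apply/funext => x; congr (_ * _%:C).
case: i {w}; first by have [_ ->] := derive_tens1 b (proj1 (proj2 (sa 1%N)) x.1).
by have [_ ->] := derive_tens2 a (proj1 (proj2 (sb 1%N)) x.2).
Qed.

Definition swap (x : pl) : pl := (x.2, x.1).

Lemma mpres_swap : mpres mu2 swap.
Proof.
have ms : measurable_fun setT swap by exact: measurable_fun_pair.
split => // f mf f0; rewrite int2_xy; [|exact: measurableT_comp mf ms|by move=> z; exact: f0].
by rewrite int2_yx.
Qed.

Lemma wd2_swap (f g : pl -> R) : measurable_fun setT f -> measurable_fun setT g ->
  wd2 f g -> wd1 (f \o swap) (g \o swap).
Proof.
move=> mf mg w a b sa sb ca cb; have m (h : R -> R) : (forall k, Sm k h) -> measurable_fun setT (derive1 h).
  move=> sh; have sh1 := sh 1%N; apply: continuous_measurable_fun; exact: (@Sm_cont _ 0%N _ sh1.2.2).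
have m0 (h : R -> R) : (forall k, Sm k h) -> measurable_fun setT h.
  by move=> sh; apply: continuous_measurable_fun; exact: (Sm_cont (sh 0%N)).
have mt (u v : R -> R) : measurable_fun setT u -> measurable_fun setT v ->
    measurable_fun setT (fun x : pl => u x.1 * v x.2).
  by move=> mu mv; apply: measurable_funM;
    [exact: measurableT_comp mu measurable_fst|exact: measurableT_comp mv measurable_snd].
have := w b a sb sa cb ca.
rewrite -(mpres_Int mpres_swap) /=; last by apply: measurable_funM => //; apply: mt; [exact: m0|exact: m].
rewrite -[X in _ = - X](mpres_Int mpres_swap) /=; last by apply: measurable_funM => //; apply: mt; exact: m0.
move=> h; rewrite (@eq_Rintegral _ _ _ mu2 _ (fun x : pl => f (swap x) * (b x.2 * derive1 a x.1))); last first.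
  by move=> x _; rewrite (mulrC (derive1 a _)).
rewrite h; congr (- _); apply: eq_Rintegral => x _; congr (_ * _); exact: mulrC.
Qed.

Lemma sq_tens (a b : R -> R) : sq mu1 a -> sq mu1 b -> sq mu2 (tens a b).
Proof.
move=> [ma ia] [mb ib].
have mt (u v : R -> R) : measurable_fun setT u -> measurable_fun setT v ->
    measurable_fun setT (fun x : pl => u x.1 * v x.2).
  by move=> mu mv; apply: measurable_funM;
    [exact: measurableT_comp mu measurable_fst|exact: measurableT_comp mv measurable_snd].
have m2 (u : R -> R) : measurable_fun setT u -> measurable_fun setT (fun x => u x ^+ 2).
  by move=> mu; exact: measurable_funX.
split; first exact: mt.
rewrite (_ : (fun x => _) = (fun x : pl => (a x.1 ^+ 2) * (b x.2 ^+ 2))); last first.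
  by apply/funext => x; rewrite /tens exprMn.
apply: L1_ge0; first exact: mt (m2 _ ma) (m2 _ mb).
  by move=> x; rewrite mulr_ge0 ?sqr_ge0.
rewrite (int2_prod (m2 _ ma) (m2 _ mb) (fun x => sqr_ge0 _) (fun x => sqr_ge0 _)).
by rewrite (L1_fin ia) (L1_fin ib) -EFinM ltry.
Qed.

Lemma bump_scale n (c := (n.+1%:R : R)^-1) :
  [/\ forall k, Sm k (fun s => bump (c * s)), csupp (fun s => bump (c * s)) &
   forall s : R, derive1 (fun s => bump (c * s)) s = derive1 (@bump R) (c * s) * c].
Proof.
have c0 : 0 < c by rewrite invr_gt0.
have E : (fun s => bump (c * s)) = (fun s => bump (c * s + 0)) by apply/funext => s; rewrite addr0.
split.
- by move=> k; rewrite E; apply: Sm_affine; exact: Sm_bump.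
- exists n.+1%:R => s hs; apply: bump_supp; rewrite normrM gtr0_norm//.
  by rewrite -(@mulVf _ n.+1%:R)// -/c ltr_pM2l.
- move=> s; have h := @dv_comp R (@bump R) (fun s => c * s) s _ _
    (Sm_is_derive (Sm_bump R 1) (c * s)) (dvZ c (dv_id s)).
  by rewrite derive1E derive_val mulr1.
Qed.

Lemma csuppM a b : csupp b -> csupp (fun s => a s * b s).
Proof. by move=> [B hB]; exists B => s /hB ->; rewrite mulr0. Qed.

Lemma cvg_inv_nat : (n.+1%:R : R)^-1 @[n --> \oo] --> (0 : R).
Proof. exact: cvg_harmonic. Qed.

Lemma bump_scale_cvg (s : R) : bump (n.+1%:R^-1 * s) @[n --> \oo] --> (1 : R).
Proof.
have h : n.+1%:R^-1 * s @[n --> \oo] --> (0 : R).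
  by rewrite -[X in _ --> X](mul0r s); apply: cvgMl; exact: cvg_inv_nat.
have := Sm_cont (Sm_bump R 0); rewrite -[X in _ --> X](bump0 R) => hc.
by apply: (cvg_comp _ _ h); exact: hc.
Qed.

(** Gaussians have no compact support, so the class of test functions has to be enlarged.
    Multiplying by the cutoffs [bump (s / (n + 1))] gives admissible functions, and the extra term
    in the derivative carries a factor [1 / (n + 1)]. *)
Lemma wd1_ext (f g : pl -> R) a b : sq mu2 f -> sq mu2 g -> wd1 f g ->
  (forall k, Sm k a) -> (forall k, Sm k b) -> sq mu1 a -> sq mu1 (derive1 a) -> sq mu1 b ->
  \int[mu2]_x (f x * (derive1 a x.1 * b x.2)) = - \int[mu2]_x (g x * (a x.1 * b x.2)).
Proof.
move=> sf sg w sa sb qa qa' qb.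
have [C hC] := bump_bound R; have C0 : 0 <= C by have [h _] := hC 0; exact: le_trans h.
pose c n : R := n.+1%:R^-1; pose chi n (s : R) := bump (c n * s).
have chi1 (s : R) : chi n s @[n --> \oo] --> (1 : R).
  exact: bump_scale_cvg.
have c01 n : 0 <= c n <= 1 by rewrite invr_ge0 ler0n invf_le1// ler1n.
pose an n (s : R) := a s * chi n s; pose bn n (s : R) := b s * chi n s.
pose dan n (s : R) := derive1 a s * chi n s + a s * (derive1 (@bump R) (c n * s) * c n).
have dan_ok n : derive1 (an n) = dan n.
  have [h1 h2 h3] := bump_scale n; apply/funext => s.
  have h := dvM (Sm_is_derive (sa 1%N) s) (Sm_is_derive (h1 1%N) s).
  by rewrite derive1E derive_val /dan h3.
have san n k : Sm k (an n) by apply: SmM => //; case: (bump_scale n).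
have sbn n k : Sm k (bn n) by apply: SmM => //; case: (bump_scale n).
have can n : csupp (an n) by apply: csuppM; case: (bump_scale n).
have cbn n : csupp (bn n) by apply: csuppM; case: (bump_scale n).
have key n := w _ _ (san n) (sbn n) (can n) (cbn n).
have mS h : (forall k, Sm k h) -> measurable_fun setT h.
  by move=> sh; apply: continuous_measurable_fun; exact: (Sm_cont (sh 0%N)).
have mt (u v : R -> R) : measurable_fun setT u -> measurable_fun setT v ->
    measurable_fun setT (fun x : pl => u x.1 * v x.2).
  by move=> mu mv; apply: measurable_funM;
    [exact: measurableT_comp mu measurable_fst|exact: measurableT_comp mv measurable_snd].
have chiC n s : `|chi n s| <= C by case: (hC (c n * s)).
have anC n s : `|an n s| <= C * `|a s|.
  by rewrite normrM mulrC ler_wpM2r.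
have bnC n s : `|bn n s| <= C * `|b s|.
  by rewrite normrM mulrC ler_wpM2r.
have danC n s : `|dan n s| <= C * `|derive1 a s| + C * `|a s|.
  apply: le_trans (ler_normD _ _) _; rewrite (normrM (derive1 a s)) (normrM (a s)) (normrM (derive1 (@bump R) _)); apply: lerD.
    by rewrite mulrC; apply: ler_wpM2r (normr_ge0 _) _ _ _; exact: chiC.
  have [_ h] := hC (c n * s); have /andP[h0 h1] := c01 n; rewrite mulrC ler_wpM2r// (ger0_norm h0).
  by apply: le_trans h; rewrite ler_piMr.
have sqC (u : R -> R) : sq mu1 u -> sq mu1 (fun s => C * `|u s|) by move=> su; apply: sqZ; exact: sq_norm.
have dan1 (s : R) : dan n s @[n --> \oo] --> derive1 a s.
  have h1 : derive1 a s * chi n s @[n --> \oo] --> derive1 a s.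
    by rewrite -[X in _ --> X]mulr1; apply: cvgMr; exact: chi1.
  have h2 : a s * (derive1 (@bump R) (c n * s) * c n) @[n --> \oo] --> (0 : R).
    rewrite -[X in _ --> X](mulr0 (a s)); apply: cvgMr.
    apply/norm_cvg0P; apply: (@squeeze_cvgr _ _ _ _ (fun=> 0) (fun n => C * c n)).
    + apply: nearW => n; rewrite normr_ge0 normrM; have [_ h] := hC (c n * s).
      by have /andP[h0 h1'] := c01 n; rewrite (ger0_norm h0) ler_wpM2r.
    + exact: cvg_cst.
    + by rewrite -[X in _ --> X](mulr0 C); apply: cvgMr; exact: cvg_inv_nat.
  by rewrite -[X in _ --> X]addr0; exact: cvgD h1 h2.
have L1 : \int[mu2]_x (f x * (derive1 (an n) x.1 * bn n x.2)) @[n --> \oo] -->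
    \int[mu2]_x (f x * (derive1 a x.1 * b x.2)).
  apply: (proj2 (@dct _ _ R mu2 (fun n x => f x * (derive1 (an n) x.1 * bn n x.2)) _
    (fun x => `|f x| * tens (fun s => C * `|derive1 a s| + C * `|a s|) (fun s => C * `|b s|) x) _ _ _ _ _)).
  - move=> n; apply: measurable_funM; first exact: sf.1.
    apply: mt; last exact: mS.
    exact: measurable_Sm (Sm_derive (san n)).
  - by apply: measurable_funM; [exact: sf.1|apply: mt; [exact: qa'.1|exact: qb.1]].
  - apply: sq_mul; first exact: sq_norm.
    by apply: sq_tens; [apply: sqD; exact: sqC|exact: sqC].
  - move=> n x; rewrite normrM ler_wpM2l// normrM /tens dan_ok ler_pM//.
  - apply: aeW => x; apply: cvgMr; apply: cvgM; last first.
      by rewrite -[X in _ --> X]mulr1; apply: cvgMr; exact: chi1.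
    rewrite (_ : (fun n => _) = (fun n => dan n x.1)); last by apply/funext => n; rewrite dan_ok.
    exact: dan1.
have L2 : \int[mu2]_x (g x * (an n x.1 * bn n x.2)) @[n --> \oo] -->
    \int[mu2]_x (g x * (a x.1 * b x.2)).
  apply: (proj2 (@dct _ _ R mu2 (fun n x => g x * (an n x.1 * bn n x.2)) _
    (fun x => `|g x| * tens (fun s => C * `|a s|) (fun s => C * `|b s|) x) _ _ _ _ _)).
  - move=> n; apply: measurable_funM; first exact: sg.1.
    by apply: mt; apply: mS.
  - by apply: measurable_funM; [exact: sg.1|apply: mt; [exact: qa.1|exact: qb.1]].
  - apply: sq_mul; first exact: sq_norm.
    by apply: sq_tens; exact: sqC.
  - by move=> n x; rewrite normrM ler_wpM2l// normrM /tens ler_pM.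
  - apply: aeW => x; apply: cvgMr; apply: cvgM;
      by rewrite -[X in _ --> X]mulr1; apply: cvgMr; exact: chi1.
have e : (fun n => \int[mu2]_x (f x * (derive1 (an n) x.1 * bn n x.2))) =
  (fun n => - \int[mu2]_x (g x * (an n x.1 * bn n x.2))) by apply/funext.
by rewrite e in L1; exact: (cvg_unique _ L1 (cvgN L2)).
Qed.

Lemma wd2_ext (f g : pl -> R) a b : sq mu2 f -> sq mu2 g -> wd2 f g ->
  (forall k, Sm k a) -> (forall k, Sm k b) -> sq mu1 a -> sq mu1 b -> sq mu1 (derive1 b) ->
  \int[mu2]_x (f x * (a x.1 * derive1 b x.2)) = - \int[mu2]_x (g x * (a x.1 * b x.2)).
Proof.
move=> sf sg w sa sb qa qb qb'.
have sw (h : pl -> R) : sq mu2 h -> sq mu2 (h \o swap).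
  move=> [mh ih]; split; first exact: (measurableT_comp mh mpres_swap.1).
  exact: (mpres_L1 mpres_swap ih).
have mt (u v : R -> R) : sq mu1 u -> sq mu1 v -> measurable_fun setT (fun x : pl => u x.1 * v x.2).
  by move=> mu mv; exact: (sq_tens mu mv).1.
have := wd1_ext (sw _ sf) (sw _ sg) (wd2_swap sf.1 sg.1 w) sb sa qb qb' qa.
rewrite -(mpres_Int mpres_swap) /=; last first.
  by apply: measurable_funM; [exact: (sw _ sf).1|exact: mt].
rewrite -[X in _ = - X](mpres_Int mpres_swap) /=; last first.
  by apply: measurable_funM; [exact: (sw _ sg).1|exact: mt].
move=> h; rewrite (@eq_Rintegral _ _ _ mu2 _ (fun x : pl => f (swap (swap x)) * (derive1 b x.2 * a x.1))); last first.
  by move=> [u v] _; rewrite (mulrC (derive1 b _)).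
by rewrite h; congr (- _); apply: eq_Rintegral => -[u v] _; congr (_ * _); exact: mulrC.
Qed.

End TensorTest.

(** * Functions determined by their integrals over rectangles *)

Section MeasurableIntegral.
Context d1 d2 (T1 : measurableType d1) (T2 : measurableType d2) (R : realType).
Variables (m1 : {sigma_finite_measure set T1 -> \bar R})
          (m2 : {sigma_finite_measure set T2 -> \bar R}).

Lemma measurable_Rint (f : T1 * T2 -> R) : measurable_fun setT f ->
  measurable_fun setT (fun x => \int[m2]_y f (x, y)).
Proof.
move=> mf; apply: (@measurableT_comp _ _ _ _ _ _ (@fine R)); first exact: fine_measurable.
rewrite (_ : (fun x => _) = (fun x => \int[m2]_y (fun z => (f z)%:E)^\+%E (x, y) -
   \int[m2]_y (fun z => (f z)%:E)^\-%E (x, y))%E); last first.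
  apply/funext => x; rewrite integralE; congr (_ - _)%E; apply: eq_integral => y _.
    by rewrite !funeposE.
  by rewrite !funenegE.
have mE : measurable_fun setT (EFin \o f) by exact/measurable_EFinP.
apply: emeasurable_funB; apply: (measurable_fun_fubini_tonelli_F (m2 := m2)) => //.
- exact: measurable_funepos.
- exact: measurable_funeneg.
Qed.

End MeasurableIntegral.

Section IntegralLimit.
Context d (T : measurableType d) (R : realType) (mu : {measure set T -> \bar R}).

Lemma Int_lim_cst (F : nat -> T -> R) (f g : T -> R) (c : R) :
  (forall n, measurable_fun setT (F n)) -> measurable_fun setT f -> L1 mu g ->
  (forall n x, `|F n x| <= g x) -> {ae mu, forall x, F n x @[n --> \oo] --> f x} ->
  (forall n, \int[mu]_x F n x = c) -> \int[mu]_x f x = c.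
Proof.
move=> mF mf Lg Fg Ff Fc; have [_ h] := dct mF mf Lg Fg Ff.
apply: cvg_unique h _ => //; rewrite (_ : (fun n => _) = (fun=> c)); first exact: cvg_cst.
exact/funext.
Qed.

End IntegralLimit.

Section Dynkin.
Context d1 d2 (T : measurableType d1) (T' : measurableType d2) (R : realType).
Variable mu : {measure set T -> \bar R}.

(** Because [F] has integral 0 over the whole space, the sets over which its integral vanishes are
    stable under complement and disjoint union, so a generating class closed under intersection
    decides. *)
Lemma Int_indic_dynkin (F : T -> R) (phi : T -> T') (G : set (set T')) :
  L1 mu F -> measurable_fun setT phi -> @measurable _ T' = <<s G >> -> setI_closed G ->
  \int[mu]_x F x = 0 -> (forall A, G A -> \int[mu]_x (F x * \1_A (phi x)) = 0) ->
  forall A, measurable A -> \int[mu]_x (F x * \1_A (phi x)) = 0.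
Proof.
move=> LF mphi GE GI F0 GF A mA.
have mi B : measurable B -> measurable_fun setT (fun x => \1_B (phi x) : R).
  by move=> mB; apply: (measurableT_comp _ mphi); exact: measurable_indic.
have mFi B : measurable B -> measurable_fun setT (fun x => F x * \1_B (phi x)).
  by move=> mB; apply: measurable_funM; [exact: L1_meas LF|exact: mi].
have LFi B : measurable B -> L1 mu (fun x => F x * \1_B (phi x)).
  move=> mB; apply: L1_le (mFi _ mB) _ (L1_norm LF) => x.
  by rewrite normrM indicE ler_piMr//; case: (_ \in _); rewrite ?normr1 ?normr0.
apply: (@dynkin_induction _ T' G (fun A => \int[mu]_x (F x * \1_A (phi x)) = 0)) => //.
- rewrite -[RHS]F0; apply: eq_Rintegral => x _.
  by rewrite indicE in_setT mulr1.
- move=> S mS h; rewrite -[RHS](subrr 0) -[in X in _ = X - _]F0 -[in X in _ = _ - X]h -IntB//; last exact: LFi.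
  by apply: eq_Rintegral => x _; rewrite !indicE in_setC; case: (_ \in S) => /=; ring.
- move=> H mH tH hH.
  have mU : measurable (\bigcup_k H k) by exact: bigcupT_measurable.
  have e n : \int[mu]_x (F x * \1_(\big[setU/set0]_(i < n) H i) (phi x)) = 0.
    elim: n => [|n IH].
      rewrite -[RHS](subrr 0) -[in X in _ = X - _]F0 -[in X in _ = _ - X]F0 -IntB//.
      by apply: eq_Rintegral => x _; rewrite big_ord0 indicE in_set0 mulr0 subrr.
    rewrite big_ord_recr/= -[RHS]addr0 -[in X in _ = X + _]IH -[in X in _ = _ + X](hH n) -IntD; last 2 first.
    + by apply: LFi; exact: bigsetU_measurable.
    + exact: LFi.
    apply: eq_Rintegral => x _; rewrite -mulrDr; congr (_ * _); rewrite !indicE in_setU.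
    have [h1|//] := boolP (phi x \in \big[setU/set0]_(i < n) H i); last by rewrite add0r.
    rewrite (_ : phi x \in H n = false) ?addr0//; apply/negbTE/negP => /set_mem h2.
    move/set_mem : h1; rewrite -bigcup_mkord => -[k /= kn h1].
    have := tH k n Logic.I Logic.I (ex_intro _ _ (conj h1 h2)) => kn'.
    by rewrite kn' ltnn in kn.
  apply: (@Int_lim_cst _ _ R mu (fun n x => F x * \1_(\big[setU/set0]_(i < n) H i) (phi x)) _
    (fun x => `|F x|)) => //.
  + by move=> n; apply: mFi; exact: bigsetU_measurable.
  + exact: mFi.
  + exact: L1_norm.
  + by move=> n x; rewrite normrM indicE ler_piMr//; case: (_ \in _); rewrite ?normr1 ?normr0.
  + apply: aeW => x; apply: cvgMr; rewrite indicE.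
    have [/set_mem[k _ hk]|hx] := boolP (phi x \in \bigcup_k H k).
      apply: cvg_near_cst; exists k.+1 => // n /= kn; rewrite indicE.
      by rewrite mem_set// -bigcup_mkord; exists k.
    apply: cvg_near_cst; apply: nearW => n; rewrite indicE.
    suff -> : phi x \in \big[setU/set0]_(i < n) H i = false by [].
    apply/negbTE; apply: contra hx => /set_mem; rewrite -bigcup_mkord => -[k _ hk].
    by apply/mem_set; exists k.
- by rewrite -GE.
Qed.

End Dynkin.

Section Density.
Variable R : realType.
Notation mu1 := (@lebesgue_measure R).
Notation mu2 := (@sleb2 R).
Notation pl := (measurableTypeR R * measurableTypeR R)%type.

Definition ind (a b s : R) : R := \1_(`]a, b]%classic : set R) s.

Lemma indE a b s : ind a b s = ((a < s) && (s <= b))%:R.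
Proof. by rewrite /ind indicE mem_setE in_itv. Qed.

Lemma ind_ge0 a b s : 0 <= ind a b s. Proof. by rewrite indE ler0n. Qed.

Lemma ind_le1 a b s : ind a b s <= 1. Proof. by rewrite indE lern1 leq_b1. Qed.

Lemma measurable_ind a b : measurable_fun setT (ind a b).
Proof. exact: measurable_indic. Qed.

(** The Dynkin argument is run in each coordinate and then on products of measurable sets, which
    gives all measurable sets. The set where [psi > 0] then yields [\int |psi| = 0]. *)
Lemma ae_eq0_box (psi : pl -> R) : L1 mu2 psi ->
  (forall a b c d, \int[mu2]_x (psi x * (ind a b x.1 * ind c d x.2)) = 0) ->
  \int[mu2]_x psi x = 0 -> {ae mu2, forall x, psi x = 0}.
Proof.
move=> Lp rect psi0.
have LM (A : set R) (F : pl -> R) (phi : pl -> measurableTypeR R) : measurable A -> measurable_fun setT phi ->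
    L1 mu2 F -> L1 mu2 (fun x => F x * \1_A (phi x)).
  move=> mA mphi LF; apply: L1_le _ _ (L1_norm LF) => [|x].
    apply: measurable_funM; first exact: L1_meas LF.
    by apply: (measurableT_comp _ mphi); exact: measurable_indic.
  by rewrite normrM indicE ler_piMr//; case: (_ \in _); rewrite ?normr1 ?normr0.
have oE : @measurable _ (measurableTypeR R) = <<s [set `]x.1, x.2]%classic | x in [set: R * R]] >> by [].
have oI : setI_closed [set `]x.1, x.2]%classic | x in [set: R * R]].
  exact: (@ocitvI R).
have s0 c d : \int[mu2]_x (psi x * \1_(`]c, d]%classic : set R) x.2) = 0.
  apply: (@Int_lim_cst _ _ R mu2 (fun n x => psi x * (ind (- n%:R) n%:R x.1 * ind c d x.2)) _
    (fun x => `|psi x|)) => //.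
  - move=> n; apply: measurable_funM; first exact: L1_meas Lp.
    by apply: measurable_funM; apply: (measurableT_comp (measurable_ind _ _)).
  - apply: measurable_funM; first exact: L1_meas Lp.
    by apply: (measurableT_comp (measurable_ind _ _)).
  - exact: L1_norm.
  - move=> n x; rewrite normrM ler_piMr// ger0_norm ?mulr_ge0 ?ind_ge0//.
    by rewrite mulr_ile1 ?ind_ge0 ?ind_le1.
  - apply: aeW => x; apply: cvgMr; rewrite -[X in _ --> X]mul1r; apply: cvgMl.
    have [k hk] : exists k : nat, `|x.1| < k%:R.
      by exists (Num.bound `|x.1|); exact: archi_boundP.
    apply: cvg_near_cst; exists k => // n /= kn; rewrite indE.
    have h1 : `|x.1| < n%:R by rewrite (lt_le_trans hk)// ler_nat.
    by move: h1; rewrite ltr_norml => /andP[-> /ltW ->].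
have st c d A : measurable A -> \int[mu2]_x (psi x * \1_(`]c, d]%classic : set R) x.2 * \1_A x.1) = 0.
  apply: (@Int_indic_dynkin _ _ _ (measurableTypeR R) R mu2 _ (fun x : pl => x.1) _ _ _ oE oI) => //.
  - exact: LM.
  - exact: measurable_fst.
  - move=> _ [[a b] _ <-]; rewrite -[RHS](rect a b c d); apply: eq_Rintegral => x _ /=.
    by rewrite -mulrA (mulrC (\1_ _ x.2)).
have s1 A : measurable A -> \int[mu2]_x (psi x * \1_A x.1) = 0.
  apply: (@Int_indic_dynkin _ _ _ (measurableTypeR R) R mu2 _ (fun x : pl => x.1) _ _ _ oE oI) => //; first exact: measurable_fst.
  move=> _ [[a b] _ <-] /=.
  apply: (@Int_lim_cst _ _ R mu2 (fun n x => psi x * (ind a b x.1 * ind (- n%:R) n%:R x.2)) _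
    (fun x => `|psi x|)) => //.
  - move=> n; apply: measurable_funM; first exact: L1_meas Lp.
    by apply: measurable_funM; apply: (measurableT_comp (measurable_ind _ _)).
  - apply: measurable_funM; first exact: L1_meas Lp.
    by apply: (measurableT_comp (measurable_ind _ _)).
  - exact: L1_norm.
  - move=> n x; rewrite normrM ler_piMr// ger0_norm ?mulr_ge0 ?ind_ge0//.
    by rewrite mulr_ile1 ?ind_ge0 ?ind_le1.
  - apply: aeW => x; apply: cvgMr; rewrite -[X in _ --> X]mulr1; apply: cvgMr.
    have [k hk] : exists k : nat, `|x.2| < k%:R.
      by exists (Num.bound `|x.2|); exact: archi_boundP.
    apply: cvg_near_cst; exists k => // n /= kn; rewrite indE.
    have h1 : `|x.2| < n%:R by rewrite (lt_le_trans hk)// ler_nat.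
    by move: h1; rewrite ltr_norml => /andP[-> /ltW ->].
have s2 A B : measurable A -> measurable B -> \int[mu2]_x (psi x * \1_A x.1 * \1_B x.2) = 0.
  move=> mA; apply: (@Int_indic_dynkin _ _ _ (measurableTypeR R) R mu2 _ (fun x : pl => x.2) _ _ _ oE oI) => //.
  - exact: LM.
  - exact: measurable_snd.
  - exact: s1.
  - move=> _ [[a b] _ <-]; rewrite -[RHS](st a b A mA); apply: eq_Rintegral => x _ /=.
    by rewrite -!mulrA (mulrC (\1_ _ x.2)).
have s3 C : measurable C -> \int[mu2]_x (psi x * \1_C (x : pl)) = 0.
  apply: (@Int_indic_dynkin _ _ _ pl R mu2 _ (fun x : pl => x) _ _ _ (measurable_prod_measurableType _ _)) => //.
  - move=> _ _ [A mA [B mB <-]] [A' mA' [B' mB' <-]]; rewrite -setXI.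
    by exists (A `&` A'); [exact: measurableI|exists (B `&` B') => //; exact: measurableI].
  - move=> _ [A mA [B mB <-]]; rewrite -[RHS](s2 A B mA mB); apply: eq_Rintegral => -[u v] _ /=.
    rewrite -mulrA; congr (_ * _); rewrite !indicE in_setX /=.
    by rewrite -natrM mulnb.
pose C := [set x : pl | 0 < psi x].
have mC : measurable C.
  have := L1_meas Lp measurableT (measurable_itv `]0, +oo[); rewrite setTI.
  by rewrite (_ : _ @^-1` _ = C)//; apply/seteqP; split => x; rewrite /C /= in_itv /= andbT.
have LC : L1 mu2 (fun x => psi x * \1_C x).
  apply: L1_le _ _ (L1_norm Lp) => [|x].
    by apply: measurable_funM; [exact: L1_meas Lp|exact: measurable_indic].
  by rewrite normrM indicE ler_piMr//; case: (_ \in _); rewrite ?normr1 ?normr0.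
have pn x : `|psi x| = 2 * (psi x * \1_C x) - psi x.
  have e : (x \in C) = (0 < psi x) by apply/idP/idP => [/set_mem//|h]; exact: mem_set.
  rewrite indicE e; have [h|h] := ltP 0 (psi x).
    by rewrite gtr0_norm// mulr1; ring.
  by rewrite ler0_norm// mulr0; ring.
apply: filterS (Int_eq0_ae (L1_norm Lp) _ _) => [x /normr0_eq0//| |].
  by move=> x; exact: normr_ge0.
under eq_Rintegral do rewrite pn.
by rewrite IntB ?IntZ//; [rewrite psi0 s3// mulr0 subr0|exact: L1Z].
Qed.

End Density.

(** * Convolution with an integrable kernel *)

Section Convolution.
Variable R : realType.
Notation mu1 := (@lebesgue_measure R).
Notation mu2 := (@sleb2 R).
Notation pl := (measurableTypeR R * measurableTypeR R)%type.

Lemma measurable_sub_pl d (T : measurableType d) (f g : T -> pl) :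
  measurable_fun setT f -> measurable_fun setT g ->
  measurable_fun setT (fun x => (f x - g x : R * R) : pl).
Proof.
move=> mf mg; apply: (@measurable_fun_pair _ _ _ _ _ _ (fun x => (f x).1 - (g x).1) (fun x => (f x).2 - (g x).2)).
  by apply: measurable_funB; exact: measurableT_comp measurable_fst _.
by apply: measurable_funB; exact: measurableT_comp measurable_snd _.
Qed.

Definition conv (k s : pl -> R) (x : pl) : R := \int[mu2]_y (k (x - y : R * R) * s y).

Lemma measurable_shift (k : pl -> R) : measurable_fun setT k ->
  measurable_fun setT (fun z : pl * pl => k (z.1 - z.2 : R * R)).
Proof.
by move=> mk; apply: (measurableT_comp mk); apply: measurable_sub_pl.
Qed.

Lemma measurable_conv k s : measurable_fun setT k -> measurable_fun setT s ->
  measurable_fun setT (conv k s).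
Proof.
move=> mk ms; apply: (@measurable_Rint _ _ _ _ _ mu2 (fun z : pl * pl => k (z.1 - z.2 : R * R) * s z.2)).
by apply: measurable_funM; [exact: measurable_shift|exact: measurableT_comp ms measurable_snd].
Qed.

Lemma L1_shift1 k h : L1 mu2 k -> L1 mu2 h ->
  L1 (mu2 \x mu2)%E (fun z : pl * pl => k (z.1 - z.2 : R * R) * h z.1).
Proof.
move=> Lk Lh; have mk := L1_meas Lk; have mh := L1_meas Lh; apply: L1_prod12.
  by apply: measurable_funM; [exact: measurable_shift|exact: measurableT_comp mh measurable_fst].
rewrite (eq_integral (fun x => (`|h x| * \int[mu2]_y `|k y|)%:E)).
  apply: L1_lty => [|x]; last by rewrite mulr_ge0// Int_ge0.
  by apply: L1_eq (L1Z (\int[mu2]_y `|k y|) (L1_norm Lh)) => x; rewrite mulrC.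
move=> x _; under eq_integral do rewrite normrM mulrC /=.
have mkx : measurable_fun setT (fun y : pl => `|k (x - y : R * R)|).
  by apply: measurableT_comp => //; exact: (measurableT_comp mk (mpres_subl x).1).
rewrite ge0_intZ// ((mpres_subl x).2 (fun y => `|k y|%:E))//.
  by rewrite EFinM (L1_fin (L1_norm Lk)).
by apply/measurable_EFinP; exact: measurableT_comp.
Qed.

Lemma L1_shift2 k h : L1 mu2 k -> L1 mu2 h ->
  L1 (mu2 \x mu2)%E (fun z : pl * pl => k (z.1 - z.2 : R * R) * h z.2).
Proof.
move=> Lk Lh; have Lk' : L1 mu2 (fun z => k (- z : R * R)) by exact: (mpres_L1 (mpres_neg R)).
apply: L1_eq (L1_swap (L1_shift1 Lk' Lh)) => z /=.
by rewrite opprB.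
Qed.

Lemma L1_pair k g s : L1 mu2 k -> sq mu2 g -> sq mu2 s ->
  L1 (mu2 \x mu2)%E (fun z : pl * pl => g z.1 * (k (z.1 - z.2 : R * R) * s z.2)).
Proof.
move=> Lk [mg g2] [ms s2]; have mk := L1_meas Lk; have Lk' := L1_norm Lk.
apply: L1_le _ _ (L1D (L1_shift1 Lk' g2) (L1_shift2 Lk' s2)) => [|z].
  apply: measurable_funM; first exact: measurableT_comp mg measurable_fst.
  by apply: measurable_funM; [exact: measurable_shift|exact: measurableT_comp ms measurable_snd].
rewrite -mulrDr mulrCA normrM ler_wpM2l// normrM.
rewrite -(real_normK (num_real (g z.1))) -(real_normK (num_real (s z.2))).
have := sqr_ge0 (`|g z.1| - `|s z.2|); have := sqr_ge0 (`|g z.1| + `|s z.2|).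
by nra.
Qed.

Lemma conv_pair k g s : L1 mu2 k -> sq mu2 g -> sq mu2 s ->
  \int[mu2]_x (g x * conv k s x) = \int[mu2]_y (s y * conv (fun z => k (- z : R * R)) g y).
Proof.
move=> Lk sg ss; have L := L1_pair Lk sg ss; have [_ _ ae1 ae2 e] := RFubini L.
have mk := L1_meas Lk.
have mkN : measurable_fun setT (fun z : pl => k (- z : R * R)).
  exact: (measurableT_comp mk (mpres_neg R).1).
transitivity (\int[mu2]_x \int[mu2]_y (g x * (k (x - y : R * R) * s y))).
  apply: Int_ae.
  - by apply: measurable_funM; [exact: sg.1|exact: measurable_conv mk ss.1].
  - by have [/L1_meas] := RFubini L.
  (* Fubini's theorem gives integrability of the integrand multiplied by [g x], which says nothing
     when [g x = 0]; in that case both sides vanish. *)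
  - apply: filterS ae1 => x /= Lx; have [->|g0] := eqVneq (g x) 0.
      by rewrite mul0r; under [RHS]eq_Rintegral do rewrite mul0r; rewrite /Rintegral integral0.
    have Ls : L1 mu2 (fun y => k (x - y : R * R) * s y).
      by apply: L1_eq (L1Z (g x)^-1 Lx) => y; rewrite mulKf.
    by rewrite [RHS](IntZ _ Ls).
rewrite e; apply/esym; apply: Int_ae.
- by apply: measurable_funM; [exact: ss.1|exact: measurable_conv mkN sg.1].
- by have [_ /L1_meas] := RFubini L.
- apply: filterS ae2 => y /= Ly; have [s0|s0] := eqVneq (s y) 0.
    rewrite s0 mul0r; apply/esym; under eq_Rintegral do rewrite mulr0 mulr0; rewrite /Rintegral integral0//.
  rewrite /conv -IntZ.
    by apply: eq_Rintegral => x _; rewrite opprB; ring.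
  apply: L1_eq (L1Z (s y)^-1 Ly) => x.
  by rewrite opprB; field.
Qed.

(** Cauchy-Schwarz for the measure |k(x - y)| dy bounds the square of the convolution by a constant
    times |k| * s^2, which is integrable by Fubini's theorem. *)
Lemma conv_sq k s : L1 mu2 k -> sq mu2 s -> sq mu2 (conv k s).
Proof.
move=> Lk [ms s2]; have mk := L1_meas Lk; have Lk' := L1_norm Lk; have mc := measurable_conv mk ms.
pose K := \int[mu2]_y `|k y|; have K0 : 0 <= K by apply: Int_ge0.
pose h x := K * \int[mu2]_y (`|k (x - y : R * R)| * s y ^+ 2).
have [LH aeH _] := RFubini1 (L1_shift2 Lk' s2); have Lh : L1 mu2 h by exact: L1Z.
have h0 x : 0 <= h x by rewrite mulr_ge0// Int_ge0// => y; rewrite mulr_ge0// sqr_ge0.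
(* The bound by [h] holds almost everywhere while [L1_le] asks for it everywhere; the minimum
   satisfies it everywhere and differs on a null set only. *)
split => //; apply: (@L1_ae _ _ R mu2 (fun x => Num.min (conv k s x ^+ 2) (h x))).
- exact: measurable_funX.
- apply: filterS aeH => x /= Lx; apply/min_idPl.
  have Lkx : L1 mu2 (fun y : pl => `|k (x - y : R * R)|) by exact: (mpres_L1 (mpres_subl x) Lk').
  have sa : sq mu2 (fun y : pl => Num.sqrt `|k (x - y : R * R)|).
    split; first by apply: (measurableT_comp (@measurable_sqrt R)); exact: L1_meas Lkx.
    by apply: L1_eq Lkx => y; rewrite sqr_sqrtr.
  have sb : sq mu2 (fun y : pl => Num.sqrt `|k (x - y : R * R)| * `|s y|).
    split; first by apply: measurable_funM; [exact: sa.1|exact: measurableT_comp].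
    by apply: L1_eq Lx => y; rewrite exprMn sqr_sqrtr// real_normK// num_real.
  have := Int_CS sa sb.
  rewrite (_ : \int[mu2]_y (Num.sqrt _ ^+ 2) = K); last first.
    rewrite /K -(@mpres_Int _ _ R mu2 _ (fun z => `|k z|) (mpres_subl x) (L1_meas Lk')).
    by apply: eq_Rintegral => y _; rewrite sqr_sqrtr.
  rewrite (_ : \int[mu2]_y ((Num.sqrt _ * _) ^+ 2) = \int[mu2]_y (`|k (x - y : R * R)| * s y ^+ 2)); last first.
    by apply: eq_Rintegral => y _; rewrite exprMn sqr_sqrtr// real_normK// num_real.
  apply: le_trans; have E : forall y : pl, Num.sqrt `|k (x - y : R * R)| * (Num.sqrt `|k (x - y : R * R)| * `|s y|) =
      `|k (x - y : R * R) * s y|.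
    by move=> y; rewrite mulrA -expr2 sqr_sqrtr// normrM.
  under eq_Rintegral do rewrite E.
  have Lks : L1 mu2 (fun y : pl => k (x - y : R * R) * s y).
    have mkx : measurable_fun setT (fun y : pl => k (x - y : R * R)).
      exact: (measurableT_comp mk (mpres_subl x).1).
    apply: L1_le _ _ (sq_mul sa sb) => [|y]; first exact: measurable_funM.
    by rewrite E.
  rewrite -(real_normK (num_real (conv k s x))) lerXn2r ?nnegrE ?Int_ge0//.
  exact: Int_norm.
- have mh := L1_meas Lh; apply: L1_le _ _ Lh => [|x].
    by apply: measurable_minr => //; exact: measurable_funX.
  by rewrite ger0_norm ?le_min ?sqr_ge0 ?h0// ge_min lexx orbT.
Qed.

End Convolution.

(** * A function is determined by its pairings with heat kernels *)

Section Injectivity.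
Variable R : realType.
Notation mu1 := (@lebesgue_measure R).
Notation mu2 := (@sleb2 R).
Notation pl := (measurableTypeR R * measurableTypeR R)%type.

Lemma L1_gauss1 (e : R) : 0 < e -> L1 mu1 (gauss1 e).
Proof.
move=> e0; apply: L1_ge0; [exact: measurable_gauss1|exact: gauss1_ge0|].
by rewrite int_gauss1// ltry.
Qed.

Lemma L1_heat (e : R) : 0 < e -> L1 mu2 (heat e).
Proof.
move=> e0; apply: L1_ge0; [exact: measurable_heat|exact: heat_ge0|].
by rewrite int_heat// ltry.
Qed.

(** Doubling the time leaves a spare Gaussian factor, which absorbs the polynomial factors of
    derivatives and makes tails small. *)
Lemma gauss1_split (e s : R) : 0 < e ->
  gauss1 e s = Num.sqrt 2 * gauss1 (2 * e) s * expR (- (s ^+ 2 / (8 * e))).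
Proof.
move=> e0; rewrite /gauss1 /pos e0 mulr_gt0//.
have -> : 4 * pi * (2 * e) = 2 * (4 * pi * e) :> R by ring.
rewrite (@sqrtrM _ 2 (4 * pi * e) (ler0n _ _)); have s2 : Num.sqrt 2 != 0 :> R by rewrite gt_eqF// sqrtr_gt0.
have p0 : Num.sqrt (4 * pi * e) != 0 by rewrite gt_eqF// sqrtr_gt0 !mulr_gt0 ?pi_gt0.
rewrite (_ : - (s ^+ 2 / (4 * e)) = - (s ^+ 2 / (4 * (2 * e))) + - (s ^+ 2 / (8 * e))); last first.
  by field; rewrite gt_eqF.
rewrite expRD; move: s2 p0; move: (expR _) (expR _) (Num.sqrt _) (Num.sqrt _) => A B C D c0 d0.
by field; rewrite c0 d0.
Qed.

Definition gbox e a b s : R := \int[mu1]_y (gauss1 e (s - y) * ind a b y).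

Lemma L1_gbox e a b s : 0 < e -> L1 mu1 (fun y => gauss1 e (s - y) * ind a b y).
Proof.
move=> e0; have L := mpres_L1 (mpres_comp (mpres_add s) (mpres_opp R)) (L1_gauss1 e0).
apply: L1_le _ _ L => [|y].
  by apply: measurable_funM; [apply: measurable_gauss1 => //; exact: measurable_funB|exact: measurable_ind].
by rewrite normrM !ger0_norm ?ind_ge0 ?gauss1_ge0//= (addrC (- y)) ler_piMr ?ind_le1 ?gauss1_ge0.
Qed.

Lemma int_gauss1_sub (e s : R) : 0 < e ->
  L1 mu1 (fun y => gauss1 e (s - y)) /\ \int[mu1]_y gauss1 e (s - y) = 1.
Proof.
move=> e0; have h := mpres_comp (mpres_add s) (mpres_opp R).
have E : (fun y : R => gauss1 e (s - y)) = (fun y => gauss1 e (- y + s)).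
  by apply/funext => y; rewrite addrC.
rewrite E; split; first exact: (mpres_L1 h (L1_gauss1 e0)).
transitivity (\int[mu1]_y gauss1 e y); last by rewrite /Rintegral int_gauss1.
apply: (@mpres_Int _ (measurableTypeR R) R mu1 _ (gauss1 e) h).
exact: measurable_gauss1.
Qed.

Lemma gbox_ge0 e a b s : 0 <= gbox e a b s.
Proof. by apply: Int_ge0 => y; rewrite mulr_ge0 ?gauss1_ge0 ?ind_ge0. Qed.

Lemma gbox_tail e a b s r : 0 < e -> (forall y, a < y <= b -> r <= (s - y) ^+ 2) ->
  gbox e a b s <= Num.sqrt 2 * expR (- (r / (8 * e))).
Proof.
move=> e0 hr; have e2 : 0 < 2 * e by rewrite mulr_gt0.
have [L I] := int_gauss1_sub s e2.
rewrite -[leRHS]mulr1 -[X in _ <= _ * X]I -IntZ//; apply: Int_le; [exact: L1_gbox|exact: L1Z|move=> y].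
rewrite indE; have [/hr h|_] := boolP ((a < y) && (y <= b)); last first.
  by rewrite mulr0 !mulr_ge0 ?gauss1_ge0 ?expR_ge0 ?sqrtr_ge0.
rewrite mulr1 gauss1_split// mulrAC ler_wpM2r ?gauss1_ge0// ler_wpM2l ?sqrtr_ge0//.
by rewrite ler_expR lerN2 ler_pM2r// invr_gt0 mulr_gt0.
Qed.

Lemma gbox_le1 e a b s : 0 < e -> gbox e a b s <= 1.
Proof.
move=> e0; have [L I] := int_gauss1_sub s e0; rewrite -I.
apply: Int_le => [|//|y]; first exact: L1_gbox.
by rewrite ler_piMr ?ind_le1 ?gauss1_ge0.
Qed.

(** The bound is uniform for [e <= 1] because it serves as the dominating function when the time [e]
    tends to 0. *)
Lemma gbox_bound a b : exists C, forall e s, 0 < e -> e <= 1 ->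
  gbox e a b s <= C * expR (- (s ^+ 2 / 16)).
Proof.
pose B := Num.max `|a| `|b|; exists (Num.sqrt 2 * expR (B ^+ 2 / 8)) => e s e0 e1.
have hB y : a < y <= b -> y ^+ 2 <= B ^+ 2.
  move=> /andP[ay yb]; have Ba : `|a| <= B by rewrite le_max lexx.
  have Bb : `|b| <= B by rewrite le_max lexx orbT.
  have yB : `|y| <= B.
    rewrite ler_norml; have := ler_norm (- a); rewrite normrN => h1; have h2 := ler_norm b.
    by apply/andP; split; lra.
  by rewrite -(real_normK (num_real y)) lerXn2r ?nnegrE// (le_trans _ yB).
have [h|h] := leP (s ^+ 2 / 2 - B ^+ 2) 0.
  apply: le_trans (gbox_le1 _ _ _ e0) _; rewrite -mulrA -expRD.
  apply: le_trans (_ : 1 * 1 <= _); first by rewrite mulr1.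
  apply: ler_pM => //.
    by rewrite -[X in X <= _]sqrtr1 ler_sqrt// ler1n.
  by rewrite -[X in X <= _]expR0 ler_expR; lra.
apply: le_trans (@gbox_tail e a b s (s ^+ 2 / 2 - B ^+ 2) e0 _) _.
  (* Expanding (s - 2 y)^2 >= 0 gives (s - y)^2 >= s^2 / 2 - y^2. *)
  by move=> y /hB h1; have := sqr_ge0 (s - 2 * y); nra.
rewrite -[leRHS]mulrA -expRD ler_wpM2l ?sqrtr_ge0// ler_expR.
rewrite -subr_ge0.
have : (s ^+ 2 / 2 - B ^+ 2) / 8 <= (s ^+ 2 / 2 - B ^+ 2) / (8 * e).
  by rewrite (ler_wpM2l (ltW h))// lef_pV2 ?posrE ?mulr_gt0// ler_piMr.
lra.
Qed.

Lemma cvg_expinv (r : R) : 0 < r ->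
  Num.sqrt 2 * expR (- (r / (8 * n.+1%:R^-1))) @[n --> \oo] --> (0 : R).
Proof.
move=> r0; rewrite -[X in _ --> X](mulr0 (Num.sqrt 2)); apply: cvgMr.
apply: (@squeeze_cvgr _ _ _ _ (fun=> 0) (fun n => (8 / r) * n.+1%:R^-1)).
- apply: nearW => n; rewrite expR_ge0/= expRN -[X in _ <= X]invrK lef_pV2 ?posrE ?expR_gt0//; last first.
    by rewrite invr_gt0 mulr_gt0 ?invr_gt0 ?divr_gt0.
  rewrite invfM !invrK invf_div; apply: le_trans (expR_ge1Dx _); rewrite invfM invrK.
  by rewrite mulrA lerDr.
- exact: cvg_cst.
- by rewrite -[X in _ --> X](mulr0 (8 / r)); apply: cvgMr; exact: cvg_inv_nat.
Qed.

Lemma gbox_cvg a b s : s != a -> s != b ->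
  gbox n.+1%:R^-1 a b s @[n --> \oo] --> ind a b s.
Proof.
move=> sa sb; have e0 n : 0 < n.+1%:R^-1 :> R by rewrite invr_gt0.
pose r := Num.min ((s - a) ^+ 2) ((s - b) ^+ 2).
have r0 : 0 < r by rewrite lt_min !exprn_even_gt0//= !subr_eq0 sa sb.
have [/andP[as_ sb']|h] := boolP ((a < s) && (s <= b)).
  rewrite indE as_ sb' /=.
  apply: (@squeeze_cvgr _ _ _ _ (fun n => 1 - 2 * (Num.sqrt 2 * expR (- (r / (8 * n.+1%:R^-1))))) (fun=> 1)).
  - apply: nearW => n; rewrite gbox_le1// andbT.
    have [L I] := int_gauss1_sub s (e0 n); have e2 : 0 < 2 * n.+1%:R^-1 :> R by rewrite mulr_gt0.
    have [L2 I2] := int_gauss1_sub s e2.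
    set c := Num.sqrt 2 * _.
    have c0 : 0 <= c by rewrite mulr_ge0 ?sqrtr_ge0 ?expR_ge0.
    apply: (@le_trans _ _ (1 - c)); first by lra.
    rewrite lerBlDr -[X in X <= _]I -[X in _ <= _ + X]mulr1 -[X in _ <= _ + _ * X]I2 -IntZ// -IntD; [|by apply: L1_gbox|exact: L1Z].
    apply: Int_le => //; first by apply: L1D; [apply: L1_gbox|exact: L1Z].
    move=> y; rewrite indE; have [hy|hy] := boolP ((a < y) && (y <= b)); first by rewrite mulr1 lerDl mulr_ge0 ?gauss1_ge0.
    rewrite mulr0 add0r gauss1_split// /c [X in _ <= X]mulrAC ler_wpM2l ?mulr_ge0 ?sqrtr_ge0 ?gauss1_ge0//.
    rewrite ler_expR lerN2 ler_pM2r ?invr_gt0 ?mulr_gt0// /r ge_min.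
    move: hy; rewrite negb_and -leNgt -ltNge => /orP[h|h]; apply/orP; [left|right].
      by nra.
    by nra.
  - rewrite -[X in _ --> X]subr0 -[X in _ - X](mulr0 2); apply: cvgB; first exact: cvg_cst.
    by apply: cvgMr; exact: cvg_expinv.
  - exact: cvg_cst.
rewrite indE (negbTE h) /=.
apply: (@squeeze_cvgr _ _ _ _ (fun=> 0) (fun n => Num.sqrt 2 * expR (- (r / (8 * n.+1%:R^-1))))).
- apply: nearW => n; rewrite gbox_ge0/=; apply: gbox_tail => // y /andP[ay yb].
  rewrite /r ge_min; move: h; rewrite negb_and -leNgt -ltNge => /orP[h|h]; apply/orP; [left|right].
    by nra.
  by nra.
- exact: cvg_cst.
- exact: cvg_expinv.
Qed.

Lemma sq_expsq (c : R) : 0 < c -> sq mu1 (fun s => expR (- (s ^+ 2 / c))).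
Proof.
move=> c0; have m : measurable_fun setT (fun s : R => expR (- (s ^+ 2 / c))).
  by do 2 apply: measurableT_comp => //; apply: measurable_funM => //; exact: measurable_funX.
split => //; have e0 : 0 < c / 8 by rewrite divr_gt0.
apply: L1_eq (L1Z (Num.sqrt (4 * pi * (c / 8))) (L1_gauss1 e0)) => s.
rewrite /gauss1 /pos e0 mulrC divfK ?gt_eqF ?sqrtr_gt0 ?mulr_gt0 ?pi_gt0//.
by rewrite -expRM_natl; congr expR; field; rewrite gt_eqF.
Qed.

Lemma sq_ind (a b : R) : sq mu1 (ind a b).
Proof.
split; first exact: measurable_ind.
apply: L1_eq (_ : L1 mu1 (ind a b)) => [s|].
  by rewrite indE; case: (_ && _); rewrite ?expr1n ?expr0n.
apply: L1_ge0; [exact: measurable_ind|exact: ind_ge0|].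
rewrite (_ : (\int[mu1]_x (ind a b x)%:E)%E = mu1 (`]a, b]%classic : set R)); last first.
  by rewrite integral_indic// setIT.
by have := @lebesgue_measure_itv R `]a, b]; case: ifP => _ ->; rewrite ?ltry.
Qed.

(* Smoothing a rectangle with the heat kernel and letting the time tend to 0. *)
Lemma heat_inj (psi : pl -> R) : sq mu2 psi ->
  (forall e y, 0 < e -> \int[mu2]_x (psi x * heat e (x - y : R * R)) = 0) ->
  {ae mu2, forall x, psi x = 0}.
Proof.
move=> spsi hpsi.
have rect a b c d : \int[mu2]_x (psi x * (ind a b x.1 * ind c d x.2)) = 0.
  have [C hC] := gbox_bound a b; have [D hD] := gbox_bound c d.
  have si : sq mu2 (tens (ind a b) (ind c d)) by apply: sq_tens; exact: sq_ind.
  have e0 n : 0 < n.+1%:R^-1 :> R by rewrite invr_gt0.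
  have e1 n : n.+1%:R^-1 <= 1 :> R by rewrite invf_le1// ler1n.
  have cE e x : 0 < e -> conv (heat e) (tens (ind a b) (ind c d)) x = gbox e a b x.1 * gbox e c d x.2.
    move=> e0'; rewrite /conv /Rintegral (eq_integral (fun y : pl =>
      ((gauss1 e (x.1 - y.1) * ind a b y.1) * (gauss1 e (x.2 - y.2) * ind c d y.2))%:E)); last first.
      by move=> y _; congr EFin; rewrite /heat /tens /=; ring.
    have mG u v s : measurable_fun setT (fun y : R => gauss1 e (s - y) * ind u v y).
      by apply: measurable_funM; [apply: measurable_gauss1 => //; exact: measurable_funB|exact: measurable_ind].
    rewrite (int2_prod (f := fun y => gauss1 e (x.1 - y) * ind a b y)
      (g := fun y => gauss1 e (x.2 - y) * ind c d y)) //.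
    + by rewrite !L1_fin //; exact: L1_gbox.
    + by move=> y; rewrite mulr_ge0 ?gauss1_ge0 ?ind_ge0.
    + by move=> y; rewrite mulr_ge0 ?gauss1_ge0 ?ind_ge0.
  have mc e : 0 < e -> measurable_fun setT (conv (heat e) (tens (ind a b) (ind c d))).
    by move=> ?; apply: measurable_conv; [exact: measurable_heat|exact: si.1].
  apply: (@Int_lim_cst _ _ R mu2 (fun n x => psi x * conv (heat n.+1%:R^-1) (tens (ind a b) (ind c d)) x) _
    (fun x => `|psi x| * tens (fun s => C * expR (- (s ^+ 2 / 16))) (fun s => D * expR (- (s ^+ 2 / 16))) x)).
  - by move=> n; apply: measurable_funM; [exact: spsi.1|exact: mc].
  - by apply: measurable_funM; [exact: spsi.1|exact: si.1].
  - apply: sq_mul; first exact: sq_norm.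
    by apply: sq_tens; apply: sqZ; apply: sq_expsq.
  - move=> n x; rewrite normrM ler_wpM2l// cE// /tens normrM !(ger0_norm (gbox_ge0 _ _ _ _)).
    by apply: ler_pM; rewrite ?gbox_ge0// ?hC ?hD.
  - have A1 t : {ae mu2, forall x : pl, x.1 != t}.
      apply: filterS (mpres_ae (mpres_subr (t, 0)) (ae_coord1 R)) => x /=.
      by rewrite subr_eq0.
    have A2 t : {ae mu2, forall x : pl, x.2 != t}.
      apply: filterS (mpres_ae (mpres_subr (0, t)) (ae_coord2 R)) => x /=.
      by rewrite subr_eq0.
    apply: filterS2 (filterI (A1 a) (A1 b)) (filterI (A2 c) (A2 d)) => x [xa xb] [xc xd].
    apply: cvgMr; under eq_fun do rewrite cE//.
    by apply: cvgM; exact: gbox_cvg.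
  (* The heat kernel is moved from the rectangle onto [psi], where the hypothesis makes the
     convolution vanish. *)
  - move=> n; rewrite conv_pair//; [|exact: L1_heat].
    rewrite /Rintegral integral0_eq// => y _; congr EFin.
    rewrite /conv (_ : \int[mu2]_x _ = 0) ?mulr0// -[RHS](hpsi _ y (e0 n)).
    by apply: eq_Rintegral => x _; rewrite opprB mulrC.
(* [psi] need not be integrable, but its product with the indicator of a square is, so that
   [ae_eq0_box] applies to each square. *)
have box n : {ae mu2, forall x, psi x * (ind (- n%:R) n%:R x.1 * ind (- n%:R) n%:R x.2) = 0}.
  have si : sq mu2 (tens (ind (- n%:R) n%:R) (ind (- n%:R) n%:R)) by apply: sq_tens; exact: sq_ind.
  apply: ae_eq0_box; [exact: sq_mul spsi si| |exact: rect].
  move=> a b c d; rewrite -[RHS](rect (Num.max a (- n%:R)) (Num.min b n%:R) (Num.max c (- n%:R)) (Num.min d n%:R)).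
  apply: eq_Rintegral => x _; rewrite -mulrA; congr (_ * _); rewrite !indE !gt_max !le_min -!natrM !mulnb.
  by congr ((nat_of_bool _)%:R); do !case: (_ < _); do !case: (_ <= _).
have := ae_foralln box; apply: filterS => x hx.
have [k hk] : exists k : nat, `|x.1| + `|x.2| < k%:R.
  by exists (Num.bound (`|x.1| + `|x.2|)); apply: archi_boundP; rewrite addr_ge0.
have h1 : `|x.1| < k%:R by apply: le_lt_trans hk; rewrite lerDl.
have h2 : `|x.2| < k%:R by apply: le_lt_trans hk; rewrite lerDr.
move: (hx k); rewrite !indE; move: h1 h2; rewrite !ltr_norml => /andP[-> /ltW ->] /andP[-> /ltW ->].
by rewrite !mulr1.
Qed.

End Injectivity.

(** * First and second derivatives of the heat kernel *)

Section GaussDerivatives.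
Variable R : realType.
Notation mu1 := (@lebesgue_measure R).
Notation mu2 := (@sleb2 R).
Notation pl := (measurableTypeR R * measurableTypeR R)%type.
Implicit Types (t s : R) (i : bool).

Definition dgauss t s := - (s / (2 * t)) * gauss1 t s.
Definition d2gauss t s := (s ^+ 2 / (4 * t ^+ 2) - 1 / (2 * t)) * gauss1 t s.

Lemma dv_gauss1 t s : 0 < t -> is_derive s 1 (gauss1 t) (dgauss t s).
Proof.
move=> t0; have E : gauss1 t = (fun s => (Num.sqrt (4 * pi * t))^-1 * expR ((- (4 * t)^-1) * s ^+ 2)).
  by apply/funext => u; rewrite /gauss1 /pos t0 mulrC; congr (_ * expR _); rewrite mulNr mulrC.
have h := dvZ (Num.sqrt (4 * pi * t))^-1 (dvexp (dvZ (- (4 * t)^-1) (dvX 2 (dv_id s)))).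
rewrite /dgauss E; apply: (dv_eq h) => /=.
move: (expR _) (Num.sqrt _)^-1 => A B; field; by rewrite gt_eqF.
Qed.

Lemma dv_dgauss t s : 0 < t -> is_derive s 1 (dgauss t) (d2gauss t s).
Proof.
move=> t0; have h := dvM (dvZ (- (2 * t)^-1) (dv_id s)) (dv_gauss1 s t0).
rewrite (_ : dgauss t = (fun s => (- (2 * t)^-1 * s) * gauss1 t s)).
  by apply: (dv_eq h); rewrite /d2gauss /dgauss; field; rewrite gt_eqF.
by apply/funext => u; rewrite /dgauss; congr (_ * _); rewrite mulNr mulrC.
Qed.

Lemma derive_gauss1 t : 0 < t -> derive1 (gauss1 t) = dgauss t.
Proof. by move=> t0; apply/funext => s; have h := dv_gauss1 s t0; rewrite derive1E derive_val. Qed.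

Lemma derive_dgauss t : 0 < t -> derive1 (dgauss t) = d2gauss t.
Proof. by move=> t0; apply/funext => s; have h := dv_dgauss s t0; rewrite derive1E derive_val. Qed.

Lemma Sm_gauss1 t : 0 < t -> forall k, Sm k (gauss1 t).
Proof.
move=> t0; apply: (@Sm_ode R _ (fun s => (- (2 * t)^-1) * s + 0)); first by move=> k; exact: Sm_lin.
by move=> s; apply: (dv_eq (dv_gauss1 s t0)); rewrite /dgauss addr0; congr (_ * _); rewrite mulNr mulrC.
Qed.

Lemma Sm_dgauss t : 0 < t -> forall k, Sm k (dgauss t).
Proof. by move=> t0 k; rewrite -derive_gauss1//; apply: Sm_derive; exact: Sm_gauss1. Qed.

Lemma Sm_shift (f : R -> R) y : (forall k, Sm k f) ->
  (forall k, Sm k (fun s => f (s - y))) /\ derive1 (fun s => f (s - y)) = (fun s => derive1 f (s - y)).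
Proof.
move=> sf; have E (g : R -> R) : (fun s => g (s - y)) = (fun s => g (1 * s + - y)).
  by apply/funext => s; rewrite mul1r.
split; first by move=> k; rewrite E; exact: Sm_affine.
apply/funext => s; have h1 : is_derive s 1 (fun s : R => s - y) 1.
  by apply: (dv_eq (dvD (dv_id s) (dv_cst (- y) s))); rewrite addr0.
have h := @dv_comp R f (fun s => s - y) s _ _ (Sm_is_derive (sf 1%N) (s - y)) h1.
by rewrite derive1E derive_val mulr1.
Qed.

(** The first two bounds are (1 + x) exp(-x) <= 1 at x = s^2 / (8 t); the third follows by 2 r |s|
    <= r^2 + s^2 with r = sqrt t. *)
Lemma exp_bounds t s (e := expR (- (s ^+ 2 / (8 * t)))) : 0 < t ->
  [/\ 0 <= e <= 1, s ^+ 2 * e <= 8 * t & `|s| * e <= 5 * Num.sqrt t].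
Proof.
move=> t0; have e0 : 0 <= e by exact: expR_ge0.
have h : (1 + s ^+ 2 / (8 * t)) * e <= 1.
  rewrite -[X in _ <= X](expRxMexpNx_1 (s ^+ 2 / (8 * t))) /e ler_wpM2r ?expR_ge0//.
  exact: expR_ge1Dx.
have s20 : 0 <= s ^+ 2 / (8 * t) by rewrite divr_ge0 ?sqr_ge0// mulr_ge0 ?ltW.
have e1 : e <= 1 by nra.
have se : s ^+ 2 * e <= 8 * t.
  have : s ^+ 2 / (8 * t) * e <= 1 by nra.
  by rewrite mulrAC ler_pdivrMr ?mul1r// mulr_gt0.
split => //; first by rewrite e0.
pose r := Num.sqrt t; have r0 : 0 < r by rewrite sqrtr_gt0.
have rr : r ^+ 2 = t by rewrite sqr_sqrtr// ltW.
have h1 : 2 * r * `|s| <= r ^+ 2 + s ^+ 2.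
  by rewrite -(real_normK (num_real s)); have := sqr_ge0 (r - `|s|); nra.
have h2 : 2 * r * (`|s| * e) <= 10 * r ^+ 2.
  rewrite mulrA; apply: le_trans (ler_wpM2r e0 h1) _; rewrite mulrDl.
  have : r ^+ 2 * e <= r ^+ 2 by rewrite ler_piMr// sqr_ge0.
  by move: se; rewrite -rr; lra.
have r2 : 0 < 2 * r by rewrite mulr_gt0.
by rewrite -(ler_pM2l r2) -/r; lra.
Qed.

Lemma sqrt2_le : Num.sqrt 2 <= 3 / 2 :> R.
Proof.
have h : 0 <= 3 / 2 :> R by lra.
by rewrite -[leRHS](ger0_norm h) -sqrtr_sqr ler_sqrt; [lra|apply: sqr_ge0].
Qed.

Lemma gauss1_le t s : 0 < t -> gauss1 t s <= 2 * gauss1 (2 * t) s.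
Proof.
move=> t0; rewrite gauss1_split//; have [/andP[e0 e1] _ _] := exp_bounds s t0.
rewrite mulrAC ler_wpM2r ?gauss1_ge0//; have := sqrt2_le; have := sqrtr_ge0 (2 : R); nra.
Qed.

Lemma dgauss_bound t s : 0 < t -> `|dgauss t s| <= 4 / Num.sqrt t * gauss1 (2 * t) s.
Proof.
move=> t0; have [_ _ h] := exp_bounds s t0; have r0 : 0 < Num.sqrt t by rewrite sqrtr_gt0.
rewrite /dgauss normrM (ger0_norm (gauss1_ge0 _ _)) normrN normrM normrV ?unitfE ?gt_eqF ?mulr_gt0//.
rewrite (gtr0_norm (_ : 0 < 2 * t)) ?mulr_gt0// gauss1_split//.
rewrite (_ : _ * _ = (`|s| * expR (- (s ^+ 2 / (8 * t)))) * Num.sqrt 2 / (2 * t) * gauss1 (2 * t) s); last by ring.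
rewrite ler_wpM2r ?gauss1_ge0//.
have e : 2 * t = 2 * Num.sqrt t ^+ 2 by rewrite sqr_sqrtr// ltW.
rewrite e ler_pdivrMr ?mulr_gt0 ?exprn_gt0//.
rewrite (_ : 4 / _ * _ = 8 * Num.sqrt t); last by field; rewrite gt_eqF.
have := sqrt2_le; have := sqrtr_ge0 (2 : R); have := expR_ge0 (- (s ^+ 2 / (8 * t))); have := normr_ge0 s.
move: h r0; move: (expR _) (Num.sqrt t) (Num.sqrt 2) `|s| => A B C D.
by move=> h B0 D0 A0 C0 C1; nra.
Qed.

(** The factor [1 / t] is not integrable at time 0, in contrast with the [1 / Num.sqrt t] of the
    first derivative. This is why the identities with a Laplacian are written at times [t + e] with
    [e > 0]. *)
Lemma d2gauss_bound t s : 0 < t -> `|d2gauss t s| <= 4 / t * gauss1 (2 * t) s.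
Proof.
move=> t0; have [/andP[e0 e1] h _] := exp_bounds s t0.
rewrite /d2gauss normrM (ger0_norm (gauss1_ge0 _ _)).
apply: (@le_trans _ _ ((s ^+ 2 / (4 * t ^+ 2) + 1 / (2 * t)) * gauss1 t s)).
  rewrite ler_wpM2r ?gauss1_ge0//; apply: le_trans (ler_normB _ _) _.
  have p1 : 0 <= s ^+ 2 / (4 * t ^+ 2) by apply: divr_ge0; [exact: sqr_ge0|apply: mulr_ge0 => //; exact: sqr_ge0].
  have p2 : 0 <= 1 / (2 * t) by rewrite divr_ge0 ?mulr_ge0 ?(ltW t0).
  by rewrite !ger0_norm.
rewrite gauss1_split// (_ : _ * _ = ((s ^+ 2 * expR (- (s ^+ 2 / (8 * t)))) / (4 * t ^+ 2) +
   expR (- (s ^+ 2 / (8 * t))) / (2 * t)) * Num.sqrt 2 * gauss1 (2 * t) s); last first.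
  by field; rewrite gt_eqF.
rewrite ler_wpM2r ?gauss1_ge0//.
have a1 : s ^+ 2 * expR (- (s ^+ 2 / (8 * t))) / (4 * t ^+ 2) <= 2 / t.
  rewrite ler_pdivrMr ?mulr_gt0 ?exprn_gt0// (_ : 2 / t * _ = 8 * t)//; field; by rewrite gt_eqF.
have a2 : expR (- (s ^+ 2 / (8 * t))) / (2 * t) <= 1 / (2 * t).
  by rewrite ler_wpM2r// invr_ge0 mulr_ge0// ltW.
have p : 0 < t^-1 by rewrite invr_gt0.
have e : 1 / (2 * t) = t^-1 / 2 by field; rewrite gt_eqF.
have n1 : 0 <= s ^+ 2 * expR (- (s ^+ 2 / (8 * t))) / (4 * t ^+ 2).
  by apply: divr_ge0; apply: mulr_ge0 => //; exact: sqr_ge0.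
have n2 : 0 <= expR (- (s ^+ 2 / (8 * t))) / (2 * t) by apply: divr_ge0 => //; rewrite mulr_ge0 ?(ltW t0).
rewrite e in a2; have := sqrt2_le; have := sqrtr_ge0 (2 : R).
move: a1 a2 n1 n2; move: (_ / (4 * _)) (_ / (2 * t)) (Num.sqrt 2) => A B C a1 a2 n1 n2 c0 c1.
by apply: le_trans (_ : (2 / t + t^-1 / 2) * (3 / 2) <= _); [apply: ler_pM => //; lra|lra].
Qed.

Lemma measurable_dgauss d (T : measurableType d) (f g : T -> R) :
  measurable_fun setT f -> measurable_fun setT g ->
  measurable_fun setT (fun x => dgauss (f x) (g x)).
Proof.
move=> mf mg; apply: measurable_funM; last exact: measurable_gauss1.
apply: measurableT_comp => //; apply: measurable_funM => //.
by apply: (measurableT_comp (@measurable_inv R)); exact: measurable_funM.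
Qed.

Lemma measurable_d2gauss d (T : measurableType d) (f g : T -> R) :
  measurable_fun setT f -> measurable_fun setT g ->
  measurable_fun setT (fun x => d2gauss (f x) (g x)).
Proof.
move=> mf mg; apply: measurable_funM; last exact: measurable_gauss1.
apply: measurable_funB; apply: measurable_funM => //; try exact: measurable_funX;
  apply: (measurableT_comp (@measurable_inv R)); apply: measurable_funM => //; exact: measurable_funX.
Qed.

Lemma gauss1_le0 t s : gauss1 t s <= gauss1 t 0.
Proof.
rewrite /gauss1 /pos; case: ifPn => // t0; rewrite ler_wpM2r ?invr_ge0 ?sqrtr_ge0//.
rewrite ler_expR expr0n mul0r oppr0 oppr_le0 divr_ge0 ?sqr_ge0// mulr_ge0// ltW//.
Qed.

Lemma sq_gauss1 t : 0 < t -> sq mu1 (gauss1 t).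
Proof.
move=> t0; split; first exact: measurable_gauss1.
apply: L1_le _ _ (L1Z (gauss1 t 0) (L1_gauss1 t0)) => [|s].
  by apply: measurable_funX; exact: measurable_gauss1.
by rewrite ger0_norm ?sqr_ge0// expr2 ler_wpM2r ?gauss1_ge0 ?gauss1_le0.
Qed.

Lemma sq_dgauss t : 0 < t -> sq mu1 (dgauss t).
Proof.
move=> t0; have t2 : 0 < 2 * t by rewrite mulr_gt0.
apply: sq_le (sqZ (4 / Num.sqrt t) (sq_gauss1 t2)) => [|s]; first exact: measurable_dgauss.
exact: dgauss_bound.
Qed.

Lemma sq_d2gauss t : 0 < t -> sq mu1 (d2gauss t).
Proof.
move=> t0; have t2 : 0 < 2 * t by rewrite mulr_gt0.
apply: sq_le (sqZ (4 / t) (sq_gauss1 t2)) => [|s]; first exact: measurable_d2gauss.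
exact: d2gauss_bound.
Qed.

Lemma sq_sub1 (f : R -> R) y : sq mu1 f -> sq mu1 (fun s => f (s - y)).
Proof.
move=> [mf f2]; have h := mpres_add (- y); split; last exact: (mpres_L1 h f2).
exact: (measurableT_comp mf h.1).
Qed.

Definition co i (x : R * R) := if i then x.1 else x.2.

Lemma measurable_co i d (T : measurableType d) (g : T -> pl) : measurable_fun setT g ->
  measurable_fun setT (fun x => co i (g x)).
Proof.
by case: i => mg; [exact: measurableT_comp measurable_fst mg|exact: measurableT_comp measurable_snd mg].
Qed.

Definition dheat i t (x : R * R) := dgauss t (co i x) * gauss1 t (co (~~ i) x).
Definition d2heat i t (x : R * R) := d2gauss t (co i x) * gauss1 t (co (~~ i) x).

Lemma heat_co i t x : heat t x = gauss1 t (co i x) * gauss1 t (co (~~ i) x).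
Proof. by case: i; rewrite /heat //= mulrC. Qed.

Lemma measurable_dheat i d (T : measurableType d) (f : T -> R) (g : T -> pl) :
  measurable_fun setT f -> measurable_fun setT g -> measurable_fun setT (fun x => dheat i (f x) (g x)).
Proof.
move=> mf mg; apply: measurable_funM.
  by apply: measurable_dgauss => //; exact: measurable_co.
by apply: measurable_gauss1 => //; exact: measurable_co.
Qed.

Lemma measurable_d2heat i d (T : measurableType d) (f : T -> R) (g : T -> pl) :
  measurable_fun setT f -> measurable_fun setT g -> measurable_fun setT (fun x => d2heat i (f x) (g x)).
Proof.
move=> mf mg; apply: measurable_funM.
  by apply: measurable_d2gauss => //; exact: measurable_co.
by apply: measurable_gauss1 => //; exact: measurable_co.
Qed.

Lemma heat_le2 t x : 0 < t -> heat t x <= 4 * heat (2 * t) x.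
Proof.
move=> t0; have h1 := gauss1_le x.1 t0; have h2 := gauss1_le x.2 t0.
have := ler_pM (gauss1_ge0 _ _) (gauss1_ge0 _ _) h1 h2; rewrite /heat => /le_trans; apply; lra.
Qed.

Lemma dheat_bound i t x : 0 < t -> `|dheat i t x| <= 8 / Num.sqrt t * heat (2 * t) x.
Proof.
move=> t0; rewrite normrM (ger0_norm (gauss1_ge0 _ _)) (heat_co i).
apply: le_trans (ler_pM (normr_ge0 _) (gauss1_ge0 _ _) (dgauss_bound _ t0) (gauss1_le _ t0)) _.
by rewrite le_eqVlt; apply/orP; left; apply/eqP; ring.
Qed.

Lemma d2heat_bound i t x : 0 < t -> `|d2heat i t x| <= 8 / t * heat (2 * t) x.
Proof.
move=> t0; rewrite normrM (ger0_norm (gauss1_ge0 _ _)) (heat_co i).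
apply: le_trans (ler_pM (normr_ge0 _) (gauss1_ge0 _ _) (d2gauss_bound _ t0) (gauss1_le _ t0)) _.
by rewrite le_eqVlt; apply/orP; left; apply/eqP; ring.
Qed.

Lemma heat_le t x : 0 < t -> heat t x <= (4 * pi * t)^-1.
Proof.
move=> t0; have h : 0 <= (4 * pi * t)^-1 by rewrite invr_ge0 !mulr_ge0 ?pi_ge0 ?(ltW t0).
rewrite heatE /pos t0 ler_piMl// -expR0 ler_expR oppr_le0 divr_ge0 ?addr_ge0 ?sqr_ge0//.
by rewrite mulr_ge0 ?(ltW t0).
Qed.

Lemma dgaussN t s : dgauss t (- s) = - dgauss t s.
Proof. by rewrite /dgauss gauss1_sym; ring. Qed.

Lemma dheatN i t x : dheat i t (- x) = - dheat i t x.
Proof.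
have e j : co j (- x) = - co j x by case: j.
by rewrite /dheat !e dgaussN gauss1_sym mulNr.
Qed.

Lemma wd_gauss (f g : pl -> R) i t (y : R * R) : sq mu2 f -> sq mu2 g ->
  (if i then @wd1 R else @wd2 R) f g -> 0 < t ->
  (\int[mu2]_x (f x * d2heat i t (x - y : R * R)) = - \int[mu2]_x (g x * dheat i t (x - y : R * R))) /\
  (\int[mu2]_x (f x * dheat i t (x - y : R * R)) = - \int[mu2]_x (g x * heat t (x - y : R * R))).
Proof.
move=> sf sg w t0.
have [sa da] := Sm_shift (co i y) (Sm_dgauss t0); have [sb db] := Sm_shift (co (~~ i) y) (Sm_gauss1 t0).
have [sc dc] := Sm_shift (co i y) (Sm_gauss1 t0).
have qa := sq_sub1 (co i y) (sq_dgauss t0); have qb := sq_sub1 (co (~~ i) y) (sq_gauss1 t0).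
have qc := sq_sub1 (co i y) (sq_gauss1 t0).
have qda : sq mu1 (derive1 (fun s => dgauss t (s - co i y))).
  by rewrite da (derive_dgauss t0); exact: (sq_sub1 (co i y) (sq_d2gauss t0)).
have qdc : sq mu1 (derive1 (fun s => gauss1 t (s - co i y))).
  by rewrite dc (derive_gauss1 t0); exact: (sq_sub1 (co i y) (sq_dgauss t0)).
case: i w sa da sb sc qa qb qc qda qdc dc {db} => w sa da sb sc qa qb qc qda qdc dc; split.
- by have := wd1_ext sf sg w sa sb qa qda qb; rewrite da derive_dgauss.
- by have := wd1_ext sf sg w sc sb qc qdc qb; rewrite dc derive_gauss1.
- have := wd2_ext sf sg w sb sa qb qa qda; rewrite da (derive_dgauss t0) /= => h.
  rewrite /dheat /d2heat /=.
  have e (u : pl -> R) (G : R -> R -> R) : \int[mu2]_x (u x * (G t (x.2 - y.2) * gauss1 t (x.1 - y.1))) =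
     \int[mu2]_x (u x * (gauss1 t (x.1 - y.1) * G t (x.2 - y.2))).
    by apply: eq_Rintegral => x _; rewrite (mulrC (G _ _)).
  by rewrite (e f d2gauss) (e g dgauss).
- have := wd2_ext sf sg w sb sc qb qc qdc; rewrite dc (derive_gauss1 t0) /= => h.
  rewrite /dheat /heat /=.
  have e (u : pl -> R) (G : R -> R -> R) : \int[mu2]_x (u x * (G t (x.2 - y.2) * gauss1 t (x.1 - y.1))) =
     \int[mu2]_x (u x * (gauss1 t (x.1 - y.1) * G t (x.2 - y.2))).
    by apply: eq_Rintegral => x _; rewrite (mulrC (G _ _)).
  by rewrite (e f dgauss).
Qed.

Lemma Int2_prod (f g : R -> R) : L1 mu1 f -> L1 mu1 g ->
  L1 mu2 (fun z => f z.1 * g z.2) /\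
  \int[mu2]_z (f z.1 * g z.2) = \int[mu1]_x f x * \int[mu1]_x g x.
Proof.
move=> Lf Lg; have mf := L1_meas Lf; have mg := L1_meas Lg.
have L : L1 mu2 (fun z => f z.1 * g z.2).
  have := @L1_prod12 _ _ _ _ R mu1 mu1 (fun z : pl => f z.1 * g z.2); apply.
    by apply: measurable_funM; [exact: measurableT_comp mf measurable_fst|exact: measurableT_comp mg measurable_snd].
  have mf' : measurable_fun setT (fun x => `|f x|) by exact: L1_meas (L1_norm Lf).
  have mg' : measurable_fun setT (fun x => `|g x|) by exact: L1_meas (L1_norm Lg).
  have := int2_prod mf' mg' (fun x => normr_ge0 _) (fun x => normr_ge0 _).
  rewrite int2_xy; [|apply/measurable_EFinP; apply: measurable_funM|by move=> z; rewrite lee_fin mulr_ge0]; last 2 first.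
  - exact: measurableT_comp mf' measurable_fst.
  - exact: measurableT_comp mg' measurable_snd.
  move=> e; under eq_integral do under eq_integral do rewrite normrM.
  by rewrite e (L1_fin (L1_norm Lf)) (L1_fin (L1_norm Lg)) -EFinM ltry.
split => //; rewrite mulrC -IntZ// /Rintegral -(integral12_prod_meas1 L); congr fine.
apply: eq_integral => x _; rewrite /fubini_F /= (L1_fin (L1Z (f x) Lg)) IntZ//.
by rewrite mulrC.
Qed.

End GaussDerivatives.

(** * Kernels given by time integrals and their action on Gaussians *)

Section TimeKernels.
Variable R : realType.
Notation mu1 := (@lebesgue_measure R).
Notation mu2 := (@sleb2 R).
Notation tl := (measurableTypeR R).
Notation pl := (measurableTypeR R * measurableTypeR R)%type.
Implicit Types (t s l e : R) (i : bool).

Definition ew l t := pos (fun t => expR (- (l * t))) t.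

Lemma ew_ge0 l t : 0 <= ew l t.
Proof. by rewrite /ew /pos; case: ifPn => // _; exact: expR_ge0. Qed.

Lemma measurable_ew l : measurable_fun setT (ew l).
Proof.
by apply: measurable_pos; do 2 apply: measurableT_comp => //; exact: measurable_funM.
Qed.

Lemma L1_ew l : 0 < l -> L1 mu1 (ew l).
Proof. exact: L1_pos_expR. Qed.

Definition tk (M : tl * pl -> R) (x : pl) : R := \int[mu1]_t M (t, x).

Lemma L1_tk M : L1 (mu1 \x mu2)%E M -> L1 mu2 (tk M).
Proof. by move=> LM; have [_ h _ _ _] := RFubini LM. Qed.

(** Boundedness of [psi], a heat kernel at a positive time in the applications, makes Fubini's
    theorem available at every point [y] and not only at almost every one. *)
Lemma time_conv M (psi : pl -> R) C (y : pl) : L1 (mu1 \x mu2)%E M ->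
  measurable_fun setT psi -> (forall x, `|psi x| <= C) ->
  L1 mu1 (fun t => \int[mu2]_x (M (t, y - x : R * R) * psi x)) /\
  conv (tk M) psi y = \int[mu1]_t \int[mu2]_x (M (t, y - x : R * R) * psi x).
Proof.
move=> LM mp hp; have mM := L1_meas LM.
have C0 : 0 <= C by apply: le_trans (hp 0).
have msub : measurable_fun setT (fun z : tl * pl => (z.1, y - z.2 : R * R) : tl * pl).
  by apply: measurable_fun_pair => //; exact: (measurableT_comp (mpres_subl y).1 measurable_snd).
have mMs : measurable_fun setT (fun z : tl * pl => M (z.1, y - z.2 : R * R)).
  exact: measurableT_comp mM msub.
have mF : measurable_fun setT (fun z : tl * pl => M (z.1, y - z.2 : R * R) * psi z.2).
  by apply: measurable_funM => //; exact: measurableT_comp mp measurable_snd.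
have LMs : L1 (mu1 \x mu2)%E (fun z : tl * pl => M (z.1, y - z.2 : R * R)).
  have mME : measurable_fun setT (EFin \o M) by exact/measurable_EFinP.
  apply: L1_prod12 => //; have := (integrable12ltyP _ _ mME).1 LM.
  have e t : (\int[mu2]_x `|M (t, y - x : R * R)|%:E = \int[mu2]_x `|M (t, x)|%:E)%E.
    apply: ((mpres_subl y).2 (fun x => `|M (t, x)|%:E)%E) => //.
    by apply/measurable_EFinP; apply: measurableT_comp => //; apply: (measurableT_comp mM); exact: measurable_fun_pair.
  by move=> h; under eq_integral do rewrite /= e.
have L : L1 (mu1 \x mu2)%E (fun z : tl * pl => M (z.1, y - z.2 : R * R) * psi z.2).
  by apply: L1_le mF _ (L1Z C (L1_norm LMs)) => z; rewrite normrM mulrC ler_wpM2r.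
have [h1 h2 _ ae2 e] := RFubini L; split => //.
rewrite e; apply: Int_ae.
- apply: measurable_funM => //; exact: (measurableT_comp (L1_meas (L1_tk LM)) (mpres_subl y).1).
- exact: L1_meas h2.
- have [_ _ _ aeM _] := RFubini LMs.
  apply: filterS aeM => x /= Lx; rewrite /tk mulrC -IntZ//.
  by apply: eq_Rintegral => t _; rewrite mulrC.
Qed.

Lemma conv_ae (k k' s : pl -> R) y : measurable_fun setT k -> measurable_fun setT k' ->
  measurable_fun setT s -> {ae mu2, forall x, k x = k' x} -> conv k s y = conv k' s y.
Proof.
move=> mk mk' ms h; apply: Int_ae.
- by apply: measurable_funM => //; exact: (measurableT_comp mk (mpres_subl y).1).
- by apply: measurable_funM => //; exact: (measurableT_comp mk' (mpres_subl y).1).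
- by apply: filterS (mpres_ae (mpres_subl y) h) => x ->.
Qed.

Definition Gt l (z : tl * pl) : R := ew l z.1 * heat z.1 z.2.
Definition kt i l (z : tl * pl) : R := ew l z.1 * dheat i z.1 z.2.
(** The partial derivative of the Green function in the direction [i], given by its time integral so
    that [K0] is never differentiated. *)
Definition kG i l (x : pl) : R := tk (kt i l) x.

Lemma measurable_Gt l : measurable_fun setT (Gt l).
Proof.
apply: measurable_funM; first exact: measurableT_comp (measurable_ew l) measurable_fst.
exact: measurable_heat.
Qed.

Lemma measurable_kt i l : measurable_fun setT (kt i l).
Proof.
apply: measurable_funM; first exact: measurableT_comp (measurable_ew l) measurable_fst.
exact: measurable_dheat.
Qed.

Lemma L1_Gt l : 0 < l -> L1 (mu1 \x mu2)%E (Gt l).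
Proof.
move=> l0; apply: L1_prod12; first exact: measurable_Gt.
apply: le_lt_trans (L1_lty (L1_ew l0) (ew_ge0 l)).
apply: ge0_le_integral => //.
- by move=> t _; apply: integral_ge0 => x _; rewrite lee_fin.
- apply: (@measurable_fun_fubini_tonelli_F _ _ _ _ _ mu2 (fun z => `|Gt l z|%:E)) => //.
  by apply/measurable_EFinP; apply: measurableT_comp => //; exact: measurable_Gt.
- by apply/measurable_EFinP; exact: measurable_ew.
- move=> t _; rewrite /Gt /=; have [t0|t0] := ltP 0 t; last first.
    by rewrite /ew /pos ltNge t0 /= integral0_eq// => x _; rewrite mul0r normr0.
  under eq_integral do rewrite (ger0_norm (mulr_ge0 (ew_ge0 l t) (heat_ge0 t _))).
  rewrite ge0_intZ ?ew_ge0//; [|exact: measurable_heat|by move=> x; exact: heat_ge0].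
  by rewrite int_heat// mule1.
Qed.

Lemma L1_kt i l : 0 < l -> L1 (mu1 \x mu2)%E (kt i l).
Proof.
move=> l0; apply: L1_prod12; first exact: measurable_kt.
have n0 t : 0 <= 8 * isq l t.
  by rewrite mulr_ge0// /isq /pos; case: ifPn => // _; rewrite mulr_ge0 ?expR_ge0 ?invr_ge0 ?sqrtr_ge0.
apply: le_lt_trans (L1_lty (L1Z 8 (L1_isq l0)) n0).
apply: ge0_le_integral => //.
- by move=> t _; apply: integral_ge0 => x _; rewrite lee_fin.
- apply: (@measurable_fun_fubini_tonelli_F _ _ _ _ _ mu2 (fun z => `|kt i l z|%:E)) => //.
  by apply/measurable_EFinP; apply: measurableT_comp => //; exact: measurable_kt.
- by apply/measurable_EFinP; apply: measurable_funM => //; exact: measurable_isq.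
- move=> t _; rewrite /kt /=; have [t0|t0] := ltP 0 t; last first.
    rewrite integral0_eq; first by rewrite lee_fin.
    by move=> x _; rewrite /ew /pos ltNge t0 /= mul0r normr0.
  have t2 : 0 < 2 * t by rewrite mulr_gt0.
  have c0 : 0 <= 8 * isq l t by exact: n0.
  apply: (@le_trans _ _ (\int[mu2]_x (8 * isq l t * heat (2 * t) x)%:E)%E).
    apply: ge0_int_le.
    - apply: measurableT_comp => //; apply: measurable_funM => //; exact: measurable_dheat.
    - by apply: measurable_funM => //; exact: measurable_heat.
    - by move=> x.
    - move=> x; rewrite normrM ger0_norm ?ew_ge0//.
      apply: le_trans (ler_wpM2l (ew_ge0 _ _) (dheat_bound i x t0)) _.
      by rewrite /ew /isq /pos t0 le_eqVlt; apply/orP; left; apply/eqP; ring.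
  by rewrite ge0_intZ ?int_heat ?mule1//; [exact: measurable_heat|move=> x; exact: heat_ge0].
Qed.

Lemma L1_kG i l : 0 < l -> L1 mu2 (kG i l).
Proof. by move=> l0; apply: L1_tk; exact: L1_kt. Qed.

(** No integrability is asked, so that the oddness of [kG] holds at every point: in the divergent
    cases both sides are 0, the value of [fine] at infinity. *)
Lemma RintN d (T : measurableType d) (mu : {measure set T -> \bar R}) (f : T -> R) :
  \int[mu]_x (- f x) = - \int[mu]_x f x.
Proof.
have e : (fun x => (- f x)%:E) = (\- (EFin \o f))%E by [].
rewrite /Rintegral e integralE [X in - fine X]integralE funeposN funenegN.
move: (integral _ _ _) (integral _ _ _) => [a| |] [b| |] //=; rewrite ?oppr0//.
by rewrite opprB.
Qed.

Lemma kGN i l (x : R * R) : kG i l (- x) = - kG i l x.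
Proof.
rewrite /kG /tk -RintN; apply: eq_Rintegral => t _.
by rewrite /kt /= dheatN mulrN.
Qed.

Lemma Green_tk l : 0 < l -> {ae mu2, forall x, Gr l x = tk (Gt l) x}.
Proof.
move=> l0; apply: filterS (ae_neq0 R) => x x0; rewrite /tk /Rintegral -[LHS]/(fine (Gr l x)%:E) Green_heat//.
congr fine; apply: eq_integral => t _; congr EFin; rewrite /eheat /Gt /ew /pos /=.
by case: ifPn => // t0; rewrite /heat /gauss1 /pos (negbTE t0) !mul0r mulr0.
Qed.

Lemma int_sgauss1 t : 0 < t -> L1 mu1 (dgauss t) /\ \int[mu1]_s dgauss t s = 0.
Proof.
move=> t0; have t2 : 0 < 2 * t by rewrite mulr_gt0.
have L : L1 mu1 (dgauss t).
  apply: L1_le _ _ (L1Z (4 / Num.sqrt t) (L1_gauss1 t2)) => [|s]; first exact: measurable_dgauss.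
  exact: dgauss_bound.
split => //; have h : \int[mu1]_s dgauss t (- s) = \int[mu1]_s dgauss t s.
  by apply: (@mpres_Int _ tl R mu1 _ (dgauss t) (mpres_opp R)); exact: measurable_dgauss.
have : \int[mu1]_s dgauss t s = - \int[mu1]_s dgauss t s.
  by rewrite -IntN// -[LHS]h; apply: eq_Rintegral => s _; rewrite dgaussN.
by move=> /eqP; rewrite -addr_eq0 -mulr2n mulrn_eq0 /= => /eqP.
Qed.

Lemma dgauss_conv t u (x : R) : 0 < t -> 0 < u ->
  L1 mu1 (fun y => dgauss t (x - y) * gauss1 u y) /\
  \int[mu1]_y (dgauss t (x - y) * gauss1 u y) = dgauss (t + u) x.
Proof.
move=> t0 u0; have tu0 : 0 < t + u by exact: addr_gt0.
pose v := t * u / (t + u); have v0 : 0 < v by rewrite divr_gt0// mulr_gt0.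
pose m := x * u / (t + u).
have vt : (t != 0) * (u != 0) * (t + u != 0) by rewrite !gt_eqF.
have p0 := @pi_gt0 R.
have E y : gauss1 t (x - y) * gauss1 u y = gauss1 (t + u) x * gauss1 v (y - m).
  rewrite /m /gauss1 /pos t0 u0 tu0 v0 !mulf_div -!expRD -!sqrtrM; [|by rewrite !mulr_ge0// ltW..].
  congr (expR _ / Num.sqrt _); rewrite /v; field; by rewrite !vt.
(* The displacement [x - y] is split around the mean of the Gaussian in [y]. The constant part gives
   [dgauss (t + u) x] and the centred part integrates to 0. *)
have E2 y : dgauss t (x - y) * gauss1 u y = dgauss (t + u) x * gauss1 v (y - m)
   - (v / t * gauss1 (t + u) x) * dgauss v (y - m).
  have -> : dgauss t (x - y) * gauss1 u y = - ((x - y) / (2 * t)) * (gauss1 t (x - y) * gauss1 u y).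
    by rewrite /dgauss mulrA.
  rewrite E /dgauss; move: (gauss1 (t + u) x) (gauss1 v (y - m)) => A B.
  by rewrite /v /m; field; rewrite !vt.
have [Ld Id] := int_sgauss1 v0; have h := mpres_add (- m).
have Lg := L1_gauss1 v0.
have L1' : L1 mu1 (fun y => gauss1 v (y - m)) by exact: (mpres_L1 h Lg).
have L2' : L1 mu1 (fun y => dgauss v (y - m)) by exact: (mpres_L1 h Ld).
split; first by apply: L1_eq (L1B (L1Z (dgauss (t + u) x) L1') (L1Z (v / t * gauss1 (t + u) x) L2')) => y.
under eq_Rintegral do rewrite E2.
rewrite IntB ?IntZ//; [|exact: L1Z|exact: L1Z].
rewrite (@mpres_Int _ tl R mu1 _ (gauss1 v) h); last exact: measurable_gauss1.
rewrite (@mpres_Int _ tl R mu1 _ (dgauss v) h); last exact: measurable_dgauss.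
by rewrite Id mulr0 subr0 /Rintegral int_gauss1// mulr1.
Qed.

Lemma L1_gauss1_conv t u (x : R) : 0 < t -> 0 < u ->
  L1 mu1 (fun y => gauss1 t (x - y) * gauss1 u y) /\
  \int[mu1]_y (gauss1 t (x - y) * gauss1 u y) = gauss1 (t + u) x.
Proof.
move=> t0 u0; split; last by rewrite /Rintegral gauss1_conv.
apply: L1_ge0; first by apply: measurable_funM; apply: measurable_gauss1 => //; exact: measurable_funB.
  by move=> y; rewrite mulr_ge0 ?gauss1_ge0.
by rewrite gauss1_conv// ltry.
Qed.

Lemma dheat_conv i t u (x : R * R) : 0 < t -> 0 < u ->
  \int[mu2]_w (dheat i t (x - w : R * R) * heat u w) = dheat i (t + u) x.
Proof.
move=> t0 u0; have [La Ia] := dgauss_conv (co i x) t0 u0; have [Lb Ib] := L1_gauss1_conv (co (~~ i) x) t0 u0.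
rewrite /(dheat i (t + u)) -Ia -Ib; case: i La Ia Lb Ib => La Ia Lb Ib /=.
  have [_ <-] := Int2_prod La Lb; apply: eq_Rintegral => w _; rewrite /dheat /heat /=; ring.
rewrite mulrC; have [_ <-] := Int2_prod Lb La; apply: eq_Rintegral => w _; rewrite /dheat /heat /=; ring.
Qed.

Lemma dheat_conv_sub i t u (x y : R * R) : 0 < t -> 0 < u ->
  \int[mu2]_w (dheat i t (x - w : R * R) * heat u (w - y : R * R)) = dheat i (t + u) (x - y).
Proof.
move=> t0 u0; transitivity (\int[mu2]_w (dheat i t (x - y - w : R * R) * heat u w)); last exact: dheat_conv.
have m : measurable_fun setT (fun w : pl => dheat i t (x - y - w : R * R) * heat u w).
  apply: measurable_funM; last exact: measurable_heat.
  by apply: measurable_dheat => //; exact: (mpres_subl (x - y)).1.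
rewrite -(@mpres_Int _ pl R mu2 _ _ (mpres_subr y) m).
by apply: eq_Rintegral => w _; rewrite opprB addrA subrK.
Qed.

Lemma heat_conv_sub t u (x y : R * R) : 0 < t -> 0 < u ->
  \int[mu2]_w (heat t (x - w : R * R) * heat u (w - y : R * R)) = heat (t + u) (x - y).
Proof.
move=> t0 u0; transitivity (\int[mu2]_w (heat t (x - y - w : R * R) * heat u w)); last first.
  by rewrite /Rintegral (heat_conv (x - y) t0 u0).
have m : measurable_fun setT (fun w : pl => heat t (x - y - w : R * R) * heat u w).
  apply: measurable_funM; last exact: measurable_heat.
  by apply: measurable_heat => //; exact: (mpres_subl (x - y)).1.
rewrite -(@mpres_Int _ pl R mu2 _ _ (mpres_subr y) m).
by apply: eq_Rintegral => w _; rewrite opprB addrA subrK.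
Qed.

Lemma heat_bounded e (y x : R * R) : 0 < e -> `|heat e (x - y)| <= (4 * pi * e)^-1.
Proof. by move=> e0; rewrite ger0_norm ?heat_ge0// heat_le. Qed.

Lemma measurable_heat_sub e (y : R * R) : measurable_fun setT (fun x : pl => heat e (x - y : R * R)).
Proof. by apply: measurable_heat => //; exact: (mpres_subr y).1. Qed.

Lemma conv_kG_heat i l e (x y : R * R) : 0 < l -> 0 < e ->
  conv (kG i l) (fun w => heat e (w - y : R * R)) x = \int[mu1]_t (ew l t * dheat i (t + e) (x - y)).
Proof.
move=> l0 e0; have [_ ->] := time_conv x (L1_kt i l0) (measurable_heat_sub e y) (fun x => heat_bounded y x e0).
apply: eq_Rintegral => t _; rewrite /kt /=; have [t0|t0] := ltP 0 t; last first.
  by rewrite /ew /pos ltNge t0 /= mul0r /Rintegral integral0_eq// => w _; rewrite !mul0r.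
rewrite -dheat_conv_sub// -IntZ; first by apply: eq_Rintegral => w _; rewrite -[LHS]mulrA.
have m := measurable_heat_sub e y.
have md : measurable_fun setT (fun w : pl => dheat i t (x - w : R * R)).
  by apply: measurable_dheat => //; exact: (mpres_subl x).1.
have t2 : 0 < 2 * t by rewrite mulr_gt0.
have Lh := mpres_L1 (mpres_subl x) (L1_heat t2).
apply: L1_le _ _ (L1Z (8 / Num.sqrt t * (4 * pi * e)^-1) Lh) => [|w]; first exact: measurable_funM.
rewrite normrM mulrAC; apply: ler_pM => //; [exact: dheat_bound|exact: heat_bounded].
Qed.

Lemma conv_Green_heat l e (x y : R * R) : 0 < l -> 0 < e ->
  conv (fun z => Gr l z) (fun w => heat e (w - y : R * R)) x = \int[mu1]_t (ew l t * heat (t + e) (x - y)).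
Proof.
move=> l0 e0; have mh := measurable_heat_sub e y.
rewrite (conv_ae x (measurable_Green0 l0) (L1_meas (L1_tk (L1_Gt l0))) mh (Green_tk l0)).
have [_ ->] := time_conv x (L1_Gt l0) mh (fun x => heat_bounded y x e0).
apply: eq_Rintegral => t _; rewrite /Gt /=; have [t0|t0] := ltP 0 t; last first.
  by rewrite /ew /pos ltNge t0 /= mul0r /Rintegral integral0_eq// => w _; rewrite !mul0r.
rewrite -heat_conv_sub// -IntZ; first by apply: eq_Rintegral => w _; rewrite -[LHS]mulrA.
have Lh := mpres_L1 (mpres_subl x) (L1_heat t0).
apply: L1_le _ _ (L1Z (4 * pi * e)^-1 Lh) => [|w].
  by apply: measurable_funM => //; apply: measurable_heat => //; exact: (mpres_subl x).1.
by rewrite normrM mulrC; apply: ler_pM => //; [exact: heat_bounded|rewrite ger0_norm ?heat_ge0].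
Qed.

End TimeKernels.

(** * Representation of a function by its weak gradient and the Green kernels *)

Section Resolvent.
Variable R : realType.
Notation mu1 := (@lebesgue_measure R).
Notation mu2 := (@sleb2 R).
Notation tl := (measurableTypeR R).
Notation pl := (measurableTypeR R * measurableTypeR R)%type.
Implicit Types (t s l e : R) (i : bool).

Definition wd i := if i then @wd1 R else @wd2 R.

Lemma L1_ew_prod l (F h : tl * pl -> R) K : 0 < l -> 0 <= K -> measurable_fun setT F ->
  measurable_fun setT h -> (forall z, 0 <= h z) -> (forall z, `|F z| <= ew l z.1 * h z) ->
  (forall t, 0 < t -> (\int[mu2]_x (h (t, x))%:E <= K%:E)%E) -> L1 (mu1 \x mu2)%E F.
Proof.
move=> l0 K0 mF mh h0 Fh hK; apply: L1_prod12 => //.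
apply: le_lt_trans (L1_lty (L1Z K (L1_ew l0)) _); last by move=> t; rewrite mulr_ge0 ?ew_ge0.
have mA : measurable_fun setT (fun z => `|F z|) by exact: measurableT_comp.
apply: ge0_le_integral => //.
- by move=> t _; apply: integral_ge0 => x _; rewrite lee_fin.
- by apply: (@measurable_fun_fubini_tonelli_F _ _ _ _ _ mu2 (fun z => `|F z|%:E)) => //; exact/measurable_EFinP.
- by apply/measurable_EFinP; apply: measurable_funM => //; exact: measurable_ew.
- move=> t _; have mt (G : tl * pl -> R) : measurable_fun setT G -> measurable_fun setT (fun x => G (t, x)).
    by move=> mG; apply: (measurableT_comp mG); exact: measurable_fun_pair.
  apply: (@le_trans _ _ (\int[mu2]_x (ew l t * h (t, x))%:E)%E).
    apply: ge0_int_le => //; first exact: (mt _ mA).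
    by apply: measurable_funM => //; exact: (mt _ mh).
  rewrite ge0_intZ ?ew_ge0//; last exact: mt.
  have [t0|t0] := ltP 0 t; last first.
    by rewrite /ew /pos ltNge t0 /= mul0e mulr0.
  by rewrite mulrC EFinM lee_wpmul2l ?lee_fin ?ew_ge0//; exact: hK.
Qed.

Section HeatTime.
Variables (l e c : R) (N : R -> pl -> R).
Hypotheses (l0 : 0 < l) (e0 : 0 < e) (c0 : 0 <= c).
Hypothesis mN : measurable_fun setT (fun z : tl * pl => N z.1 z.2).
Hypothesis hN : forall t x, e <= t -> `|N t x| <= c * heat (2 * t) x.

(** Shifting the time by [e] keeps the kernel [N] away from its singularity at time 0. *)
Definition Nt (x : pl) : R := \int[mu1]_t (ew l t * N (t + e) x).

Let C := (4 * pi * (2 * e))^-1 : R.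

Let C0 : 0 <= C. Proof. by rewrite invr_ge0 !mulr_ge0 ?pi_ge0// ltW. Qed.

Let heatC t x : e <= t -> heat (2 * t) x <= C.
Proof.
move=> et; have t0 : 0 < t by exact: lt_le_trans et.
apply: le_trans (heat_le x (_ : 0 < 2 * t)) _; first by rewrite mulr_gt0.
rewrite lef_pV2 ?posrE ?mulr_gt0 ?pi_gt0// ler_pM2l ?mulr_gt0 ?pi_gt0//.
by rewrite ler_pM2l.
Qed.

Lemma measurable_Nx (x : pl) : measurable_fun setT (fun t => ew l t * N (t + e) x).
Proof.
apply: measurable_funM; first exact: measurable_ew.
have mt : measurable_fun setT (fun t : tl => (t + e, x) : tl * pl).
  by apply: measurable_fun_pair => //; exact: measurable_funD.
exact: measurableT_comp mN mt.
Qed.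

Lemma L1_Nx (x : pl) : L1 mu1 (fun t => ew l t * N (t + e) x).
Proof.
have h := L1Z (c * C) (L1_ew l0); apply: L1_le h => [|t]; first exact: measurable_Nx.
rewrite normrM ger0_norm ?ew_ge0// mulrC; have [t0|t0] := ltP 0 t; last first.
  by rewrite /ew /pos ltNge t0 /= !mulr0.
rewrite ler_wpM2r ?ew_ge0//; have et : e <= t + e by rewrite lerDr ltW.
by apply: le_trans (hN _ et) _; rewrite ler_wpM2l// heatC.
Qed.

Lemma heat_time (f : pl -> R) (y : pl) : sq mu2 f ->
  [/\ L1 mu2 (fun x => f x * Nt (x - y : R * R)),
      L1 mu1 (fun t => ew l t * \int[mu2]_x (f x * N (t + e) (x - y : R * R))) &
      \int[mu2]_x (f x * Nt (x - y : R * R)) =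
      \int[mu1]_t (ew l t * \int[mu2]_x (f x * N (t + e) (x - y : R * R)))].
Proof.
move=> [mf f2].
pose F (z : tl * pl) := ew l z.1 * (f z.2 * N (z.1 + e) (z.2 - y : R * R)).
pose h (z : tl * pl) := c * heat (2 * (z.1 + e)) (z.2 - y : R * R) + (c * C) * f z.2 ^+ 2 + 0.
have msub : measurable_fun setT (fun z : tl * pl => (z.2 - y : R * R) : pl).
  exact: (measurableT_comp (mpres_subr y).1 measurable_snd).
have mte : measurable_fun setT (fun z : tl * pl => z.1 + e) by exact: measurable_funD.
have mf2 : measurable_fun setT (fun z : tl * pl => f z.2) by exact: measurableT_comp mf measurable_snd.
have mNs : measurable_fun setT (fun z : tl * pl => N (z.1 + e) (z.2 - y : R * R)).
  apply: (@measurableT_comp _ _ _ _ _ _ (fun z : tl * pl => N z.1 z.2) _ (fun z : tl * pl => (z.1 + e, z.2 - y : R * R) : tl * pl) mN).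
  exact: measurable_fun_pair.
have mF : measurable_fun setT F.
  apply: measurable_funM; last exact: measurable_funM.
  exact: measurableT_comp (measurable_ew l) measurable_fst.
have mh : measurable_fun setT h.
  apply: measurable_funD => //; apply: measurable_funD; apply: measurable_funM => //.
    by apply: measurable_heat => //; exact: measurable_funM.
  exact: measurable_funX.
have h0 z : 0 <= h z.
  by rewrite /h addr0 addr_ge0// mulr_ge0 ?heat_ge0 ?sqr_ge0// mulr_ge0.
have key t x : 0 < t -> `|f x * N (t + e) (x - y : R * R)| <= h (t, x).
  move=> t0; have et : e <= t + e by rewrite lerDr ltW.
  rewrite normrM mulrC; apply: le_trans (ler_wpM2r (normr_ge0 _) (hN _ et)) _.
  rewrite /h /= addr0 -mulrA -(mulrA c) -mulrDr ler_wpM2l//.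
  have H0 := heat_ge0 (2 * (t + e)) (x - y : R * R); have HC := heatC (x - y : R * R) et.
  have a0 := normr_ge0 (f x); rewrite -(real_normK (num_real (f x))).
  (* [f] is only square integrable. The 1 is paired with the integrable heat kernel, and [f^2] with
     the bound [C] of that kernel. *)
  have h1 : `|f x| <= 1 + `|f x| ^+ 2 by have := sqr_ge0 (`|f x| - 1); nra.
  apply: le_trans (ler_wpM2l H0 h1) _; rewrite mulrDr mulr1 lerD2l ler_wpM2r ?sqr_ge0//.
pose K := c + c * C * \int[mu2]_x f x ^+ 2.
have LH t : 0 < t -> L1 mu2 (fun x => h (t, x)).
  move=> t0; have t2 : 0 < 2 * (t + e) by rewrite mulr_gt0 ?addr_gt0.
  have L1' := L1Z c (mpres_L1 (mpres_subr y) (L1_heat t2)); have L2' := L1Z (c * C) f2.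
  by apply: L1_eq (L1D L1' L2') => x; rewrite /h /= addr0.
have hK t : 0 < t -> (\int[mu2]_x (h (t, x))%:E <= K%:E)%E.
  move=> t0; have t2 : 0 < 2 * (t + e) by rewrite mulr_gt0 ?addr_gt0.
  have L1' := mpres_L1 (mpres_subr y) (L1_heat t2).
  rewrite (L1_fin (LH t t0)) lee_fin /h /=.
  under eq_Rintegral do rewrite addr0.
  rewrite (IntD (L1Z c L1') (L1Z (c * C) f2)) (IntZ _ L1') (IntZ _ f2).
  rewrite (@mpres_Int _ pl R mu2 _ (heat (2 * (t + e))) (mpres_subr y)); last exact: measurable_heat.
  by rewrite /(Rintegral mu2 setT (heat _)) int_heat//= mulr1.
have K0 : 0 <= K by rewrite addr_ge0// mulr_ge0 ?mulr_ge0// Int_ge0// => x; exact: sqr_ge0.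
have LF : L1 (mu1 \x mu2)%E F.
  apply: (L1_ew_prod l0 K0 mF mh h0 _ hK) => z; rewrite normrM ger0_norm ?ew_ge0//.
  have [t0|t0] := ltP 0 z.1; last by rewrite /ew /pos ltNge t0 /= !mul0r.
  by rewrite ler_wpM2l ?ew_ge0//; case: z t0 => t x; exact: key.
have [A1 A2 _ _ A3] := RFubini LF.
have E1 t : \int[mu2]_x F (t, x) = ew l t * \int[mu2]_x (f x * N (t + e) (x - y : R * R)).
  have [t0|t0] := ltP 0 t; last first.
    rewrite /F /ew /pos /= ltNge t0 /= mul0r /Rintegral integral0_eq// => x _.
    by rewrite mul0r.
  rewrite /F /= IntZ//; apply: L1_le _ _ (LH t t0) => [|x]; last exact: key.
  apply: measurable_funM => //.
  have mt : measurable_fun setT (fun x : pl => (t + e, x - y : R * R) : tl * pl).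
    by apply: measurable_fun_pair => //; exact: (mpres_subr y).1.
  exact: measurableT_comp mN mt.
have E2 (x : pl) : \int[mu1]_t F (t, x) = f x * Nt (x - y : R * R).
  rewrite /Nt -(IntZ _ (L1_Nx _)); apply: eq_Rintegral => t _; rewrite /F /=.
  by rewrite mulrCA.
split.
- by apply: L1_eq A2 => x; rewrite E2.
- by apply: L1_eq A1 => t; rewrite E1.
- by under eq_Rintegral do rewrite -E2; rewrite -A3; apply: eq_Rintegral => t _; rewrite E1.
Qed.

End HeatTime.

(** This is [l - Laplacian] applied to [heat t]. By the heat equation, [exp(-l t) * lheat l t] is
    minus the time derivative of [exp(-l t) * heat t]. *)
Definition lheat l t (x : R * R) := l * heat t x - (d2heat true t x + d2heat false t x).

Lemma lheatE l t (x : R * R) :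
  lheat l t x = (l - ((x.1 ^+ 2 + x.2 ^+ 2) / (4 * t ^+ 2) - 1 / t)) * heat t x.
Proof.
rewrite /lheat /d2heat /d2gauss /heat /=; have [->|t0] := eqVneq t 0.
  by rewrite /gauss1 /pos ltxx; ring.
by move: (gauss1 t x.1) (gauss1 t x.2) => A B; field; rewrite t0.
Qed.

Lemma measurable_lheat l : measurable_fun setT (fun z : tl * pl => lheat l z.1 z.2).
Proof.
apply: measurable_funB; first by apply: measurable_funM => //; exact: measurable_heat.
by apply: measurable_funD; exact: measurable_d2heat.
Qed.

Lemma lheat_bound l e t x : 0 < l -> 0 < e -> e <= t ->
  `|lheat l t x| <= (4 * l + 16 / e) * heat (2 * t) x.
Proof.
move=> l0 e0 et; have t0 : 0 < t by exact: lt_le_trans et.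
have h1 := heat_le2 x t0; have h2 := d2heat_bound true x t0; have h3 := d2heat_bound false x t0.
have te : 8 / t * heat (2 * t) x <= 8 / e * heat (2 * t) x.
  by rewrite ler_wpM2r ?heat_ge0// ler_wpM2l// lef_pV2.
rewrite /lheat; apply: le_trans (ler_normB _ _) _; rewrite normrM (gtr0_norm l0) (ger0_norm (heat_ge0 _ _)).
have h4 := ler_normD (d2heat true t x) (d2heat false t x).
have h5 := ler_wpM2l (ltW l0) h1.
rewrite mulrDl; move: h2 h3 te h4 h5; move: (heat (2 * t) x) (heat t x) `|d2heat _ _ _| `|d2heat _ _ _| `|_ + _| => A B C D G.
move=> h2 h3 te h4 h5; rewrite (_ : 16 / e * A = 8 / e * A + 8 / e * A); last by ring.
lra.
Qed.

(** The integrand is the derivative of [- exp(-l t) * heat (t + e) x], which goes from [- heat e x]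
    to 0. It is the equation (l - Laplacian) G = delta, smoothed by [heat e]. *)
Lemma lheat_ftc l e (x : R * R) : 0 < l -> 0 < e -> Nt l e (lheat l) x = heat e x.
Proof.
move=> l0 e0; pose r := x.1 ^+ 2 + x.2 ^+ 2; have r0 : 0 <= r by rewrite addr_ge0 ?sqr_ge0.
(* [F] and its derivative are written without the cutoff at time 0, so that they are regular on the
   closed half-line. *)
pose F t := expR (- (l * t)) * (expR (- (r * (4 * (t + e))^-1)) * (4 * pi * (t + e))^-1).
pose g t := expR (- (l * t)) * ((l + (- r * (4 * ((t + e) * (t + e)))^-1 + (t + e)^-1)) *
  (expR (- (r * (4 * (t + e))^-1)) * (4 * pi * (t + e))^-1)).
have FE t : 0 <= t -> F t = expR (- (l * t)) * heat (t + e) x.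
  by move=> t0; rewrite heatE /pos (_ : 0 < t + e)//; exact: ltr_wpDl.
have gE t : 0 < t -> ew l t * lheat l (t + e) x = g t.
  move=> t0; have te : 0 < t + e by exact: addr_gt0.
  rewrite /ew lheatE heatE /pos t0 te /g -/r; congr (_ * (_ * _)).
  by field; rewrite gt_eqF.
have pn : pi != 0 :> R by rewrite gt_eqF ?pi_gt0.
have dG t : 0 <= t -> is_derive t 1 (fun t => - F t) (g t) /\ {for t, continuous g}.
  move=> t0; have te : 0 < t + e by exact: ltr_wpDl.
  have d0 : is_derive t 1 (fun t : R => t + e) (1 + 0) by exact: (dvD (dv_id t) (dv_cst e t)).
  have d1 : is_derive t 1 (fun t : R => - (l * t)) (- (l * 1)) by exact: (dvN (dvZ l (dv_id t))).
  have d2 : is_derive t 1 (fun t : R => 4 * (t + e)) (4 * (1 + 0)) by exact: (dvZ 4 d0).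
  have d3 : is_derive t 1 (fun t : R => 4 * pi * (t + e)) (4 * pi * (1 + 0)) by exact: (dvZ (4 * pi) d0).
  have n1 : t + e != 0 by rewrite gt_eqF.
  have n2 : 4 * (t + e) != 0 by rewrite gt_eqF ?mulr_gt0.
  have n3 : 4 * pi * (t + e) != 0 by rewrite gt_eqF ?mulr_gt0 ?pi_gt0.
  have n4 : 4 * ((t + e) * (t + e)) != 0 by rewrite gt_eqF ?mulr_gt0.
  have hh := dvM (dvexp (dvN (dvM (dv_cst r t) (@dvV R (fun t => 4 * (t + e)) t _ n2 d2)))) (@dvV R (fun t => 4 * pi * (t + e)) t _ n3 d3).
  have h := dvN (dvM (dvexp d1) hh).
  split.
    apply: (dv_eq h); rewrite /g.
    move: (expR _) (expR _) pn => A B; move: (pi : R) => p p0; field.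
    by rewrite p0 gt_eqF.
  have h2 := dvM (dvexp d1) (dvM (dvD (dv_cst l t) (dvD (dvM (dv_cst (- r) t) (@dvV R (fun t => 4 * ((t + e) * (t + e))) t _ n4 (dvZ 4 (dvM d0 d0)))) (@dvV R (fun t => t + e) t _ n1 d0))) hh).
  by case: h2 => dx _; exact/differentiable_continuous/derivable1_diffP.
have mg : measurable_fun setT g.
  have ma : measurable_fun setT (fun t : R => t + e) by exact: measurable_funD.
  have mi (c : R) (u : R -> R) : measurable_fun setT u -> measurable_fun setT (fun t : R => (c * u t)^-1).
    by move=> mu; apply: (measurableT_comp (@measurable_inv R)); exact: measurable_funM.
  have mx (u : R -> R) : measurable_fun setT u -> measurable_fun setT (fun t : R => expR (- u t)).
    by move=> mu; do 2 apply: measurableT_comp => //.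
  apply: measurable_funM; first by apply: mx; exact: measurable_funM.
  apply: measurable_funM; last first.
    by apply: measurable_funM; [apply: mx; apply: measurable_funM => //; exact: mi|exact: mi].
  apply: measurable_funD; first exact: measurable_cst.
  apply: measurable_funD; last exact: (measurableT_comp (@measurable_inv R)).
  by apply: measurable_funM => //; apply: mi; exact: measurable_funM.
have c0 : 0 <= 4 * l + 16 / e by apply: addr_ge0; [rewrite mulr_ge0// ltW|rewrite divr_ge0// ltW].
have mN : measurable_fun setT (fun z : tl * pl => lheat l z.1 z.2) by exact: measurable_lheat.
have LN := L1_Nx l0 e0 c0 mN (fun t x => lheat_bound x l0 e0) x.
have F0 : F 0 = heat e x by rewrite FE// mulr0 oppr0 expR0 mul1r add0r.
have Finf : F n.+1%:R @[n --> \oo] --> (0 : R).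
  apply: (@squeeze_cvgr _ _ _ _ (fun=> 0) (fun n => (l^-1 * (4 * pi * e)^-1) * n.+1%:R^-1)).
  - apply: nearW => n; rewrite FE// mulr_ge0 ?expR_ge0 ?heat_ge0//=.
    have ln0 : 0 < l * n.+1%:R by rewrite mulr_gt0.
    rewrite [leRHS]mulrAC; apply: ler_pM; rewrite ?expR_ge0 ?heat_ge0//.
      rewrite -invfM expRN lef_pV2 ?posrE ?expR_gt0//.
      by apply: le_trans (expR_ge1Dx _); rewrite lerDr.
    have ne : 0 < n.+1%:R + e by rewrite addr_gt0.
    apply: le_trans (heat_le x ne) _; rewrite lef_pV2 ?posrE ?mulr_gt0 ?pi_gt0//.
    by rewrite ler_pM2l ?mulr_gt0 ?pi_gt0// lerDr.
  - exact: cvg_cst.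
  - by rewrite -[X in _ --> X](mulr0 (l^-1 * (4 * pi * e)^-1)); apply: cvgMr; exact: cvg_inv_nat.
have Fn n : \int[mu1]_t (ind 0 n.+1%:R t * (ew l t * lheat l (t + e) x)) = - F n.+1%:R - - F 0.
  have n0 : 0 < n.+1%:R :> R by [].
  have ftc := @FTC2 R (fun t => - F t) g 0 n.+1%:R n0 (fun t tn => (dG t (andP tn).1).1) (fun t tn => (dG t (andP tn).1).2).
  rewrite -[RHS]/(fine (- F n.+1%:R - - F 0)%:E) -ftc.
  rewrite /Rintegral -integral_itv_obnd_cbnd; last first.
    by apply: measurable_funTS; apply/measurable_EFinP; exact: mg.
  congr fine; rewrite [RHS]integral_mkcond; apply: eq_integral => t _; rewrite patchE mem_setE in_itv /= indE.
  case: ifPn => [/andP[t0 _]|_]; last by rewrite mul0r.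
  by rewrite mul1r gE.
have [_ lim] : L1 mu1 (fun t => ew l t * lheat l (t + e) x) /\
    (\int[mu1]_t (ind 0 n.+1%:R t * (ew l t * lheat l (t + e) x)) @[n --> \oo] --> Nt l e (lheat l) x).
  apply: (@dct _ tl R mu1 (fun n t => ind 0 n.+1%:R t * (ew l t * lheat l (t + e) x)) _
    (fun t => `|ew l t * lheat l (t + e) x|)).
  - by move=> n; apply: measurable_funM; [exact: measurable_ind|exact: L1_meas LN].
  - exact: L1_meas LN.
  - exact: L1_norm.
  - by move=> n t; rewrite normrM ger0_norm ?ind_ge0// ler_piMl ?ind_le1.
  - apply: aeW => t; have [t0|t0] := ltP 0 t; last first.
      by rewrite /ew /pos ltNge t0 /= mul0r; under eq_fun do rewrite mulr0; exact: cvg_cst.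
    rewrite -[X in _ --> X]mul1r; apply: cvgMl.
    have hk := archi_boundP (ltW t0).
    apply: cvg_near_cst; exists (Num.bound t) => // n /= kn; rewrite indE t0 /=.
    by rewrite (le_trans (ltW hk))// ler_nat (leq_trans kn).
have lim2 : \int[mu1]_t (ind 0 n.+1%:R t * (ew l t * lheat l (t + e) x)) @[n --> \oo] --> - 0 - - F 0.
  under eq_fun do rewrite Fn; apply: cvgB; first exact: cvgN.
  exact: cvg_cst.
rewrite (cvg_unique _ lim lim2)//.
by rewrite oppr0 add0r opprK.
Qed.

Lemma sq_heat_sub t (y : pl) : 0 < t -> sq mu2 (fun x => heat t (x - y : R * R)).
Proof.
move=> t0; apply: (sq_tens (a := fun s => gauss1 t (s - y.1)) (b := fun s => gauss1 t (s - y.2)));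
  apply: sq_sub1; exact: sq_gauss1.
Qed.

Lemma sq_d2heat_sub i t (y : pl) : 0 < t -> sq mu2 (fun x => d2heat i t (x - y : R * R)).
Proof.
move=> t0; have t2 : 0 < 2 * t by rewrite mulr_gt0.
apply: sq_le (sqZ (8 / t) (sq_heat_sub y t2)) => [|x].
  by apply: measurable_d2heat => //; exact: (mpres_subr y).1.
exact: d2heat_bound.
Qed.

(** Sealed like [Gr], to keep unification from unfolding the convolution. *)
Fact cG_key : {T : R -> (pl -> R) -> pl -> R | T = fun l (s : pl -> R) => conv (fun z => Gr l z) s}.
Proof. by exists (fun l (s : pl -> R) => conv (fun z => Gr l z) s). Qed.

Definition cG : R -> (pl -> R) -> pl -> R := sval cG_key.

Lemma cGE l (s : pl -> R) : cG l s = conv (fun z => Gr l z) s.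
Proof. by rewrite /cG (svalP cG_key). Qed.

Fact ck_key : {T : bool -> R -> (pl -> R) -> pl -> R | T = fun i l (s : pl -> R) => conv (kG i l) s}.
Proof. by exists (fun i l (s : pl -> R) => conv (kG i l) s). Qed.

Definition ck : bool -> R -> (pl -> R) -> pl -> R := sval ck_key.

Lemma ckE i l (s : pl -> R) : ck i l s = conv (kG i l) s.
Proof. by rewrite /ck (svalP ck_key). Qed.

Lemma convN_Green l (f : pl -> R) x : conv (fun z => Gr l (- z : R * R)) f x = cG l f x.
Proof. by rewrite cGE; apply: eq_Rintegral => z _; rewrite (GreenN l (x - z)). Qed.

Lemma convN_kG i l (f : pl -> R) x : conv (fun z => kG i l (- z : R * R)) f x = - ck i l f x.
Proof. by rewrite ckE -RintN; apply: eq_Rintegral => z _; rewrite (kGN i l (x - z)) mulNr. Qed.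

Lemma cG_pair l (f s : pl -> R) : 0 < l -> sq mu2 f -> sq mu2 s ->
  \int[mu2]_x (f x * cG l s x) = \int[mu2]_x (cG l f x * s x).
Proof.
move=> l0 sf ss; rewrite cGE; apply: (etrans (conv_pair (L1_Green l0) sf ss)); apply: eq_Rintegral => x _.
by rewrite [LHS]mulrC convN_Green.
Qed.

Lemma ck_pair i l (f s : pl -> R) : 0 < l -> sq mu2 f -> sq mu2 s ->
  \int[mu2]_x (f x * ck i l s x) = - \int[mu2]_x (ck i l f x * s x).
Proof.
move=> l0 sf ss; rewrite ckE; apply: (etrans (conv_pair (L1_kG i l0) sf ss)); rewrite -RintN; apply: eq_Rintegral => x _.
by rewrite [LHS]mulrC convN_kG mulNr.
Qed.

Lemma sq_cG l (s : pl -> R) : 0 < l -> sq mu2 s -> sq mu2 (cG l s).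
Proof. by move=> l0; rewrite cGE; exact: conv_sq (L1_Green l0). Qed.

Lemma sq_ck i l (s : pl -> R) : 0 < l -> sq mu2 s -> sq mu2 (ck i l s).
Proof. by move=> l0; rewrite ckE; exact: conv_sq (L1_kG i l0). Qed.

(** Each term is a time integral by [heat_time]; the weak gradients are moved onto the Gaussians by
    [wd_gauss], and the three integrands add up to the pairing of [f] with [lheat], which
    [lheat_ftc] integrates. *)
Lemma energy_heat (f : pl -> R) (g : bool -> pl -> R) l e (y : pl) : 0 < l -> 0 < e ->
  sq mu2 f -> (forall i, sq mu2 (g i)) -> (forall i, wd i f (g i)) ->
  \int[mu2]_x (g true x * ck true l (fun w => heat e (w - y : R * R)) x) +
  \int[mu2]_x (g false x * ck false l (fun w => heat e (w - y : R * R)) x) +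
  l * \int[mu2]_x (f x * cG l (fun w => heat e (w - y : R * R)) x) =
  \int[mu2]_x (f x * heat e (x - y : R * R)).
Proof.
move=> l0 e0 sf sg w.
have cg i : 0 <= 8 / Num.sqrt e by rewrite divr_ge0 ?sqrtr_ge0.
have hg i t x : e <= t -> `|dheat i t x| <= 8 / Num.sqrt e * heat (2 * t) x.
  move=> et; have t0 := lt_le_trans e0 et; apply: le_trans (dheat_bound i x t0) _.
  by rewrite ler_wpM2r ?heat_ge0// ler_wpM2l// lef_pV2 ?posrE ?sqrtr_gt0//; exact: ler_wsqrtr.
have mg i : measurable_fun setT (fun z : tl * pl => dheat i z.1 z.2) by exact: measurable_dheat.
have hG t x : e <= t -> `|heat t x| <= 4 * heat (2 * t) x.
  by move=> et; rewrite ger0_norm ?heat_ge0// heat_le2//; exact: lt_le_trans et.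
have mG : measurable_fun setT (fun z : tl * pl => heat z.1 z.2) by exact: measurable_heat.
have c0 : 0 <= 4 * l + 16 / e by apply: addr_ge0; [rewrite mulr_ge0// ltW|rewrite divr_ge0// ltW].
have [_ La Ia] := heat_time l0 e0 (cg true) (mg true) (hg true) y (sg true).
have [_ Lb Ib] := heat_time l0 e0 (cg false) (mg false) (hg false) y (sg false).
have [_ Lc Ic] := heat_time l0 e0 (ler0n _ 4) mG hG y sf.
have [_ Ld Id] := heat_time l0 e0 c0 (measurable_lheat l) (fun t x => lheat_bound x l0 e0) y sf.
have Ea i : \int[mu2]_x (g i x * ck i l (fun w => heat e (w - y : R * R)) x) =
    \int[mu2]_x (g i x * Nt l e (dheat i) (x - y : R * R)).
  by apply: eq_Rintegral => x _; rewrite ckE; congr (_ * _); exact: conv_kG_heat.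
have Ec : \int[mu2]_x (f x * cG l (fun w => heat e (w - y : R * R)) x) =
    \int[mu2]_x (f x * Nt l e (heat (R:=R)) (x - y : R * R)).
  by apply: eq_Rintegral => x _; rewrite cGE; congr (_ * _); exact: conv_Green_heat.
rewrite [X in X + _ + _]Ea [X in _ + X + _]Ea [X in _ + _ + _ * X]Ec.
rewrite [X in X + _ + _]Ia [X in _ + X + _]Ib [X in _ + _ + _ * X]Ic -(IntZ l Lc) -(IntD La Lb) -(IntD (L1D La Lb) (L1Z l Lc)).
rewrite -[RHS](_ : \int[mu2]_x (f x * Nt l e (lheat l) (x - y : R * R)) = _); last first.
  by apply: eq_Rintegral => x _; rewrite lheat_ftc.
rewrite Id; apply: eq_Rintegral => t _; have [t0|t0] := ltP 0 t; last first.
  have ez : ew l t = 0 by rewrite /ew /pos ltNge t0.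
  rewrite ez; move: (Rintegral _ _ _) (Rintegral _ _ _) (Rintegral _ _ _) (Rintegral _ _ _) => a b c d.
  by ring.
have te : 0 < t + e by exact: addr_gt0.
have [wt _] := wd_gauss (i := true) y sf (sg true) (w true) te.
have [wf _] := wd_gauss (i := false) y sf (sg false) (w false) te.
have Lt := sq_mul sf (sq_d2heat_sub true y te); have Lf := sq_mul sf (sq_d2heat_sub false y te).
have Lh := sq_mul sf (sq_heat_sub y te).
have E : \int[mu2]_x (f x * lheat l (t + e) (x - y : R * R)) =
    l * \int[mu2]_x (f x * heat (t + e) (x - y : R * R)) -
    (\int[mu2]_x (f x * d2heat true (t + e) (x - y : R * R)) + \int[mu2]_x (f x * d2heat false (t + e) (x - y : R * R))).
  rewrite -(IntZ l Lh) -(IntD Lt Lf) -(IntB (L1Z l Lh) (L1D Lt Lf)).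
  by apply: eq_Rintegral => x _; rewrite /lheat; ring.
rewrite E wt wf; move: (Rintegral _ _ _) (Rintegral _ _ _) (Rintegral _ _ _) => a b c.
by ring.
Qed.

(** Formally [f] is the resolvent applied to [l f - div g], with the divergence carried by the
    kernel. Paired with heat kernels this is [energy_heat], and [heat_inj] removes the pairing. *)
Lemma resolvent_rep (f : pl -> R) (g : bool -> pl -> R) l : 0 < l ->
  sq mu2 f -> (forall i, sq mu2 (g i)) -> (forall i, wd i f (g i)) ->
  {ae mu2, forall x, f x = l * cG l f x -
    (ck true l (g true) x + ck false l (g false) x)}.
Proof.
move=> l0 sf sg w; have sG := sq_cG l0 sf.
have sk i := sq_ck i l0 (sg i).
pose psi x := f x - (l * cG l f x - (ck true l (g true) x + ck false l (g false) x)).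
have spsi : sq mu2 psi by apply: sqB => //; apply: sqB; [exact: sqZ|exact: sqD].
suff h : {ae mu2, forall x, psi x = 0}.
  by apply: filterS h => x /eqP; rewrite subr_eq0 => /eqP.
apply: heat_inj => // e y e0; have sh := sq_heat_sub y e0.
have Lfh := sq_mul sf sh; have Lgh := sq_mul sG sh; have Lkh i := sq_mul (sk i) sh.
have := energy_heat y l0 e0 sf sg w.
rewrite [X in X + _ + _](ck_pair _ l0 (sg true) sh) [X in _ + X + _](ck_pair _ l0 (sg false) sh).
rewrite [X in _ + _ + _ * X](cG_pair l0 sf sh) => E.
have -> : \int[mu2]_x (psi x * heat e (x - y : R * R)) =
  \int[mu2]_x (f x * heat e (x - y : R * R)) - (l * \int[mu2]_x (cG l f x * heat e (x - y : R * R)) -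
  (\int[mu2]_x (ck true l (g true) x * heat e (x - y : R * R)) + \int[mu2]_x (ck false l (g false) x * heat e (x - y : R * R)))).
  rewrite -IntZ// -IntD// -IntB; [|exact: L1Z|exact: L1D].
  rewrite -IntB//; last by apply: L1B; [exact: L1Z|exact: L1D].
  by apply: eq_Rintegral => x _; rewrite /psi; ring.
move: E; move: (Rintegral _ _ _) (Rintegral _ _ _) (Rintegral _ _ _) (Rintegral _ _ _) => a b c d.
lra.
Qed.

(** [cG l s] is the Riesz representative of [f |-> \int f s] for the energy. The case of Gaussian
    [s] gave the representation formula; pairing that formula with [s] gives the general case. *)
Lemma energy_conv (f s : pl -> R) (g : bool -> pl -> R) l : 0 < l ->
  sq mu2 f -> (forall i, sq mu2 (g i)) -> (forall i, wd i f (g i)) -> sq mu2 s ->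
  \int[mu2]_x (g true x * ck true l s x) + \int[mu2]_x (g false x * ck false l s x) +
  l * \int[mu2]_x (f x * cG l s x) = \int[mu2]_x (f x * s x).
Proof.
move=> l0 sf sg w ss; have sG := sq_cG l0 sf.
have sk i := sq_ck i l0 (sg i).
rewrite [X in X + _ + _](ck_pair _ l0 (sg true) ss) [X in _ + X + _](ck_pair _ l0 (sg false) ss).
rewrite [X in _ + _ + _ * X](cG_pair l0 sf ss).
have Lt := sq_mul (sk true) ss; have Lf := sq_mul (sk false) ss; have LG := sq_mul sG ss.
rewrite -(IntZ l LG) -opprD -(IntD Lt Lf) addrC -(IntB (L1Z l LG) (L1D Lt Lf)).
apply: Int_ae.
- exact: L1_meas (L1B (L1Z l LG) (L1D Lt Lf)).
- exact: L1_meas (sq_mul sf ss).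
- by apply: filterS (resolvent_rep l0 sf sg w) => x ->; ring.
Qed.

End Resolvent.

(** * Arbitrary test functions, and derivatives of convolutions *)

Section TestFunctions.
Variable R : realType.
Notation mu1 := (@lebesgue_measure R).
Notation mu2 := (@sleb2 R).
Notation pl := (measurableTypeR R * measurableTypeR R)%type.
Implicit Types (t s l e : R) (i : bool).

Lemma Int2_xy (F : pl -> R) : L1 mu2 F -> \int[mu2]_z F z = \int[mu1]_x \int[mu1]_y F (x, y).
Proof.
move=> L; have [_ _ e] := @RFubini1 _ _ _ _ R mu1 mu1 F L.
by rewrite /Rintegral -(integral12_prod_meas1 L) [in LHS]/fubini_F -[RHS]/(fine (_%:E)) -e.
Qed.

Lemma Int2_yx (F : pl -> R) : L1 mu2 F -> \int[mu2]_z F z = \int[mu1]_y \int[mu1]_x F (x, y).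
Proof. by move=> L; rewrite (Int2_xy L); have [_ _ _ _ ->] := @RFubini _ _ _ _ R mu1 mu1 F L. Qed.

(** The measurable sets of the plane are those of the product sigma-algebra, so an open set has to
    be written as a countable union of rational rectangles. *)
Lemma open_pl_measurable (U : set (R * R)) : open U -> measurable (U : set pl).
Proof.
move=> oU; pose box (q : (rat * rat) * (rat * rat)) : set pl :=
  `]ratr q.1.1, ratr q.1.2[%classic `*` `]ratr q.2.1, ratr q.2.2[%classic.
have mbox q : measurable (box q) by apply: measurableX; exact: measurable_itv.
have -> : (U : set pl) = \bigcup_q (if `[< box q `<=` U >] then box q else set0).
  apply/seteqP; split => [x Ux|x [q _]]; last by case: ifPn => // /asboolP; exact.
  have /nbhs_ballP[e e0 he] := open_nbhs_nbhs (conj oU Ux).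
  have gap (s : R) : exists a b : rat, [/\ s - e < ratr a :> R, ratr a < s :> R, s < ratr b :> R & ratr b < s + e :> R].
    have h1 : s - e < s by rewrite ltrBlDr ltrDl.
    have h2 : s < s + e by rewrite ltrDl.
    have [a] := rat_in_itvoo h1; rewrite in_itv /= => /andP[? ?].
    by have [b] := rat_in_itvoo h2; rewrite in_itv /= => /andP[? ?]; exists a, b.
  have [a [b [a1 a2 b1 b2]]] := gap x.1; have [c [d [c1 c2 d1 d2]]] := gap x.2.
  exists ((a, b), (c, d)) => //; rewrite ifT.
    by rewrite /box /=; split; rewrite /= in_itv /=; apply/andP.
  apply/asboolP => z [/=]; rewrite !in_itv /= => /andP[z1 z2] /andP[z3 z4]; apply: he; split.
    by rewrite /ball /= distrC ltr_distl; apply/andP; split; lra.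
  by rewrite /ball /= distrC ltr_distl; apply/andP; split; lra.
by apply: countable_bigcupT_measurable => // q; case: ifP.
Qed.

Lemma continuous_pl_measurable (f : R * R -> R) : continuous f ->
  measurable_fun setT (f : pl -> R).
Proof.
move=> /continuousP cf; apply: (measurability _ (RGenOpens.measurableE R)).
move=> _ [_ [a [b ->] <-]]; rewrite setTI; apply: open_pl_measurable.
exact/cf/interval_open.
Qed.

Lemma csupp_bounded (f : R * R -> R) (K : set (R * R)) : compact K -> continuous f ->
  (forall x, ~ K x -> f x = 0) ->
  exists C B, forall x, `|f x| <= C * (ind (- B) B x.1 * ind (- B) B x.2).
Proof.
move=> cK cf f0.
have /compact_bounded[M1 [_ hM]] := cK.
have cfK : compact (f @` K) by apply: continuous_compact => //; exact: continuous_subspaceT.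
have /compact_bounded[M2 [_ hC]] := cfK.
pose B := `|M1| + 1; pose C := `|M2| + 1.
have B1 : M1 < B by rewrite (le_lt_trans (ler_norm _))// ltrDl.
have C1 : M2 < C by rewrite (le_lt_trans (ler_norm _))// ltrDl.
exists C, (B + 1) => x; have [Kx|Kx] := pselect (K x); last first.
  by rewrite f0// normr0 !mulr_ge0 ?ind_ge0// addr_ge0.
have h := hM B B1 x Kx; have hf := hC C C1 (f x) (ex_intro2 _ _ x Kx erefl).
have co1 : `|x.1| <= B by apply: le_trans h; rewrite /= le_max lexx.
have co2 : `|x.2| <= B by apply: le_trans h; rewrite /= le_max lexx orbT.
move: co1 co2; rewrite !ler_norml => /andP[a1 a2] /andP[b1 b2].
rewrite !indE.
have -> : (- (B + 1) < x.1) && (x.1 <= B + 1) by apply/andP; split; lra.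
have -> : (- (B + 1) < x.2) && (x.2 <= B + 1) by apply/andP; split; lra.
by rewrite /= !mulr1 -ler_norml.
Qed.

Lemma sq_csupp (f : R * R -> R) (K : set (R * R)) : compact K -> continuous f ->
  (forall x, ~ K x -> f x = 0) -> sq mu2 (f : pl -> R).
Proof.
move=> cK cf f0; have [C [B h]] := csupp_bounded cK cf f0.
have hq := sqZ C (sq_tens (sq_ind (- B) B) (sq_ind (- B) B)).
by apply: sq_le hq => [|x]; [exact: continuous_pl_measurable|exact: h].
Qed.

Definition ei i : R * R := if i then e1 R else e2 R.
Definition pt i s r : R * R := if i then (s, r) else (r, s).

Lemma dv_path (f : R * R -> R) i s r : derivable f (pt i s r) (ei i) ->
  is_derive s 1 (fun s => f (pt i s r)) ('D_(ei i) f (pt i s r)).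
Proof.
move=> df; have E : (fun h : R => h^-1 *: ((f \o shift (pt i s r)) (h *: ei i) - f (pt i s r))) =
    (fun h : R => h^-1 *: (((fun s => f (pt i s r)) \o shift s) (h *: 1) - f (pt i s r))).
  apply/funext => h; congr (_ *: (f _ - _)); rewrite /pt /ei; case: i {df} => /=.
    by rewrite /e1 /=; congr (_, _); rewrite /= ?scaler0 ?add0r.
  by rewrite /e2 /=; congr (_, _); rewrite /= ?scaler0 ?add0r.
split; first by move: df; rewrite /derivable E.
by rewrite /derive E.
Qed.

Lemma continuous_path (f : R * R -> R) i r : continuous f -> continuous (fun s => f (pt i s r)).
Proof.
move=> cf s; apply: (@continuous_comp _ _ _ (fun s => pt i s r) f); last exact: cf.
move=> A /nbhs_ballP[e e0 he]; apply/nbhs_ballP; exists e => // z hz; apply: he.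
by case: i; split => //=; exact: ballxx.
Qed.

Lemma ibp_csupp (p p' q : R -> R) : (forall s, is_derive s 1 p (p' s)) -> continuous p' ->
  (forall k, Sm k q) -> csupp q ->
  \int[mu1]_s (p s * derive1 q s) = - \int[mu1]_s (p' s * q s).
Proof.
move=> dp cp' sq_ [B hB].
have cp : continuous p by move=> s; case: (dp s) => d _; exact/differentiable_continuous/derivable1_diffP.
have cq : continuous q by exact: (Sm_cont (sq_ 0%N)).
have cq' : continuous (derive1 q) by exact: (Sm_cont (Sm_derive sq_ 0%N)).
pose b := `|B| + 1; have b0 : 0 < b by rewrite ltr_wpDl.
have Bb : B < b by rewrite (le_lt_trans (ler_norm _))// ltrDl.
have q0 s : b <= `|s| -> q s = 0 by move=> h; apply: hB; exact: lt_le_trans h.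
have q'0 s : b <= `|s| -> derive1 q s = 0.
  move=> h; have := Sm_is_derive (sq_ 1%N) s => dq.
  have h1 : is_derive s 1 q 0.
    have n0 : (\near s, (fun=> 0 : R) s = q s).
      apply/nbhs_ballP; exists (`|s| - B); first by rewrite /= subr_gt0 (lt_le_trans Bb).
      move=> z; rewrite /ball /= => hz; rewrite hB//.
      by have := ler_normD z (s - z); rewrite (_ : z + (s - z) = s); [lra|ring].
    exact: near_eq_is_derive n0 (dv_cst 0 s).
  by have := @derive_val _ _ _ _ _ _ _ h1; rewrite derive1E.
pose f s := p' s * q s + p s * derive1 q s.
have df s : is_derive s 1 (fun s => p s * q s) (f s) by exact: (dvM (dp s) (Sm_is_derive (sq_ 1%N) s)).
have cf : continuous f by move=> s; apply: cvgD; apply: cvgM; [exact: cp'|exact: cq|exact: cp|exact: cq'].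
have supp (h : R -> R) : continuous h -> (forall s, b <= `|s| -> h s = 0) -> L1 mu1 h.
  move=> ch h0; have cK : compact (h @` `[- b, b]%classic).
    by apply: continuous_compact; [exact: continuous_subspaceT|exact: segment_compact].
  have /compact_bounded[M [_ hM]] := cK.
  have hC := hM (`|M| + 1) _; have M1 : M < `|M| + 1 by rewrite (le_lt_trans (ler_norm _))// ltrDl.
  have Li : L1 mu1 (ind (- (b + 1)) b).
    by apply: L1_eq (sq_ind (- (b + 1)) b).2 => s; rewrite indE; case: (_ && _); rewrite ?expr1n ?expr0n.
  apply: L1_le (L1Z (`|M| + 1) Li) => [|s]; first exact: continuous_measurable_fun.
  have [hs|hs] := leP b `|s|; first by rewrite h0// normr0 mulr_ge0 ?ind_ge0// addr_ge0.
  have /andP[s1 s2] : - b < s < b by rewrite -ltr_norml.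
  have -> : ind (- (b + 1)) b s = 1.
    by rewrite indE (ltW s2) andbT (_ : - (b + 1) < s)//; apply: le_lt_trans s1; lra.
  rewrite mulr1; apply: (hC M1); exists s => //; rewrite /= in_itv /=.
  by apply/andP; split; exact: ltW.
have L1a : L1 mu1 (fun s => p' s * q s).
  by apply: supp => [s|s /q0 ->]; [apply: cvgM; [exact: cp'|exact: cq]|rewrite mulr0].
have L1b : L1 mu1 (fun s => p s * derive1 q s).
  by apply: supp => [s|s /q'0 ->]; [apply: cvgM; [exact: cp|exact: cq']|rewrite mulr0].
suff : \int[mu1]_s f s = 0.
  by rewrite /f (IntD L1a L1b); move: (Rintegral _ _ _) (Rintegral _ _ _) => u v; lra.
have bb : - b < b by lra.
have ftc := @FTC2 R _ f (- b) b bb (fun t _ => df t) (fun t _ => cf t).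
have qb : q b = 0 by apply: q0; rewrite ger0_norm// ltW.
have qNb : q (- b) = 0 by apply: q0; rewrite normrN ger0_norm// ltW.
rewrite /Rintegral -[RHS]/(fine (0 : R)%:E) (_ : 0 = p b * q b - p (- b) * q (- b)); last first.
  by rewrite qb qNb !mulr0 subrr.
rewrite -ftc; congr fine; rewrite [RHS]integral_mkcond; apply: eq_integral => s _.
rewrite patchE mem_setE in_itv /=; case: ifPn => // hs.
rewrite /f q0 ?q'0 ?mulr0 ?addr0//; rewrite leNgt; apply: contra hs; rewrite ltr_norml => /andP[h1 h2];
  by rewrite !ltW.
Qed.

(** It makes a general test function an instance of the real theory, so that identities proved for
    tensor weak derivatives yield the full [weak_partial] in [H1_cG]. *)
Lemma wd_test i (psi : R * R -> R) : test_function psi ->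
  [/\ sq mu2 (psi : pl -> R), sq mu2 ('D_(ei i) psi : pl -> R) &
      wd i (psi : pl -> R) ('D_(ei i) psi : pl -> R)].
Proof.
move=> [hk cK]; set K := closure _ in cK.
have cpsi : continuous psi by have [] := hk 0%N.
have [_ [d1 d2 [cd1 _] [cd2 _]]] := hk 1%N.
have dpsi x : derivable psi x (ei i) by case: (i).
have cd : continuous ('D_(ei i) psi) by rewrite /ei; case: i {dpsi}; [exact: cd1|exact: cd2].
have psi0 x : ~ K x -> psi x = 0.
  move=> Kx; apply/eqP; apply: contrapT => /negP px; apply: Kx; exact: subset_closure.
have dpsi0 x : ~ K x -> 'D_(ei i) psi x = 0.
  move=> Kx; have oK : open (~` K) by rewrite openC; exact: closed_closure.
  have n0 : (\near x, (cst 0 : R * R -> R) x = psi x).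
    by apply: filterS (open_nbhs_nbhs (conj oK Kx)) => z hz; rewrite psi0.
  have h1 := near_eq_is_derive n0 (is_derive_cst 0 x (ei i)).
  exact: (@derive_val _ _ _ _ _ _ _ h1).
have q1 := sq_csupp cK cpsi psi0; have q2 := sq_csupp cK cd dpsi0.
split=> //.
have sqS (a : R -> R) : (forall k, Sm k a) -> csupp a -> sq mu1 a.
  move=> sa [B hB]; have cKa : compact (a @` `[- `|B|, `|B|]%classic).
    by apply: continuous_compact; [apply: continuous_subspaceT; exact: (Sm_cont (sa 0%N))|exact: segment_compact].
  have /compact_bounded[M [_ hM]] := cKa.
  have M1 : M < `|M| + 1 by rewrite (le_lt_trans (ler_norm _))// ltrDl.
  have B0 := normr_ge0 B; have hBB := ler_norm B.
  apply: sq_le (sqZ (`|M| + 1) (sq_ind (- (`|B| + 1)) `|B|)) => [|s]; first exact: measurable_Sm.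
  have [hs|hs] := ltP `|B| `|s|.
    by rewrite hB ?(le_lt_trans hBB)// normr0 mulr_ge0 ?ind_ge0// addr_ge0.
  move: (hs); rewrite ler_norml => /andP[s1 s2].
  rewrite indE (_ : - (`|B| + 1) < s) ?s2 /=; last by lra.
  by rewrite mulr1; apply: (hM _ M1); exists s => //; rewrite /= in_itv /= s1 s2.
have ibp r c (q : R -> R) : (forall k, Sm k q) -> csupp q ->
    \int[mu1]_s (c * psi (pt i s r) * derive1 q s) = - \int[mu1]_s (c * 'D_(ei i) psi (pt i s r) * q s).
  move=> sq_ cq; apply: (ibp_csupp (p := fun s => c * psi (pt i s r))) => // s.
    exact: (dvZ c (dv_path (dpsi (pt i s r)))).
  have h := @continuous_path _ i r cd.
  exact: (continuousM (@cst_continuous _ _ c s) (h s)).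
case: i dpsi cd dpsi0 q2 ibp => dpsi cd dpsi0 q2 ibp a b sa sb ca cb.
- have La := sq_mul q1 (sq_tens (sqS _ (Sm_derive sa) (csupp_derive sa ca)) (sqS _ sb cb)).
  have Lb := sq_mul q2 (sq_tens (sqS _ sa ca) (sqS _ sb cb)).
  apply: (etrans (Int2_yx La)); apply/esym; rewrite [X in - X](Int2_yx Lb) -RintN.
  apply: eq_Rintegral => y _; have h := ibp y (b y) a sa ca.
  transitivity (- \int[mu1]_s (b y * 'D_(ei true) psi (pt true s y) * a s)).
    by congr (- _); apply: eq_Rintegral => s _; rewrite /tens /=; ring.
  by rewrite -h; apply: eq_Rintegral => s _; rewrite /tens /=; ring.
- have La := sq_mul q1 (sq_tens (sqS _ sa ca) (sqS _ (Sm_derive sb) (csupp_derive sb cb))).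
  have Lb := sq_mul q2 (sq_tens (sqS _ sa ca) (sqS _ sb cb)).
  apply: (etrans (Int2_xy La)); apply/esym; rewrite [X in - X](Int2_xy Lb) -RintN.
  apply: eq_Rintegral => y _; have h := ibp y (a y) b sb cb.
  transitivity (- \int[mu1]_s (a y * 'D_(ei false) psi (pt false s y) * b s)).
    by congr (- _); apply: eq_Rintegral => s _; rewrite /tens /=; ring.
  by rewrite -h; apply: eq_Rintegral => s _; rewrite /tens /=; ring.
Qed.

(** A derivative may fall on either factor of a convolution: tested on heat kernels, both sides
    become time integrals that [wd_gauss] equates. *)
Lemma cG_ck i l (f g : pl -> R) : 0 < l -> sq mu2 f -> sq mu2 g -> wd i f g ->
  {ae mu2, forall x, cG l g x = ck i l f x}.
Proof.
move=> l0 sf sg w; have s1 := sq_cG l0 sg; have s2 := sq_ck i l0 sf.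
suff h : {ae mu2, forall x, cG l g x - ck i l f x = 0}.
  by apply: filterS h => x /eqP; rewrite subr_eq0 => /eqP.
apply: heat_inj; first exact: sqB.
move=> e y e0; have sh := sq_heat_sub y e0.
have -> : \int[mu2]_x ((cG l g x - ck i l f x) * heat e (x - y : R * R)) =
    \int[mu2]_x (cG l g x * heat e (x - y : R * R)) - \int[mu2]_x (ck i l f x * heat e (x - y : R * R)).
  rewrite -(IntB (sq_mul s1 sh) (sq_mul s2 sh)); apply: eq_Rintegral => x _; ring.
rewrite -[X in X - _](cG_pair l0 sg sh) -[X in _ - X]opprK -[X in _ - - X](ck_pair i l0 sf sh) opprK.
have Ea : \int[mu2]_x (f x * ck i l (fun w => heat e (w - y : R * R)) x) =
    \int[mu2]_x (f x * Nt l e (dheat i) (x - y : R * R)).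
  by apply: eq_Rintegral => x _; rewrite ckE; congr (_ * _); exact: conv_kG_heat.
have Ec : \int[mu2]_x (g x * cG l (fun w => heat e (w - y : R * R)) x) =
    \int[mu2]_x (g x * Nt l e (heat (R:=R)) (x - y : R * R)).
  by apply: eq_Rintegral => x _; rewrite cGE; congr (_ * _); exact: conv_Green_heat.
have cg : 0 <= 8 / Num.sqrt e by rewrite divr_ge0 ?sqrtr_ge0.
have hg t x : e <= t -> `|dheat i t x| <= 8 / Num.sqrt e * heat (2 * t) x.
  move=> et; have t0 := lt_le_trans e0 et; apply: le_trans (dheat_bound i x t0) _.
  by rewrite ler_wpM2r ?heat_ge0// ler_wpM2l// lef_pV2 ?posrE ?sqrtr_gt0//; exact: ler_wsqrtr.
have mg : measurable_fun setT (fun z : measurableTypeR R * pl => dheat i z.1 z.2) by exact: measurable_dheat.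
have hG t x : e <= t -> `|heat t x| <= 4 * heat (2 * t) x.
  by move=> et; rewrite ger0_norm ?heat_ge0// heat_le2//; exact: lt_le_trans et.
have mG : measurable_fun setT (fun z : measurableTypeR R * pl => heat z.1 z.2) by exact: measurable_heat.
have [_ La Ia] := heat_time l0 e0 cg mg hg y sf.
have [_ Lc Ic] := heat_time l0 e0 (ler0n _ 4) mG hG y sg.
rewrite [X in X + _]Ec [X in X + _]Ic [X in _ + X]Ea [X in _ + X]Ia -(IntD Lc La) /Rintegral integral0_eq// => t _.
congr EFin; rewrite -mulrDr; have [t0|t0] := ltP 0 t; last by rewrite /ew /pos ltNge t0 /= mul0r.
have te : 0 < t + e by exact: addr_gt0.
have [_ h] := wd_gauss y sf sg w te.
by rewrite [X in _ * (_ + X)]h subrr mulr0.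
Qed.

(** For a test function [f] this says that [ck i l s] is the weak derivative of [cG l s]. *)
Lemma cG_grad i l (s f g : pl -> R) : 0 < l -> sq mu2 s -> sq mu2 f -> sq mu2 g -> wd i f g ->
  \int[mu2]_x (cG l s x * g x) = - \int[mu2]_x (ck i l s x * f x).
Proof.
move=> l0 ss sf sg w; rewrite -(cG_pair l0 ss sg) -[RHS](ck_pair i l0 ss sf).
apply: Int_ae.
- exact: L1_meas (sq_mul ss (sq_cG l0 sg)).
- exact: L1_meas (sq_mul ss (sq_ck i l0 sf)).
- by apply: filterS (cG_ck l0 sf sg w) => x ->.
Qed.

Lemma wd_unique i (f g g' : pl -> R) : sq mu2 f -> sq mu2 g -> sq mu2 g' ->
  wd i f g -> wd i f g' -> {ae mu2, forall x, g x = g' x}.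
Proof.
move=> sf sg sg' w w'.
suff h : {ae mu2, forall x, g x - g' x = 0}.
  by apply: filterS h => x /eqP; rewrite subr_eq0 => /eqP.
apply: heat_inj; first exact: sqB.
move=> e y e0; have sh := sq_heat_sub y e0.
have [_ h1] := wd_gauss y sf sg w e0; have [_ h2] := wd_gauss y sf sg' w' e0.
have -> : \int[mu2]_x ((g x - g' x) * heat e (x - y : R * R)) =
    \int[mu2]_x (g x * heat e (x - y : R * R)) - \int[mu2]_x (g' x * heat e (x - y : R * R)).
  rewrite -(IntB (sq_mul sg sh) (sq_mul sg' sh)); apply: eq_Rintegral => x _; ring.
move: h1 h2; move: (Rintegral _ _ _) (Rintegral _ _ _) (Rintegral _ _ _) => u v w0; lra.
Qed.

End TestFunctions.

(** * The energy of real functions, uniqueness of the charge, change of frequency *)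

Section RealForm.
Variable R : realType.
Notation mu1 := (@lebesgue_measure R).
Notation mu2 := (@sleb2 R).
Notation pl := (measurableTypeR R * measurableTypeR R)%type.
Implicit Types (l m q c : R) (i : bool) (f s u v : pl -> R) (g h : bool -> pl -> R).

Definition dtens i (a b : R -> R) : R * R -> R :=
  if i then tens (derive1 a) b else tens a (derive1 b).

Lemma wdE i f (g : pl -> R) : wd i f g <-> forall a b, (forall k, Sm k a) -> (forall k, Sm k b) ->
  csupp a -> csupp b ->
  \int[mu2]_x (f x * dtens i a b x) = - \int[mu2]_x (g x * tens a b x).
Proof. by rewrite /wd /dtens; case: i. Qed.

Lemma sq_test i (a b : R -> R) : (forall k, Sm k a) -> (forall k, Sm k b) -> csupp a -> csupp b ->
  [/\ sq mu2 (tens a b : pl -> R), sq mu2 (dtens i a b : pl -> R) &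
      wd i (tens a b : pl -> R) (dtens i a b : pl -> R)].
Proof.
move=> sa sb ca cb; have e : 'D_(ei R i) (tens a b) = dtens i a b.
  apply/funext => x; rewrite /ei /dtens; case: i.
    by have [_ ->] := derive_tens1 b (proj1 (proj2 (sa 1%N)) x.1).
  by have [_ ->] := derive_tens2 a (proj1 (proj2 (sb 1%N)) x.2).
by have := wd_test i (test_tens sa sb ca cb); rewrite e.
Qed.

Definition rH1 (f : pl -> R) g := sq mu2 f /\ forall i, sq mu2 (g i) /\ wd i f (g i).

Lemma rH1_lin c f g u h : rH1 f g -> rH1 u h ->
  rH1 (fun x => f x + c * u x) (fun i x => g i x + c * h i x).
Proof.
move=> [sf wf] [su wu]; split; first by apply: sqD => //; exact: sqZ.
move=> i; have [sg wg] := wf i; have [sh wh] := wu i; split; first by apply: sqD => //; exact: sqZ.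
apply/wdE => a b sa sb ca cb; have [st sd _] := sq_test i sa sb ca cb.
have := (wdE i _ _).1 wg a b sa sb ca cb; have := (wdE i _ _).1 wh a b sa sb ca cb.
have -> : \int[mu2]_x ((f x + c * u x) * dtens i a b x) =
    \int[mu2]_x (f x * dtens i a b x) + c * \int[mu2]_x (u x * dtens i a b x).
  rewrite -(IntZ c (sq_mul su sd)) -(IntD (sq_mul sf sd) (L1Z c (sq_mul su sd))).
  by apply: eq_Rintegral => x _; ring.
have -> : \int[mu2]_x ((g i x + c * h i x) * tens a b x) =
    \int[mu2]_x (g i x * tens a b x) + c * \int[mu2]_x (h i x * tens a b x).
  rewrite -(IntZ c (sq_mul sh st)) -(IntD (sq_mul sg st) (L1Z c (sq_mul sh st))).
  by apply: eq_Rintegral => x _; ring.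
by move=> -> ->; move: (Rintegral _ _ _) (Rintegral _ _ _) => a0 b0; ring.
Qed.

Lemma rH1_ae f g u : measurable_fun setT u -> {ae mu2, forall x, f x = u x} -> rH1 f g -> rH1 u g.
Proof.
move=> mu fu [sf wf]; have su := sq_ae mu fu sf; split => // i; have [sg wg] := wf i; split => //.
apply/wdE => a b sa sb ca cb; have [st sd _] := sq_test i sa sb ca cb.
rewrite -((wdE i _ _).1 wg a b sa sb ca cb); apply: Int_ae.
- exact: L1_meas (sq_mul su sd).
- exact: L1_meas (sq_mul sf sd).
- by apply: filterS fu => x ->.
Qed.

Lemma rH1_cG l s : 0 < l -> sq mu2 s -> rH1 (cG l s) (fun i => ck i l s).
Proof.
move=> l0 ss; split; first exact: sq_cG.
move=> i; split; first exact: sq_ck.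
by apply/wdE => a b sa sb ca cb; have [st sd w] := sq_test i sa sb ca cb; exact: cG_grad.
Qed.

Definition En l f g := \int[mu2]_x (g true x ^+ 2) + \int[mu2]_x (g false x ^+ 2) + l * \int[mu2]_x (f x ^+ 2).

Lemma En_ge0 l f g : 0 < l -> 0 <= En l f g.
Proof.
by move=> l0; rewrite !addr_ge0 ?mulr_ge0 ?Int_ge0 ?ltW// => x; exact: sqr_ge0.
Qed.

Lemma Int_sqD c f u : sq mu2 f -> sq mu2 u ->
  \int[mu2]_x ((f x + c * u x) ^+ 2) = \int[mu2]_x (f x ^+ 2) + 2 * c * \int[mu2]_x (f x * u x) +
    c ^+ 2 * \int[mu2]_x (u x ^+ 2).
Proof.
move=> sf su; have L := sq_mul sf su.
rewrite -(IntZ (2 * c) L) -(IntZ (c ^+ 2) su.2) -(IntD sf.2 (L1Z _ L)) -(IntD (L1D sf.2 (L1Z _ L)) (L1Z _ su.2)).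
by apply: eq_Rintegral => x _; ring.
Qed.

Lemma En_cG l s : 0 < l -> sq mu2 s -> En l (cG l s) (fun i => ck i l s) = \int[mu2]_x (s x * cG l s x).
Proof.
move=> l0 ss; have [s1 w] := rH1_cG l0 ss.
have := energy_conv l0 s1 (fun i => (w i).1) (fun i => (w i).2) ss.
rewrite /En => e; transitivity (\int[mu2]_x (cG l s x * s x)); first exact: e.
by apply: eq_Rintegral => x _; exact: mulrC.
Qed.

(** The cross terms collapse to [\int f s] by [energy_conv]; every completion of the square below
    rests on this expansion. *)
Lemma En_add_cG l c f g s : 0 < l -> rH1 f g -> sq mu2 s ->
  En l (fun x => f x + c * cG l s x) (fun i x => g i x + c * ck i l s x) =
  En l f g + 2 * c * \int[mu2]_x (f x * s x) + c ^+ 2 * \int[mu2]_x (s x * cG l s x).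
Proof.
move=> l0 [sf w] ss; have s1 := sq_cG l0 ss; have sk i := sq_ck i l0 ss.
rewrite -(En_cG l0 ss) -(energy_conv l0 sf (fun i => (w i).1) (fun i => (w i).2) ss) /En.
rewrite [X in X + _ + _]Int_sqD//; last exact: (w true).1.
rewrite [X in _ + X + _]Int_sqD//; last exact: (w false).1.
rewrite [X in _ + _ + _ * X]Int_sqD//.
have alg (a1 b1 c1 a2 b2 c2 a3 b3 c3 : R) :
    a1 + 2 * c * b1 + c ^+ 2 * c1 + (a2 + 2 * c * b2 + c ^+ 2 * c2) + l * (a3 + 2 * c * b3 + c ^+ 2 * c3) =
    a1 + a2 + l * a3 + 2 * c * (b1 + b2 + l * b3) + c ^+ 2 * (c1 + c2 + l * c3) by ring.
exact: alg.
Qed.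

Lemma En_CS l f g s : 0 < l -> rH1 f g -> sq mu2 s ->
  (\int[mu2]_x (f x * s x)) ^+ 2 <= (\int[mu2]_x (s x * cG l s x)) * En l f g.
Proof.
move=> l0 H ss; apply: quad_discr.
  by rewrite -(En_cG l0 ss); exact: En_ge0.
move=> t; have := En_add_cG (- t) l0 H ss; have := En_ge0 (fun x => f x + - t * cG l s x) (fun i x => g i x + - t * ck i l s x) l0.
move=> h e; move: h; rewrite e; move: (Rintegral _ _ _) (Rintegral _ _ _) (En l f g) => a b c.
by congr (_ <= _); ring.
Qed.

Lemma cG_comm l m x : 0 < l -> 0 < m -> cG l (Gr m) x = cG m (Gr l) x.
Proof.
move=> l0 m0; have mk : measurable_fun setT (fun y : pl => Gr m (x - y : R * R) * Gr l y).
  apply: measurable_funM; first by apply: measurable_Green => //; exact: (mpres_subl x).1.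
  exact: measurable_Green.
rewrite !cGE /conv -[RHS](@mpres_Int _ pl R mu2 _ _ (mpres_subl x) mk).
by apply: eq_Rintegral => y _; rewrite subKr mulrC.
Qed.

Lemma green_diff l m : 0 < l -> 0 < m ->
  {ae mu2, forall x : pl, Gr l x - Gr m x = (m - l) * cG l (Gr m) x}.
Proof.
move=> l0 m0; apply: filterS (ae_neq0 R) => x x0.
have [lm|ml|->] := ltgtP l m; last by rewrite !subrr mul0r.
  have e : cG l (Gr m) x = (Gr l x - Gr m x) / (m - l).
    by rewrite cGE /conv /Rintegral (Green_resolvent l0 lm x0).
  have lm0 : m - l != 0 by rewrite subr_eq0 gt_eqF.
  by rewrite e mulrC divfK.
have e : cG l (Gr m) x = (Gr m x - Gr l x) / (l - m).
  by rewrite cG_comm// cGE /conv /Rintegral (Green_resolvent m0 ml x0).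
have lm0 : l - m != 0 by rewrite subr_eq0 gt_eqF.
rewrite e; move: (Gr l x) (Gr m x) => A B; by field.
Qed.

Lemma theta_sub l m : 0 < l -> 0 < m -> theta m - theta l = ln (m / l) / (4 * pi).
Proof.
have p0 : pi != 0 :> R by rewrite gt_eqF ?pi_gt0.
have lnsq (y : R) : 0 < y -> ln (Num.sqrt y / 2) = ln y / 2 - ln 2.
  move=> y0; have sy : 0 < Num.sqrt y by rewrite sqrtr_gt0.
  rewrite ln_div ?posrE// -[in ln y](sqr_sqrtr (ltW y0)) lnXn ?posrE// -mulr_natr.
  by field.
move=> l0 m0; rewrite /theta !lnsq// ln_div ?posrE//.
by move: p0; move: (ln _) (ln _) (ln _) (euler_gamma R) (pi : R) => A B C D q q0; field.
Qed.

Lemma Green_ip' l m : 0 < l -> 0 < m ->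
  (m - l) * \int[mu2]_x (Gr m x * Gr l x) = theta m - theta l.
Proof.
have key a b : 0 < a -> a < b -> (b - a) * \int[mu2]_x (Gr a x * Gr b x) = theta b - theta a.
  move=> a0 ab; have b0 := lt_trans a0 ab; rewrite /Rintegral Green_ip//= theta_sub//.
  have p0 : pi != 0 :> R by rewrite gt_eqF ?pi_gt0.
  by move: p0; move: (ln _) (pi : R) => A q q0; field; rewrite q0 subr_eq0 gt_eqF.
move=> l0 m0; have [lm|ml|->] := ltgtP l m; last by rewrite !subrr mul0r.
  rewrite -(key l m l0 lm); congr (_ * _); apply: eq_Rintegral => x _; exact: mulrC.
by rewrite -[RHS]opprB -(key m l m0 ml) -mulNr opprB.
Qed.

(** The Green function is not in H^1: pairing [c G_l] with [G_m] in [En_CS] bounds [c^2 ln (m / l)]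
    uniformly in [m]. The uniqueness of the charge follows. *)
Lemma charge0 l c f g : 0 < l -> rH1 f g -> {ae mu2, forall x, f x = c * Gr l x} -> c = 0.
Proof.
move=> l0 H fc; pose C := En l f g; have C0 : 0 <= C by exact: En_ge0.
have key m : l < m -> c ^+ 2 * ln (m / l) <= 4 * pi * C.
  move=> lm; have m0 := lt_trans l0 lm; have sm := sq_Green m0; have sl := sq_Green l0.
  have h := En_CS l0 H sm; pose I := \int[mu2]_x (Gr l x * Gr m x).
  have e1 : \int[mu2]_x (f x * Gr m x) = c * I.
    rewrite -(IntZ c (sq_mul sl sm)); apply: Int_ae.
    - exact: L1_meas (sq_mul H.1 sm).
    - exact: L1_meas (L1Z c (sq_mul sl sm)).
    - by apply: filterS fc => x ->; rewrite mulrA.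
  have IE : I = ln (m / l) / (4 * pi * (m - l)) by rewrite /I /Rintegral Green_ip.
  have e2 : (m - l) * \int[mu2]_x (Gr m x * cG l (Gr m) x) <= I.
    have sc := sq_cG l0 sm; rewrite -(IntZ (m - l) (sq_mul sm sc)) /I.
    have -> : \int[mu2]_x ((m - l) * (Gr m x * cG l (Gr m) x)) =
        \int[mu2]_x (Gr l x * Gr m x - Gr m x * Gr m x).
      apply: Int_ae.
      - exact: L1_meas (L1Z _ (sq_mul sm sc)).
      - exact: L1_meas (L1B (sq_mul sl sm) (sq_mul sm sm)).
      - by apply: filterS (green_diff l0 m0) => x e; rewrite mulrCA -e; ring.
    apply: Int_le; [exact: L1B (sq_mul sl sm) (sq_mul sm sm)|exact: sq_mul|].
    by move=> x; rewrite lerBlDr lerDl mulr_ge0 ?Green_ge0.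
  have ml0 : 0 < m - l by rewrite subr_gt0.
  have ln0 : 0 < ln (m / l) by rewrite ln_gt0// ltr_pdivlMr ?mul1r.
  have I0 : 0 < I by rewrite IE divr_gt0 ?mulr_gt0 ?pi_gt0.
  rewrite e1 in h; move: h e2; rewrite -/C; move: (\int[mu2]_x (Gr m x * _)) => K h e2.
  have h1 : (m - l) * (c ^+ 2 * I ^+ 2) <= I * C.
    have h' : c ^+ 2 * I ^+ 2 <= K * C by rewrite -exprMn.
    by have := ler_wpM2r C0 e2; rewrite -mulrA; apply: le_trans; rewrite (ler_wpM2l (ltW ml0)).
  have h2 : (m - l) * (c ^+ 2 * I) <= C.
    rewrite -(ler_pM2l I0); apply: le_trans h1; rewrite le_eqVlt; apply/orP; left; apply/eqP; ring.
  have e3 : 4 * pi * ((m - l) * (c ^+ 2 * I)) = c ^+ 2 * ln (m / l).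
    rewrite IE; have p0 := @pi_gt0 R; move: p0 (ln _); move: (pi : R) => p p0 L.
    by field; rewrite !gt_eqF.
  by rewrite -e3 ler_wpM2l// mulr_ge0 ?pi_ge0.
apply/eqP; rewrite -sqrf_eq0; apply/eqP/le_anti; rewrite sqr_ge0 andbT leNgt; apply/negP => c0.
(* At [m = l * expR N] the left-hand side of [key] equals [4 * pi * C + c ^+ 2], above the bound. *)
pose N := 4 * pi * C / c ^+ 2 + 1.
have N0 : 0 < N by rewrite ltr_wpDl// divr_ge0 ?sqr_ge0 ?mulr_ge0 ?pi_ge0.
have := key (l * expR N); rewrite ltr_pMr// expR_gt1 N0 => /(_ isT).
rewrite (mulrC l) mulfK ?gt_eqF// expRK /N mulrDr mulr1 mulrC divfK ?gt_eqF//.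
by lra.
Qed.

Definition rform (a l q : R) v g := En l (fun x : pl => v x - q * Gr l x) g - l * \int[mu2]_x (v x ^+ 2)
  + (a + theta l) * q ^+ 2.

Definition rdec l q v g := rH1 (fun x : pl => v x - q * Gr l x) g.

Lemma rdec_sq l q v g : 0 < l -> rdec l q v g -> sq mu2 v.
Proof.
move=> l0 [h _]; have := sqD h (sqZ q (sq_Green l0)).
by under eq_fun do rewrite subrK.
Qed.

(** By the resolvent identity the regular part changes by [q (m - l) G_l * G_m], which lies in H^1.
    The terms this adds to the energy cancel against the increment of [theta], computed by
    [Green_ip']. *)
Lemma rdec_change a l m q v g : 0 < l -> 0 < m -> rdec l q v g ->
  exists h, rdec m q v h /\ rform a m q v h = rform a l q v g.
Proof.
move=> l0 m0 H; have sv := rdec_sq l0 H; have sl := sq_Green l0; have sm := sq_Green m0.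
pose c := q * (m - l); pose f x := v x - q * Gr l x; pose f' x := v x - q * Gr m x.
pose h := fun i x => g i x + c * ck i l (Gr m) x.
have sf : sq mu2 f := H.1; have sf' : sq mu2 f' by apply: sqB => //; exact: sqZ.
have sc := sq_cG l0 sm.
have ae : {ae mu2, forall x, f x + c * cG l (Gr m) x = f' x}.
  by apply: filterS (green_diff l0 m0) => x e; rewrite /c -mulrA -e /f /f'; ring.
have H' : rdec m q v h.
  exact: (rH1_ae sf'.1 ae (rH1_lin c H (rH1_cG l0 sm))).
exists h; split => //; rewrite /rform -/f -/f'.
have e1 := En_add_cG c l0 H sm; rewrite -/f -/h in e1.
have e2 : En l (fun x => f x + c * cG l (Gr m) x) h = En l f' h.
  rewrite /En; congr (_ + _ + _ * _); apply: Int_ae.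
  - by apply: measurable_funX; apply: measurable_funD; [exact: sf.1|apply: measurable_funM => //; exact: sc.1].
  - by apply: measurable_funX; exact: sf'.1.
  - by apply: filterS ae => x ->.
have e3 : En m f' h = En l f' h + (m - l) * \int[mu2]_x (f' x ^+ 2).
  have al (A B C : R) : A + B + m * C = A + B + l * C + (m - l) * C by ring.
  exact: al.
have e4 : \int[mu2]_x (v x ^+ 2) = \int[mu2]_x (f' x ^+ 2) + 2 * q * \int[mu2]_x (f' x * Gr m x) +
    q ^+ 2 * \int[mu2]_x (Gr m x ^+ 2).
  rewrite -Int_sqD//; apply: eq_Rintegral => x _; rewrite /f'; congr (_ ^+ 2); ring.
have e5 : \int[mu2]_x (f' x * Gr m x) = \int[mu2]_x (f x * Gr m x) + c * \int[mu2]_x (Gr m x * cG l (Gr m) x).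
  rewrite -(IntZ c (sq_mul sm sc)) -(IntD (sq_mul sf sm) (L1Z c (sq_mul sm sc))).
  apply: Int_ae.
  - exact: L1_meas (sq_mul sf' sm).
  - exact: L1_meas (L1D (sq_mul sf sm) (L1Z c (sq_mul sm sc))).
  - by apply: filterS ae => x <-; ring.
have e6 : c * \int[mu2]_x (Gr m x * cG l (Gr m) x) =
    q * (\int[mu2]_x (Gr m x * Gr l x) - \int[mu2]_x (Gr m x ^+ 2)).
  rewrite -(IntB (sq_mul sm sl) sm.2) -(IntZ c (sq_mul sm sc)) -(IntZ q (L1B (sq_mul sm sl) sm.2)).
  apply: Int_ae.
  - exact: L1_meas (L1Z c (sq_mul sm sc)).
  - exact: L1_meas (L1Z q (L1B (sq_mul sm sl) sm.2)).
  - by apply: filterS (green_diff l0 m0) => x e; rewrite /c mulrCA -mulrA -e; ring.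
have e7 := Green_ip' l0 m0.
have e8 : theta m = theta l + (m - l) * \int[mu2]_x (Gr m x * Gr l x) by rewrite e7; ring.
rewrite e3 -e2 e1 e4 e5 e8.
have cE : c = q * (m - l) by [].
have alg (c0 t E F G K L M N : R) : c0 = q * (m - l) -> c0 * K = q * (L - M) ->
    E + 2 * c0 * F + c0 ^+ 2 * K + (m - l) * G - m * (G + 2 * q * (F + c0 * K) + q ^+ 2 * M) + (a + (t + (m - l) * L)) * q ^+ 2 =
    E - l * (G + 2 * q * (F + c0 * K) + q ^+ 2 * M) + (a + t) * q ^+ 2.
  move=> -> hK; apply/eqP; rewrite -subr_eq0; apply/eqP.
  have -> : E + 2 * (q * (m - l)) * F + (q * (m - l)) ^+ 2 * K + (m - l) * G - m * (G + 2 * q * (F + q * (m - l) * K) + q ^+ 2 * M) + (a + (t + (m - l) * L)) * q ^+ 2 -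
    (E - l * (G + 2 * q * (F + q * (m - l) * K) + q ^+ 2 * M) + (a + t) * q ^+ 2) =
    - (q * (m - l)) * (q * (m - l) * K - q * (L - M)) by ring.
  by rewrite hK subrr mulr0.
exact: alg.
Qed.

Lemma rdec_unique a l m q r v g h : 0 < l -> 0 < m -> rdec l q v g -> rdec m r v h ->
  [/\ q = r & rform a l q v g = rform a m r v h].
Proof.
move=> l0 m0 Hg Hh; have [g' [Hg' e]] := rdec_change a l0 m0 Hg.
have qr : q = r.
  have := rH1_lin (-1) Hh Hg' => Hd; apply/eqP; rewrite -subr_eq0; apply/eqP.
  apply: (charge0 m0 Hd); apply: aeW => x; ring.
split => //; rewrite -e -qr /rform; congr (_ - _ + _); rewrite /En.
rewrite -qr in Hh; have [sf w] := Hg'; have [_ w'] := Hh.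
congr (_ + _ + _); apply: Int_ae.
- by apply: measurable_funX; exact: (w true).1.1.
- by apply: measurable_funX; exact: (w' true).1.1.
- by apply: filterS (wd_unique sf (w true).1 (w' true).1 (w true).2 (w' true).2) => x ->.
- by apply: measurable_funX; exact: (w false).1.1.
- by apply: measurable_funX; exact: (w' false).1.1.
- by apply: filterS (wd_unique sf (w false).1 (w' false).1 (w false).2 (w' false).2) => x ->.
Qed.

End RealForm.

(** * Real powers, Young's inequality and power-integrable functions *)

Section Powers.
Variable R : realType.
Implicit Types (a b s p : R).

Lemma powR_cvg (u : nat -> R) a s : 0 < s -> (forall n, 0 <= u n) -> u n @[n --> \oo] --> a ->
  u n `^ s @[n --> \oo] --> a `^ s.
Proof.
move=> s0 u0 ua; have a0 : 0 <= a.
  rewrite leNgt; apply/negP => a0; near \oo => n.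
  have := u0 n; rewrite leNgt => /negP; apply; near: n; exact: cvgr_lt ua _ a0.
have [a00|an0] := eqVneq a 0; last first.
  have {an0}a0 : 0 < a by rewrite lt_def an0.
  rewrite /powR (gt_eqF a0).
  have h : expR (s * ln (u n)) @[n --> \oo] --> expR (s * ln a).
    apply: continuous_cvg; first exact: continuous_expR.
    apply: cvgMr; apply: continuous_cvg => //; exact: continuous_ln.
  apply: cvg_trans h; apply: near_eq_cvg; near=> n.
  rewrite gt_eqF//; near: n; exact: cvgr_gt ua _ a0.
rewrite a00 in ua *; rewrite powR0 ?gt_eqF//; apply/cvgrPdist_lt => e e0; near=> n.
rewrite sub0r normrN ger0_norm ?powR_ge0//.
have -> : e = (e `^ s^-1) `^ s by rewrite -powRrM mulVf ?gt_eqF// powRr1// ltW.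
apply: gt0_ltr_powR; rewrite ?nnegrE ?powR_ge0//.
near: n; exact: cvgr_lt ua _ (powR_gt0 _ e0).
Unshelve. all: by end_near. Qed.

Lemma powR_add_le a b s : 0 <= a -> 0 <= b -> 0 <= s -> (a + b) `^ s <= 2 `^ s * (a `^ s + b `^ s).
Proof.
move=> a0 b0 s0; have [ab|ba] := leP a b.
  apply: (@le_trans _ _ ((2 * b) `^ s)); first by apply: ge0_ler_powR; rewrite ?nnegrE ?addr_ge0 ?mulr_ge0//; lra.
  by rewrite powRM// ler_wpM2l ?powR_ge0// lerDr powR_ge0.
apply: (@le_trans _ _ ((2 * a) `^ s)); first by apply: ge0_ler_powR; rewrite ?nnegrE ?addr_ge0 ?mulr_ge0//; lra.
by rewrite powRM// ler_wpM2l ?powR_ge0// lerDl powR_ge0.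
Qed.

Lemma powR_sub_le a b s : 0 <= a -> 0 <= b -> 0 <= s -> `|a - b| `^ s <= a `^ s + b `^ s.
Proof.
move=> a0 b0 s0; have [ab|ba] := leP a b.
  apply: (@le_trans _ _ (b `^ s)); last by rewrite lerDr powR_ge0.
  by apply: ge0_ler_powR; rewrite ?nnegrE//; rewrite ler0_norm; lra.
apply: (@le_trans _ _ (a `^ s)); last by rewrite lerDl powR_ge0.
by apply: ge0_ler_powR; rewrite ?nnegrE//; rewrite gtr0_norm; lra.
Qed.

Definition cj p := p / (p - 1).

Lemma cjP p : 2 < p -> [/\ 1 < cj p, cj p < 2, p^-1 + (cj p)^-1 = 1 & (p - 1) * cj p = p].
Proof.
move=> p2; have p1 : 0 < p - 1 by lra.
have pn : p - 1 != 0 by rewrite gt_eqF.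
rewrite /cj; split.
- by rewrite ltr_pdivlMr//; lra.
- by rewrite ltr_pdivrMr//; lra.
- by field; rewrite pn gt_eqF//; lra.
- by rewrite mulrC divfK.
Qed.

Lemma young p a b : 2 < p -> 0 <= a -> 0 <= b -> a * b <= a `^ p / p + b `^ cj p / cj p.
Proof.
move=> p2 a0 b0; have [r1 r2 e _] := cjP p2.
by apply: conjugate_powR => //; lra.
Qed.

(** A small [d] makes the part in [b] negligible at the price of a large factor on the part in
    [a]. *)
Lemma young_scaled p a b d : 2 < p -> 0 <= a -> 0 <= b -> 0 < d ->
  a * b <= d `^ (- p) * a `^ p + d `^ cj p * b `^ cj p.
Proof.
move=> p2 a0 b0 d0; have [r1 r2 e _] := cjP p2.
have -> : a * b = (d^-1 * a) * (d * b) by rewrite mulrACA mulVf ?mul1r// gt_eqF.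
apply: le_trans (young p2 _ _) _; rewrite ?mulr_ge0 ?invr_ge0 ?(ltW d0)//.
have dp : d^-1 `^ p = d `^ (- p) by rewrite -powR_inv1 ?(ltW d0)// -powRrM mulN1r.
rewrite (powRM _ _ a0) ?invr_ge0 ?(ltW d0)// (powRM _ _ b0) ?(ltW d0)// dp.
apply: lerD; first by rewrite ler_piMr ?mulr_ge0 ?powR_ge0// invf_le1; lra.
by rewrite ler_piMr ?mulr_ge0 ?powR_ge0// invf_le1; lra.
Qed.

(* The tangent to [x |-> x `^ s] at [b] lies below the graph. *)
Lemma powR_tangent a b s : 1 < s -> 0 <= a -> 0 <= b ->
  b `^ s + s * b `^ (s - 1) * (a - b) <= a `^ s.
Proof.
move=> s1 a0 b0; have s10 : s - 1 != 0 by rewrite gt_eqF; lra.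
have s0 : 0 < s by lra.
have h := @conjugate_powR R a (b `^ (s - 1)) s (s / (s - 1)) a0 (powR_ge0 _ _) s0 _ _.
have s2 : 0 < s / (s - 1) by rewrite divr_gt0//; lra.
have e : s^-1 + (s / (s - 1))^-1 = 1 by field; rewrite s10 gt_eqF.
have := h s2 e; rewrite -powRrM [_ * (s / _)]mulrC divfK// => h1.
have e2 : b `^ (s - 1) * b = b `^ s by rewrite mulrC mulr_powRB1.
have e3 : b `^ s / (s / (s - 1)) = b `^ s * (s - 1) / s by rewrite invf_div mulrA.
rewrite e3 in h1; have h2 := ler_wpM2l (ltW s0) h1.
rewrite mulrDr !mulrA in h2.
have e4 : s * (a `^ s / s) = a `^ s by rewrite mulrC divfK// gt_eqF.
have e5 : s * (b `^ s * (s - 1) / s) = b `^ s * (s - 1) by rewrite mulrC divfK// gt_eqF.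
have : s * (a * b `^ (s - 1)) <= a `^ s + b `^ s * (s - 1).
  by rewrite -e4 -e5 !mulrA; exact: h2.
rewrite -e2; move: (b `^ (s - 1)) (a `^ s) => B A; nra.
Qed.

End Powers.

Section PowerIntegrable.
Context d (T : measurableType d) (R : realType) (mu : {measure set T -> \bar R}).
Implicit Types (f g : T -> R) (s p c C : R).

(** Nonnegativity is part of the notion because [powR] of a negative base is not a power of its
    modulus. *)
Definition pw s f := [/\ measurable_fun setT f, forall x, 0 <= f x & L1 mu (fun x => f x `^ s)].

Lemma measurable_pow s f : measurable_fun setT f -> measurable_fun setT (fun x => f x `^ s).
Proof. by move=> mf; apply: (@measurableT_comp _ _ _ _ _ _ (@powR R ^~ s)). Qed.

Lemma pw_le s f g : 0 <= s -> measurable_fun setT f -> (forall x, 0 <= f x <= g x) -> pw s g -> pw s f.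
Proof.
move=> s0 mf fg [mg g0 gi]; have f0 x : 0 <= f x by have /andP[] := fg x.
split => //; apply: L1_le gi => [|x]; first exact: measurable_pow.
rewrite ger0_norm ?powR_ge0//; apply: ge0_ler_powR; rewrite ?nnegrE//.
by have /andP[] := fg x.
Qed.

Lemma pwZ s c f : 0 <= c -> pw s f -> pw s (fun x => c * f x).
Proof.
move=> c0 [mf f0 fi]; split; [exact: measurable_funM|by move=> x; rewrite mulr_ge0|].
by apply: L1_eq (L1Z (c `^ s) fi) => x; rewrite powRM.
Qed.

Lemma pwD s f g : 0 <= s -> pw s f -> pw s g -> pw s (fun x => f x + g x).
Proof.
move=> s0 [mf f0 fi] [mg g0 gi]; split; [exact: measurable_funD|by move=> x; rewrite addr_ge0|].
apply: L1_le (L1Z (2 `^ s) (L1D fi gi)) => [|x]; first by apply: measurable_pow; exact: measurable_funD.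
by rewrite ger0_norm ?powR_ge0//; exact: powR_add_le.
Qed.

Lemma pw_interp s t f C : 0 < s -> s <= t -> (forall x, f x <= C) -> pw s f ->
  pw t f /\ \int[mu]_x (f x `^ t) <= C `^ (t - s) * \int[mu]_x (f x `^ s).
Proof.
move=> s0 st fC [mf f0 fi].
have key x : f x `^ t <= C `^ (t - s) * f x `^ s.
  have [->|fx0] := eqVneq (f x) 0; first by rewrite !powR0 ?mulr0// gt_eqF// (lt_le_trans s0).
  have -> : f x `^ t = f x `^ (t - s) * f x `^ s by rewrite -powRD ?subrK// fx0 implybT.
  rewrite ler_wpM2r ?powR_ge0//.
  by apply: ge0_ler_powR; rewrite ?nnegrE ?subr_ge0// (le_trans (f0 x)).
have L : L1 mu (fun x => f x `^ t).
  by apply: L1_le (L1Z (C `^ (t - s)) fi) => [|x]; [exact: measurable_pow|rewrite ger0_norm ?powR_ge0].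
split => //; rewrite -IntZ//; apply: Int_le => //; exact: L1Z.
Qed.

Lemma pw2_sq f : pw 2 f -> sq mu f.
Proof. by move=> [mf f0 fi]; split => //; apply: L1_eq fi => x; rewrite powR_mulrn. Qed.

Lemma sq_pw2 f : (forall x, 0 <= f x) -> sq mu f -> pw 2 f.
Proof. by move=> f0 [mf fi]; split => //; apply: L1_eq fi => x; rewrite powR_mulrn. Qed.

Lemma pw_mul p f g : 2 < p -> pw p f -> pw (cj p) g ->
  L1 mu (fun x => f x * g x) /\
  \int[mu]_x (f x * g x) <= \int[mu]_x (f x `^ p) / p + \int[mu]_x (g x `^ cj p) / cj p.
Proof.
move=> p2 [mf f0 fi] [mg g0 gi].
have L1' := L1Z p^-1 fi; have L2' := L1Z (cj p)^-1 gi; have L := L1D L1' L2'.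
have key x : f x * g x <= p^-1 * f x `^ p + (cj p)^-1 * g x `^ cj p.
  by apply: le_trans (young p2 (f0 x) (g0 x)) _; rewrite mulrC (mulrC _ (cj p)^-1).
have Lfg : L1 mu (fun x => f x * g x).
  by apply: L1_le L => [|x]; [exact: measurable_funM|rewrite ger0_norm ?mulr_ge0].
split => //; apply: le_trans (Int_le Lfg L key) _.
by rewrite (IntD L1' L2') (IntZ _ fi) (IntZ _ gi) [X in X + _]mulrC [X in _ + X]mulrC.
Qed.

Lemma pw_mul_scaled p f g e : 2 < p -> 0 < e -> pw p f -> pw (cj p) g ->
  \int[mu]_x (f x * g x) <= e `^ (- p) * \int[mu]_x (f x `^ p) + e `^ cj p * \int[mu]_x (g x `^ cj p).
Proof.
move=> p2 e0 [mf f0 fi] [mg g0 gi]; have [Lfg _] := pw_mul p2 (And3 mf f0 fi) (And3 mg g0 gi).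
rewrite -(IntZ _ fi) -(IntZ _ gi) -(IntD (L1Z _ fi) (L1Z _ gi)).
by apply: Int_le => [//||x]; [exact: L1D (L1Z _ fi) (L1Z _ gi)|exact: young_scaled].
Qed.

End PowerIntegrable.

(** Since the heat kernel has integral 1, the plane is not a null set; this is how points are
    extracted from almost everywhere statements. *)
Lemma ae_false (R : realType) :
  {ae @sleb2 R, forall x : measurableTypeR R * measurableTypeR R, False} -> False.
Proof.
move=> h; have m : measurable_fun setT (heat (1 : R)) by exact: measurable_heat.
have := @Int_ae _ _ R (@sleb2 R) (heat 1) (fun=> 0) m (measurable_cst _).
rewrite /Rintegral int_heat// integral0 /= => e.
have /eqP : (1 : R) = 0 by apply: e; apply: filterS h.
by rewrite oner_eq0.
Qed.

(** * The Green potential on L^r *)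

Section GreenConvolution.
Variables (R : realType) (p w : R).
Hypotheses (hp : 2 < p) (w0 : 0 < w).
Notation mu1 := (@lebesgue_measure R).
Notation mu2 := (@sleb2 R).
Notation pl := (measurableTypeR R * measurableTypeR R)%type.
Implicit Types f g : pl -> R.
Local Notation r := (cj p).
Local Notation G := (Gr w : pl -> R).

Lemma pw_Gr s : 1 <= s -> pw mu2 s G.
Proof.
by move=> s1; split; [exact: measurable_Green|move=> x; exact: Green_ge0|exact: L1_Green_pow].
Qed.

Lemma pw_mpres phi s f : mpres mu2 phi -> pw mu2 s f -> pw mu2 s (f \o phi).
Proof.
move=> hphi [mf f0 fi]; split; first exact: (measurableT_comp mf hphi.1).
  by move=> x; exact: f0.
exact: (mpres_L1 hphi fi).
Qed.

Definition Gp := \int[mu2]_x (G x `^ p).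
Definition GI := \int[mu2]_x G x.

Lemma GI_gt0 : 0 < GI.
Proof.
rewrite lt_def Int_ge0 ?andbT; last by move=> x; exact: Green_ge0.
apply/negP => /eqP h; have := Int_eq0_ae (L1_Green w0) (fun x => Green_ge0 x w0) h.
move=> /(filterI (ae_neq0 R)) h0; apply: (@ae_false R); apply: filterS h0 => x [x0 Gx].
by have := Green_gt0 w0 x0; rewrite Gx ltxx.
Qed.

Lemma L1_Gf f (x : pl) : pw mu2 r f -> L1 mu2 (fun y => G (x - y : R * R) * f y).
Proof.
move=> pf; have p1 : 1 <= p by move: hp; lra.
by have [] := pw_mul hp (pw_mpres (mpres_subl x) (pw_Gr p1)) pf.
Qed.

Lemma cG_ge0 f x : (forall y, 0 <= f y) -> 0 <= cG w f x.
Proof. by move=> f0; rewrite cGE; apply: Int_ge0 => y; rewrite mulr_ge0 ?Green_ge0. Qed.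

(** The Green function is in L^p, so the potential of an element of L^r is bounded at every
    point. *)
Lemma cG_le f x : pw mu2 r f -> cG w f x <= Gp / p + \int[mu2]_y (f y `^ r) / r.
Proof.
move=> pf; have p1 : 1 <= p by move: hp; lra.
have [_ h] := pw_mul hp (pw_mpres (mpres_subl x) (pw_Gr p1)) pf.
rewrite cGE; apply: le_trans h _; rewrite lerD2r.
have e := @mpres_Int _ pl R mu2 _ (fun y => G y `^ p) (mpres_subl x) (L1_meas (L1_Green_pow w0 p1)).
by rewrite le_eqVlt; apply/orP; left; apply/eqP; congr (_ / _); exact: e.
Qed.

(** Jensen's inequality for the probability density [G(x - y) / GI], obtained by integrating the
    tangent inequality at the mean [b], followed by Fubini's theorem. *)
Lemma pw_cG f : pw mu2 r f -> pw mu2 r (cG w f) /\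
  \int[mu2]_x (cG w f x `^ r) <= GI `^ r * \int[mu2]_x (f x `^ r).
Proof.
move=> pf; have [mf f0 fi] := pf; have [r1 r2 _ _] := cjP hp.
have r0 : 0 < r by lra.
have mG : measurable_fun setT G by exact: measurable_Green.
have mc : measurable_fun setT (cG w f) by rewrite cGE; exact: measurable_conv.
have LG := L1_Green w0; have I0 := GI_gt0.
have [LH aeH _] := RFubini1 (L1_shift2 LG fi).
pose h x := GI `^ (r - 1) * \int[mu2]_y (G (x - y : R * R) * f y `^ r).
have Lh : L1 mu2 h by exact: L1Z.
have key : {ae mu2, forall x, cG w f x `^ r <= h x}.
  apply: filterS aeH => x /= Lx; pose b := cG w f x / GI.
  have c0 : 0 <= cG w f x by exact: cG_ge0.
  have b0 : 0 <= b by rewrite divr_ge0// ltW.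
  have LGx : L1 mu2 (fun y => G (x - y : R * R)) by exact: (mpres_L1 (mpres_subl x) LG).
  have IGx : \int[mu2]_y G (x - y : R * R) = GI.
    exact: (@mpres_Int _ pl R mu2 _ G (mpres_subl x) mG).
  have LGf := L1_Gf x pf.
  have hb : b `^ r * GI <= \int[mu2]_y (G (x - y : R * R) * f y `^ r).
    have Lt : L1 mu2 (fun y => (b `^ r - r * b `^ (r - 1) * b) * G (x - y : R * R) + r * b `^ (r - 1) * (G (x - y : R * R) * f y)).
      exact: L1D (L1Z _ LGx) (L1Z _ LGf).
    have -> : b `^ r * GI = \int[mu2]_y ((b `^ r - r * b `^ (r - 1) * b) * G (x - y : R * R) + r * b `^ (r - 1) * (G (x - y : R * R) * f y)).
      rewrite (IntD (L1Z _ LGx) (L1Z _ LGf)) (IntZ _ LGx) (IntZ _ LGf) IGx.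
      have -> : \int[mu2]_y (G (x - y : R * R) * f y) = b * GI by rewrite /b divfK ?gt_eqF// cGE.
      by ring.
    apply: Int_le => // y; have := powR_tangent r1 (f0 y) b0.
    move=> ht; have := ler_wpM2l (Green_ge0 (x - y : R * R) w0) ht.
    by move: (Gr w _) (b `^ r) (b `^ (r - 1)) (f y `^ r) (f y) => A B C D E; lra.
  have -> : cG w f x `^ r = GI `^ (r - 1) * (b `^ r * GI).
    rewrite /b powRM ?invr_ge0 ?(ltW I0)// -[in RHS](powR_inv1 (ltW I0)) -powRrM mulN1r powRN.
    rewrite -(mulr_powRB1 (ltW I0) r0); have gn : GI != 0 by rewrite gt_eqF.
    have bn : GI `^ (r - 1) != 0 by rewrite gt_eqF// powR_gt0.
    move: (cG w f x `^ r) gn bn; move: (GI `^ (r - 1)) => B A gn bn; field.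
    by rewrite bn gn.
  by rewrite ler_wpM2l ?powR_ge0.
have Ih : \int[mu2]_x h x = GI `^ r * \int[mu2]_x (f x `^ r).
  rewrite /h (IntZ _ LH).
  have [_ _ _ _ /= e] := RFubini (L1_shift2 LG fi); rewrite e.
  have -> : \int[mu2]_y \int[mu2]_x (G (x - y : R * R) * f y `^ r) = \int[mu2]_y (GI * f y `^ r).
    apply: eq_Rintegral => y _; rewrite mulrC.
    have LGy : L1 mu2 (fun x => G (x - y : R * R)) by exact: (mpres_L1 (mpres_subr y) LG).
    rewrite /GI -(@mpres_Int _ pl R mu2 _ G (mpres_subr y) mG) -(IntZ _ LGy).
    by apply: eq_Rintegral => x _; rewrite mulrC.
  rewrite (IntZ _ fi) -(mulr_powRB1 (ltW I0) r0).
  have alg (A B C : R) : A * (B * C) = B * A * C by ring.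
  exact: alg.
have L : L1 mu2 (fun x => Num.min (cG w f x `^ r) (h x)).
  have mh := L1_meas Lh; apply: L1_le (L1_norm Lh) => [|x].
    by apply: measurable_minr => //; exact: measurable_pow.
  have h0 : 0 <= h x.
    by rewrite mulr_ge0 ?powR_ge0// Int_ge0// => y; rewrite mulr_ge0 ?Green_ge0 ?powR_ge0.
  by rewrite !ger0_norm ?le_min ?powR_ge0 ?h0// ge_min lexx orbT.
have mcr : measurable_fun setT (fun x => cG w f x `^ r) by exact: measurable_pow.
have ae : {ae mu2, forall x, Num.min (cG w f x `^ r) (h x) = cG w f x `^ r}.
  by apply: filterS key => x /min_idPl.
split; first by split => //; [move=> x; exact: cG_ge0|exact: L1_ae mcr ae L].
rewrite -Ih -(Int_ae (L1_meas L) mcr ae); apply: Int_le => // x.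
by rewrite ge_min lexx orbT.
Qed.

End GreenConvolution.

(** * The dual form, its supremum and the duality map *)

Section DualForm.
Variables (R : realType) (p w k : R).
Hypotheses (hp : 2 < p) (w0 : 0 < w) (k0 : 0 < k).
Notation mu1 := (@lebesgue_measure R).
Notation mu2 := (@sleb2 R).
Notation pl := (measurableTypeR R * measurableTypeR R)%type.
Implicit Types f g h u : pl -> R.
Local Notation r := (cj p).
Local Notation G := (Gr w : pl -> R).

Definition green_int f := \int[mu2]_x (f x * G x).
Definition dual_form f g := \int[mu2]_x (f x * cG w g x) + k^-1 * (green_int f * green_int g).
Definition dual_op f x := cG w f x + k^-1 * green_int f * G x.

Lemma J_TT f g : sq mu2 f -> sq mu2 g -> \int[mu2]_x (g x * dual_op f x) = dual_form g f.
Proof.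
move=> sf sg; have L1' := sq_mul sg (sq_cG w0 sf); have L2' := sq_mul sg (sq_Green w0).
transitivity (\int[mu2]_x (g x * cG w f x + k^-1 * green_int f * (g x * G x))).
  by apply: eq_Rintegral => x _; rewrite /dual_op; ring.
rewrite (IntD L1' (L1Z _ L2')) (IntZ _ L2') /dual_form -/(green_int g); congr (_ + _); ring.
Qed.

Lemma JC f g : sq mu2 f -> sq mu2 g -> dual_form f g = dual_form g f.
Proof.
move=> sf sg; rewrite /dual_form (cG_pair w0 sf sg) (mulrC (green_int f)); congr (_ + _).
by apply: eq_Rintegral => x _; exact: mulrC.
Qed.

Lemma J_lin c f g h : sq mu2 f -> sq mu2 g -> sq mu2 h ->
  dual_form (fun x => f x + c * g x) h = dual_form f h + c * dual_form g h.
Proof.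
move=> sf sg sh; have sc := sq_cG w0 sh; have sG := sq_Green w0.
have e u : sq mu2 u -> \int[mu2]_x ((f x + c * g x) * u x) = \int[mu2]_x (f x * u x) + c * \int[mu2]_x (g x * u x).
  move=> su; rewrite -(IntZ c (sq_mul sg su)) -(IntD (sq_mul sf su) (L1Z c (sq_mul sg su))).
  by apply: eq_Rintegral => x _; ring.
rewrite /dual_form /green_int (e _ sc) (e _ sG).
have alg (a b a' b' i : R) : a + c * b + k^-1 * ((a' + c * b') * i) = a + k^-1 * (a' * i) + c * (b + k^-1 * (b' * i)) by ring.
exact: alg.
Qed.

Lemma J_ge0 f : sq mu2 f -> 0 <= dual_form f f.
Proof.
move=> sf; rewrite addr_ge0//; last by rewrite mulr_ge0 ?invr_ge0 ?(ltW k0)// -expr2 sqr_ge0.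
by rewrite -(En_cG w0 sf); exact: En_ge0.
Qed.

Lemma J_add c f g : sq mu2 f -> sq mu2 g ->
  dual_form (fun x => f x + c * g x) (fun x => f x + c * g x) = dual_form f f + 2 * c * dual_form f g + c ^+ 2 * dual_form g g.
Proof.
move=> sf sg; have sfg : sq mu2 (fun x => f x + c * g x) by apply: sqD => //; exact: sqZ.
rewrite (J_lin c sf sg sfg) (JC sf sfg) (JC sg sfg) (J_lin c sf sg sf) (J_lin c sf sg sg) (JC sg sf).
by move: (dual_form _ _) (dual_form _ _) (dual_form _ _) => a b d; ring.
Qed.

Lemma J_CS f g : sq mu2 f -> sq mu2 g -> (dual_form f g) ^+ 2 <= dual_form f f * dual_form g g.
Proof.
move=> sf sg; rewrite mulrC; apply: quad_discr; first exact: J_ge0.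
move=> t; have := J_ge0 (sqD sf (sqZ (- t) sg)); rewrite (J_add (- t) sf sg).
by move: (dual_form _ _) (dual_form _ _) (dual_form _ _) => a b d; congr (_ <= _); ring.
Qed.

(** Since r < 2, the bound in L^r does not give the square integrability under which convolutions
    can be paired, so it is required as well. *)
Definition dual_ball f := [/\ pw mu2 r f, sq mu2 f & \int[mu2]_x (f x `^ r) <= 1].

(** Over the dual ball, [C1] bounds the potential [cG w f] uniformly and [C2] the integral of its
    p-th power. *)
Definition C1 := Gp p w / p + r^-1.
Definition C2 := C1 `^ (p - r) * GI w `^ r.

Lemma r_gt1 : 1 < r. Proof. by have [] := cjP hp. Qed.
Lemma r_gt0 : 0 < r. Proof. by have := r_gt1; lra. Qed.
Lemma r_lt2 : r < 2. Proof. by have [] := cjP hp. Qed.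
Lemma p_gt0 : 0 < p. Proof. by move: hp; lra. Qed.

Lemma cls_cG f x : dual_ball f -> cG w f x <= C1.
Proof.
move=> [pf sf If]; apply: le_trans (cG_le hp w0 x pf) _; rewrite /C1 lerD2l.
by rewrite ler_pdivrMr ?r_gt0// mulVf// gt_eqF// r_gt0.
Qed.

Lemma iG_cG f : measurable_fun setT f -> green_int f = cG w f 0.
Proof.
move=> mf; rewrite cGE /green_int /conv; apply: eq_Rintegral => y _.
by rewrite sub0r GreenN mulrC.
Qed.

Lemma cls_pw_cG f t : dual_ball f -> r <= t -> pw mu2 t (cG w f).
Proof.
move=> cf rt; have [pf _ _] := cf; have [pc _] := pw_cG hp w0 pf.
by have [] := pw_interp r_gt0 rt (fun x => cls_cG x cf) pc.
Qed.

Lemma r_le_p : r <= p. Proof. by have := r_lt2; move: hp; lra. Qed.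

Lemma cls_cG_p f : dual_ball f -> \int[mu2]_x (cG w f x `^ p) <= C2.
Proof.
move=> cf; have [pf _ If] := cf; have [pc Ic] := pw_cG hp w0 pf.
have [_ h] := pw_interp r_gt0 r_le_p (fun x => cls_cG x cf) pc.
apply: le_trans h _; rewrite ler_wpM2l ?powR_ge0//; apply: le_trans Ic _.
by rewrite ler_piMr ?powR_ge0.
Qed.

Lemma cls_iG f : dual_ball f -> 0 <= green_int f <= C1.
Proof.
move=> cf; have [[mf f0 _] _ _] := cf; rewrite iG_cG// cls_cG// andbT; exact: cG_ge0.
Qed.

Lemma cls_J f : dual_ball f -> dual_form f f <= C2 / p + r^-1 + k^-1 * (C1 * C1).
Proof.
move=> cf; have [pf sf If] := cf; have /andP[i0 i1] := cls_iG cf; have k1 : 0 <= k^-1 by rewrite invr_ge0 ltW.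
apply: lerD; last by rewrite ler_wpM2l// ler_pM.
have [_ h] := pw_mul hp (cls_pw_cG cf r_le_p) pf.
have e : \int[mu2]_x (f x * cG w f x) = \int[mu2]_x (cG w f x * f x) by apply: eq_Rintegral => x _; exact: mulrC.
rewrite e; apply: le_trans h _; apply: lerD.
  by rewrite ler_pM2r ?invr_gt0 ?p_gt0//; exact: cls_cG_p.
by rewrite ler_pdivrMr ?r_gt0// mulVf// gt_eqF// r_gt0.
Qed.

Definition dual_max := sup [set dual_form f f | f in dual_ball].

Lemma cls0 : dual_ball (fun=> 0).
Proof.
have z : \int[mu2]_x ((0 : R) `^ r) = 0.
  by rewrite /Rintegral integral0_eq// => x _; rewrite powR0// gt_eqF// r_gt0.
have L0 : L1 mu2 (fun=> 0) by apply: integrable0.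
split; last by rewrite z.
  by split => //; apply: L1_eq L0 => x; rewrite powR0// gt_eqF// r_gt0.
by split => //; apply: L1_eq L0 => x; rewrite expr0n.
Qed.

Lemma has_sup_J : has_sup [set dual_form f f | f in dual_ball].
Proof.
split; first by exists (dual_form (fun=> 0) (fun=> 0)); exists (fun=> 0) => //; exact: cls0.
by exists (C2 / p + r^-1 + k^-1 * (C1 * C1)) => _ [f cf <-]; exact: cls_J.
Qed.

Lemma J_le_MM f : dual_ball f -> dual_form f f <= dual_max.
Proof. by move=> cf; apply: ub_le_sup; [exact: has_sup_J.2|exists f]. Qed.

Lemma MM_approx e : 0 < e -> exists2 f, dual_ball f & dual_max - e < dual_form f f.
Proof.
move=> e0; have [_ [f cf <-] h] := sup_adherent e0 has_sup_J.
by exists f.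
Qed.

Lemma JZ c f : sq mu2 f -> dual_form (fun x => c * f x) (fun x => c * f x) = c ^+ 2 * dual_form f f.
Proof.
move=> sf; have s0 : sq mu2 (fun=> 0 : R) by have [_ ? _] := cls0.
have := J_add c s0 sf; have e : (fun x : pl => 0 + c * f x) = (fun x => c * f x) by apply/funext => x; rewrite add0r.
rewrite e => ->; have z g : dual_form (fun=> 0) g = 0.
  have zz (h : pl -> R) : \int[mu2]_x (0 * h x) = 0.
    by rewrite /Rintegral integral0_eq// => x _; rewrite mul0r.
  by rewrite /dual_form /green_int !zz mul0r mulr0 addr0.
by rewrite !z mulr0 !add0r.
Qed.

Lemma cls_scale f : pw mu2 r f -> sq mu2 f -> 0 < \int[mu2]_x (f x `^ r) ->
  dual_ball (fun x => (\int[mu2]_x (f x `^ r)) `^ (- r^-1) * f x).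
Proof.
move=> pf sf; move If : (\int[mu2]_x (f x `^ r)) => I I0; have c0 := powR_ge0 I (- r^-1).
split; [exact: pwZ|exact: sqZ|].
have [mf f0 fi] := pf.
have -> : \int[mu2]_x ((I `^ (- r^-1) * f x) `^ r) = \int[mu2]_x (I^-1 * f x `^ r).
  apply: eq_Rintegral => x _; rewrite powRM// -powRrM mulNr mulVf ?gt_eqF ?r_gt0//.
  by rewrite powR_inv1// ltW.
by rewrite (IntZ _ fi) If mulVf// gt_eqF.
Qed.

Lemma J_le f : pw mu2 r f -> sq mu2 f -> dual_form f f <= dual_max * (\int[mu2]_x (f x `^ r)) `^ (2 / r).
Proof.
move=> pf sf; have [I0|I0] := ltP 0 (\int[mu2]_x (f x `^ r)); last first.
  have I00 : \int[mu2]_x (f x `^ r) = 0.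
    by apply/le_anti; rewrite I0 Int_ge0// => x; exact: powR_ge0.
  have [mf f0 fi] := pf; have ae := Int_eq0_ae fi (fun x => powR_ge0 _ _) I00.
  have ae' : {ae mu2, forall x, f x = 0} by apply: filterS ae => x /powR_eq0_eq0.
  have z u : sq mu2 u -> \int[mu2]_x (f x * u x) = 0.
    move=> su; transitivity (\int[mu2]_x (0 : R)); last by rewrite /Rintegral integral0.
    apply: Int_ae => //; first exact: L1_meas (sq_mul sf su).
    by apply: filterS ae' => x ->; rewrite mul0r.
  rewrite I00 /dual_form /green_int (z _ (sq_cG w0 sf)) (z _ (sq_Green w0)) mul0r mulr0 addr0.
  by rewrite powR0 ?mulr0// gt_eqF// divr_gt0// r_gt0.
have := J_le_MM (cls_scale pf sf I0); rewrite JZ//.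
move: I0; move: (\int[mu2]_x _) => I I0 h.
have e : (I `^ (- r^-1)) ^+ 2 = (I `^ (2 / r))^-1.
  rewrite -powR_mulrn ?powR_ge0// -powRrM -powRN; congr (_ `^ _); ring.
by move: h; rewrite e mulrC ler_pdivrMr// powR_gt0.
Qed.

Lemma MM_gt0 : 0 < dual_max.
Proof.
have r2 := r_lt2; have sG := sq_Green w0; have pG : pw mu2 r G by apply: pw_Gr => //; exact: ltW r_gt1.
have i0 : 0 < green_int G.
  rewrite lt_def Int_ge0 ?andbT; last by move=> x; rewrite mulr_ge0 ?Green_ge0.
  apply/negP => /eqP h; have h2 := Int_eq0_ae (sq_mul sG sG) (fun x => mulr_ge0 (Green_ge0 x w0) (Green_ge0 x w0)) h.
  apply: (@ae_false R); apply: filterS2 (ae_neq0 R) h2 => x x0 /eqP.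
  by rewrite mulf_eq0 orbb gt_eqF// Green_gt0.
have J0 : 0 < dual_form G G.
  rewrite ltr_wpDl//; first by rewrite -(En_cG w0 sG); exact: En_ge0.
  by rewrite mulr_gt0 ?invr_gt0// mulr_gt0.
have h := J_le pG sG; have {}h := lt_le_trans J0 h.
rewrite ltNge; apply/negP => M0; move: h; rewrite ltNge => /negP; apply.
by rewrite mulr_le0_ge0// powR_ge0.
Qed.

Section DualNorm.
Variable u : pl -> R.
Hypothesis pu : pw mu2 p u.
Definition pnorm := (\int[mu2]_x (u x `^ p)) `^ p^-1.
(** The normalized duality map, that is the function for which Hoelder's inequality against [u] is
    an equality. *)
Definition du x := (u x / pnorm) `^ (p - 1).

Lemma NN_pow : pnorm `^ p = \int[mu2]_x (u x `^ p).
Proof.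
rewrite /pnorm -powRrM mulVf ?powRr1 ?gt_eqF ?p_gt0//.
by apply: Int_ge0 => x; exact: powR_ge0.
Qed.

Lemma NN_hoelder g : pw mu2 r g -> \int[mu2]_x (g x `^ r) <= 1 -> 0 < pnorm ->
  \int[mu2]_x (g x * u x) <= pnorm.
Proof.
move=> pg Ig N0; have [mu_ u0 ui] := pu; have n0 : 0 < pnorm^-1 by rewrite invr_gt0.
have pu' := pwZ (ltW n0) pu.
have [L h] := pw_mul hp pu' pg; have [Lug _] := pw_mul hp pu pg.
have e1 : \int[mu2]_x ((pnorm^-1 * u x) `^ p) = 1.
  have -> : \int[mu2]_x ((pnorm^-1 * u x) `^ p) = \int[mu2]_x ((pnorm `^ p)^-1 * u x `^ p).
    apply: eq_Rintegral => x _; rewrite powRM ?(ltW n0)//; congr (_ * _).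
    by rewrite -powR_inv1 ?(ltW N0)// -powRrM mulN1r powRN.
  by rewrite (IntZ _ ui) -NN_pow mulVf// gt_eqF// powR_gt0.
have e2 : \int[mu2]_x (pnorm^-1 * u x * g x) = pnorm^-1 * \int[mu2]_x (g x * u x).
  have -> : \int[mu2]_x (g x * u x) = \int[mu2]_x (u x * g x) by apply: eq_Rintegral => x _; exact: mulrC.
  by rewrite -(IntZ _ Lug); apply: eq_Rintegral => x _; rewrite mulrA.
move: h; rewrite e1 e2 => h; rewrite -(ler_pM2l n0) mulVf ?gt_eqF//; apply: le_trans h _.
have [_ _ e _] := cjP hp.
by rewrite -[leRHS]e div1r lerD2l ler_pdivrMr ?r_gt0// mulVf// gt_eqF// r_gt0.
Qed.

Lemma du_spec : 0 < pnorm -> [/\ pw mu2 r du, \int[mu2]_x (du x `^ r) = 1,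
  L1 mu2 (fun x => du x * u x) & \int[mu2]_x (du x * u x) = pnorm].
Proof.
move=> N0; have [mu_ u0 ui] := pu; have [_ _ _ pr] := cjP hp; have n0 : 0 <= pnorm^-1 by rewrite invr_ge0 ltW.
have [mun un0 uni] := pwZ n0 pu; have p0 := p_gt0.
have e x : du x `^ r = (pnorm^-1 * u x) `^ p by rewrite /du -powRrM pr mulrC.
have md : measurable_fun setT du.
  by apply: measurable_pow; exact: measurable_funM.
have I1 : \int[mu2]_x ((pnorm^-1 * u x) `^ p) = 1.
  have -> : \int[mu2]_x ((pnorm^-1 * u x) `^ p) = \int[mu2]_x ((pnorm `^ p)^-1 * u x `^ p).
    apply: eq_Rintegral => x _; rewrite powRM//; congr (_ * _).
    by rewrite -powR_inv1 ?(ltW N0)// -powRrM mulN1r powRN.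
  by rewrite (IntZ _ ui) -NN_pow mulVf// gt_eqF// powR_gt0.
have e2 x : du x * u x = pnorm * (pnorm^-1 * u x) `^ p.
  rewrite -(mulr_powRB1 (un0 x) p0) /du (mulrC (u x)); set B := _ `^ _.
  by rewrite mulrC mulrA mulrA mulfV ?mul1r// gt_eqF.
split.
- by split => //; [move=> x; exact: powR_ge0|apply: L1_eq uni => x; rewrite e].
- by rewrite -I1; apply: eq_Rintegral => x _; rewrite e.
- by apply: L1_eq (L1Z pnorm uni) => x; rewrite e2.
- by rewrite -[RHS]mulr1 -I1 -(IntZ _ uni); apply: eq_Rintegral => x _; rewrite e2.
Qed.

End DualNorm.

Lemma pw_TT f t : pw mu2 r f -> r <= t -> pw mu2 t (dual_op f).
Proof.
move=> pf rt; have i0 : 0 <= green_int f.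
  by have [mf f0 _] := pf; apply: Int_ge0 => x; rewrite mulr_ge0 ?Green_ge0.
have t0 : 0 <= t by have := r_gt0; move: rt; lra.
apply: pwD => //.
  have [pc _] := pw_cG hp w0 pf.
  by have [] := pw_interp r_gt0 rt (fun x => cG_le hp w0 x pf) pc.
apply: pwZ; first by rewrite mulr_ge0// invr_ge0 ltW.
by apply: pw_Gr => //; apply: le_trans rt; exact: ltW r_gt1.
Qed.

Lemma cls_du f : dual_ball f -> 0 < pnorm (dual_op f) -> dual_ball (du (dual_op f)).
Proof.
move=> cf N0; have [pf _ _] := cf; have pu := pw_TT pf r_le_p; have [pd Id _ _] := du_spec pu N0.
split => //; last by rewrite Id.
apply: pw2_sq; split; [by case: pd|by move=> x; exact: powR_ge0|].
have h2 : r <= (p - 1) * 2 by have := r_lt2; move: hp; lra.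
have n0 : 0 <= (pnorm (dual_op f))^-1 by rewrite invr_ge0 ltW.
have [_ _ L] := pwZ n0 (pw_TT pf h2).
by apply: L1_eq L => x; rewrite /du -powRrM mulrC.
Qed.

(** One step of the iteration that sends [f] to the dual function of [T f]. Hoelder's inequality
    gives the first bound, Cauchy-Schwarz for [J] between [f] and that dual function gives the
    second, and expanding [J] of the difference gives the third: along a maximizing sequence the
    step moves [f] by little. *)
Lemma NN_step f : dual_ball f -> 0 < dual_form f f ->
  [/\ dual_form f f <= pnorm (dual_op f), pnorm (dual_op f) <= dual_max &
      dual_form (fun x => f x - du (dual_op f) x) (fun x => f x - du (dual_op f) x) <= 2 * (dual_max - dual_form f f)].
Proof.
move=> cf J0; have [pf sf If] := cf; have pu := pw_TT pf r_le_p; have [mu_ u0 ui] := pu.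
have JE : \int[mu2]_x (f x * dual_op f x) = dual_form f f by exact: J_TT.
have N0 : 0 < pnorm (dual_op f).
  rewrite lt_def powR_ge0 andbT; apply/negP => /eqP N0.
  have I0 : \int[mu2]_x (dual_op f x `^ p) = 0 by rewrite -NN_pow N0 powR0// gt_eqF// p_gt0.
  have ae := Int_eq0_ae ui (fun x => powR_ge0 _ _) I0.
  move: J0; rewrite -JE (_ : \int[mu2]_x _ = 0) ?ltxx//.
  have [L _] := pw_mul hp pu pf.
  transitivity (\int[mu2]_x (0 : R)); last by rewrite /Rintegral integral0.
  apply: Int_ae => //; first by apply: measurable_funM => //; case: pf.
  by apply: filterS ae => x /powR_eq0_eq0 ->; rewrite mulr0.
have h1 : dual_form f f <= pnorm (dual_op f) by rewrite -JE; exact: NN_hoelder.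
have cd := cls_du cf N0; have [_ _ Ld Id] := du_spec pu N0; have [_ sd _] := cd.
have Jd : dual_form (du (dual_op f)) f = pnorm (dual_op f) by rewrite -J_TT.
have JM := J_le_MM cf; have JdM := J_le_MM cd; have CS := J_CS sd sf; rewrite Jd in CS.
split => //.
  have M0 := MM_gt0; have Jd0 := J_ge0 sd.
  have : pnorm (dual_op f) ^+ 2 <= dual_max ^+ 2 by apply: le_trans CS _; rewrite expr2 ler_pM// ltW.
  by rewrite ler_pXn2r// ?nnegrE ?ltW.
have e : (fun x => f x - du (dual_op f) x) = (fun x => f x + -1 * du (dual_op f) x) by apply/funext => x; rewrite mulN1r.
rewrite e (J_add (-1) sf sd) (JC sf sd) Jd; lra.
Qed.

End DualForm.

(** * Equicontinuity of potentials and extraction of limits *)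

Section Compactness.
Variables (R : realType) (p w : R).
Hypotheses (hp : 2 < p) (w0 : 0 < w).
Notation mu1 := (@lebesgue_measure R).
Notation mu2 := (@sleb2 R).
Notation pl := (measurableTypeR R * measurableTypeR R)%type.
Implicit Types f g h u : pl -> R.
Local Notation r := (cj p).
Local Notation G := (Gr w : pl -> R).

Lemma Gr_seq (a b : nat -> R) (x : R * R) : x != 0 -> a n @[n --> \oo] --> x.1 -> b n @[n --> \oo] --> x.2 ->
  Gr w (a n, b n) @[n --> \oo] --> Gr w x.
Proof.
move=> x0 ax bx; rewrite Green_K0.
have h : Num.sqrt w * enorm (a n, b n) @[n --> \oo] --> Num.sqrt w * enorm x.
  have hs : a n ^+ 2 + b n ^+ 2 @[n --> \oo] --> x.1 ^+ 2 + x.2 ^+ 2.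
    by apply: cvgD; rewrite !expr2; apply: cvgM.
  by apply: cvgMr; apply: cvg_comp hs _; exact: sqrt_continuous.
have z0 : 0 < Num.sqrt w * enorm x by apply: mulr_gt0; [rewrite sqrtr_gt0|rewrite enorm_gt0].
have := K0_cvg z0 h => h2.
rewrite (_ : (fun n => _) = (fun n => K0 (Num.sqrt w * enorm (a n, b n)) / (2 * pi))); last first.
  by apply/funext => n; rewrite Green_K0.
by apply: cvgMl.
Qed.

Definition Dp (eta : R * R) := \int[mu2]_z (`|G (z + eta : R * R) - G z| `^ p).

Lemma pw_shift s f (eta : R * R) : pw mu2 s f -> pw mu2 s (fun z => f (z + eta : R * R)).
Proof.
move=> pf; have := pw_mpres (mpres_subr (- eta)) pf.
by rewrite (_ : f \o _ = (fun z => f (z + eta : R * R)))//; apply/funext => z /=; rewrite opprK.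
Qed.

Lemma pw_Dp (eta : R * R) : pw mu2 p (fun z => `|G (z + eta : R * R) - G z|).
Proof.
have p1 : 1 <= p by move: hp; lra.
have p0 : 0 <= p by move: hp; lra.
have pG := pw_Gr w0 p1; have pG' := pw_shift eta pG.
apply: pw_le p0 _ _ (pwD p0 pG' pG) => [|x].
  by apply: measurableT_comp => //; apply: measurable_funB; [case: pG'|case: pG].
rewrite normr_ge0/=; apply: le_trans (ler_normB _ _) _.
by rewrite !ger0_norm ?Green_ge0.
Qed.

(** Continuity of translations without a density argument: Fatou's lemma is applied to the
    nonnegative functions [G(z + eta)^p + G(z)^p - |G(z + eta) - G(z)|^p], which converge to [2 G^p]
    almost everywhere. *)
Lemma Gr_trans e : 0 < e -> exists2 d, 0 < d &
  forall eta : R * R, `|eta.1| < d -> `|eta.2| < d -> Dp eta < e.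
Proof.
move=> e0; apply: contrapT => /forall2NP H.
have p1 : 1 <= p by move: hp; lra.
have p0 : 0 < p by move: hp; lra.
have pG := pw_Gr w0 p1; have [mG G0 LG] := pG.
have /choice[eta heta] : forall n : nat, exists eta : R * R,
    [/\ `|eta.1| < n.+1%:R^-1, `|eta.2| < n.+1%:R^-1 & e <= Dp eta].
  move=> n; case: (H n.+1%:R^-1) => [|h]; first by rewrite invr_gt0.
  apply: contrapT => hn; apply: h => eta e1 e2; rewrite ltNge; apply/negP => e3.
  by apply: hn; exists eta.
pose F n z := G (z + eta n : R * R) `^ p + G z `^ p - `|G (z + eta n : R * R) - G z| `^ p.
have LF n : L1 mu2 (F n).
  have [_ _ L1'] := pw_shift (eta n) pG; have [_ _ L2'] := pw_Dp (eta n).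
  exact: L1B (L1D L1' LG) L2'.
have IF n : \int[mu2]_z F n z = 2 * Gp p w - Dp (eta n).
  have [_ _ L1'] := pw_shift (eta n) pG; have [_ _ L2'] := pw_Dp (eta n).
  rewrite (IntB (L1D L1' LG) L2') (IntD L1' LG) /Dp; congr (_ - _).
  have -> : \int[mu2]_z (G (z + eta n : R * R) `^ p) = Gp p w.
    rewrite /Gp -(@mpres_Int _ pl R mu2 _ _ (mpres_subr (- eta n)) (L1_meas LG)).
    by apply: eq_Rintegral => z _; rewrite opprK.
  by rewrite mulr_natl mulr2n.
have seq0 (c : nat -> R) : (forall n, `|c n| < n.+1%:R^-1) -> c n @[n --> \oo] --> (0 : R).
  move=> hc; apply/norm_cvg0P; apply: (@squeeze_cvgr _ _ _ _ (fun=> 0) (fun n => n.+1%:R^-1)).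
  - by apply: nearW => n; rewrite normr_ge0 ltW.
  - exact: cvg_cst.
  - exact: cvg_inv_nat.
have e1 := seq0 (fun n => (eta n).1) (fun n => let: And3 h _ _ := heta n in h).
have e2 := seq0 (fun n => (eta n).2) (fun n => let: And3 _ h _ := heta n in h).
have L2G := L1D LG LG.
have := @fatou_le _ _ R mu2 F (fun z => G z `^ p + G z `^ p) (2 * Gp p w - e) (fun n => L1_meas (LF n)) (L1_meas L2G).
rewrite (L1_fin L2G) lee_fin (IntD LG LG) -/(Gp p w) => h.
have : Gp p w + Gp p w <= 2 * Gp p w - e; last by move: e0; lra.
apply: h => [n x|x||n].
- by rewrite subr_ge0; apply: powR_sub_le; rewrite ?Green_ge0 ?ltW.
- by rewrite addr_ge0 ?powR_ge0.
- apply: filterS (ae_neq0 R) => x x0.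
  have c1 : Gr w (x + eta n : R * R) @[n --> \oo] --> Gr w x.
    apply: (Gr_seq x0); rewrite -[X in _ --> X]addr0; apply: cvgD => //; exact: cvg_cst.
  rewrite -[X in _ --> X]subr0; apply: cvgB.
    apply: cvgD; last exact: cvg_cst.
    by apply: powR_cvg => // n; exact: Green_ge0.
  rewrite -[X in _ --> X](powR0 (_ : p != 0)); last by rewrite gt_eqF.
  apply: powR_cvg => //; apply/norm_cvg0P.
  by rewrite -[X in _ --> X](subrr (Gr w x)); apply: cvgB => //; exact: cvg_cst.
- by rewrite (L1_fin (LF n)) lee_fin IF lerD2l lerN2; case: (heta n).
Qed.

Lemma cG_equi e : 0 < e -> exists2 d, 0 < d &
  forall f (x eta : R * R), pw mu2 r f -> \int[mu2]_y (f y `^ r) <= 1 ->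
    `|eta.1| < d -> `|eta.2| < d -> `|cG w f (x + eta) - cG w f x| <= e.
Proof.
move=> e0; have r0 := r_gt0 hp; have e20 : 0 < e / 2 by rewrite divr_gt0.
(* In the scaled Young inequality this [c] makes the L^r part at most [e / 2]; the threshold asked
   of [Gr_trans] makes the L^p part at most [e / 2]. *)
pose c := (e / 2) `^ r^-1; have c0 : 0 < c by rewrite powR_gt0.
have cr : c `^ r = e / 2 by rewrite -powRrM mulVf ?gt_eqF// powRr1// ltW.
have [|d d0 hd] := @Gr_trans (e / 2 * c `^ p); first by rewrite mulr_gt0 ?powR_gt0.
exists d => // f x eta pf If e1 e2; have [mf f0 fi] := pf.
have L1' := L1_Gf hp w0 (x + eta) pf; have L2' := L1_Gf hp w0 x pf.
rewrite cGE /conv -(IntB L1' L2').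
have pD := pw_mpres (mpres_subl x) (pw_Dp eta).
have h := pw_mul_scaled hp c0 pD pf.
have [LD _] := pw_mul hp pD pf.
apply: le_trans (Int_norm (L1B L1' L2')) _.
apply: (@le_trans _ _ (\int[mu2]_y (`|G (x - y + eta : R * R) - G (x - y : R * R)| * f y))).
  apply: Int_le => [||y]; [exact: L1_norm (L1B L1' L2')|exact: LD|].
  by rewrite -mulrBl normrM (ger0_norm (f0 y)) addrAC.
apply: le_trans h _; rewrite -[leRHS](_ : e / 2 + e / 2 = e); last by field.
apply: lerD; last by rewrite cr ler_piMr// ltW.
have -> : \int[mu2]_x0 (((fun z => `|G (z + eta : R * R) - G z|) \o (fun z : R * R => x - z)) x0 `^ p) = Dp eta.
  exact: (@mpres_Int _ pl R mu2 _ (fun z => `|G (z + eta : R * R) - G z| `^ p) (mpres_subl x) (L1_meas (let: And3 _ _ h := pw_Dp eta in h))).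
by rewrite powRN mulrC ler_pdivrMr ?powR_gt0//; exact: ltW (hd eta e1 e2).
Qed.

(** A bound in L^r and convergence almost everywhere imply weak convergence. Young's inequality cuts
    [g |fn n - f|] into a dominated part and a part that is small uniformly in [n]. *)
Lemma weak_cvg (fn : nat -> pl -> R) f g : (forall n, pw mu2 r (fn n)) ->
  (forall n, \int[mu2]_x (fn n x `^ r) <= 1) -> pw mu2 r f -> \int[mu2]_x (f x `^ r) <= 1 ->
  {ae mu2, forall x, fn n x @[n --> \oo] --> f x} -> pw mu2 p g ->
  \int[mu2]_x (g x * fn n x) @[n --> \oo] --> \int[mu2]_x (g x * f x).
Proof.
move=> pn In pf If ae pg; have r0 := r_gt0 hp; have [mg g0 gi] := pg; have [mf f0 fi] := pf.
have [Lgf _] := pw_mul hp pg pf; have Lgn n := (pw_mul hp pg (pn n)).1.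
apply/cvgrPdist_lt => e e0; have e80 : 0 < e / 8 by rewrite divr_gt0.
pose d := (e / 8) `^ r^-1; have d0 : 0 < d by rewrite powR_gt0.
have dr : d `^ r = e / 8 by rewrite -powRrM mulVf ?gt_eqF// powRr1// ltW.
pose D n x := `|fn n x - f x|.
have mD n : measurable_fun setT (D n).
  by apply: measurableT_comp => //; apply: measurable_funB => //; case: (pn n).
have Dle n x : D n x `^ r <= fn n x `^ r + f x `^ r.
  by apply: powR_sub_le; rewrite ?f0 ?(ltW r0)//; case: (pn n) => _ + _; exact.
have LD n : L1 mu2 (fun x => D n x `^ r).
  have [_ _ Ln] := pn n; apply: L1_le (L1D Ln fi) => [|x]; first exact: measurable_pow.
  by rewrite ger0_norm ?powR_ge0.
have ID n : \int[mu2]_x (D n x `^ r) <= 2.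
  have [_ _ Ln] := pn n; apply: le_trans (Int_le (LD n) (L1D Ln fi) (Dle n)) _.
  rewrite (IntD Ln fi) -[leRHS]/(1 + 1); exact: lerD (In n) If.
have pD n : pw mu2 r (D n) by split => // x; exact: normr_ge0.
(* The excess over [d^r D^r]. By Young's inequality it is dominated by [d^(-p) g^p], so its integral
   tends to 0, while what remains integrates to at most [2 * d^r = e / 4]. *)
pose B n x := Num.max 0 (g x * D n x - d `^ r * D n x `^ r).
have mB n : measurable_fun setT (B n).
  apply: measurable_maxr => //; apply: measurable_funB; first exact: measurable_funM.
  by apply: measurable_funM => //; exact: measurable_pow.
have B0 n x : 0 <= B n x by rewrite le_max lexx.
have Bg n x : `|B n x| <= d `^ (- p) * g x `^ p.
  rewrite ger0_norm// ge_max mulr_ge0 ?powR_ge0//= lerBlDr.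
  by apply: young_scaled => //; exact: normr_ge0.
have LB n : L1 mu2 (B n) by apply: L1_le (L1Z (d `^ (- p)) gi).
have [_ BI] : L1 mu2 (fun x : pl => 0 : R) /\ (\int[mu2]_x B n x @[n --> \oo] --> \int[mu2]_x (0 : R)).
  apply: (dct mB _ (L1Z (d `^ (- p)) gi) Bg) => //.
  apply: filterS ae => x hx.
  have D0 : D n x @[n --> \oo] --> (0 : R).
    by apply/norm_cvg0P; rewrite -[X in _ --> X](subrr (f x)); apply: cvgB => //; exact: cvg_cst.
  have h1 : g x * D n x - d `^ r * D n x `^ r @[n --> \oo] --> (0 : R).
    rewrite -[X in _ --> X]subr0; apply: cvgB; first by rewrite -[X in _ --> X](mulr0 (g x)); exact: cvgMr.
    rewrite -[X in _ --> X](mulr0 (d `^ r)); apply: cvgMr; rewrite -[X in _ --> X](powR0 (_ : r != 0)) ?gt_eqF//.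
    by apply: powR_cvg => // n; exact: normr_ge0.
  apply: (@squeeze_cvgr _ _ _ _ (fun=> 0) (fun n => `|g x * D n x - d `^ r * D n x `^ r|)).
  - by apply: nearW => n; rewrite B0 ge_max normr_ge0 ler_norm.
  - exact: cvg_cst.
  - by rewrite -[X in _ --> X](@normr0 _ R); exact: cvg_norm.
rewrite {2}/Rintegral integral0 /= in BI.
near=> n.
have Ln := Lgn n; rewrite distrC -(IntB Ln Lgf).
have LgD : L1 mu2 (fun x => g x * D n x) by have [] := pw_mul hp pg (pD n).
apply: (@le_lt_trans _ _ (\int[mu2]_x (g x * D n x))).
  apply: le_trans (Int_norm (L1B Ln Lgf)) _; apply: Int_le => // [|x]; first exact: L1_norm (L1B Ln Lgf).
  by rewrite -mulrBr normrM (ger0_norm (g0 x)).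
apply: (@le_lt_trans _ _ (\int[mu2]_x B n x + d `^ r * \int[mu2]_x (D n x `^ r))).
  rewrite -(IntZ _ (LD n)) -(IntD (LB n) (L1Z _ (LD n))); apply: Int_le => // [|x].
    exact: L1D (LB n) (L1Z _ (LD n)).
  by rewrite -lerBlDr /B le_max lexx orbT.
have h1 : \int[mu2]_x B n x < e / 2.
  near: n; apply: (cvgr_lt 0 BI); by rewrite divr_gt0.
have h2 := ler_wpM2l (ltW e80) (ID n); rewrite dr; move: h1 h2.
move: (Rintegral _ _ _) (Rintegral _ _ _) => a b; lra.
Unshelve. all: by end_near. Qed.

(** A form of the Arzela-Ascoli theorem. Along an ultrafilter every value converges, by compactness
    of [[0, C]], and the limit inherits the equicontinuity. An index at which the first [k] rational
    points are within [1 / (k + 1)] of their limits gives the k-th term, and the remaining points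
    follow by equicontinuity. *)
Lemma select (h : nat -> pl -> R) C : (forall n x, 0 <= h n x <= C) ->
  (forall e, 0 < e -> exists2 d, 0 < d & forall n (x eta : R * R), `|eta.1| < d -> `|eta.2| < d ->
     `|h n (x + eta : R * R) - h n x| <= e) ->
  exists (phi : nat -> nat) (H : pl -> R), (forall k, (k <= phi k)%N) /\
    forall x, h (phi k) x @[k --> \oo] --> H x.
Proof.
move=> hC heq; have [U [UU oU]] := ultraFilterLemma (@eventually_filter).
have PU : ProperFilter U by exact: ultra_proper.
have /choice[c hc] : forall x, exists c : R, h n x @[n --> U] --> c.
  move=> x; have := @segment_compact R 0 C; rewrite compact_ultra.
  have FU : UltraFilter (h n x @[n --> U]).
    split=> [|K PK UK]; first exact: fmap_proper_filter.
    rewrite eqEsubset; split=> // A KA.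
    have [//|nA] := in_ultra_setVsetC [set n | A (h n x)] UU.
    by have [y [/= ? ?]] := filter_ex (filterI KA (UK (~` A) nA)).
  move=> /(_ _ FU) [|c [_ hc]]; last by exists c.
  by apply: (@filterE _ U) => n; rewrite /preimage /= in_itv /=; exact: hC.
have ceq e : 0 < e -> exists2 d, 0 < d & (forall n (x eta : R * R), `|eta.1| < d -> `|eta.2| < d ->
     `|h n (x + eta : R * R) - h n x| <= e) /\ (forall (x eta : R * R), `|eta.1| < d -> `|eta.2| < d ->
     `|c (x + eta : R * R) - c x| <= e).
  move=> e0; have [d d0 hd] := heq e e0; exists d => //; split => // x eta e1 e2.
  apply: (@closed_cvg _ _ U _ (fun n => `|h n (x + eta : R * R) - h n x|) [set y | y <= e]) => //.
  - by apply: nearW => n; exact: hd.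
  - by apply: cvg_norm; apply: cvgB; exact: hc.
pose xs (j : nat) : R * R := if unpickle j is Some (a, b) then (ratr (a : rat), ratr (b : rat)) else (0, 0).
have /choice[phi hphi] : forall k : nat, exists n, (k <= n)%N /\
    forall j, (j <= k)%N -> `|h n (xs j) - c (xs j)| < k.+1%:R^-1.
  move=> k; have e0 : 0 < k.+1%:R^-1 :> R by rewrite invr_gt0.
  have U1 : U [set n | (k <= n)%N] by apply: oU; exists k.
  have U2 m : U [set n | forall j, (j < m)%N -> `|h n (xs j) - c (xs j)| < k.+1%:R^-1].
    elim: m => [|m IH]; first by apply: filterE.
    have hm : U [set n | `|h n (xs m) - c (xs m)| < k.+1%:R^-1].
      by have /cvgrPdist_lt/(_ _ e0) := hc (xs m); apply: filterS => n; rewrite distrC.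
    apply: filterS (filterI IH hm) => n [h1 h2] j; rewrite ltnS leq_eqVlt => /orP[/eqP ->//|]; exact: h1.
  have [n [n1 n2]] := filter_ex (filterI U1 (U2 k.+1)).
  by exists n; split => // j jk; apply: n2.
exists phi, c; split => [k|x]; first by case: (hphi k).
apply/cvgrPdist_le => e e0; have e30 : 0 < e / 3 by rewrite divr_gt0.
have [d d0 [hd cd]] := ceq _ e30.
have gap (s : R) : exists q : rat, `|s - ratr q| < d.
  have h1 : s - d < s + d by lra.
  have [q] := rat_in_itvoo h1; rewrite in_itv /= => /andP[q1 q2]; exists q.
  by rewrite ltr_norml; apply/andP; split; lra.
have [a ha] := gap x.1; have [b hb] := gap x.2.
pose j := pickle (a, b); have xj : xs j = (ratr a, ratr b) by rewrite /xs /j pickleK.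
pose eta := x - xs j; have xE : x = xs j + eta by rewrite /eta addrC subrK.
have eta1 : `|eta.1| < d by rewrite /eta xj.
have eta2 : `|eta.2| < d by rewrite /eta xj.
near=> k.
have kj : (j <= k)%N by near: k; exists j.
have k3 : k.+1%:R^-1 < e / 3 by near: k; exact: cvgr_lt (@cvg_inv_nat R) _ e30.
have h1 := hd (phi k) (xs j) eta eta1 eta2; have h2 := cd (xs j) eta eta1 eta2.
have [_ h3] := hphi k; have {}h3 := h3 j kj; rewrite -xE in h1 h2.
have -> : c x - h (phi k) x = (c x - c (xs j)) - (h (phi k) (xs j) - c (xs j)) - (h (phi k) x - h (phi k) (xs j)) by ring.
apply: le_trans (ler_normB _ _) _; have h4 := ler_normB (c x - c (xs j)) (h (phi k) (xs j) - c (xs j)).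
have alg (A B D E u : R) : A <= B + D -> D < u -> u < e / 3 -> B <= e / 3 -> E <= e / 3 -> A + E <= e by lra.
exact: alg h4 h3 k3 h2 h1.
Unshelve. all: by end_near. Qed.

End Compactness.

(** * Existence of a maximizer of the dual form *)

Section Maximizer.
Variables (R : realType) (p w k : R).
Hypotheses (hp : 2 < p) (w0 : 0 < w) (k0 : 0 < k).
Notation mu2 := (@sleb2 R).
Notation pl := (measurableTypeR R * measurableTypeR R)%type.
Implicit Types f g h u : pl -> R.
Local Notation r := (cj p).
Local Notation G := (Gr w : pl -> R).
Local Notation M := (dual_max p w k).
Local Notation J := (dual_form w k).
Local Notation TT := (dual_op w k).
Local Notation iG := (green_int w).
Local Notation cls := (dual_ball p).

Lemma cvg_ge_cst (u : nat -> R) a l : u n @[n --> \oo] --> l -> (forall n, a <= u n) -> a <= l.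
Proof.
move=> ul h; rewrite -(cvg_lim (@Rhausdorff R) ul); apply: limr_ge; first exact: cvgP ul.
exact: nearW.
Qed.

Lemma cvg_le_cst (u : nat -> R) a l : u n @[n --> \oo] --> l -> (forall n, u n <= a) -> l <= a.
Proof.
move=> ul h; rewrite -lerN2; apply: (cvg_ge_cst (cvgN ul)) => n; by rewrite lerN2.
Qed.

Lemma pw_lim s (f : nat -> pl -> R) g C : 0 < s -> (forall n, pw mu2 s (f n)) ->
  (forall x, f n x @[n --> \oo] --> g x) -> (forall n, \int[mu2]_x (f n x `^ s) <= C) ->
  pw mu2 s g /\ \int[mu2]_x (g x `^ s) <= C.
Proof.
move=> s0 pf fg If.
have mg : measurable_fun setT g.
  by apply: (measurable_fun_cvg (h := f)) => [n|x _]; [case: (pf n)|exact: fg].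
have g0 x : 0 <= g x.
  by apply: (cvg_ge_cst (fg x)) => n; case: (pf n).
have h : (\int[mu2]_x (g x `^ s)%:E <= C%:E)%E.
  apply: (@fatou_le _ _ R mu2 (fun n x => f n x `^ s)).
  - by move=> n; apply: measurable_pow; case: (pf n).
  - exact: measurable_pow.
  - by move=> n x; exact: powR_ge0.
  - by move=> x; exact: powR_ge0.
  - by apply: aeW => x; apply: powR_cvg => // n; case: (pf n).
  - by move=> n; rewrite L1_fin ?lee_fin//; case: (pf n).
have L : L1 mu2 (fun x => g x `^ s).
  by apply: L1_ge0 => [|x|]; [exact: measurable_pow|exact: powR_ge0|apply: le_lt_trans h _; rewrite ltry].
by split; [split|rewrite -lee_fin -(L1_fin L)].
Qed.

Lemma pw_heat_sub t e (y : R * R) : 0 < e -> 1 <= t -> pw mu2 t (fun x => heat e (x - y : R * R)).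
Proof.
move=> e0 t1; have mh := measurable_heat_sub e y.
have p1 : pw mu2 1 (fun x => heat e (x - y : R * R)).
  split => // [x|]; first exact: heat_ge0.
  have := mpres_L1 (mpres_subr y) (L1_heat e0); apply: L1_eq => x /=.
  by rewrite powRr1 ?heat_ge0.
by have [] := pw_interp ltr01 t1 (fun x : pl => heat_le ((x : R * R) - y) e0) p1.
Qed.

Lemma iG_ge0 f : (forall x, 0 <= f x) -> 0 <= iG f.
Proof. by move=> f0; apply: Int_ge0 => x; rewrite mulr_ge0 ?Green_ge0. Qed.

Lemma cG_shift f (y : R * R) x : measurable_fun setT f ->
  cG w (fun z => f (z + y : R * R)) x = cG w f (x + y : R * R).
Proof.
move=> mf; rewrite !cGE /conv; have mG : measurable_fun setT (fun z : pl => Gr w (x + y - z : R * R) * f z).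
  apply: measurable_funM => //; apply: (@measurableT_comp _ _ _ _ _ _ (Gr w : pl -> R)).
    exact: measurable_Green.
  exact: (mpres_subl (x + y : R * R)).1.
rewrite -(@mpres_Int _ pl R mu2 _ _ (mpres_subr (- y)) mG); apply: eq_Rintegral => z _.
by rewrite opprK; congr (Gr w _ * _); rewrite opprD addrACA subrr addr0.
Qed.

(* Comparing a competitor with its translate centred at [y]: if [f] is nearly
   optimal, the potential of [f] cannot be much larger at [y] than at the origin. *)
Lemma cG_sq_le f y : cls f -> cG w f y ^+ 2 <= iG f ^+ 2 + k * (M - J f f).
Proof.
move=> cf; have [pf sf If] := cf; have [mf f0 fi] := pf; pose s x := f (x + y : R * R).
have sy : mpres mu2 (fun z : pl => (z + y : R * R) : pl).
  by have := @mpres_subr R (- y); rewrite (_ : (fun z : pl => _) = (fun z => z - - y))//; apply/funext => z; rewrite opprK.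
have Is g : measurable_fun setT g -> \int[mu2]_x (g (x + y : R * R)) = \int[mu2]_x g x.
  by move=> mg; exact: (@mpres_Int _ pl R mu2 _ g sy mg).
have cs : cls s.
  split; first exact: pw_shift.
    by split; [exact: measurableT_comp mf sy.1|exact: mpres_L1 sy sf.2].
  by rewrite (Is (fun x => f x `^ r) (L1_meas fi)).
have := J_le_MM hp w0 k0 cs.
have e1 : iG s = cG w f y.
  by rewrite iG_cG ?cG_shift ?add0r//; case: cs => -[].
have e2 : \int[mu2]_x (s x * cG w s x) = \int[mu2]_x (f x * cG w f x).
  rewrite -(Is (fun x => f x * cG w f x)); last exact: L1_meas (sq_mul sf (sq_cG w0 sf)).
  by apply: eq_Rintegral => x _; rewrite /s cG_shift.
rewrite /dual_form e1 e2; move: (Rintegral _ _ _) (iG f) (cG w f y) => A i c h.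
rewrite -!expr2 in h *; rewrite -[leLHS](_ : k * (k^-1 * c ^+ 2) = _); last by rewrite mulVKf// gt_eqF.
have -> : i ^+ 2 + k * (M - (A + k^-1 * i ^+ 2)) = k * (M - A) by field; rewrite gt_eqF.
by apply: ler_wpM2l; [exact: ltW|rewrite lerBrDl].
Qed.

(** If the potential is uniformly small, only the charge term of [J] can be large; this is used to
    rule out a vanishing limit. *)
Lemma J_small f d s : 0 < d -> cls f -> (forall x, cG w f x <= s) ->
  J f f <= d `^ (- p) * (s `^ (p - r) * GI w `^ r) + d `^ r + k^-1 * iG f ^+ 2.
Proof.
move=> d0 cf hs; have [pf sf If] := cf; have [pc Ic] := pw_cG hp w0 pf.
rewrite /dual_form -expr2 lerD2r.
have [pcp Ip] := pw_interp (r_gt0 hp) (r_le_p hp) hs pc.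
have -> : \int[mu2]_x (f x * cG w f x) = \int[mu2]_x (cG w f x * f x) by apply: eq_Rintegral => x _; exact: mulrC.
apply: le_trans (pw_mul_scaled hp d0 pcp pf) _; apply: lerD.
  rewrite ler_wpM2l ?powR_ge0//; apply: le_trans Ip _; rewrite ler_wpM2l ?powR_ge0//.
  by apply: le_trans Ic _; rewrite ler_piMr ?powR_ge0.
by rewrite ler_piMr ?powR_ge0.
Qed.

Lemma max_seq : exists (f : nat -> pl -> R) (H : pl -> R),
  [/\ forall n, cls (f n), forall n, M - M / 2 * n.+1%:R^-1 < J (f n) (f n) &
      forall x, cG w (f n) x @[n --> \oo] --> H x].
Proof.
have M0 := MM_gt0 hp w0 k0.
(* The tolerance starts at [M / 2], so that all the values of [J] along the sequence exceed
   [M / 2]. *)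
have /choice[f hf] : forall n : nat, exists f, cls f /\ M - M / 2 * n.+1%:R^-1 < J f f.
  move=> n; have e0 : 0 < M / 2 * n.+1%:R^-1 by rewrite mulr_gt0 ?divr_gt0 ?invr_gt0.
  by have [f cf Jf] := MM_approx hp w0 k0 e0; exists f.
have [|e e0|phi [H [h1 h2]]] := @select R (fun n => cG w (f n)) (C1 p w).
- move=> n x; have [cf _] := hf n; rewrite cls_cG// andbT; apply: cG_ge0 => // y.
  by case: cf => -[].
- have [d d0 hd] := cG_equi hp w0 e0; exists d => // n x eta; apply: hd; by case: (hf n) => -[].
exists (f \o phi), H; split => //= n; first by case: (hf (phi n)).
have [_] := hf (phi n); apply: le_lt_trans; rewrite lerD2l lerN2 ler_wpM2l ?divr_ge0 ?(ltW M0)//.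
by rewrite lef_pV2 ?posrE// ler_nat ltnS h1.
Qed.

Lemma max_exists : exists F, [/\ cls F, J F F = M & \int[mu2]_x (F x `^ r) = 1].
Proof.
have M0 := MM_gt0 hp w0 k0; have r0 := r_gt0 hp; have r1 := r_gt1 hp; have p0 := p_gt0 hp; have r2 := r_lt2 hp.
have tr1 t : r <= t -> 1 <= t by move: r1; lra.
have tr0 t : r <= t -> 0 <= t by move: r1; lra.
have p1 : 0 < p - 1 by move: hp; lra.
have rp2 : r <= (p - 1) * 2 by move: r2 hp; lra.
have pr0 : 0 < p - r by move: r2 hp; lra.
have small (a b : R) : M / 2 < a -> b < M / 8 -> a <= M / 8 + M / 8 + b -> False by move: M0; lra.
have [f [H [cf Jf Hf]]] := max_seq; have k1 : 0 <= k^-1 by rewrite invr_ge0 ltW.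
have pf n : pw mu2 r (f n) by case: (cf n).
have sf n : sq mu2 (f n) by case: (cf n).
have Jf2 n : M / 2 < J (f n) (f n).
  apply: le_lt_trans (Jf n); have h : M / 2 * n.+1%:R^-1 <= M / 2.
    by rewrite ler_piMr ?divr_ge0 ?(ltW M0)// invf_le1// ler1n.
  have alg (a : R) : a <= M / 2 -> M / 2 <= M - a by lra.
  exact: alg.
have J0 n : 0 < J (f n) (f n) by apply: lt_trans (Jf2 n); rewrite divr_gt0.
have ec : M / 2 * n.+1%:R^-1 @[n --> \oo] --> (0 : R).
  by rewrite -[X in _ --> X](mulr0 (M / 2)); apply: cvgMr; exact: cvg_inv_nat.
have ec2 (a : R) : a * (2 * (M / 2 * n.+1%:R^-1)) @[n --> \oo] --> (0 : R).
  rewrite (_ : (fun n => _) = (fun n => a * 2 * (M / 2 * n.+1%:R^-1))); last first.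
    by apply/funext => n; rewrite -[RHS]mulrA.
  by rewrite -[X in _ --> X](mulr0 (a * 2)); exact: cvgMr.
have gap n : M - J (f n) (f n) <= M / 2 * n.+1%:R^-1 by rewrite lerBlDl -lerBlDr ltW.
pose u n := TT (f n); pose N n := pnorm p (u n); pose I := H 0.
have ic : iG (f n) @[n --> \oo] --> I.
  by rewrite (_ : (fun n => _) = (fun n => cG w (f n) 0)) //; apply/funext => n; rewrite iG_cG//; case: (pf n).
pose U x := H x + k^-1 * I * G x.
have uU x : u n x @[n --> \oo] --> U x.
  by apply: cvgD => //; apply: cvgMl; apply: cvgMr.
have NM : N n @[n --> \oo] --> M.
  apply: (@squeeze_cvgr _ _ _ _ (fun n => M - M / 2 * n.+1%:R^-1) (fun=> M)).
  - apply: nearW => n; have [h1 h2 _] := NN_step hp w0 k0 (cf n) (J0 n).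
    by rewrite h2 andbT (le_trans _ h1)// ltW.
  - by rewrite -[X in _ --> X]subr0; apply: cvgB => //; exact: cvg_cst.
  - exact: cvg_cst.
have N0 n : 0 < N n by have [h1 _ _] := NN_step hp w0 k0 (cf n) (J0 n); exact: lt_le_trans h1.
pose F x := (U x / M) `^ (p - 1).
have u0 n x : 0 <= u n x by have [_ + _] := pw_TT hp w0 k0 (pf n) (r_le_p hp); exact.
have dF x : du p (u n) x @[n --> \oo] --> F x.
  apply: powR_cvg => // [n|]; first by apply: divr_ge0; [exact: u0|exact: ltW (N0 n)].
  by apply: cvgM => //; apply: cvgV => //; rewrite gt_eqF.
have cd n : cls (du p (u n)) by apply: cls_du => //; exact: N0.
have [pF IF] : pw mu2 r F /\ \int[mu2]_x (F x `^ r) <= 1.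
  by apply: (pw_lim r0 _ dF) => n; case: (cd n).
have [pH IH] : pw mu2 r H /\ \int[mu2]_x (H x `^ r) <= GI w `^ r.
  apply: (pw_lim r0 _ Hf) => n; have [pc Ic] := pw_cG hp w0 (pf n) => //.
  by apply: le_trans Ic _; apply: ler_piMr; [exact: powR_ge0|case: (cf n)].
have HC x : H x <= C1 p w.
  by apply: (cvg_le_cst (Hf x)) => n; exact: cls_cG.
have I0 : 0 <= I by have [_ + _] := pH; exact.
have pU t : r <= t -> pw mu2 t U.
  move=> rt; have [pt _] := pw_interp r0 rt HC pH.
  apply: pwD => //; first exact: tr0.
  by apply: pwZ; [rewrite mulr_ge0|apply: pw_Gr => //; exact: tr1].
have [mU U0 _] := pU r (lexx _).
have cF : cls F.
  split => //; apply: pw2_sq; split; [by case: pF|by case: pF|].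
  have M1 : 0 <= M^-1 by rewrite invr_ge0 ltW.
  have [_ _ L] := pwZ M1 (pU _ rp2).
  by apply: L1_eq L => x; rewrite /F -powRrM mulrC.
have sF : sq mu2 F by case: cF.
have sU : sq mu2 U by apply: pw2_sq; apply: pU; exact: ltW (r_lt2 hp).
have sT : sq mu2 (TT F) by apply: pw2_sq; exact: pw_TT hp w0 k0 _ _ pF (ltW r2).
(* The limit [U] of [T f_n] is identified with [T F]. Against a Gaussian [g], [J g (f n)] tends to
   [\int g U] by domination, [J g] of the dual functions tends to [\int g T F] by weak convergence,
   and the difference tends to 0 by Cauchy-Schwarz for [J] and the third bound of [NN_step]. *)
have TU : {ae mu2, forall x : pl, U x - TT F x = 0}.
  apply: heat_inj => [|e y e0]; first exact: sqB.
  pose g (x : pl) := heat e (x - y : R * R); have pg t : 1 <= t -> pw mu2 t g by exact: pw_heat_sub.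
  have sg : sq mu2 g by exact: sq_heat_sub.
  have rg := pg _ (ltW r1).
  have L1' := sq_mul sg sU; have L2' := sq_mul sg sT.
  have -> : \int[mu2]_x ((U x - TT F x) * heat e (x - y : R * R)) = \int[mu2]_x (g x * U x) - \int[mu2]_x (g x * TT F x).
    by rewrite -(IntB L1' L2'); apply: eq_Rintegral => x _; rewrite /g; ring.
  apply/eqP; rewrite subr_eq0; apply/eqP.
  have c1 : J g (f n) @[n --> \oo] --> \int[mu2]_x (g x * U x).
    have m1 n : measurable_fun setT (fun x => g x * u n x).
      by apply: measurable_funM; [case: sg|case: (pw_TT hp w0 k0 (pf n) (r_le_p hp))].
    have m3 : L1 mu2 (fun x => C1 p w * g x + k^-1 * C1 p w * (g x * G x)).
      apply: L1D; [apply: L1Z; have [_ _] := pg 1 (lexx _)|exact: L1Z (sq_mul sg (sq_Green w0))].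
      by apply: L1_eq => x; rewrite powRr1// heat_ge0.
    have m4 n x : `|g x * u n x| <= C1 p w * g x + k^-1 * C1 p w * (g x * G x).
      rewrite ger0_norm; last by apply: mulr_ge0; [exact: heat_ge0|exact: u0].
      rewrite /u /dual_op mulrDr (mulrC (C1 p w)); apply: lerD.
        by apply: ler_wpM2l; [exact: heat_ge0|have := cls_cG hp w0 x (cf n); exact].
      rewrite mulrCA; apply: ler_wpM2r; first by apply: mulr_ge0; [exact: heat_ge0|exact: Green_ge0].
      by apply: ler_wpM2l => //; have /andP[] := cls_iG hp w0 (cf n).
    have m5 : {ae mu2, forall x : pl, g x * u n x @[n --> \oo] --> g x * U x}.
      by apply: aeW => x; exact: cvgMr.
    have [_] := dct m1 (L1_meas L1') m3 m4 m5.
    rewrite (_ : (fun n => \int[mu2]_x _) = (fun n => J g (f n)))//.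
    by apply/funext => n; rewrite -(J_TT k w0 (sf n) sg).
  have c2 : J g (du p (u n)) @[n --> \oo] --> \int[mu2]_x (g x * TT F x).
    rewrite (J_TT k w0 sF sg) (JC k w0 sg sF) -(J_TT k w0 sg sF).
    rewrite [X in _ --> X](_ : _ = \int[mu2]_x (TT g x * F x)); last by apply: eq_Rintegral => x _; exact: mulrC.
    rewrite (_ : (fun n => _) = (fun n => \int[mu2]_x (TT g x * du p (u n) x))).
      have := weak_cvg hp (fun n => let: And3 a _ _ := cd n in a) (fun n => let: And3 _ _ c := cd n in c)
        pF IF (aeW _ dF) (pw_TT hp w0 k0 rg (r_le_p hp)); exact.
    apply/funext => n; have [_ sd _] := cd n.
    by rewrite (JC k w0 sg sd) -(J_TT k w0 sg sd); apply: eq_Rintegral => x _; exact: mulrC.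
  have c3 : J g (f n) - J g (du p (u n)) @[n --> \oo] --> (0 : R).
    apply/norm_cvg0P; apply: (@squeeze_cvgr _ _ _ _ (fun=> 0) (fun n => Num.sqrt (J g g * (2 * (M / 2 * n.+1%:R^-1))))).
    - apply: nearW => n; rewrite normr_ge0/=; have [_ sd _] := cd n.
      rewrite -sqrtr_sqr ler_wsqrtr//.
      have -> : J g (f n) - J g (du p (u n)) = J g (fun x => f n x - du p (u n) x).
        have e2 : (fun x => f n x - du p (u n) x) = (fun x => f n x + -1 * du p (u n) x) by apply/funext => x; rewrite mulN1r.
        have s2 : sq mu2 (fun x => f n x + -1 * du p (u n) x) by rewrite -e2; exact: sqB.
        by rewrite e2 (JC k w0 sg s2) (J_lin k w0 (-1) (sf n) sd sg) (JC k w0 sg (sf n)) (JC k w0 sg sd) mulN1r.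
      apply: le_trans (J_CS w0 k0 sg (sqB (sf n) sd)) _; rewrite ler_wpM2l ?J_ge0//.
      have [_ _ h] := NN_step hp w0 k0 (cf n) (J0 n); apply: le_trans h _.
      by rewrite ler_pM2l.
    - exact: cvg_cst.
    - rewrite -[X in _ --> X](@sqrtr0 R); apply: cvg_comp; last exact: sqrt_continuous.
      exact: ec2.
  have c4 : J g (f n) - J g (du p (u n)) @[n --> \oo] --> \int[mu2]_x (g x * U x) - \int[mu2]_x (g x * TT F x) by exact: cvgB.
  by apply/eqP; rewrite -subr_eq0; apply/eqP; exact: (cvg_unique _ c4 c3).
have UF x : F x * U x = M * F x `^ r.
  have [_ _ _ pr] := cjP hp; rewrite /F -powRrM pr -(mulr_powRB1 _ p0) ?divr_ge0 ?(ltW M0)//.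
  by rewrite [M * _]mulrA [M * _]mulrC divfK ?gt_eqF// mulrC.
have [_ _ Fi] := pF.
have JF : J F F = M * \int[mu2]_x (F x `^ r).
  rewrite -(IntZ _ Fi) -(J_TT k w0 sF sF); apply: Int_ae.
  - exact: L1_meas (sq_mul sF sT).
  - exact: L1_meas (L1Z M Fi).
  - by apply: filterS TU => x /eqP; rewrite subr_eq0 => /eqP <-; exact: UF.
(* Write A for the integral of [F^r]. Then [J F F = M A], while [J_le] bounds it by [M A^(2/r)] with
   [2 / r > 1]; together with A <= 1 this leaves A = 1 or A = 0. *)
have [IF0|IF0] := ltP 0 (\int[mu2]_x (F x `^ r)).
  have IF1 : \int[mu2]_x (F x `^ r) = 1.
    apply/eqP; rewrite eq_le IF/= leNgt; apply/negP => IFl.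
    have := J_le hp w0 k0 pF sF; rewrite JF ler_pM2l//.
    move: IF0 IFl; move: (Rintegral _ _ _) => A A0 A1; rewrite leNgt => /negP; apply.
    have e1 : 1 < 2 / r by rewrite ltr_pdivlMr// mul1r r_lt2.
    rewrite -(mulr_powRB1 (ltW A0)) ?(lt_trans _ e1)// gtr_pMr//.
    have o1 : (1 : R) `^ (2 / r - 1) = 1 by rewrite powR1.
    have := @gt0_ltr_powR _ (2 / r - 1) _ A 1; rewrite o1; apply; rewrite ?nnegrE ?subr_gt0 ?ler01 ?(ltW A0)//.
  by exists F; split => //; rewrite JF IF1 mulr1.
(* If [F] vanishes then so does [U], hence the limit [I] of the charges. By [cG_sq_le] the
   potentials are then uniformly small, against [J > M / 2]. *)
exfalso; have IFz : \int[mu2]_x (F x `^ r) = 0.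
  by apply/le_anti; rewrite IF0/= Int_ge0// => x; exact: powR_ge0.
have I00 : I = 0.
  apply: contrapT => In0; apply: (@ae_false R).
  apply: filterS2 (Int_eq0_ae Fi (fun x => powR_ge0 _ _) IFz) (ae_neq0 R) => x /powR_eq0_eq0/powR_eq0_eq0 h x0.
  have Ip : 0 < I by rewrite lt_def I0 andbT; apply/eqP.
  have : 0 < U x / M.
    rewrite divr_gt0//; apply: ltr_wpDl; first by case: pH.
    by rewrite !mulr_gt0 ?invr_gt0// Green_gt0.
  by rewrite h ltxx.
(* [d] and then [s] are chosen so that the first two terms of the bound in [J_small] are at most
   [M / 8] each. *)
pose d := (M / 8) `^ r^-1; have M8 : 0 < M / 8 by rewrite divr_gt0.
have d0 : 0 < d by rewrite powR_gt0.
have dr : d `^ r = M / 8 by rewrite -powRrM mulVf ?gt_eqF// powRr1// ltW.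
pose s := (M / 8 / (d `^ (- p) * GI w `^ r)) `^ (p - r)^-1.
have D0 : 0 < d `^ (- p) * GI w `^ r by rewrite mulr_gt0 ?powR_gt0// GI_gt0.
have s0 : 0 < s by apply: powR_gt0; exact: divr_gt0.
have sE : d `^ (- p) * (s `^ (p - r) * GI w `^ r) = M / 8.
  rewrite /s -powRrM mulVf ?gt_eqF// powRr1 ?ltW ?divr_gt0//.
  by rewrite mulrCA divfK// gt_eqF.
have i2 : iG (f n) ^+ 2 @[n --> \oo] --> (0 : R).
  by rewrite -[X in _ --> X](mulr0 0) -I00; under eq_fun do rewrite expr2; apply: cvgM.
have c5 : iG (f n) ^+ 2 + k * (M / 2 * n.+1%:R^-1) @[n --> \oo] --> (0 : R).
  by rewrite -[X in _ --> X]addr0 -[X in _ + X](mulr0 k); apply: cvgD => //; exact: cvgMr.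
have c6 : k^-1 * iG (f n) ^+ 2 @[n --> \oo] --> (0 : R).
  by rewrite -[X in _ --> X](mulr0 k^-1); exact: cvgMr.
have s20 : 0 < s ^+ 2 by rewrite exprn_gt0.
have [n [n1 n2]] : exists n, iG (f n) ^+ 2 + k * (M / 2 * n.+1%:R^-1) < s ^+ 2 /\ k^-1 * iG (f n) ^+ 2 < M / 8.
  exact: filter_ex (filterI (cvgr_lt _ c5 _ s20) (cvgr_lt _ c6 _ M8)).
have hs x : cG w (f n) x <= s.
  rewrite -(ler_pXn2r (_ : (0 < 2)%N)) ?nnegrE ?(ltW s0)//; last by apply: cG_ge0 => //; case: (pf n).
  apply: le_trans (cG_sq_le x (cf n)) (le_trans _ (ltW n1)).
  by rewrite lerD2l ler_wpM2l// ltW.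
have := J_small d0 (cf n) hs; rewrite sE dr; exact: small (Jf2 n) n2.
Qed.

End Maximizer.

(** * From complex functions and the given notions to real and imaginary parts *)

Section Bridge.
Variable R : realType.
Notation mu2 := (@sleb2 R).
Notation pl := (measurableTypeR R * measurableTypeR R)%type.
Implicit Types (v u : R * R -> R[i]) (z : R[i]).

Definition cre v : pl -> R := fun x => complex.Re (v x).
Definition cim v : pl -> R := fun x => complex.Im (v x).
Definition cab v : pl -> R := fun x => cabs (v x).

Lemma cabs_sqr z : cabs z ^+ 2 = complex.Re z ^+ 2 + complex.Im z ^+ 2.
Proof. by case: z => a b; rewrite /cabs /= sqr_sqrtr// addr_ge0 ?sqr_ge0. Qed.

Lemma cabs_ge0 z : 0 <= cabs z.
Proof. by case: z => a b; rewrite /cabs /= sqrtr_ge0. Qed.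

Lemma cabs_eq0 z : cabs z = 0 -> z = 0.
Proof.
case: z => a b h; have := cabs_sqr (a +i* b); rewrite h expr0n /= => /esym/eqP.
by rewrite paddr_eq0 ?sqr_ge0// !sqrf_eq0 => /andP[/eqP -> /eqP ->].
Qed.

Lemma powR2 (a : R) : 0 <= a -> a `^ 2 = a ^+ 2.
Proof. by move=> a0; rewrite -[2]/(2%:R) powR_mulrn. Qed.

Lemma measurable_cab v : cmeasurable v -> measurable_fun setT (cab v).
Proof.
move=> [mr mi]; have -> : cab v = fun x => Num.sqrt (cre v x ^+ 2 + cim v x ^+ 2).
  by apply/funext => x; rewrite /cab /cre /cim; case: (v x).
by apply: (@measurableT_comp _ _ _ _ _ _ (@Num.sqrt R) _ _ (@measurable_sqrt R)); apply: measurable_funD; exact: measurable_funX.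
Qed.

Lemma LpnormE s v : 0 < s -> L1 mu2 (fun x => cab v x `^ s) ->
  Lpnorm s v = (\int[mu2]_x (cab v x `^ s)) `^ s^-1.
Proof.
move=> s0 L; rewrite /Lpnorm leb2E unlock /=.
under eq_integral do rewrite ger0_norm ?cabs_ge0//.
by rewrite L1_fin.
Qed.

Lemma Lpnorm_pow s v : 0 < s -> L1 mu2 (fun x => cab v x `^ s) ->
  Lpnorm s v `^ s = \int[mu2]_x (cab v x `^ s).
Proof.
move=> s0 L; rewrite LpnormE// -powRrM mulVf ?powRr1 ?gt_eqF//.
by apply: Int_ge0 => x; exact: powR_ge0.
Qed.

Lemma L2P v : L2 v <-> sq mu2 (cre v) /\ sq mu2 (cim v).
Proof.
have nE : ('N[ @leb2 R ]_2%:E [ EFin \o (fun x => cabs (v x)) ] =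
    (\int[mu2]_x (cre v x ^+ 2 + cim v x ^+ 2)%:E) `^ 2^-1)%E.
  rewrite leb2E unlock /=; congr (_ `^ _)%E; apply: eq_integral => x _.
  by rewrite ger0_norm ?cabs_ge0// powR2 ?cabs_ge0// cabs_sqr.
rewrite /L2 /finite_norm nE; split=> [[[mr mi] h]|[[mr Lr] [mi Li]]].
  have L : L1 mu2 (fun x => cre v x ^+ 2 + cim v x ^+ 2).
    apply: L1_ge0 => [|x|]; first by apply: measurable_funD; exact: measurable_funX.
      by rewrite addr_ge0 ?sqr_ge0.
    exact: (lty_poweRy (_ : 2^-1 != 0 :> R) h).
  split; (split => //; apply: L1_le L; first exact: measurable_funX) => x;
    by rewrite ger0_norm ?sqr_ge0// ?lerDl ?lerDr sqr_ge0.
split=> //; rewrite (L1_fin (L1D Lr Li)) poweR_EFin ltry//.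
Qed.

Lemma Lpnorm2 v : L2 v -> Lpnorm 2 v ^+ 2 = \int[mu2]_x (cre v x ^+ 2) + \int[mu2]_x (cim v x ^+ 2).
Proof.
move=> /L2P[sr si]; rewrite -(IntD sr.2 si.2).
have e x : cab v x `^ 2 = cre v x ^+ 2 + cim v x ^+ 2 by rewrite powR2 ?cabs_ge0// cabs_sqr.
have L : L1 mu2 (fun x => cab v x `^ 2) by apply: L1_eq (L1D sr.2 si.2) => x; rewrite e.
have n0 : 0 <= Lpnorm 2 v by rewrite LpnormE// powR_ge0.
by rewrite -powR2// Lpnorm_pow//; apply: eq_Rintegral => x _; rewrite e.
Qed.

Lemma regular_part_re l (q : R[i]) v : cre (regular_part l q v) = fun x => cre v x - complex.Re q * Gr l x.
Proof.
apply/funext => x; rewrite /cre /regular_part GrE; case: q (v x) => a b [c d] /=.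
by rewrite mulr0 subr0.
Qed.

Lemma regular_part_im l (q : R[i]) v : cim (regular_part l q v) = fun x => cim v x - complex.Im q * Gr l x.
Proof.
apply/funext => x; rewrite /cim /regular_part GrE; case: q (v x) => a b [c d] /=.
by rewrite mulr0 add0r.
Qed.

Lemma H1_rdec l (q : R[i]) v g1 g2 : H1_gradient (regular_part l q v) g1 g2 ->
  rdec l (complex.Re q) (cre v) (fun i => cre (if i then g1 else g2)) /\
  rdec l (complex.Im q) (cim v) (fun i => cim (if i then g1 else g2)).
Proof.
move=> [/L2P[sr si] /L2P[s1r s1i] /L2P[s2r s2i] w1 w2].
have [w1r w1i] := @weak_partial_wd R _ _ true w1; have [w2r w2i] := @weak_partial_wd R _ _ false w2.
rewrite /rdec -regular_part_re -regular_part_im; split; split=> // -[]; split => //.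
Qed.

Lemma form_value_rform a l (q : R[i]) v g1 g2 : 0 < l -> H1_gradient (regular_part l q v) g1 g2 ->
  (Lpnorm 2 g1 ^+ 2 + Lpnorm 2 g2 ^+ 2)
          + l * (Lpnorm 2 (regular_part l q v) ^+ 2 - Lpnorm 2 v ^+ 2)
          + (a + theta l) * cabs q ^+ 2 =
  rform a l (complex.Re q) (cre v) (fun i => cre (if i then g1 else g2)) +
  rform a l (complex.Im q) (cim v) (fun i => cim (if i then g1 else g2)).
Proof.
move=> l0 H; have [dr di] := H1_rdec H; case: H => h0 h1 h2 _ _.
have hv : L2 v by apply/L2P; split; [exact: rdec_sq dr|exact: rdec_sq di].
rewrite !Lpnorm2// cabs_sqr /rform /En (regular_part_re l q v) (regular_part_im l q v).
have alg (A1 A2 B1 B2 C1 C2 D1 D2 x y : R) : A1 + A2 + (B1 + B2) + l * (C1 + C2 - (D1 + D2)) + (a + theta l) * (x + y) =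
  A1 + B1 + l * C1 - l * D1 + (a + theta l) * x + (A2 + B2 + l * C2 - l * D2 + (a + theta l) * y) by ring.
exact: alg.
Qed.

Lemma energy_dec v l : energy_space v -> 0 < l ->
  exists a b g h, rdec l a (cre v) g /\ rdec l b (cim v) h.
Proof.
move=> [_ [q [m [m0 [g1 [g2 /H1_rdec[dr di]]]]]]] l0.
have [g [dg _]] := rdec_change 0 m0 l0 dr; have [h [dh _]] := rdec_change 0 m0 l0 di.
by exists (complex.Re q), (complex.Im q), g, h.
Qed.

(** [xget] selects some value of the form: one exists in the energy space, so the default is not
    reached, and all of them agree by [rdec_unique]. *)
Lemma Q_rdec (a : R) v l q1 q2 g h : energy_space v -> 0 < l -> rdec l q1 (cre v) g -> rdec l q2 (cim v) h ->
  Q a v = rform a l q1 (cre v) g + rform a l q2 (cim v) h.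
Proof.
move=> [_ [q [m [m0 [g1 [g2 H]]]]]] l0 dg dh; rewrite /Q; case: xgetP => [r _|no].
  move=> [l' [q' [g1' [g2' [l'0 H' ->]]]]]; rewrite (form_value_rform _ l'0 H').
  have [dr di] := H1_rdec H'.
  by have [_ ->] := rdec_unique a l'0 l0 dr dg; have [_ ->] := rdec_unique a l'0 l0 di dh.
by exfalso; apply: (no _); exists m, q, g1, g2; split; [exact: m0|exact: H|].
Qed.

Lemma H1_charge l (q : R[i]) v m q1 q2 g h : 0 < l -> 0 < m -> H1 (regular_part l q v) ->
  rdec m q1 (cre v) g -> rdec m q2 (cim v) h -> q = q1 +i* q2.
Proof.
move=> l0 m0 [g1 [g2 /H1_rdec[dr di]]] dg dh.
have [e1 _] := rdec_unique 0 l0 m0 dr dg; have [e2 _] := rdec_unique 0 l0 m0 di dh.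
by rewrite -e1 -e2; case: q {dr di e1 e2}.
Qed.

Lemma rform_En (a : R) l q (v : pl -> R) g : rform a l q v g + l * \int[mu2]_x (v x ^+ 2) =
  En l (fun x : pl => v x - q * Gr l x) g + (a + theta l) * q ^+ 2.
Proof. by rewrite /rform addrAC subrK. Qed.

Lemma re_mulC z (a : R) : complex.Re (z * a%:C) = complex.Re z * a.
Proof. by case: z => x y /=; rewrite mulr0 subr0. Qed.

Lemma im_mulC z (a : R) : complex.Im (z * a%:C) = complex.Im z * a.
Proof. by case: z => x y /=; rewrite mulr0 add0r. Qed.

(** The derivatives must be tested on all test functions and not on tensor products alone, hence
    [wd_test] combined with [cG_grad]. *)
Lemma H1_cG l z s u : 0 < l -> sq mu2 s -> (forall x, u x = z * (cG l s x)%:C) -> H1 u.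
Proof.
move=> l0 ss hu; have sc := sq_cG l0 ss.
exists (fun x => z * (ck true l s x)%:C), (fun x => z * (ck false l s x)%:C).
have L (t : pl -> R) : sq mu2 t -> L2 (fun x => z * (t x)%:C).
  by move=> st; apply/L2P; split; rewrite /cre /cim; under eq_fun do rewrite ?re_mulC ?im_mulC; exact: sqZ.
have -> : u = (fun x => z * (cG l s x)%:C) by apply/funext.
have W i : weak_partial (ei R i) (fun x => z * (cG l s x)%:C) (fun x => z * (ck i l s x)%:C).
  move=> psi tp; have [s1 s2 w] := wd_test i tp; have k := cG_grad l0 ss s1 s2 w.
  rewrite !cintegral_real.
  have e c (f g : pl -> R) : sq mu2 f -> sq mu2 g -> \int[mu2]_x (c * f x * g x) = c * \int[mu2]_x (f x * g x).
    by move=> sf sg; rewrite -(IntZ _ (sq_mul sf sg)); apply: eq_Rintegral => x _; rewrite mulrA.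
  have E t g : sq mu2 t -> sq mu2 g ->
     (\int[mu2]_x (complex.Re (z * (t x)%:C) * g x)) +i* (\int[mu2]_x (complex.Im (z * (t x)%:C) * g x)) =
     (complex.Re z * \int[mu2]_x (t x * g x)) +i* (complex.Im z * \int[mu2]_x (t x * g x)).
    move=> st sg; rewrite -!e//; congr (_ +i* _); apply: eq_Rintegral => x _; by rewrite ?re_mulC ?im_mulC.
  rewrite (E _ _ sc s2) (E _ _ (sq_ck i l0 ss) s1) k.
  by rewrite /GRing.opp /= !mulrN.
split; [exact: L|exact: L (sq_ck true l0 ss)|exact: L (sq_ck false l0 ss)|exact: (W true)|exact: (W false)].
Qed.

End Bridge.

(** * The Sobolev inequality of the form, by duality *)

Section Sobolev.
Variables (R : realType) (p w k : R).
Hypotheses (hp : 2 < p) (w0 : 0 < w) (k0 : 0 < k).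
Notation mu2 := (@sleb2 R).
Notation pl := (measurableTypeR R * measurableTypeR R)%type.
Implicit Types (f v F m : pl -> R) (g h : bool -> pl -> R).
Local Notation r := (cj p).
Local Notation G := (Gr w : pl -> R).
Local Notation M := (dual_max p w k).
Local Notation J := (dual_form w k).
Local Notation TT := (dual_op w k).
Local Notation iG := (green_int w).

(** With [k = alpha + theta w] this is the form plus [w] times the squared L^2 norm, for a real
    function of charge [q]; see [rform_En]. *)
Definition Aq q v g := En w (fun x : pl => v x - q * Gr w x) g + k * q ^+ 2.

Lemma Aq_ge0 q v g : 0 <= Aq q v g.
Proof. by rewrite addr_ge0 ?En_ge0// mulr_ge0 ?sqr_ge0// ltW. Qed.

(** [TT f], whose charge is [k^-1 * iG f], represents [v |-> \int f v] for the form, and its own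
    value is [J f f]. *)
Lemma Aq_sub c q v g f : rdec w q v g -> sq mu2 f ->
  rdec w (q - c * (k^-1 * iG f)) (fun x => v x - c * TT f x) (fun i x => g i x - c * ck i w f x) /\
  Aq (q - c * (k^-1 * iG f)) (fun x => v x - c * TT f x) (fun i x => g i x - c * ck i w f x) =
  Aq q v g - 2 * c * \int[mu2]_x (f x * v x) + c ^+ 2 * J f f.
Proof.
move=> d sf; have sG := sq_Green w0; have sv := rdec_sq w0 d; have sc := sq_cG w0 sf.
have e : (fun x : pl => v x - c * TT f x - (q - c * (k^-1 * iG f)) * Gr w x) =
    (fun x : pl => v x - q * Gr w x + - c * cG w f x).
  by apply/funext => x; rewrite /dual_op; ring.
have eg : (fun i x => g i x - c * ck i w f x) = (fun i x => g i x + - c * ck i w f x).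
  by apply/funext => i; apply/funext => x; rewrite mulNr.
rewrite /rdec /Aq e eg; split; first exact: rH1_lin d (rH1_cG w0 sf).
rewrite (En_add_cG (- c) w0 d sf).
have -> : \int[mu2]_x (f x * v x) = \int[mu2]_x ((v x - q * Gr w x) * f x) + q * iG f.
  rewrite -(IntZ q (sq_mul sf sG)) -(IntD (sq_mul d.1 sf) (L1Z q (sq_mul sf sG))).
  by apply: eq_Rintegral => x _; ring.
rewrite /dual_form; have kn0 : k != 0 by rewrite gt_eqF.
have alg (E B K i : R) : E + 2 * - c * B + (- c) ^+ 2 * K + k * (q - c * (k^-1 * i)) ^+ 2 =
   E + k * q ^+ 2 - 2 * c * (B + q * i) + c ^+ 2 * (K + k^-1 * (i * i)) by field.
exact: alg.
Qed.

Lemma duality q1 q2 v1 v2 g h f1 f2 : rdec w q1 v1 g -> rdec w q2 v2 h -> sq mu2 f1 -> sq mu2 f2 ->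
  (\int[mu2]_x (f1 x * v1 x) + \int[mu2]_x (f2 x * v2 x)) ^+ 2 <=
  (J f1 f1 + J f2 f2) * (Aq q1 v1 g + Aq q2 v2 h).
Proof.
move=> d1 d2 s1 s2; apply: quad_discr => [|t]; first by rewrite addr_ge0// J_ge0.
have [_ e1] := Aq_sub t d1 s1; have [_ e2] := Aq_sub t d2 s2.
have := addr_ge0 (Aq_ge0 (q1 - t * (k^-1 * iG f1)) (fun x => v1 x - t * TT f1 x) (fun i x => g i x - t * ck i w f1 x))
  (Aq_ge0 (q2 - t * (k^-1 * iG f2)) (fun x => v2 x - t * TT f2 x) (fun i x => h i x - t * ck i w f2 x)).
rewrite e1 e2; move: (Rintegral _ _ _) (Rintegral _ _ _) (J _ _) (J _ _) (Aq _ _ _) (Aq _ _ _) => a b c d e f.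
by congr (_ <= _); ring.
Qed.

(** The common consequence of membership in L^2 and in L^r under which potentials can be handled at
    every point; the nonlinearity of an extremal is at first known only in L^r. *)
Definition Lpt f := forall x, L1 mu2 (fun y => G (x - y : R * R) * f y).

Lemma Lpt_sq f : sq mu2 f -> Lpt f.
Proof.
move=> sf x; apply: sq_mul => //; split.
  exact: measurableT_comp (measurable_Green0 w0) (mpres_subl x).1.
exact: mpres_L1 (mpres_subl x) (sq_Green w0).2.
Qed.

Lemma cG_mod f1 f2 F u1 u2 u x : Lpt f1 -> Lpt f2 -> Lpt F ->
  (forall y, u1 * f1 y + u2 * f2 y <= u * F y) ->
  u1 * cG w f1 x + u2 * cG w f2 x <= u * cG w F x.
Proof.
move=> L1' L2' LF h; have A1 := L1' x; have A2 := L2' x; have A := LF x.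
rewrite !cGE /conv -(IntZ _ A1) -(IntZ _ A2) -(IntZ _ A) -(IntD (L1Z u1 A1) (L1Z u2 A2)).
apply: Int_le => [||y]; [exact: L1D (L1Z u1 A1) (L1Z u2 A2)|exact: L1Z|].
rewrite !(mulrCA _ (Gr w _)) -mulrDr; apply: ler_wpM2l; [exact: Green_ge0|exact: h].
Qed.

Lemma TT_mod f1 f2 F u1 u2 u x : measurable_fun setT f1 -> measurable_fun setT f2 -> measurable_fun setT F ->
  Lpt f1 -> Lpt f2 -> Lpt F ->
  (forall y, u1 * f1 y + u2 * f2 y <= u * F y) ->
  u1 * TT f1 x + u2 * TT f2 x <= u * TT F x.
Proof.
move=> m1 m2 mF L1' L2' LF h; rewrite /dual_op !iG_cG//.
have h1 := cG_mod x L1' L2' LF h; have h2 := cG_mod 0 L1' L2' LF h.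
rewrite [leRHS]mulrDr (_ : u1 * _ + _ = u1 * cG w f1 x + u2 * cG w f2 x + k^-1 * G x * (u1 * cG w f1 0 + u2 * cG w f2 0)); last by ring.
apply: lerD => //; rewrite (_ : u * _ = k^-1 * G x * (u * cG w F 0)); last by ring.
by apply: ler_wpM2l => //; apply: mulr_ge0; [rewrite invr_ge0 ltW|exact: Green_ge0].
Qed.

Lemma cauchy2 (a b c d s t : R) : 0 <= s -> 0 <= t -> a ^+ 2 + b ^+ 2 = s ^+ 2 -> c ^+ 2 + d ^+ 2 = t ^+ 2 ->
  a * c + b * d <= s * t.
Proof.
move=> s0 t0 e1 e2; apply: le_trans (ler_norm _) _.
rewrite -(ler_pXn2r (_ : (0 < 2)%N)) ?nnegrE ?mulr_ge0// real_normK ?num_real// exprMn -e1 -e2.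
by have := sqr_ge0 (a * d - b * c); lra.
Qed.

(** The kernel of [TT] is nonnegative, and the planar vectors [(f1, f2)] at two points have a scalar
    product at most the product of their norms [F]. *)
Lemma J_mod f1 f2 F : sq mu2 f1 -> sq mu2 f2 -> sq mu2 F -> (forall x, 0 <= F x) ->
  (forall x, f1 x ^+ 2 + f2 x ^+ 2 = F x ^+ 2) -> J f1 f1 + J f2 f2 <= J F F.
Proof.
move=> s1 s2 sF F0 e; rewrite -!(J_TT k w0)//.
have sT f : sq mu2 f -> sq mu2 (TT f).
  by move=> sf; apply: sqD; [exact: sq_cG|apply: sqZ; exact: sq_Green].
rewrite -(IntD (sq_mul s1 (sT _ s1)) (sq_mul s2 (sT _ s2))); apply: Int_le => [||x].
- exact: L1D (sq_mul s1 (sT _ s1)) (sq_mul s2 (sT _ s2)).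
- exact: sq_mul (sT _ sF).
- apply: TT_mod; [exact: s1.1|exact: s2.1|exact: sF.1|exact: Lpt_sq|exact: Lpt_sq|exact: Lpt_sq|].
  by move=> y; exact: cauchy2.
Qed.

Definition md v1 v2 : pl -> R := fun x => Num.sqrt (v1 x ^+ 2 + v2 x ^+ 2).

Lemma md_ge0 v1 v2 x : 0 <= md v1 v2 x. Proof. exact: sqrtr_ge0. Qed.

Lemma md_sqr v1 v2 x : md v1 v2 x ^+ 2 = v1 x ^+ 2 + v2 x ^+ 2.
Proof. by rewrite sqr_sqrtr// addr_ge0 ?sqr_ge0. Qed.

Lemma measurable_md v1 v2 : measurable_fun setT v1 -> measurable_fun setT v2 -> measurable_fun setT (md v1 v2).
Proof.
move=> m1 m2; apply: (@measurableT_comp _ _ _ _ _ _ (@Num.sqrt R) _ _ (@measurable_sqrt R)).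
by apply: measurable_funD; exact: measurable_funX.
Qed.

(** Large values are replaced by 0 and not by [n], so that [trunc^s * m = trunc^(s + 1)] for
    [s > 0]. The lower end -1 puts the value 0 inside the half-open interval. *)
Definition trunc m (n : nat) x := m x * ind (-1) n%:R (m x).

Section Trunc.
Variables (m : pl -> R).
Hypotheses (mm : measurable_fun setT m) (m0 : forall x, 0 <= m x).

Lemma truncP n x : trunc m n x = m x /\ m x <= n%:R \/ trunc m n x = 0.
Proof.
rewrite /trunc indE; have [h|_] := boolP (_ && _); last by right; rewrite mulr0.
by left; rewrite mulr1; case/andP: h.
Qed.

Lemma trunc_ge0 n x : 0 <= trunc m n x.
Proof. by rewrite mulr_ge0 ?ind_ge0. Qed.

Lemma trunc_le n x : trunc m n x <= m x.
Proof. by rewrite ler_piMr ?ind_le1. Qed.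

Lemma trunc_len n x : trunc m n x <= n%:R.
Proof. by case: (truncP n x) => [[-> //]|->]; rewrite ler0n. Qed.

Lemma measurable_trunc n : measurable_fun setT (trunc m n).
Proof. by apply: measurable_funM => //; exact: measurableT_comp (measurable_ind _ _) mm. Qed.

Lemma trunc_eventually x : \forall n \near \oo, trunc m n x = m x.
Proof.
near=> n; rewrite /trunc indE (_ : -1 < m x); last by apply: lt_le_trans (m0 x); rewrite ltrN10.
by rewrite (_ : m x <= n%:R) ?mulr1//; near: n; exact: nbhs_infty_ger.
Unshelve. all: by end_near. Qed.

Lemma trunc_cvg x : trunc m n x @[n --> \oo] --> m x.
Proof.
apply: cvg_near_cst; exact: trunc_eventually.
Qed.

Lemma pw_trunc n s t : 0 < s -> s <= t -> pw mu2 s m -> pw mu2 t (trunc m n).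
Proof.
move=> s0 st pm; have ps : pw mu2 s (trunc m n).
  by apply: pw_le (ltW s0) (measurable_trunc n) _ pm => x; rewrite trunc_ge0 trunc_le.
by have [] := pw_interp s0 st (trunc_len n) ps.
Qed.

End Trunc.

Lemma dual_pair v1 v2 n (m := md v1 v2) : sq mu2 v1 -> sq mu2 v2 ->
  let t := trunc m n in
  [/\ sq mu2 (fun x => t x `^ (p - 2) * v1 x), sq mu2 (fun x => t x `^ (p - 2) * v2 x),
      pw mu2 p t & J (fun x => t x `^ (p - 2) * v1 x) (fun x => t x `^ (p - 2) * v1 x) +
        J (fun x => t x `^ (p - 2) * v2 x) (fun x => t x `^ (p - 2) * v2 x) <=
        M * (\int[mu2]_x (t x `^ p)) `^ (2 / r)].
Proof.
move=> s1 s2 t; have mm := measurable_md s1.1 s2.1; have p20 : 0 < p - 2 by move: hp; lra.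
have p10 : 0 < p - 1 by move: hp; lra.
have m0 x : 0 <= m x by exact: md_ge0.
have sm : sq mu2 m by split => //; apply: L1_eq (L1D s1.2 s2.2) => x; rewrite md_sqr.
have pm : pw mu2 2 m by exact: sq_pw2.
have pt s : 2 <= s -> pw mu2 s t by move=> s2'; have := pw_trunc mm m0 n (ltr0Sn R 1) s2' pm; exact.
have mt := measurable_trunc mm n.
have [_ _ e pr] := cjP hp.
have sf v : measurable_fun setT v -> (forall x, `|v x| <= m x) -> sq mu2 (fun x => t x `^ (p - 2) * v x).
  move=> mv hv; apply: (sq_le _ _ (sqZ (n%:R `^ (p - 2)) sm)).
    by apply: measurable_funM => //; exact: measurable_pow.
  move=> x; rewrite normrM (ger0_norm (powR_ge0 _ _)); apply: ler_pM; rewrite ?powR_ge0//.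
  by apply: ge0_ler_powR; rewrite ?nnegrE ?ler0n//; [exact: ltW|exact: trunc_ge0|exact: trunc_len].
have n1 x : `|v1 x| <= m x by rewrite -sqrtr_sqr; apply: ler_wsqrtr; rewrite lerDl sqr_ge0.
have n2 x : `|v2 x| <= m x by rewrite -sqrtr_sqr; apply: ler_wsqrtr; rewrite lerDr sqr_ge0.
have sf1 := sf v1 s1.1 n1; have sf2 := sf v2 s2.1 n2.
pose F x := t x `^ (p - 1); have t0 x : 0 <= t x by exact: trunc_ge0.
have F0 x : 0 <= F x by exact: powR_ge0.
have tF x : t x `^ (p - 2) * m x = F x.
  rewrite /F /t; case: (truncP m n x) => [[-> _]|->]; last by rewrite !powR0 ?mul0r// gt_eqF.
  by rewrite mulrC -(mulr_powRB1 (m0 x) p10); congr (_ * _ `^ _); ring.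
have mF : measurable_fun setT F by exact: measurable_pow.
have pF : pw mu2 r F.
  split => //; have [_ _ L] := pt p (ltW hp); apply: L1_eq L => x; by rewrite /F -powRrM pr.
have sF : sq mu2 F.
  have := sf m mm (fun x => _); rewrite (_ : (fun x => _) = F); last by apply/funext.
  by apply => x; rewrite ger0_norm.
split => //; first exact: pt (ltW hp).
have := J_le hp w0 k0 pF sF; rewrite (_ : \int[mu2]_x (F x `^ r) = \int[mu2]_x (t x `^ p)); last first.
  by apply: eq_Rintegral => x _; rewrite /F -powRrM pr.
apply: le_trans; apply: J_mod => // x.
by rewrite -tF !exprMn -mulrDr md_sqr.
Qed.

Lemma trunc_pair v1 v2 n (m := md v1 v2) x :
  trunc m n x `^ (p - 2) * v1 x * v1 x + trunc m n x `^ (p - 2) * v2 x * v2 x = trunc m n x `^ p.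
Proof.
have p20 : 0 < p - 2 by move: hp; lra.
rewrite -!mulrA -mulrDr -!expr2 -md_sqr -/m; case: (truncP m n x) => [[-> _]|->]; last first.
  by rewrite !powR0 ?mul0r ?gt_eqF// (p_gt0 hp).
rewrite -powR2 ?md_ge0// -powRD; first by congr (_ `^ _); ring.
by apply/implyP; rewrite subrK gt_eqF// (p_gt0 hp).
Qed.

(** Duality is applied to the truncated nonlinearity, for which the integral I of [t^p] is finite:
    I^2 <= M I^(2/r) A can be divided to give I^(2/p) <= M A, uniformly in the truncation level. *)
Lemma Sobolev q1 q2 v1 v2 g h (m := md v1 v2) (A := Aq q1 v1 g + Aq q2 v2 h) :
  rdec w q1 v1 g -> rdec w q2 v2 h ->
  pw mu2 p m /\ \int[mu2]_x (m x `^ p) <= (M * A) `^ (p / 2).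
Proof.
move=> d1 d2; have s1 := rdec_sq w0 d1; have s2 := rdec_sq w0 d2; have M0 := MM_gt0 hp w0 k0.
have mm := measurable_md s1.1 s2.1; have m0 x : 0 <= m x by exact: md_ge0.
have A0 : 0 <= A by rewrite addr_ge0 ?Aq_ge0.
have p0 := p_gt0 hp; have r0 := r_gt0 hp; have [_ _ e _] := cjP hp.
have key n : pw mu2 p (trunc m n) /\ \int[mu2]_x (trunc m n x `^ p) <= (M * A) `^ (p / 2).
  have [sf1 sf2 pt Jt] := dual_pair n s1 s2; split => //.
  have := duality d1 d2 sf1 sf2; rewrite -(IntD (sq_mul sf1 s1) (sq_mul sf2 s2)) -/A.
  have -> : \int[mu2]_x (trunc (md v1 v2) n x `^ (p - 2) * v1 x * v1 x +
     trunc (md v1 v2) n x `^ (p - 2) * v2 x * v2 x) = \int[mu2]_x (trunc m n x `^ p).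
    by apply: eq_Rintegral => x _; exact: trunc_pair.
  move=> h1; have h2 := le_trans h1 (ler_wpM2r A0 Jt); move: h2; rewrite -/m.
  have I0 : 0 <= \int[mu2]_x (trunc m n x `^ p) by apply: Int_ge0 => x; exact: powR_ge0.
  move: I0; move: (Rintegral _ _ _) => I; rewrite le_eqVlt => /orP[/eqP <- _|I0]; first exact: powR_ge0.
  rewrite mulrAC => h2; have c0 : 0 < I `^ (2 / r) by rewrite powR_gt0.
  have h3 : I `^ (2 / p) <= M * A.
    rewrite -(ler_pM2r c0); apply: le_trans h2; rewrite -powRD ?(gt_eqF I0) ?implybT//.
    by rewrite -mulrDr e mulr1 powR2// ltW.
  have -> : I = (I `^ (2 / p)) `^ (p / 2).
    by rewrite -powRrM mulrA divfK ?gt_eqF// divff// powRr1// ltW.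
  by apply: ge0_ler_powR; rewrite ?nnegrE ?powR_ge0 ?divr_ge0 ?(ltW p0)// mulr_ge0// ltW.
by apply: (pw_lim p0 (fun n => (key n).1)) => [x|n]; [exact: trunc_cvg|exact: (key n).2].
Qed.

End Sobolev.

(** * The case of equality: Euler-Lagrange equation and constant phase *)

Section Equality.
Variables (R : realType) (p w k : R).
Hypotheses (hp : 2 < p) (w0 : 0 < w) (k0 : 0 < k).
Notation mu2 := (@sleb2 R).
Notation pl := (measurableTypeR R * measurableTypeR R)%type.
Implicit Types (f v F m : pl -> R) (g h : bool -> pl -> R).
Local Notation r := (cj p).
Local Notation G := (Gr w : pl -> R).
Local Notation M := (dual_max p w k).
Local Notation J := (dual_form w k).
Local Notation TT := (dual_op w k).
Local Notation iG := (green_int w).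
Local Notation Aq := (Aq w k).

Lemma cG_ae f1 f2 x : measurable_fun setT f1 -> measurable_fun setT f2 ->
  {ae mu2, forall y, f1 y = f2 y} -> cG w f1 x = cG w f2 x.
Proof.
move=> m1 m2 h; rewrite !cGE /conv.
have mG : measurable_fun setT (fun y : pl => Gr w (x - y : R * R)).
  exact: measurableT_comp (measurable_Green0 w0) (mpres_subl x).1.
by apply: Int_ae; [exact: measurable_funM|exact: measurable_funM|apply: filterS h => y ->].
Qed.

Lemma TT_ae f1 f2 x : measurable_fun setT f1 -> measurable_fun setT f2 ->
  {ae mu2, forall y, f1 y = f2 y} -> TT f1 x = TT f2 x.
Proof. by move=> m1 m2 h; rewrite /dual_op !iG_cG// !(cG_ae _ m1 m2 h). Qed.

Lemma TTZ c f x : measurable_fun setT f -> Lpt w f -> TT (fun y => c * f y) x = c * TT f x.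
Proof.
move=> mf Lf; have e z : cG w (fun y => c * f y) z = c * cG w f z.
  rewrite !cGE /conv -(IntZ _ (Lf z)); apply: eq_Rintegral => y _; exact: mulrCA.
have mc : measurable_fun setT (fun y => c * f y) by exact: measurable_funM.
by rewrite /dual_op !iG_cG// !e; ring.
Qed.

Lemma Lpt_le f F : measurable_fun setT f -> (forall x, `|f x| <= F x) -> Lpt w F -> Lpt w f.
Proof.
move=> mf fF LF x; apply: L1_le (LF x) => [|y].
  apply: measurable_funM => //; exact: measurableT_comp (measurable_Green0 w0) (mpres_subl x).1.
by rewrite normrM ger0_norm ?Green_ge0//; apply: ler_wpM2l; [exact: Green_ge0|exact: fF].
Qed.

Lemma TT_cvg (fn : nat -> pl -> R) f F x : (forall n, measurable_fun setT (fn n)) -> measurable_fun setT f ->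
  (forall n y, `|fn n y| <= F y) -> Lpt w F -> (forall y, fn n y @[n --> \oo] --> f y) ->
  TT (fn n) x @[n --> \oo] --> TT f x.
Proof.
move=> mn mf hF LF cv.
have mG z : measurable_fun setT (fun y : pl => Gr w (z - y : R * R)).
  exact: measurableT_comp (measurable_Green0 w0) (mpres_subl z).1.
have e z : cG w (fn n) z @[n --> \oo] --> cG w f z.
  rewrite cGE (_ : (fun n => _) = (fun n => conv (fun z => Gr w z) (fn n) z)); last by apply/funext => n; rewrite cGE.
  have h1 n : measurable_fun setT (fun y : pl => Gr w (z - y : R * R) * fn n y) by exact: measurable_funM.
  have h2 : measurable_fun setT (fun y : pl => Gr w (z - y : R * R) * f y) by exact: measurable_funM.
  have h3 n (y : pl) : `|Gr w (z - y : R * R) * fn n y| <= Gr w (z - y : R * R) * F y.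
    by rewrite normrM ger0_norm ?Green_ge0//; apply: ler_wpM2l; [exact: Green_ge0|exact: hF].
  have h4 : {ae mu2, forall y : pl, Gr w (z - y : R * R) * fn n y @[n --> \oo] --> Gr w (z - y : R * R) * f y}.
    by apply: aeW => y; exact: cvgMr.
  by have [_] := dct h1 h2 (LF z) h3 h4.
rewrite /dual_op (_ : (fun n => _) = (fun n => cG w (fn n) x + k^-1 * cG w (fn n) 0 * G x)); last first.
  by apply/funext => n; rewrite iG_cG.
by rewrite iG_cG//; apply: cvgD => //; apply: cvgMl; exact: cvgMr.
Qed.

Lemma sum_sqr_eq0 (a b : R) : a ^+ 2 + b ^+ 2 = 0 -> a = 0 /\ b = 0.
Proof. by move/eqP; rewrite paddr_eq0 ?sqr_ge0// !sqrf_eq0 => /andP[/eqP -> /eqP ->]. Qed.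

Lemma lim0_ae (Fn : nat -> pl -> R) F : (forall n, L1 mu2 (Fn n)) -> (forall n x, 0 <= Fn n x) ->
  (forall x, Fn n x @[n --> \oo] --> F x) -> \int[mu2]_x Fn n x @[n --> \oo] --> (0 : R) ->
  {ae mu2, forall x, F x = 0}.
Proof.
move=> Ln Fn0 cv c0.
have mF : measurable_fun setT F.
  by apply: (measurable_fun_cvg (h := Fn)) => [n|x _]; [exact: L1_meas (Ln n)|exact: cv].
have F0 x : 0 <= F x by apply: (cvg_ge_cst (cv x)).
have key e : 0 < e -> (\int[mu2]_x (F x)%:E <= e%:E)%E.
  move=> e0; have [n0 _ hn] := cvgr_le _ c0 _ e0.
  apply: (@fatou_le _ _ R mu2 (fun n => Fn (n + n0)%N)) => //.
  - by move=> n; exact: L1_meas.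
  - by apply: aeW => x; have := cv x; rewrite -(cvg_shiftn n0).
  - by move=> n; rewrite L1_fin// lee_fin; apply: hn => /=; rewrite leq_addl.
have L : L1 mu2 F by apply: L1_ge0 => //; apply: le_lt_trans (key 1 ltr01) _; rewrite ltry.
apply: Int_eq0_ae => //; apply/le_anti; rewrite Int_ge0// andbT; apply/ler_addgt0Pl => e e0.
by rewrite addr0 -lee_fin -(L1_fin L); exact: key.
Qed.

(** [(a, b)] is the direction of [(f1, f2)] at [x0]. Equality at this one point makes the integral
    of [G(x0 - y) * (F - a f1 - b f2)(y)] vanish; since [G] is positive off the origin, [(f1, f2)]
    is aligned with [(a, b)] almost everywhere. *)
Lemma constant_phase f1 f2 F x0 : measurable_fun setT f1 -> measurable_fun setT f2 -> measurable_fun setT F ->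
  Lpt w f1 -> Lpt w f2 -> Lpt w F -> (forall x, 0 <= F x) -> (forall x, f1 x ^+ 2 + f2 x ^+ 2 = F x ^+ 2) ->
  0 < F x0 -> F x0 * TT F x0 = f1 x0 * TT f1 x0 + f2 x0 * TT f2 x0 ->
  exists a b : R, [/\ a ^+ 2 + b ^+ 2 = 1, {ae mu2, forall x : pl, f1 x = a * F x} &
    {ae mu2, forall x : pl, f2 x = b * F x}].
Proof.
move=> mf1 mf2 mF Lf1 Lf2 LF F0 f12 Fx0 eD.
pose a := f1 x0 / F x0; pose b := f2 x0 / F x0; have Fn : F x0 != 0 by rewrite gt_eqF.
have ab : a ^+ 2 + b ^+ 2 = 1 by rewrite /a /b !expr_div_n -mulrDl f12 divff// sqrf_eq0.
have hab y : a * f1 y + b * f2 y <= F y.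
  by rewrite -[leRHS]mul1r; apply: (cauchy2 ler01 (F0 y) _ (f12 y)); rewrite expr1n.
have eT : TT F x0 <= a * TT f1 x0 + b * TT f2 x0.
  have ea : F x0 * a = f1 x0 by rewrite /a mulrC divfK.
  have eb : F x0 * b = f2 x0 by rewrite /b mulrC divfK.
  rewrite -(ler_pM2l Fx0) [leRHS]mulrDr (mulrA _ a) (mulrA _ b) ea eb.
  by rewrite eD.
have h1 x : a * cG w f1 x + b * cG w f2 x <= cG w F x.
  by rewrite -[leRHS]mul1r; apply: (cG_mod w0 x Lf1 Lf2 LF) => y; rewrite mul1r.
have eC : cG w F x0 <= a * cG w f1 x0 + b * cG w f2 x0.
  have hi := h1 0; rewrite -!iG_cG// in hi.
  move: eT; rewrite /dual_op; have c0 : 0 <= k^-1 * G x0 by apply: mulr_ge0; [rewrite invr_ge0 ltW|exact: Green_ge0].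
  have := ler_wpM2l c0 hi; move: (cG w F x0) (cG w f1 x0) (cG w f2 x0) (iG f1) (iG f2) (iG F) (G x0) => A B C i j l s.
  move=> h2 h3; apply: le_trans (_ : _ <= a * (B + k^-1 * i * s) + b * (C + k^-1 * j * s) - k^-1 * l * s) _.
    by rewrite lerBrDr.
  rewrite lerBlDr; apply: le_trans (_ : _ <= a * B + b * C + k^-1 * s * (a * i + b * j)) _.
    by rewrite le_eqVlt; apply/orP; left; apply/eqP; ring.
  by rewrite lerD2l; apply: le_trans h2 _; rewrite mulrAC.
pose E y := F y - (a * f1 y + b * f2 y).
have LE : L1 mu2 (fun y : pl => Gr w (x0 - y : R * R) * E y).
  have := L1B (LF x0) (L1D (L1Z a (Lf1 x0)) (L1Z b (Lf2 x0))); apply: L1_eq => y; rewrite /E; ring.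
have E0 y : 0 <= E y by rewrite subr_ge0.
have IE : \int[mu2]_y (Gr w (x0 - y : R * R) * E y) = 0.
  apply/le_anti; rewrite andbC Int_ge0/=; last by move=> y; apply: mulr_ge0; [exact: Green_ge0|exact: E0].
  rewrite (_ : \int[mu2]_y _ = cG w F x0 - (a * cG w f1 x0 + b * cG w f2 x0)) ?subr_le0//.
  rewrite !cGE /conv -(IntZ a (Lf1 x0)) -(IntZ b (Lf2 x0)) -(IntD (L1Z a (Lf1 x0)) (L1Z b (Lf2 x0))).
  rewrite -(IntB (LF x0) (L1D (L1Z a (Lf1 x0)) (L1Z b (Lf2 x0)))); apply: eq_Rintegral => y _; rewrite /E; ring.
have aeE : {ae mu2, forall y, E y = 0}.
  have hE := Int_eq0_ae LE (fun y => mulr_ge0 (Green_ge0 _ w0) (E0 y)) IE.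
  apply: filterS2 hE (@ae_neq R x0) => y /eqP; rewrite mulf_eq0 => /orP[|/eqP//] gx yx.
  by rewrite gt_eqF// Green_gt0// subr_eq0 eq_sym in gx.
have fin y : E y = 0 -> f1 y = a * F y /\ f2 y = b * F y.
  rewrite /E => /eqP; rewrite subr_eq0 => /eqP e.
  have z : (f1 y - a * F y) ^+ 2 + (f2 y - b * F y) ^+ 2 = 0.
    have -> : (f1 y - a * F y) ^+ 2 + (f2 y - b * F y) ^+ 2 =
      f1 y ^+ 2 + f2 y ^+ 2 - 2 * F y * (a * f1 y + b * f2 y) + (a ^+ 2 + b ^+ 2) * F y ^+ 2 by ring.
    by rewrite -e f12 ab; ring.
  by have [/subr0_eq -> /subr0_eq ->] := sum_sqr_eq0 z.
by exists a, b; split; [exact: ab|apply: filterS aeE => y /fin[]|apply: filterS aeE => y /fin[]].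
Qed.

Section Extremal.
Variables (q1 q2 : R) (v1 v2 : pl -> R) (g h : bool -> pl -> R).
Hypotheses (d1 : rdec w q1 v1 g) (d2 : rdec w q2 v2 h).
Let m := md v1 v2.
Let N := \int[mu2]_x (m x `^ p).
Hypotheses (N0 : 0 < N) (AN : Aq q1 v1 g + Aq q2 v2 h = N) (NM : N `^ (2 / p) = M * N).
Let f1 x := m x `^ (p - 2) * v1 x.
Let f2 x := m x `^ (p - 2) * v2 x.
Let F x := m x `^ (p - 1).

Let s1 : sq mu2 v1. Proof. exact: rdec_sq d1. Qed.
Let s2 : sq mu2 v2. Proof. exact: rdec_sq d2. Qed.
Let mm : measurable_fun setT m. Proof. exact: measurable_md s1.1 s2.1. Qed.
Let m0 x : 0 <= m x. Proof. exact: md_ge0. Qed.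
Let pm : pw mu2 p m. Proof. by have [] := Sobolev hp w0 k0 d1 d2. Qed.
Let p0 : 0 < p. Proof. exact: p_gt0. Qed.
Let p10 : 0 < p - 1. Proof. by move: hp; lra. Qed.
Let rp2 : r <= (p - 1) * 2. Proof. by have := r_lt2 hp; move: hp; lra. Qed.
Let p20 : 0 < p - 2. Proof. by move: hp; lra. Qed.
Let r0 : 0 < r. Proof. exact: r_gt0. Qed.
Let M0 : 0 < M. Proof. exact: MM_gt0. Qed.
Let mF : measurable_fun setT F. Proof. exact: measurable_pow. Qed.
Let F0 x : 0 <= F x. Proof. exact: powR_ge0. Qed.
Let Fr x : F x `^ r = m x `^ p. Proof. by have [_ _ _ pr] := cjP hp; rewrite /F -powRrM pr. Qed.
Let IF : \int[mu2]_x (F x `^ r) = N. Proof. by apply: eq_Rintegral => x _; exact: Fr. Qed.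
Let pF : pw mu2 r F.
Proof. by split; [exact: mF|exact: F0|]; have [_ _ L] := pm; apply: L1_eq L => x; rewrite Fr. Qed.
Let LF : Lpt w F. Proof. by move=> x; have := L1_Gf hp w0 x pF; exact. Qed.
Let v1m x : `|v1 x| <= m x.
Proof. by rewrite -sqrtr_sqr; apply: ler_wsqrtr; rewrite lerDl sqr_ge0. Qed.
Let v2m x : `|v2 x| <= m x.
Proof. by rewrite -sqrtr_sqr; apply: ler_wsqrtr; rewrite lerDr sqr_ge0. Qed.
Let mFE x : m x `^ (p - 2) * m x = F x.
Proof.
by rewrite /F mulrC -(mulr_powRB1 (m0 x) p10); congr (_ * _ `^ _); ring.
Qed.
Let f1F x : `|f1 x| <= F x.
Proof. by rewrite normrM (ger0_norm (powR_ge0 _ _)) -mFE; apply: ler_wpM2l; [exact: powR_ge0|exact: v1m]. Qed.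
Let f2F x : `|f2 x| <= F x.
Proof. by rewrite normrM (ger0_norm (powR_ge0 _ _)) -mFE; apply: ler_wpM2l; [exact: powR_ge0|exact: v2m]. Qed.
Let mf1 : measurable_fun setT f1.
Proof. by apply: measurable_funM; [exact: measurable_pow|exact: s1.1]. Qed.
Let mf2 : measurable_fun setT f2.
Proof. by apply: measurable_funM; [exact: measurable_pow|exact: s2.1]. Qed.
Let Lf1 : Lpt w f1. Proof. exact: Lpt_le mf1 f1F LF. Qed.
Let Lf2 : Lpt w f2. Proof. exact: Lpt_le mf2 f2F LF. Qed.
Let f12 x : f1 x ^+ 2 + f2 x ^+ 2 = F x ^+ 2.
Proof. by rewrite -mFE !exprMn -mulrDr -md_sqr. Qed.
Let f12v x : f1 x * v1 x + f2 x * v2 x = m x `^ p.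
Proof.
rewrite /f1 /f2 -!mulrA -mulrDr -!expr2 -md_sqr -/m expr2 mulrA mFE mulrC; exact: mulr_powRB1.
Qed.
Let MN : M * N `^ (2 / r) = N.
Proof.
have [_ _ e _] := cjP hp; apply: (@mulfI _ N); first by rewrite gt_eqF.
rewrite mulrCA mulrA -NM -powRD; last by rewrite (gt_eqF N0) implybT.
by rewrite -mulrDr e mulr1 powR2 ?ltW// expr2.
Qed.

(** Subtracting from [v] the image under [T] of the truncated nonlinearity leaves a function whose
    form is at most [N - 2 I + M I^(2/r)], with [I] the truncated integral. As [I] tends to [N] this
    tends to 0, and the Sobolev inequality makes the difference vanish in L^p. *)
Lemma extremal_TT : {ae mu2, forall x : pl, v1 x = TT f1 x /\ v2 x = TT f2 x}.
Proof.
pose I n := \int[mu2]_x (trunc m n x `^ p).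
pose t1 n x := trunc m n x `^ (p - 2) * v1 x; pose t2 n x := trunc m n x `^ (p - 2) * v2 x.
have key n := dual_pair hp w0 k0 n s1 s2.
have st1 n : sq mu2 (t1 n) by have [] := key n.
have st2 n : sq mu2 (t2 n) by have [] := key n.
have It n : \int[mu2]_x (t1 n x * v1 x) + \int[mu2]_x (t2 n x * v2 x) = I n.
  by rewrite -(IntD (sq_mul (st1 n) s1) (sq_mul (st2 n) s2)); apply: eq_Rintegral => x _; exact: trunc_pair.
have IN : I n @[n --> \oo] --> N.
  have [_ _ Lm] := pm; have tc x : trunc m n x `^ p @[n --> \oo] --> m x `^ p.
    by apply: (powR_cvg p0) => [n|]; [exact: trunc_ge0|exact: trunc_cvg].
  have [//||n x||_] := @dct _ _ R mu2 (fun n x => trunc m n x `^ p) (fun x => m x `^ p) _ _ _ Lm.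
  - by move=> n; apply: measurable_pow; exact: measurable_trunc.
  - exact: measurable_pow.
  - by rewrite (ger0_norm (powR_ge0 _ _)); apply: (ge0_ler_powR (ltW p0) (trunc_ge0 m0 n x) (m0 x)); exact: trunc_le.
  - by apply: aeW => x; exact: tc.
  - exact.
pose q1' n := q1 - 1 * (k^-1 * iG (t1 n)); pose q2' n := q2 - 1 * (k^-1 * iG (t2 n)).
pose u1 n x := v1 x - 1 * TT (t1 n) x; pose u2 n x := v2 x - 1 * TT (t2 n) x.
pose g' n i x := g i x - 1 * ck i w (t1 n) x; pose h' n i x := h i x - 1 * ck i w (t2 n) x.
have D1 n := Aq_sub w0 k0 1 d1 (st1 n); have D2 n := Aq_sub w0 k0 1 d2 (st2 n).
pose A n := Aq (q1' n) (u1 n) (g' n) + Aq (q2' n) (u2 n) (h' n).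
have A0 n : 0 <= A n by rewrite addr_ge0 ?Aq_ge0.
have AI n : A n <= N - 2 * I n + M * I n `^ (2 / r).
  rewrite /A (D1 n).2 (D2 n).2 -AN -(It n); have [_ _ _ Jn] := key n; move: Jn; rewrite -/(t1 n) -/(t2 n).
  have <- : \int[mu2]_x (t1 n x * v1 x) + \int[mu2]_x (t2 n x * v2 x) = \int[mu2]_x (trunc m n x `^ p) := It n.
  move: (Rintegral _ _ _) (Rintegral _ _ _) (J _ _) (J _ _) (Aq _ _ _) (Aq _ _ _) (M * _) => a b c d e i j; lra.
have Ac : A n @[n --> \oo] --> (0 : R).
  apply: (@squeeze_cvgr _ _ _ _ (fun=> 0) (fun n => N - 2 * I n + M * I n `^ (2 / r))).
  - by apply: nearW => n; rewrite A0 AI.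
  - exact: cvg_cst.
  - have -> : 0 = N - 2 * N + M * N `^ (2 / r) by rewrite MN; ring.
    apply: cvgD; first by apply: cvgB; [exact: cvg_cst|exact: cvgMr].
    apply: cvgMr; apply: (powR_cvg _ _ IN) => [|n]; first exact: divr_gt0.
    by apply: Int_ge0 => x; exact: powR_ge0.
have S n := Sobolev hp w0 k0 (D1 n).1 (D2 n).1.
have t1F n x : `|t1 n x| <= F x.
  apply: le_trans (f1F x); rewrite !normrM; apply: (ler_wpM2r (normr_ge0 _)); rewrite !(ger0_norm (powR_ge0 _ _)).
  by apply: (ge0_ler_powR (ltW p20) (trunc_ge0 m0 n x) (m0 x)); exact: trunc_le.
have t2F n x : `|t2 n x| <= F x.
  apply: le_trans (f2F x); rewrite !normrM; apply: (ler_wpM2r (normr_ge0 _)); rewrite !(ger0_norm (powR_ge0 _ _)).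
  by apply: (ge0_ler_powR (ltW p20) (trunc_ge0 m0 n x) (m0 x)); exact: trunc_le.
have tc x : trunc m n x `^ (p - 2) @[n --> \oo] --> m x `^ (p - 2).
  by apply: (powR_cvg p20) => [n|]; [exact: trunc_ge0|exact: trunc_cvg].
have c1 x : u1 n x @[n --> \oo] --> v1 x - TT f1 x.
  apply: cvgB; first exact: cvg_cst.
  have hc y : t1 n y @[n --> \oo] --> f1 y by apply: cvgMl; exact: tc.
  have := @TT_cvg _ _ _ x (fun n => (st1 n).1) mf1 t1F LF hc.
  by under eq_fun do rewrite -[TT _ _]mul1r.
have c2 x : u2 n x @[n --> \oo] --> v2 x - TT f2 x.
  apply: cvgB; first exact: cvg_cst.
  have hc y : t2 n y @[n --> \oo] --> f2 y by apply: cvgMl; exact: tc.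
  have := @TT_cvg _ _ _ x (fun n => (st2 n).1) mf2 t2F LF hc.
  by under eq_fun do rewrite -[TT _ _]mul1r.
have cm x : md (u1 n) (u2 n) x `^ p @[n --> \oo] --> md (fun x => v1 x - TT f1 x) (fun x => v2 x - TT f2 x) x `^ p.
  apply: (powR_cvg p0) => [n|]; first exact: md_ge0.
  have hs : u1 n x ^+ 2 + u2 n x ^+ 2 @[n --> \oo] --> (v1 x - TT f1 x) ^+ 2 + (v2 x - TT f2 x) ^+ 2.
    by apply: cvgD; rewrite !expr2; apply: cvgM.
  by apply: cvg_comp hs _; exact: sqrt_continuous.
have := @lim0_ae _ _ (fun n => let: And3 _ _ L := (S n).1 in L) (fun n x => powR_ge0 _ _) cm.
move=> H; apply: filterS (H _) => [x /powR_eq0_eq0 e|].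
  have := md_sqr (fun x => v1 x - TT f1 x) (fun x => v2 x - TT f2 x) x; rewrite e expr0n /= => /esym/sum_sqr_eq0[].
  by move=> /subr0_eq -> /subr0_eq ->.
apply: (@squeeze_cvgr _ _ _ _ (fun=> 0) (fun n => (M * A n) `^ (p / 2))).
- apply: nearW => n; rewrite (S n).2 andbT; apply: Int_ge0 => x; exact: powR_ge0.
- exact: cvg_cst.
- have p2 : 0 < p / 2 by rewrite divr_gt0.
  have p2n : p / 2 != 0 by rewrite gt_eqF.
  rewrite -[X in _ --> X](powR0 p2n); apply: (powR_cvg p2) => [n|]; first by apply: mulr_ge0; [exact: ltW M0|exact: A0].
  by rewrite -[X in _ --> X](mulr0 M); exact: cvgMr.
Qed.

(** By the equation the modulus is at most [T F], which is in L^t for every [t >= r]; with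
    [t = 2 (p - 1)] this lifts [F] from L^r to L^2. *)
Lemma extremal_sq : {ae mu2, forall x : pl, m x <= TT F x} /\ sq mu2 F.
Proof.
have pT t : r <= t -> pw mu2 t (TT F) by exact: pw_TT.
have [mT T0 _] := pT r (lexx _).
have ae : {ae mu2, forall x : pl, m x <= TT F x}.
  apply: filterS extremal_TT => x [e1 e2]; have [mx0|mx0] := ltP 0 (m x); last by apply: le_trans mx0 (T0 x).
  rewrite -(ler_pM2l mx0) -expr2 md_sqr !expr2 {2}e1 {2}e2.
  apply: (TT_mod w0 k0 x mf1 mf2 mF Lf1 Lf2 LF) => y; apply: cauchy2 => //.
  by rewrite -md_sqr.
split; first exact: ae.
have mn : measurable_fun setT (fun x => Num.min (F x) (TT F x `^ (p - 1))).
  by apply: measurable_minr; [exact: mF|exact: measurable_pow].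
apply: (@sq_ae _ _ R mu2 (fun x => Num.min (F x) (TT F x `^ (p - 1))) F mF).
  apply: filterS ae => x mT'; apply: min_l; exact: (ge0_ler_powR (ltW p10) (m0 x) (T0 x) mT').
have [_ _ L] := pT _ rp2; have sT : sq mu2 (fun x => TT F x `^ (p - 1)).
  apply: pw2_sq; split; [exact: measurable_pow|by move=> x; exact: powR_ge0|].
  by apply: L1_eq L => x; rewrite -powRrM.
apply: (sq_le mn _ sT) => x; rewrite ger0_norm; last by rewrite le_min F0 powR_ge0.
by rewrite ge_min lexx orbT.
Qed.

(** [F T F - f1 T f1 - f2 T f2] is nonnegative, and its integral is at most 0 because [J F F] is at
    most [M N^(2/r) = N]. It therefore vanishes almost everywhere, and a point with [F > 0] feeds
    [constant_phase]. *)
Lemma extremal_phase : exists a b : R, [/\ a ^+ 2 + b ^+ 2 = 1,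
  {ae mu2, forall x : pl, f1 x = a * F x} & {ae mu2, forall x : pl, f2 x = b * F x}].
Proof.
have [mT sF] := extremal_sq.
have sf1 : sq mu2 f1 by exact: sq_le mf1 f1F sF.
have sf2 : sq mu2 f2 by exact: sq_le mf2 f2F sF.
have pw1 x u1 u2 u : (forall y, u1 * f1 y + u2 * f2 y <= u * F y) -> u1 * TT f1 x + u2 * TT f2 x <= u * TT F x.
  have := TT_mod w0 k0 x mf1 mf2 mF Lf1 Lf2 LF; exact.
have sT f : sq mu2 f -> sq mu2 (TT f).
  by move=> sf; apply: sqD; [exact: sq_cG|apply: sqZ; exact: sq_Green].
have L1' := sq_mul sf1 (sT _ sf1); have L2' := sq_mul sf2 (sT _ sf2); have L3 := sq_mul sF (sT _ sF).
pose D x := F x * TT F x - (f1 x * TT f1 x + f2 x * TT f2 x).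
have D0 x : 0 <= D x by rewrite subr_ge0; apply: pw1 => y; apply: cauchy2.
have LD : L1 mu2 D by exact: L1B L3 (L1D L1' L2').
have ID : \int[mu2]_x D x = 0.
  apply/le_anti; rewrite Int_ge0// andbT (IntB L3 (L1D L1' L2')) subr_le0.
  have -> : \int[mu2]_x (f1 x * TT f1 x + f2 x * TT f2 x) = N.
    apply: Int_ae; [exact: L1_meas (L1D L1' L2')|exact: measurable_pow|].
    by apply: filterS extremal_TT => x [<- <-]; exact: f12v.
  rewrite (J_TT k w0 sF sF) -MN; apply: le_trans (J_le hp w0 k0 pF sF) _.
  by rewrite IF.
have aeD := Int_eq0_ae LD D0 ID.
have [x0 [x00 Fx0 eD]] : exists x0 : pl, [/\ (x0 : R * R) != 0, 0 < F x0 & D x0 = 0].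
  apply: contrapT => H; have aeF : {ae mu2, forall x : pl, m x `^ p = 0}.
    apply: filterS2 aeD (ae_neq0 R) => x e xn0; have [//|Fx] := eqVneq (m x `^ p) 0.
    exfalso; apply: H; exists x; split; [exact: xn0| |exact: e].
    rewrite lt_def F0 andbT; apply/eqP => Fx'; move: Fx; rewrite -Fr Fx' powR0 ?eqxx//.
    exact: lt0r_neq0.
  have : N = 0; last by move/eqP; rewrite gt_eqF.
  transitivity (\int[mu2]_x (0 : R)); last by rewrite /Rintegral integral0.
  by apply: Int_ae aeF; [exact: measurable_pow|exact: measurable_cst].
apply: (constant_phase mf1 mf2 mF Lf1 Lf2 LF F0 f12 Fx0).
by apply/eqP; rewrite -subr_eq0; apply/eqP.
Qed.

(** [f = (T F)^(p-1)] agrees with [F] almost everywhere, hence [T f = T F] everywhere, and the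
    equation for [f] holds at every point. *)
Lemma extremal_profile : exists (a b : R) (f : pl -> R), [/\ a ^+ 2 + b ^+ 2 = 1,
  [/\ pw mu2 r f, sq mu2 f, 0 < \int[mu2]_x (f x `^ r) & J f f = M * (\int[mu2]_x (f x `^ r)) `^ (2 / r)],
  forall x, f x = TT f x `^ (p - 1),
  {ae mu2, forall x : pl, v1 x = a * TT f x} & {ae mu2, forall x : pl, v2 x = b * TT f x}].
Proof.
have [a [b [ab e1 e2]]] := extremal_phase; have [_ sF] := extremal_sq.
have mc c : measurable_fun setT (fun x => c * F x) by exact: measurable_funM.
have T1 x : TT f1 x = a * TT F x by rewrite (TT_ae x mf1 (mc a) e1) TTZ.
have T2 x : TT f2 x = b * TT F x by rewrite (TT_ae x mf2 (mc b) e2) TTZ.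
have V1 : {ae mu2, forall x : pl, v1 x = a * TT F x} by apply: filterS extremal_TT => x [-> _].
have V2 : {ae mu2, forall x : pl, v2 x = b * TT F x} by apply: filterS extremal_TT => x [_ ->].
have [mT T0 _] := pw_TT hp w0 k0 pF (lexx r).
pose f x := TT F x `^ (p - 1).
have mf : measurable_fun setT f by exact: measurable_pow.
have Ff : {ae mu2, forall x : pl, F x = f x}.
  apply: filterS2 V1 V2 => x h1 h2; rewrite /F /f; congr (_ `^ _).
  by rewrite /m /md h1 h2 !exprMn -mulrDl ab mul1r sqrtr_sqr ger0_norm.
have Tf x : TT f x = TT F x by apply/esym/TT_ae.
have Ir : \int[mu2]_x (f x `^ r) = N.
  rewrite -IF.
  apply: Int_ae; [exact: measurable_pow|exact: measurable_pow|by apply: filterS Ff => x ->].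
have sf : sq mu2 f by exact: sq_ae Ff sF.
have pf : pw mu2 r f.
  split; [exact: mf|by move=> x; exact: powR_ge0|].
  have [_ _ L] := pF; apply: L1_ae L; first exact: measurable_pow.
  by apply: filterS Ff => x ->.
exists a, b, f; split; [exact: ab| |by move=> x; rewrite Tf| |].
- split; [exact: pf|exact: sf|by rewrite Ir|].
  rewrite Ir MN -(J_TT k w0 sf sf) -Ir; apply: eq_Rintegral => x _.
  rewrite Tf /f; have [_ _ _ pr] := cjP hp; rewrite -powRrM pr mulrC; exact: mulr_powRB1 (T0 x) p0.
- by apply: filterS V1 => x ->; rewrite Tf.
- by apply: filterS V2 => x ->; rewrite Tf.
Qed.

End Extremal.

End Equality.

(** * Reflection across lines, monotonicity and radial symmetry *)

Section Polarization.
Variables (R : realType) (p w k : R).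
Hypotheses (hp : 2 < p) (w0 : 0 < w) (k0 : 0 < k).
Notation mu2 := (@sleb2 R).
Notation pl := (measurableTypeR R * measurableTypeR R)%type.
Implicit Types (f e : pl -> R).
Local Notation r := (cj p).
Local Notation G := (Gr w : pl -> R).
Local Notation M := (dual_max p w k).
Local Notation J := (dual_form w k).
Local Notation TT := (dual_op w k).
Local Notation iG := (green_int w).

Lemma green_int_gt0 f : pw mu2 r f -> sq mu2 f -> 0 < \int[mu2]_x (f x `^ r) -> 0 < iG f.
Proof.
move=> [mf f0 fi] sf If; rewrite lt_def iG_ge0// andbT; apply/eqP => z.
have ae := Int_eq0_ae (sq_mul sf (sq_Green w0)) (fun x => mulr_ge0 (f0 x) (Green_ge0 x w0)) z.
move: If; rewrite (_ : \int[mu2]_x _ = 0) ?ltxx//.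
transitivity (\int[mu2]_x (0 : R)); last by rewrite /Rintegral integral0.
apply: Int_ae; [exact: L1_meas fi|exact: measurable_cst|].
apply: filterS2 ae (ae_neq0 R) => x /eqP; rewrite mulf_eq0 => /orP[/eqP -> _|gx x0].
  by rewrite powR0// gt_eqF// r_gt0.
by rewrite (gt_eqF (Green_gt0 w0 x0)) in gx.
Qed.

Section Reflection.
Variables (a b c : R).
Hypotheses (ab : a ^+ 2 + b ^+ 2 = 1).
Local Notation sg := (refl a b c).
(** The signed distance to the line; for [c > 0] the origin is on the negative side. *)
Definition side (z : R * R) := a * z.1 + b * z.2 - c.
Local Notation L := side.

Lemma side_refl z : L (sg z) = - L z.
Proof.
rewrite /side /refl /=.
have -> : a * (z.1 - 2 * (a * z.1 + b * z.2 - c) * a) + b * (z.2 - 2 * (a * z.1 + b * z.2 - c) * b) - c =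
  (a * z.1 + b * z.2 - c) - 2 * (a * z.1 + b * z.2 - c) * (a ^+ 2 + b ^+ 2) by ring.
by rewrite ab; ring.
Qed.

Lemma reflK z : sg (sg z) = z.
Proof.
have h := side_refl z; rewrite /side in h; rewrite {1}/refl h; case: z h => u v h /=.
by congr (_, _); ring.
Qed.

Lemma refl_fix z : L z = 0 -> sg z = z.
Proof. by rewrite /refl /side => ->; case: z => u v /=; congr (_, _); ring. Qed.

Lemma enormsq (z : R * R) : enorm z ^+ 2 = z.1 ^+ 2 + z.2 ^+ 2.
Proof. by rewrite sqr_sqrtr// addr_ge0 ?sqr_ge0. Qed.

Lemma enorm_refl_sub x y : enorm (x - sg y) ^+ 2 = enorm (x - y) ^+ 2 + 4 * (L x * L y).
Proof.
rewrite !enormsq /= /side.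
have -> : (x.1 - (y.1 - 2 * (a * y.1 + b * y.2 - c) * a)) ^+ 2 + (x.2 - (y.2 - 2 * (a * y.1 + b * y.2 - c) * b)) ^+ 2 =
  (x.1 - y.1) ^+ 2 + (x.2 - y.2) ^+ 2 + 4 * (a * y.1 + b * y.2 - c) * (a * (x.1 - y.1) + b * (x.2 - y.2)) +
  4 * (a * y.1 + b * y.2 - c) ^+ 2 * (a ^+ 2 + b ^+ 2) by ring.
by rewrite ab; ring.
Qed.

Lemma enorm_isom x y : enorm (sg x - sg y) = enorm (x - y).
Proof.
apply/eqP; rewrite -(eqrXn2 (_ : (0 < 2)%N)) ?sqrtr_ge0//; apply/eqP.
rewrite enorm_refl_sub -(opprB y) enormN enorm_refl_sub side_refl -(opprB x) enormN; ring.
Qed.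

Lemma Gr_lt x y : L x * L y > 0 -> x != y -> Gr w (x - sg y) < Gr w (x - y).
Proof.
move=> h xy; apply: Green_dec => //; first by rewrite subr_eq0.
rewrite -(ltr_pXn2r (_ : (0 < 2)%N)) ?nnegrE ?sqrtr_ge0// enorm_refl_sub ltrDl.
by rewrite mulr_gt0.
Qed.

Let ms : mpres mu2 (sg : pl -> pl). Proof. exact: mpres_refl. Qed.

Lemma cG_refl f x : measurable_fun setT f -> cG w (fun y => f (sg y)) x = cG w f (sg x).
Proof.
move=> mf; rewrite !cGE /conv.
have mG : measurable_fun setT (fun y : pl => Gr w (sg x - y : R * R) * f y).
  apply: measurable_funM => //; exact: measurableT_comp (measurable_Green0 w0) (mpres_subl (sg x)).1.
rewrite -(@mpres_Int _ pl R mu2 _ _ ms mG); apply: eq_Rintegral => y _; congr (_ * _).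
by apply: Green_radial; rewrite enorm_isom.
Qed.

Definition anti e := forall x, e (sg x) = - e x.
Definition posH e := forall x, L x < 0 -> 0 <= e x.

Section Anti.
Variable e : pl -> R.
Hypotheses (me : measurable_fun setT e) (Le : Lpt w e) (ae : anti e).

Lemma cG_anti x : cG w e (sg x) = - cG w e x.
Proof.
rewrite -cG_refl// (_ : (fun y => e (sg y)) = (fun y => - e y)); last by apply/funext.
by rewrite !cGE /conv -(IntN (Le x)); apply: eq_Rintegral => y _; rewrite mulrN.
Qed.

Let D x (y : pl) := (Gr w (x - y : R * R) - Gr w (x - sg y)) * e y.

(** Averaging the potential with its reflected form, an antisymmetric [e] sees only the kernel
    [G(x - y) - G(x - sg y)], which is positive when [x] and [y] are distinct and strictly on the
    same side. *)
Lemma anti_fold x : L1 mu2 (D x) /\ 2 * cG w e x = \int[mu2]_y D x y.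
Proof.
have h1 := Le x; have h2 := mpres_L1 ms h1.
have h3 : L1 mu2 (fun y : pl => Gr w (x - y : R * R) * e y + Gr w (x - sg y) * e (sg y)) by exact: L1D h1 h2.
have E : (fun y : pl => Gr w (x - y : R * R) * e y + Gr w (x - sg y) * e (sg y)) = D x.
  by apply/funext => y; rewrite ae /D; ring.
rewrite E in h3; split => //; rewrite -E (IntD h1 h2) -[X in _ = _ + X]/(\int[mu2]_y ((fun y : pl => Gr w (x - y : R * R) * e y) (sg y))).
by rewrite (@mpres_Int _ pl R mu2 _ _ ms (L1_meas h1)) cGE /conv mulr_natl mulr2n.
Qed.

Lemma fold_ge0 x y : posH e -> L x < 0 -> y != x -> sg y != x -> 0 <= D x y.
Proof.
move=> pe Lx yx syx; rewrite /D; have [Ly|Ly|Ly] := ltgtP (L y) 0.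
- apply: mulr_ge0; last exact: pe.
  by rewrite subr_ge0; apply/ltW/Gr_lt; [rewrite nmulr_rgt0|rewrite eq_sym].
- rewrite -mulrNN; apply: mulr_ge0; last by rewrite -ae; apply: pe; rewrite side_refl oppr_lt0.
  rewrite opprB subr_ge0 -[X in Gr w (x - X) <= _]reflK.
  by apply/ltW/Gr_lt; [rewrite nmulr_rgt0// side_refl oppr_lt0|rewrite eq_sym].
- by rewrite (refl_fix Ly) subrr mul0r.
Qed.

Let ae_ge0 x : posH e -> L x < 0 -> {ae mu2, forall y : pl, `|D x y| = D x y}.
Proof.
move=> pe Lx; apply: filterS2 (@ae_neq R x) (@ae_neq R (sg x)) => y yx ysx.
rewrite ger0_norm//; apply: fold_ge0 => //; apply: contra ysx => /eqP <-.
by rewrite reflK.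
Qed.

Lemma anti_ge0 x : posH e -> L x < 0 -> 0 <= cG w e x.
Proof.
move=> pe Lx; have [LD h] := anti_fold x; rewrite -(pmulr_rge0 _ (ltr0Sn R 1)) h.
rewrite -(@Int_ae _ _ R mu2 (fun y => `|D x y|) (D x)).
- by apply: Int_ge0 => y; exact: normr_ge0.
- exact: L1_meas (L1_norm LD).
- exact: L1_meas LD.
- exact: ae_ge0.
Qed.

Lemma anti_eq0 x : posH e -> L x < 0 -> cG w e x = 0 -> {ae mu2, forall y, e y = 0}.
Proof.
move=> pe Lx z; have [LD h] := anti_fold x.
have I0 : \int[mu2]_y `|D x y| = 0.
  rewrite (Int_ae (L1_meas (L1_norm LD)) (L1_meas LD) (ae_ge0 pe Lx)) -h z mulr0 //.
have hD := Int_eq0_ae (L1_norm LD) (fun y => normr_ge0 _) I0.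
apply: filterS2 hD (filterI (@ae_neq R x) (@ae_neq R (sg x))) => y /normr0P/eqP; rewrite /D => Dy [yx ysx].
have [Ly|Ly|Ly] := ltgtP (L y) 0.
- move/eqP: Dy; rewrite mulf_eq0 => /orP[|/eqP//]; rewrite subr_eq0 gt_eqF// Gr_lt//; first by rewrite nmulr_rgt0.
  by rewrite eq_sym.
- move/eqP: Dy; rewrite mulf_eq0 => /orP[|/eqP//]; rewrite subr_eq0 lt_eqF//.
  rewrite -[X in Gr w (x - X) < _]reflK; apply: Gr_lt; first by rewrite nmulr_rgt0// side_refl oppr_lt0.
  by apply: contra ysx => /eqP ->; rewrite reflK.
- have := ae y; rewrite (refl_fix Ly) => /eqP; rewrite -addr_eq0 -mulr2n mulrn_eq0 /= => /eqP//.
Qed.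

End Anti.

(** The arithmetic of [polarize]: [B], [C], [D], [E] are the pairings of [e] with the potentials of
    [f], [d], [e], [e'], and [X], [Y], [Z] are the charge terms. The convolution part of the gain is
    [E / 4]. *)
Lemma gain (A B C D E X Y Z : R) : 2 * B = C -> E = D + 2 * C -> 0 <= E -> 0 <= X ->
  A + Z + 2 * 2^-1 * (B + Y) + 2^-1 ^+ 2 * (D + X) <= A + Z -> Y <= 0.
Proof. by lra. Qed.

Lemma polarize f : 0 < c -> pw mu2 r f -> sq mu2 f -> 0 < \int[mu2]_x (f x `^ r) ->
  J f f = M * (\int[mu2]_x (f x `^ r)) `^ (2 / r) ->
  forall x, L x < 0 -> x != 0 -> TT f (sg x) < TT f x.
Proof.
move=> c0 pf sf If Jf; have [mf f0 fi] := pf; have r0 := r_gt0 hp.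
have Lf : Lpt w f by exact: Lpt_sq.
have sfs : sq mu2 (fun x => f (sg x)).
  by split; [exact: measurableT_comp mf ms.1|exact: mpres_L1 ms sf.2].
pose d x := f x - f (sg x); have sd : sq mu2 d by exact: sqB.
have ad : anti d by move=> x; rewrite /d reflK opprB.
(* The difference between the values at [x] and [sg x] once the larger one is on the side of the
   origin. *)
pose dH x := if L x < 0 then `|d x| else - `|d x|.
have mL : measurable_fun setT (fun x : pl => L x).
  by apply: measurable_funB => //; apply: measurable_funD; apply: measurable_funM.
have sdH : sq mu2 dH.
  have mn : measurable_fun setT (fun x => `|d x|) by exact: measurableT_comp sd.1.
  split; last by apply: L1_eq sd.2 => x; rewrite /dH; case: ifP => _; rewrite ?sqrrN real_normK ?num_real.
  apply: measurable_fun_ifT => //; first exact: measurable_fun_ltr.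
  exact: measurableT_comp mn.
have adH : anti dH.
  move=> x; rewrite /dH side_refl oppr_lt0 ad normrN.
  have [Lx|Lx|Lx] := ltgtP (L x) 0; rewrite ?opprK//.
  by have := ad x; rewrite (refl_fix Lx) => /eqP; rewrite -addr_eq0 -mulr2n mulrn_eq0 /= => /eqP ->; rewrite normr0 oppr0.
(* The polarized function is [f + e / 2]. Both [e] and [e'] are antisymmetric and nonnegative on the
   side of the origin, hence so are their potentials and [\int e cG e'] is nonnegative. *)
pose e x := dH x - d x; pose e' x := dH x + d x.
have se : sq mu2 e by exact: sqB.
have se' : sq mu2 e' by exact: sqD.
have ane : anti e by move=> x; rewrite /e adH ad; ring.
have ane' : anti e' by move=> x; rewrite /e' adH ad; ring.
have pe : posH e by move=> x Lx; rewrite /e /dH Lx subr_ge0 ler_norm.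
have pe' : posH e' by move=> x Lx; rewrite /e' /dH Lx -[X in _ + X]opprK subr_ge0 -normrN ler_norm.
have L0 : L 0 < 0 by rewrite /side /= !mulr0 addr0 sub0r oppr_lt0.
pose fH x := f x + 2^-1 * e x.
have sfH : sq mu2 fH by apply: sqD => //; exact: sqZ.
have fHE x : fH x = f x /\ fH (sg x) = f (sg x) \/ fH x = f (sg x) /\ fH (sg x) = f x.
  have h : dH x = d x \/ dH x = - d x.
    by rewrite /dH; case: ifP => _; case: (ger0P (d x)) => _; rewrite ?opprK; [left|right|right|left].
  by rewrite /fH ane /e; case: h => ->; [left|right]; rewrite /d; split; field.
have fH0 x : 0 <= fH x by case: (fHE x) => [[-> _]|[-> _]].
have LfH : L1 mu2 (fun x => fH x `^ r).
  have h1 := mpres_L1 ms fi; apply: L1_le (L1D fi h1) => [|x]; first by apply: measurable_pow; exact: sfH.1.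
  rewrite ger0_norm ?powR_ge0//; case: (fHE x) => [[-> _]|[-> _]]; rewrite ?lerDl ?lerDr powR_ge0//.
have pfH : pw mu2 r fH by split => //; exact: sfH.1.
have IfH : \int[mu2]_x (fH x `^ r) = \int[mu2]_x (f x `^ r).
  have h1 := mpres_L1 ms LfH; have h2 := mpres_L1 ms fi.
  have : \int[mu2]_x (fH x `^ r) + \int[mu2]_x (((fun x => fH x `^ r) \o (sg : pl -> pl)) x) =
      \int[mu2]_x (f x `^ r) + \int[mu2]_x (((fun x => f x `^ r) \o (sg : pl -> pl)) x).
    rewrite -(IntD LfH h1) -(IntD fi h2); apply: eq_Rintegral => x _ /=.
    by case: (fHE x) => [[-> ->]//|[-> ->]]; exact: addrC.
  rewrite (@mpres_Int _ pl R mu2 _ _ ms (L1_meas LfH)) (@mpres_Int _ pl R mu2 _ _ ms (L1_meas fi)).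
  move: (Rintegral _ _ _) (Rintegral _ _ _) => A B; lra.
have JH : J fH fH <= J f f by rewrite Jf -IfH; exact: J_le.
have Lpe : Lpt w e by exact: Lpt_sq.
have Lpe' : Lpt w e' by exact: Lpt_sq.
have ie0 : 0 <= iG e by rewrite (iG_cG w se.1); exact: anti_ge0 L0.
have if0 : 0 < iG f by exact: green_int_gt0.
have ki0 : 0 < k^-1 by rewrite invr_gt0.
have scf := sq_cG w0 sf; have sce := sq_cG w0 se; have scd := sq_cG w0 sd; have sce' := sq_cG w0 se'.
have ecd : 2 * \int[mu2]_x (e x * cG w f x) = \int[mu2]_x (e x * cG w d x).
  have h1 := sq_mul se scf; have h2 := mpres_L1 ms h1.
  rewrite mulr_natl mulr2n -[X in _ + X = _](@mpres_Int _ pl R mu2 _ _ ms (L1_meas h1)) -(IntD h1 h2).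
  apply: eq_Rintegral => x _ /=; rewrite ane -(cG_refl _ mf).
  rewrite !cGE /conv (_ : \int[mu2]_y (Gr w (x - y : R * R) * d y) = \int[mu2]_y (Gr w (x - y : R * R) * f y) - \int[mu2]_y (Gr w (x - y : R * R) * f (sg y))); first by ring.
  rewrite -(IntB (Lf x) (Lpt_sq w0 sfs x)); apply: eq_Rintegral => y _; rewrite /d; ring.
have ece : \int[mu2]_x (e x * cG w e' x) = \int[mu2]_x (e x * cG w e x) + 2 * \int[mu2]_x (e x * cG w d x).
  rewrite -(IntZ 2 (sq_mul se scd)) -(IntD (sq_mul se sce) (L1Z 2 (sq_mul se scd))).
  apply: eq_Rintegral => x _; rewrite !cGE /conv.
  rewrite (_ : \int[mu2]_y (Gr w (x - y : R * R) * e' y) = \int[mu2]_y (Gr w (x - y : R * R) * e y) + 2 * \int[mu2]_y (Gr w (x - y : R * R) * d y)); first by ring.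
  rewrite -(IntZ 2 (Lpt_sq w0 sd x)) -(IntD (Lpe x) (L1Z 2 (Lpt_sq w0 sd x))).
  by apply: eq_Rintegral => y _; rewrite /e' /e; ring.
have pos : 0 <= \int[mu2]_x (e x * cG w e' x).
  apply: Int_ge0 => x; have [Lx|Lx|Lx] := ltgtP (L x) 0.
  - by apply: mulr_ge0; [exact: pe|exact: anti_ge0].
  - have Lsx : L (sg x) < 0 by rewrite side_refl oppr_lt0.
    by rewrite -mulrNN -ane -(cG_anti se'.1 Lpe' ane'); apply: mulr_ge0; [exact: pe|exact: anti_ge0].
  - by have := ane x; rewrite (refl_fix Lx) => /eqP; rewrite -addr_eq0 -mulr2n mulrn_eq0 /= => /eqP ->; rewrite mul0r.
have iez : iG e = 0.
  apply/le_anti; rewrite ie0 andbT -(pmulr_rle0 _ if0) -(pmulr_rle0 _ ki0).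
  move: JH; rewrite (J_add k w0 2^-1 sf se) /dual_form (cG_pair w0 sf se).
  rewrite (_ : \int[mu2]_x (cG w f x * e x) = \int[mu2]_x (e x * cG w f x)); last by apply: eq_Rintegral => x _; exact: mulrC.
  move: ecd ece pos; move: (\int[mu2]_x (e x * cG w f x)) (\int[mu2]_x (e x * cG w d x)) (\int[mu2]_x (e x * cG w e x)) (\int[mu2]_x (e x * cG w e' x)).
  have := sqr_ge0 (iG e); have := ltW if0; move: (iG e) (iG f) (\int[mu2]_x (f x * cG w f x)) => i j A j0 i20 B C D E e1 e2 e3.
  have k1 : 0 <= k^-1 * i ^+ 2 := mulr_ge0 (ltW ki0) i20.
  by rewrite expr2 in k1; exact: gain e1 e2 e3 k1.
(* [iG e] is the potential of [e] at the origin, a point of the negative side, so its vanishing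
   forces [e = 0] almost everywhere. *)
have aez := anti_eq0 Lpe ane pe L0; rewrite -(iG_cG w se.1) in aez; have {}aez := aez iez.
move=> x Lx x0; rewrite /dual_op -subr_gt0.
have cd : 0 <= cG w f x - cG w f (sg x).
  rewrite -(cG_refl _ mf) (_ : _ - _ = cG w d x).
    rewrite (@cG_ae R w w0 d dH x sd.1 sdH.1); last by apply: filterS aez => y /subr0_eq.
    have pd : posH dH by move=> y Ly; rewrite /dH Ly.
    exact: anti_ge0 (Lpt_sq w0 sdH) adH x pd Lx.
  by rewrite !cGE /conv -(IntB (Lf x) (Lpt_sq w0 sfs x)); apply: eq_Rintegral => y _; rewrite /d; ring.
have gd : 0 < G x - G (sg x).
  rewrite subr_gt0; have := @Gr_lt 0 x; rewrite !sub0r !GreenN; apply; last by rewrite eq_sym.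
  by rewrite nmulr_rgt0.
rewrite opprD addrACA -mulrBr; apply: (ltr_wpDl cd); exact: mulr_gt0 (mulr_gt0 ki0 if0) gd.
Qed.

End Reflection.

Section Profile.
Variable f : pl -> R.
Hypotheses (pf : pw mu2 r f) (sf : sq mu2 f) (If : 0 < \int[mu2]_x (f x `^ r))
  (Jf : J f f = M * (\int[mu2]_x (f x `^ r)) `^ (2 / r)).

(** The line is the perpendicular bisector of [x] and [y], with unit normal [(y - x) / D]; it misses
    the origin, which lies on the side of [x], exactly because [x] is the closer point. *)
Lemma TT_decreasing (x y : R * R) : x != 0 -> enorm x < enorm y -> TT f y < TT f x.
Proof.
move=> x0 xy; pose D := enorm (y - x); have yx : y - x != 0.
  by rewrite subr_eq0; apply: contraTneq xy => ->; rewrite ltxx.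
have D0 : 0 < D by rewrite enorm_gt0.
have Dn : D != 0 by rewrite gt_eqF.
have D2 : D ^+ 2 = (y.1 - x.1) ^+ 2 + (y.2 - x.2) ^+ 2 by rewrite enormsq.
pose a := (y.1 - x.1) / D; pose b := (y.2 - x.2) / D.
pose c := (enorm y ^+ 2 - enorm x ^+ 2) / (2 * D).
have ab : a ^+ 2 + b ^+ 2 = 1 by rewrite /a /b !expr_div_n -mulrDl -D2 divff// sqrf_eq0.
have c0 : 0 < c.
  rewrite divr_gt0 ?mulr_gt0// subr_gt0 ltr_pXn2r ?nnegrE ?sqrtr_ge0//.
have Lx : side a b c x = - (D / 2).
  rewrite /side /a /b /c !enormsq.
  have -> : D / 2 = D ^+ 2 / (2 * D) by field.
  by rewrite D2; field.
have sx : refl a b c x = y.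
  move: Lx; rewrite /side /refl => ->; case: (x) (y) => [x1 x2] [y1 y2] /= in a b c D0 Dn D2 ab c0 * .
  by congr (_, _); rewrite /a /b /=; field.
rewrite -{1}sx; apply: (polarize ab c0) => //.
by rewrite Lx oppr_lt0 divr_gt0.
Qed.

(** The points approach [x] along its radius from inside; with [n.+2] the factor is at least 1/2, so
    none of them is the origin. *)
Lemma TT_seq (x : R * R) : x != 0 -> TT f ((1 - n.+2%:R^-1) * x.1, (1 - n.+2%:R^-1) * x.2) @[n --> \oo] --> TT f x.
Proof.
move=> x0; have r0 := r_gt0 hp.
have t1 (s : R) : (1 - n.+2%:R^-1) * s @[n --> \oo] --> s.
  rewrite -[X in _ --> X]mul1r -[X in X * s]subr0; apply: cvgMl; apply: cvgB; first exact: cvg_cst.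
  by have := @cvg_inv_nat R; rewrite -(cvg_shiftn 1); under eq_fun do rewrite addn1.
apply: cvgD; last by apply: cvgMr; exact: Gr_seq.
pose c := (\int[mu2]_x (f x `^ r)) `^ (- r^-1); have c0 : 0 < c by rewrite powR_gt0.
have [pc _ Ic] := cls_scale hp pf sf If; rewrite -/c in pc Ic.
have ec z : cG w (fun y => c * f y) z = c * cG w f z.
  by rewrite !cGE /conv -(IntZ _ (Lpt_sq w0 sf z)); apply: eq_Rintegral => y _; exact: mulrCA.
apply/cvgrPdist_le => e e0; have [d d0 hd] := cG_equi hp w0 (mulr_gt0 c0 e0).
have h1 := t1 x.1; have h2 := t1 x.2.
move/cvgrPdist_lt: h1 => /(_ _ d0) h1; move/cvgrPdist_lt: h2 => /(_ _ d0) h2.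
near=> n; pose eta : R * R := ((1 - n.+2%:R^-1) * x.1 - x.1, (1 - n.+2%:R^-1) * x.2 - x.2).
have e1 : `|eta.1| < d by rewrite /= distrC; near: n.
have e2 : `|eta.2| < d by rewrite /= distrC; near: n.
have := hd _ x eta pc Ic e1 e2; rewrite !ec -mulrBr normrM (gtr0_norm c0) ler_pM2l// distrC.
rewrite (_ : x + eta = ((1 - n.+2%:R^-1) * x.1, (1 - n.+2%:R^-1) * x.2))//.
by rewrite /eta; case: (x) => u v; rewrite /GRing.add /= ; congr (_, _); rewrite addrC subrK.
Unshelve. all: by end_near. Qed.

(** Moving one of two points of a circle slightly inwards makes its value strictly larger than at
    the other; the limit gives both inequalities. *)
Lemma TT_radial (x y : R * R) : enorm x = enorm y -> TT f x = TT f y.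
Proof.
have le (u v : R * R) : u != 0 -> enorm u = enorm v -> TT f v <= TT f u.
  move=> u0 uv; apply: (cvg_ge_cst (TT_seq u0)) => n.
  have n1 : 0 < 1 - n.+2%:R^-1 :> R by rewrite subr_gt0 invf_lt1// ltr1n.
  have eu : enorm ((1 - n.+2%:R^-1) * u.1, (1 - n.+2%:R^-1) * u.2) = (1 - n.+2%:R^-1) * enorm u.
    rewrite /enorm /= !exprMn -mulrDr sqrtrM ?sqr_ge0// sqrtr_sqr gtr0_norm//.
  have u1 : 0 < enorm u by rewrite enorm_gt0.
  apply/ltW/TT_decreasing; first by rewrite -enorm_gt0 eu mulr_gt0.
  by rewrite eu -uv gtr_pMl// gtrBl invr_gt0.
move=> xy; have [x0|x0] := eqVneq x 0.
  by move: xy; rewrite x0 enorm0 => /esym/eqP; rewrite enorm_eq0 => /eqP ->.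
have y0 : y != 0 by rewrite -enorm_gt0 -xy enorm_gt0.
by apply/le_anti/andP; split; exact: le.
Qed.

End Profile.

End Polarization.

(** * Trial functions, and the absence of minimizers up to [omega0] *)

Section Trial.
Variables (R : realType) (p alpha : R).
Hypothesis hp : 2 < p.
Notation mu2 := (@sleb2 R).
Notation pl := (measurableTypeR R * measurableTypeR R)%type.
Implicit Types (s f : pl -> R) (l m q : R).

(** The origin of [omega0]: at this frequency the coefficient of [|q|^2] in the form vanishes. *)
Lemma theta_omega0 : alpha + theta (omega0 alpha) = 0.
Proof.
have p0 : pi != 0 :> R by rewrite gt_eqF ?pi_gt0.
rewrite /theta /omega0; set E := expR _.
have -> : Num.sqrt (4 * E) / 2 = expR (- 2 * pi * alpha - euler_gamma R).
  have -> : 4 * E = (2 * expR (- 2 * pi * alpha - euler_gamma R)) ^+ 2.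
    rewrite exprMn -expRM_natl /E; congr (_ * expR _); first by ring.
    by ring.
  by rewrite sqrtr_sqr gtr0_norm ?mulr_gt0 ?expR_gt0// mulrAC divff// mul1r.
rewrite expRK; move: p0; move: (euler_gamma R) (pi : R) => D q q0; by field.
Qed.

Lemma omega0_gt0 : 0 < omega0 alpha.
Proof. by rewrite mulr_gt0 ?expR_gt0. Qed.

Lemma kappa_gt0 w : omega0 alpha < w -> 0 < alpha + theta w.
Proof.
move=> h; have h0 := omega0_gt0; have w0 := lt_trans h0 h.
rewrite -[ltLHS]theta_omega0 ltrD2l -subr_gt0 theta_sub// divr_gt0 ?mulr_gt0 ?pi_gt0//.
by rewrite ln_gt0// ltr_pdivlMr// mul1r.
Qed.

Definition tv l s q : pl -> R := fun x => cG l s x + q * Gr l x.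
Definition trial l s q : R * R -> R[i] := fun x => (tv l s q x)%:C.

Section One.
Variables (l q : R) (s : pl -> R).
Hypotheses (l0 : 0 < l) (ss : sq mu2 s).

Lemma sq_tv : sq mu2 (tv l s q).
Proof. by apply: sqD; [exact: sq_cG|apply: sqZ; exact: sq_Green]. Qed.

Lemma cre_trial : cre (trial l s q) = tv l s q. Proof. by []. Qed.
Lemma cim_trial : cim (trial l s q) = fun=> 0. Proof. by []. Qed.
Lemma cab_trial x : cab (trial l s q) x = `|tv l s q x|.
Proof. by rewrite /cab /cabs /= expr0n addr0 sqrtr_sqr. Qed.

Lemma sq0 : sq mu2 (fun=> 0 : R).
Proof. by split => //; under eq_fun do rewrite expr0n; exact: integrable0. Qed.

Lemma rdec_trial : rdec l q (cre (trial l s q)) (fun i => ck i l s).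
Proof.
rewrite cre_trial /rdec (_ : (fun x : pl => _) = cG l s); first exact: rH1_cG.
by apply/funext => x; rewrite /tv addrK.
Qed.

Lemma rH1_0 : @rH1 R (fun=> 0) (fun _ => fun=> 0).
Proof.
split; first exact: sq0.
move=> i; split; first exact: sq0.
apply/wdE => a b _ _ _ _.
have z (h : pl -> R) : \int[mu2]_x (0 * h x) = 0.
  by rewrite /Rintegral integral0_eq// => x _; rewrite mul0r.
by rewrite !z oppr0.
Qed.

Lemma rdec_trial_im : rdec l 0 (cim (trial l s q)) (fun i => fun=> 0).
Proof.
rewrite cim_trial /rdec (_ : (fun x : pl => _) = (fun=> 0)); first exact: rH1_0.
by apply/funext => x; rewrite mul0r subr0.
Qed.

Lemma trial_energy : energy_space (trial l s q).
Proof.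
split; first by apply/L2P; split; [exact: sq_tv|exact: sq0].
exists q%:C, l; split => //; apply: (@H1_cG R l 1 s) => // x.
rewrite /regular_part /trial /tv mul1r -GrE; apply/eqP; rewrite eq_complex /=; apply/andP; split; apply/eqP; ring.
Qed.

Lemma trial_L2 : Lpnorm 2 (trial l s q) ^+ 2 = \int[mu2]_x (tv l s q x ^+ 2).
Proof.
rewrite Lpnorm2; last by case: trial_energy.
rewrite cre_trial cim_trial [X in _ + X](_ : _ = 0) ?addr0//.
by rewrite /Rintegral integral0_eq// => x _; rewrite expr0n.
Qed.

Lemma trial_Q : Q alpha (trial l s q) = \int[mu2]_x (s x * cG l s x) - l * \int[mu2]_x (tv l s q x ^+ 2)
  + (alpha + theta l) * q ^+ 2.
Proof.
rewrite (Q_rdec alpha trial_energy l0 rdec_trial rdec_trial_im) /rform.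
rewrite -(En_cG l0 ss) cre_trial cim_trial.
have z : \int[mu2]_x ((0 : R) ^+ 2) = 0.
  by rewrite /Rintegral integral0_eq// => x _; rewrite expr0n.
have -> : En l (fun x : pl => (0 : R) - 0 * Gr l x) (fun i => fun=> 0) = 0.
  rewrite /En z; have -> : \int[mu2]_x (((0 : R) - 0 * Gr l x) ^+ 2) = 0; last by rewrite mulr0 !addr0.
  by rewrite /Rintegral integral0_eq// => x _; rewrite mul0r subr0 expr0n.
rewrite z expr0n mulr0 mulr0 subr0 addr0 addr0; congr (_ - _ + _).
by congr (En _ _ _); apply/funext => x; rewrite /tv addrK.
Qed.

End One.

Lemma cGZ l c s x : 0 < l -> sq mu2 s -> cG l (fun y => c * s y) x = c * cG l s x.
Proof.
move=> l0 ss; rewrite !cGE /conv -(IntZ _ (Lpt_sq l0 ss x)).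
by apply: eq_Rintegral => y _; exact: mulrCA.
Qed.

Lemma tvZ l c s q : 0 < l -> sq mu2 s -> tv l (fun y => c * s y) (c * q) = fun x => c * tv l s q x.
Proof. by move=> l0 ss; apply/funext => x; rewrite /tv cGZ// mulrDr mulrA. Qed.

Lemma trial_nehari w l s q (n := \int[mu2]_x (`|tv l s q x| `^ p))
  (a := Q alpha (trial l s q) + w * Lpnorm 2 (trial l s q) ^+ 2) :
  0 < l -> sq mu2 s -> pw mu2 p (fun x => `|tv l s q x|) -> 0 < n -> 0 < a ->
  exists u, nehari_manifold p alpha w u /\ action p alpha w u = (2^-1 - p^-1) * ((a / n) `^ (2 / (p - 2)) * a).
Proof.
move=> l0 ss pv n0 a0; have p0 := p_gt0 hp; have p20 : 0 < p - 2 by move: hp; lra.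
have an : 0 < a / n by rewrite divr_gt0.
(* The scaling factor that solves [t^p n = t^2 a], which puts [t v] on the Nehari manifold. *)
pose t := (a / n) `^ (p - 2)^-1; have t0 : 0 < t by rewrite powR_gt0.
have t2 : t ^+ 2 = (a / n) `^ (2 / (p - 2)) by rewrite -(powR2 (ltW t0)) /t -powRrM (mulrC 2).
have tp : t `^ p * n = t ^+ 2 * a.
  have -> : t `^ p = t ^+ 2 * (a / n).
    have h : t `^ (p - 2) = a / n by rewrite -powRrM mulVf ?powRr1 ?gt_eqF// ltW.
    by rewrite -h -(powR2 (ltW t0)) -powRD ?(gt_eqF t0) ?implybT//; congr (_ `^ _); ring.
  by rewrite -mulrA divfK// gt_eqF.
have st : sq mu2 (fun y => t * s y) by exact: sqZ.
pose u := trial l (fun y => t * s y) (t * q).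
have tvE : tv l (fun y => t * s y) (t * q) = fun x => t * tv l s q x by exact: tvZ.
have cu x : cab u x `^ p = t `^ p * `|tv l s q x| `^ p.
  by rewrite cab_trial tvE normrM powRM ?normr_ge0// gtr0_norm.
have [_ _ Lv] := pv.
have Np : Lpnorm p u `^ p = t `^ p * n.
  rewrite Lpnorm_pow//; last by apply: L1_eq (L1Z (t `^ p) Lv) => x; rewrite cu.
  by rewrite /n -(IntZ _ Lv); apply: eq_Rintegral => x _; rewrite cu.
have N2 : Lpnorm 2 u ^+ 2 = t ^+ 2 * Lpnorm 2 (trial l s q) ^+ 2.
  rewrite !trial_L2// tvE -(IntZ _ (sq_tv q l0 ss).2).
  by apply: eq_Rintegral => x _; rewrite exprMn.
have Qu : Q alpha u = t ^+ 2 * Q alpha (trial l s q).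
  rewrite !trial_Q// tvE.
  have -> : \int[mu2]_x ((t * tv l s q x) ^+ 2) = t ^+ 2 * \int[mu2]_x (tv l s q x ^+ 2).
    by rewrite -(IntZ _ (sq_tv q l0 ss).2); apply: eq_Rintegral => x _; rewrite exprMn.
  have -> : \int[mu2]_x (t * s x * cG l (fun y => t * s y) x) = t ^+ 2 * \int[mu2]_x (s x * cG l s x).
    rewrite -(IntZ _ (sq_mul ss (sq_cG l0 ss))); apply: eq_Rintegral => x _; rewrite cGZ//; ring.
  by rewrite exprMn; move: (Rintegral _ _ _) (Rintegral _ _ _) => A B; ring.
have Au : Q alpha u + w * Lpnorm 2 u ^+ 2 = t ^+ 2 * a by rewrite N2 Qu /a; ring.
exists u; split.
  split; [exact: trial_energy| |by rewrite /nehari_functional Au Np tp subrr].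
  move=> u0; have : Lpnorm p u `^ p = 0; last by move/eqP; rewrite Np mulf_eq0 !gt_eqF// powR_gt0.
  rewrite Lpnorm_pow//; last by apply: L1_eq (L1Z (t `^ p) Lv) => x; rewrite cu.
  transitivity (\int[mu2]_x (0 : R)); last by rewrite /Rintegral integral0.
  apply: Int_ae => //.
    by apply: measurable_pow; apply: measurable_cab; case: (trial_energy (t * q) l0 st) => -[].
  have u0' : {ae mu2, forall x : pl, u x = 0} by move: u0; rewrite /eq_ae leb2E.
  apply: filterS u0' => x e.
  by rewrite /cab e /cabs /= !expr0n addr0 sqrtr0 powR0// gt_eqF.
rewrite /action /energy -t2 Np tp.
have -> : Q alpha u / 2 - t ^+ 2 * a / p + w / 2 * Lpnorm 2 u ^+ 2 = (Q alpha u + w * Lpnorm 2 u ^+ 2) / 2 - t ^+ 2 * a / p by ring.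
by rewrite Au; ring.
Qed.

Lemma nehari_action w u : nehari_manifold p alpha w u ->
  action p alpha w u = (2^-1 - p^-1) * Lpnorm p u `^ p.
Proof.
move=> [_ _]; rewrite /nehari_functional => /eqP; rewrite subr_eq0 => /eqP e.
rewrite /action /energy.
have -> : Q alpha u / 2 - Lpnorm p u `^ p / p + w / 2 * Lpnorm 2 u ^+ 2 = (Q alpha u + w * Lpnorm 2 u ^+ 2) / 2 - Lpnorm p u `^ p / p by ring.
by rewrite e; ring.
Qed.

Lemma cab_md (v : R * R -> R[i]) : cab v = md (cre v) (cim v).
Proof. by apply/funext => x; rewrite /cab /md /cre /cim; case: (v x). Qed.

(** Membership in L^p does not refer to a frequency, so the Sobolev inequality may be used at any
    one above [omega0]. *)
Lemma energy_Lp u : energy_space u -> pw mu2 p (cab u).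
Proof.
move=> Eu; have h : omega0 alpha < omega0 alpha + 1 by rewrite ltrDl.
have w0 : 0 < omega0 alpha + 1 by rewrite addr_gt0// omega0_gt0.
have [a [b [g [hh [d1 d2]]]]] := energy_dec Eu w0.
by have [] := Sobolev hp w0 (kappa_gt0 h) d1 d2; rewrite -cab_md.
Qed.

Lemma energy_Lp_gt0 u : energy_space u -> ~ eq_ae u (fun=> 0) -> 0 < Lpnorm p u `^ p.
Proof.
move=> Eu u0; have [mu_ c0 L] := energy_Lp Eu; have p0 := p_gt0 hp.
rewrite lt_def powR_ge0 andbT; apply/eqP => z; apply: u0.
rewrite Lpnorm_pow// in z; have := Int_eq0_ae L (fun x => powR_ge0 _ _) z.
by rewrite /eq_ae leb2E; apply: filterS => x /powR_eq0_eq0/cabs_eq0.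
Qed.

Lemma half_sub_gt0 : 0 < 2^-1 - p^-1.
Proof. by rewrite subr_gt0 ltf_pV2 ?posrE// (p_gt0 hp). Qed.

Lemma no_minimizer w u : w <= omega0 alpha -> ~ action_minimizer p alpha w u.
Proof.
move=> wl [Nu Su]; have p0 := p_gt0 hp; have c0 := half_sub_gt0.
have [Eu u0 _] := Nu; have N0 := energy_Lp_gt0 Eu u0.
pose l := omega0 alpha; have l0 : 0 < l := omega0_gt0; pose de := l - w; have de0 : 0 <= de by rewrite subr_ge0.
have pi0 := @pi_gt0 R; have ln20 : 0 < ln 2 :> R by rewrite ln_gt0// ltr1n.
(* The form at [G_m] is [ln (m / l) / (4 pi) - (m - w) |G_m|_2^2]. The subtracted term is at most
   [ln 2 / pi], since [m - w <= 2 m] by the summand [|w|], and the exponent makes the logarithm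
   exceed [4 ln 2]. *)
pose m := l * expR (4 * ln 2 + 4 * pi) + `|w|.
have lm : l < m.
  apply: ltr_wpDr => //; rewrite ltr_pMr// expR_gt1 addr_gt0// mulr_gt0//.
have m0 := lt_trans l0 lm; have m20 : 0 < m / 2 by rewrite divr_gt0.
have sl := sq_Green l0; have sm := sq_Green m0; have sm2 := sq_Green m20.
(* By the resolvent identity, the trial function with this density and charge 1 is
   [(1 - t) G_l + t G_m] almost everywhere. *)
pose s t (x : pl) := - t * (m - l) * Gr m x.
have ss t : sq mu2 (s t) by exact: sqZ.
pose v t := tv l (s t) 1.
have vE t : {ae mu2, forall x : pl, v t x = Gr l x - t * (Gr l x - Gr m x)}.
  by apply: filterS (green_diff l0 m0) => x ->; rewrite /v /tv /s cGZ//; ring.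
pose a t := Q alpha (trial l (s t) 1) + w * Lpnorm 2 (trial l (s t) 1) ^+ 2.
pose K := \int[mu2]_x (Gr m x * cG l (Gr m) x); pose B := \int[mu2]_x (Gr l x * cG l (Gr m) x).
pose C := \int[mu2]_x (cG l (Gr m) x ^+ 2); pose D := \int[mu2]_x (Gr l x ^+ 2).
have sc := sq_cG l0 sm.
have aE0 t : a t = t ^+ 2 * (m - l) ^+ 2 * K - de * \int[mu2]_x (v t x ^+ 2).
  rewrite /a trial_Q// trial_L2// -/(v t) theta_omega0 mul0r addr0.
  have -> : \int[mu2]_x (s t x * cG l (s t) x) = t ^+ 2 * (m - l) ^+ 2 * K.
    rewrite -(IntZ _ (sq_mul sm sc)); apply: eq_Rintegral => x _; rewrite /s cGZ//; ring.
  by rewrite /de; ring.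
have vE2 t : \int[mu2]_x (v t x ^+ 2) = D - 2 * t * (m - l) * B + t ^+ 2 * (m - l) ^+ 2 * C.
  rewrite (_ : \int[mu2]_x _ = \int[mu2]_x ((Gr l x + (- t * (m - l)) * cG l (Gr m) x) ^+ 2)).
    by rewrite Int_sqD//; rewrite -/B -/C -/D; ring.
  by apply: eq_Rintegral => x _; rewrite /v /tv /s cGZ// mul1r addrC.
have aE t : a t = t ^+ 2 * (m - l) ^+ 2 * K - de * (D - 2 * t * (m - l) * B + t ^+ 2 * (m - l) ^+ 2 * C).
  by rewrite aE0 vE2.
have a00 : a 0 <= 0.
  rewrite aE !expr0n !mul0r mulr0 !mul0r sub0r subr0 addr0 oppr_le0 mulr_ge0//.
  by apply: Int_ge0 => x; exact: sqr_ge0.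
pose Gm := \int[mu2]_x (Gr m x ^+ 2).
(* [Green_ip] is for two distinct frequencies, so one factor [G_m] is replaced by the larger
   [G_(m/2)]. *)
have Gm_le : Gm <= ln 2 / (2 * pi * m).
  have -> : ln 2 / (2 * pi * m) = \int[mu2]_x (Gr m x * Gr (m / 2) x).
    have h : (m - m / 2) * \int[mu2]_x (Gr m x * Gr (m / 2) x) = theta m - theta (m / 2) by exact: Green_ip'.
    have mn : m - m / 2 != 0 by rewrite gt_eqF// [X in X - _]splitr addrK.
    apply: (mulfI mn); rewrite h theta_sub// (_ : m / (m / 2) = 2); last by field; rewrite gt_eqF.
    have fl (A P N : R) : P != 0 -> N != 0 -> (N - N / 2) * (A / (2 * P * N)) = A / (4 * P) by move=> P0 Nn; field; rewrite P0 Nn.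
    by apply: fl; rewrite gt_eqF.
  apply: Int_le => [||x]; [exact: sm.2|exact: sq_mul|].
  rewrite expr2; apply: ler_wpM2l; first exact: Green_ge0.
  have [->|x0] := eqVneq (x : R * R) 0; first by rewrite !Green0.
  by apply/ltW/Green_decl => //; rewrite ltr_pdivrMr// ltr_pMr// ltr1n.
have a1 : 0 < a 1.
  rewrite aE0.
  have -> : \int[mu2]_x (v 1 x ^+ 2) = Gm.
    apply: Int_ae; [by apply: measurable_funX; exact: (sq_tv 1 l0 (ss 1)).1|exact: L1_meas sm.2|].
    by apply: filterS (vE 1) => x ->; rewrite mul1r opprB addrC subrK.
  have -> : 1 ^+ 2 * (m - l) ^+ 2 * K = theta m - theta l - (m - l) * Gm.
    have -> : theta m - theta l = (m - l) * \int[mu2]_x (Gr m x * Gr l x) by rewrite Green_ip'.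
    rewrite -mulrBr -(IntB (sq_mul sm sl) sm.2) expr1n mul1r expr2 -mulrA; congr (_ * _).
    rewrite -(IntZ _ (sq_mul sm sc)); apply: Int_ae; [exact: L1_meas (L1Z _ (sq_mul sm sc))|exact: L1_meas (L1B (sq_mul sm sl) sm.2)|].
    by apply: filterS (green_diff l0 m0) => x e; rewrite mulrCA -e; ring.
  rewrite theta_sub// -addrA -opprD -mulrDl subr_gt0.
  have mw : m - l + de <= 2 * m.
    have h1 : - w <= `|w| by rewrite -normrN ler_norm.
    have h2 : `|w| <= m by rewrite lerDr mulr_ge0 ?expR_ge0// ltW.
    by rewrite /de; move: h1 h2; lra.
  have Gm0 : 0 <= Gm by apply: Int_ge0 => x; exact: sqr_ge0.
  apply: le_lt_trans (ler_wpM2r Gm0 mw) _; have m2 : 0 <= 2 * m by rewrite mulr_ge0// ltW.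
  apply: le_lt_trans (ler_wpM2l m2 Gm_le) _.
  have fl (A P N : R) : P != 0 -> N != 0 -> 2 * N * (A / (2 * P * N)) = 4 * A / (4 * P) by move=> P0 Nn; field; rewrite P0 Nn.
  rewrite fl ?gt_eqF//.
  rewrite ltr_pM2r ?invr_gt0 ?mulr_gt0//; apply: (@lt_le_trans _ _ (ln (expR (4 * ln 2 + 4 * pi)))).
    by rewrite expRK ltrDl mulr_gt0.
  rewrite ler_ln ?posrE ?expR_gt0 ?divr_gt0//; rewrite ler_pdivlMr// mulrC lerDl//.
pose n0 := \int[mu2]_x (Gr m x `^ p).
have p1 : 1 <= p by move: hp; lra.
have [mGm Gm0 LGm] := pw_Gr m0 p1; have [mGl Gl0 LGl] := pw_Gr l0 p1.
have n00 : 0 < n0.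
  rewrite lt_def Int_ge0 ?andbT; last by move=> x; exact: powR_ge0.
  apply/eqP => z; apply: (@ae_false R); apply: filterS2 (ae_neq0 R) (Int_eq0_ae LGm (fun x => powR_ge0 _ _) z) => x x0 /powR_eq0_eq0.
  by move/eqP; rewrite gt_eqF// Green_gt0.
(* Along the segment the functions lie between [G_m] and [G_l], which bounds their L^p norms from
   below by that of [G_m]. *)
have pv t : 0 <= t <= 1 -> pw mu2 p (fun x => `|v t x|) /\ n0 <= \int[mu2]_x (`|v t x| `^ p).
  move=> /andP[t0 t1]; have mv : measurable_fun setT (v t) := (sq_tv 1 l0 (ss t)).1.
  have mnv : measurable_fun setT (fun x => `|v t x| `^ p) by apply: measurable_pow; exact: measurableT_comp mv.
  pose h (x : pl) := Gr l x - t * (Gr l x - Gr m x).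
  have mh : measurable_fun setT h.
    by apply: measurable_funB => //; apply: measurable_funM => //; exact: measurable_funB.
  have gle (x : pl) : Gr m x <= Gr l x.
    have [->|x0] := eqVneq (x : R * R) 0; first by rewrite !Green0.
    by apply/ltW/Green_decl.
  have hl x : Gr m x <= h x <= Gr l x.
    rewrite /h; apply/andP; split; last by rewrite gerBl mulr_ge0// subr_ge0.
    rewrite lerBrDr -lerBrDl -[leRHS]mul1r; apply: ler_wpM2r => //; by rewrite subr_ge0.
  have h0 x : 0 <= h x by case/andP: (hl x) => + _; apply: le_trans; exact: Green_ge0.
  have Lh : L1 mu2 (fun x => h x `^ p).
    apply: L1_le LGl => [|x]; first exact: measurable_pow.
    rewrite ger0_norm ?powR_ge0//; apply: ge0_ler_powR; rewrite ?nnegrE ?(ltW p0)//; by case/andP: (hl x).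
  have ae : {ae mu2, forall x : pl, h x `^ p = `|v t x| `^ p}.
    by apply: filterS (vE t) => x ->; rewrite ger0_norm//; exact: h0.
  split; first by split; [exact: measurableT_comp mv|by []|exact: L1_ae mnv ae Lh].
  rewrite -(Int_ae (L1_meas Lh) mnv ae); apply: Int_le => // x.
  by apply: ge0_ler_powR; rewrite ?nnegrE ?(ltW p0)//; case/andP: (hl x).
(* Below [a 1] the value [e] is taken on the segment, below [n0] the scaling factor is at most 1,
   and below the p-th power of the norm of [u] the resulting action contradicts minimality. *)
pose e := Num.min (a 1) (Num.min n0 (Lpnorm p u `^ p)) / 2.
have min0 : 0 < Num.min (a 1) (Num.min n0 (Lpnorm p u `^ p)) by rewrite !lt_min a1 n00 N0.
have e0 : 0 < e by rewrite divr_gt0.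
have emin : e < Num.min (a 1) (Num.min n0 (Lpnorm p u `^ p)).
  by rewrite ltr_pdivrMr// ltr_pMr// ltr1n.
move: (emin); rewrite !lt_min => /and3P[e1 e2 e3].
have cont : continuous a.
  rewrite (_ : a = fun t : R => t ^+ 2 * (m - l) ^+ 2 * K - de * (D - 2 * t * (m - l) * B + t ^+ 2 * (m - l) ^+ 2 * C)); last first.
    by apply/funext => t; exact: aE.
  have cX2 (t : R) : {for t, continuous (fun t : R => t ^+ 2)} by exact: exprn_continuous.
  move=> t; apply: cvgB.
    by do 2! apply: cvgMl; exact: cX2.
  apply: cvgMr; apply: cvgD; last by do 2! apply: cvgMl; exact: cX2.
  apply: cvgB; first exact: cvg_cst.
  by do 2! apply: cvgMl; apply: cvgMr; exact: cvg_id.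
have [|t t01 at_] := @IVT R a 0 1 e ler01 (continuous_subspaceT cont).
  by rewrite ge_min le_max (le_trans a00 (ltW e0)) (ltW e1) orbT.
have t01' : 0 <= t <= 1 by move: t01; rewrite in_itv.
have [pvt nt] := pv t t01'; have nt0 := lt_le_trans n00 nt.
have a0 : 0 < Q alpha (trial l (s t) 1) + w * Lpnorm 2 (trial l (s t) 1) ^+ 2 by rewrite -/(a t) at_.
have [z [Nz Sz]] := trial_nehari l0 (ss t) pvt nt0 a0.
have := ereal_inf_lbound (_ : [set (action p alpha w v)%:E | v in nehari_manifold p alpha w] (action p alpha w z)%:E).
move=> /(_ (ex_intro2 _ _ z Nz erefl)); rewrite -/(action_level p alpha w) -Su lee_fin (nehari_action Nu) Sz -/(a t) at_.
rewrite ler_pM2l// leNgt => /negP; apply; apply: le_lt_trans e3.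
rewrite ler_piMl ?(ltW e0)//; have o1 : (1 : R) `^ (2 / (p - 2)) = 1 by rewrite powR1.
rewrite -[leRHS]o1.
have q0 : 0 <= 2 / (p - 2) by rewrite ltW// divr_gt0// subr_gt0.
apply: (ge0_ler_powR q0 _ ler01); first exact: divr_ge0 (ltW e0) (ltW nt0).
by rewrite (ler_pdivrMr _ _ nt0) mul1r; exact: le_trans (ltW e2) nt.
Qed.

End Trial.

(** * Injectivity of the Green potential; the Green function is not constant *)

Section Injectivity.
Variable R : realType.
Notation mu2 := (@sleb2 R).
Notation pl := (measurableTypeR R * measurableTypeR R)%type.

(** [h] is orthogonal to all potentials, and each tensor test function is one, namely that of
    [l - Laplacian] applied to it; so [h] is a weak derivative of 0. *)
Lemma cG_inj l (h : pl -> R) : 0 < l -> sq mu2 h -> {ae mu2, forall x, cG l h x = 0} ->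
  {ae mu2, forall x, h x = 0}.
Proof.
move=> l0 sh hz; have orth s : sq mu2 s -> \int[mu2]_x (h x * cG l s x) = 0.
  move=> ss; rewrite (cG_pair l0 sh ss).
  transitivity (\int[mu2]_x (0 : R)); last by rewrite /Rintegral integral0.
  apply: Int_ae; [exact: L1_meas (sq_mul (sq_cG l0 sh) ss)|exact: measurable_cst|].
  by apply: filterS hz => x ->; rewrite mul0r.
have s0 : sq mu2 (fun=> 0 : R) by exact: sq0.
have z (g : pl -> R) : \int[mu2]_x (0 * g x) = 0.
  by rewrite /Rintegral integral0_eq// => x _; rewrite mul0r.
apply: (@wd_unique _ true (fun=> 0) h (fun=> 0)) => //; apply/wdE => a b sa sb ca cb; last by rewrite !z oppr0.
rewrite z; apply/esym/eqP; rewrite oppr_eq0; apply/eqP.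
have sda := Sm_derive sa; have sdb := Sm_derive sb.
have cda := csupp_derive sa ca; have cdb := csupp_derive sb cb.
have [st sd1 w1] := sq_test true sa sb ca cb; have [_ sd2 w2] := sq_test false sa sb ca cb.
have [_ se1 v1] := sq_test true sda sb cda cb; have [_ se2 v2] := sq_test false sa sdb ca cdb.
have rep := @resolvent_rep R (tens a b) (fun i => dtens i a b) l l0 st (fun i => if i then sd1 else sd2) (fun i => if i then w1 else w2).
have c1 := cG_ck l0 sd1 se1 v1; have c2 := cG_ck l0 sd2 se2 v2.
have sc := sq_cG l0 st; have sc1 := sq_cG l0 se1; have sc2 := sq_cG l0 se2.
have L0 := sq_mul sh sc; have L1' := sq_mul sh sc1; have L2' := sq_mul sh sc2.
transitivity (\int[mu2]_x (l * (h x * cG l (tens a b) x) - (h x * cG l (dtens true (derive1 a) b) x + h x * cG l (dtens false a (derive1 b)) x))).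
  apply: Int_ae; [exact: L1_meas (sq_mul sh st)|exact: L1_meas (L1B (L1Z l L0) (L1D L1' L2'))|].
  by apply: filterS2 rep (filterI c1 c2) => x -> [-> ->]; rewrite /dtens; ring.
by rewrite (IntB (L1Z l L0) (L1D L1' L2')) (IntD L1' L2') (IntZ _ L0) !orth// mulr0 addr0 subrr.
Qed.

(** Pairing with [heat t], of mass 1 and height [1 / (4 pi t)], bounds the constant by the integral
    of the Green function divided by [4 pi t], for every [t]. *)
Lemma Green_not_cst l (c : R) : 0 < l -> ~ {ae mu2, forall x : pl, Gr l x = c}.
Proof.
move=> l0 hc; have c0 : 0 < c.
  have [//|c0] := ltP 0 c; exfalso; apply: (@ae_false R).
  by apply: filterS2 hc (ae_neq0 R) => x e x0; move: c0; rewrite -e leNgt Green_gt0.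
have LG := L1_Green l0; pose I := \int[mu2]_x Gr l x.
have I0 : 0 <= I by apply: Int_ge0 => x; exact: Green_ge0.
have key t : 0 < t -> c <= (4 * pi * t)^-1 * I.
  move=> t0; have Lh := L1_heat t0; rewrite -(IntZ (4 * pi * t)^-1 LG).
  have e : \int[mu2]_x (c * heat t x) = \int[mu2]_x (Gr l x * heat t x).
    apply: Int_ae; first exact: L1_meas (L1Z c Lh).
      by apply: measurable_funM; [exact: L1_meas LG|exact: L1_meas Lh].
    by apply: filterS hc => x ->.
  have L1' : L1 mu2 (fun x => Gr l x * heat t x).
    apply: L1_le (L1Z (4 * pi * t)^-1 LG) => [|x].
      by apply: measurable_funM; [exact: L1_meas LG|exact: L1_meas Lh].
    rewrite ger0_norm; last by apply: mulr_ge0; [exact: Green_ge0|exact: heat_ge0].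
    by rewrite mulrC; apply: ler_wpM2r; [exact: Green_ge0|exact: heat_le].
  have -> : c = \int[mu2]_x (c * heat t x).
    by rewrite (IntZ c Lh) (_ : \int[mu2]_x heat t x = 1) ?mulr1// /Rintegral int_heat.
  rewrite e; apply: Int_le => // [|x]; first exact: L1Z.
  by rewrite mulrC; apply: ler_wpM2r; [exact: Green_ge0|exact: heat_le].
have q0 : 0 < I / (2 * pi * c) + 1 by rewrite ltr_wpDl// divr_ge0 ?mulr_ge0 ?pi_ge0 ?(ltW c0).
have := key _ q0; have pi0 := @pi_gt0 R.
have P0 : 0 < 4 * pi * (I / (2 * pi * c) + 1) by rewrite !mulr_gt0.
rewrite mulrC ler_pdivlMr// leNgt => /negP; apply.
have -> : c * (4 * pi * (I / (2 * pi * c) + 1)) = 2 * I + 4 * pi * c.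
  have alg (P A d : R) : P != 0 -> d != 0 -> d * (4 * P * (A / (2 * P * d) + 1)) = 2 * A + 4 * P * d.
    by move=> h1 h2; field; rewrite h1 h2.
  by apply: alg; rewrite gt_eqF.
by rewrite mulr_natl mulr2n -addrA ltrDl ltr_wpDl// !mulr_gt0.
Qed.

End Injectivity.

(** * Minimizers of the action and their profile *)

Section Main.
Variables (R : realType) (p alpha w : R).
Hypotheses (hp : 2 < p) (hw : omega0 alpha < w).
Notation mu2 := (@sleb2 R).
Notation pl := (measurableTypeR R * measurableTypeR R)%type.
Implicit Types (u v : R * R -> R[i]) (f : pl -> R).
Let w0 : 0 < w. Proof. exact: lt_trans (omega0_gt0 alpha) hw. Qed.
Let k := alpha + theta w.
Let k0 : 0 < k. Proof. exact: kappa_gt0. Qed.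
Local Notation r := (cj p).
Local Notation M := (dual_max p w k).
Local Notation TT := (dual_op w k).
Local Notation Np u := (Lpnorm p u `^ p).

Lemma quad_Aq u q1 q2 g h : energy_space u -> rdec w q1 (cre u) g -> rdec w q2 (cim u) h ->
  Q alpha u + w * Lpnorm 2 u ^+ 2 = Aq w k q1 (cre u) g + Aq w k q2 (cim u) h.
Proof.
move=> Eu d1 d2; rewrite (Q_rdec alpha Eu w0 d1 d2) Lpnorm2; last by case: Eu.
by rewrite mulrDr addrACA !rform_En.
Qed.

Lemma nehari_quad u : nehari_manifold p alpha w u -> Q alpha u + w * Lpnorm 2 u ^+ 2 = Np u.
Proof. by move=> [_ _] /eqP; rewrite /nehari_functional subr_eq0 => /eqP. Qed.

Lemma nehari_lower u : nehari_manifold p alpha w u -> 0 < Np u /\ Np u `^ (2 / p) <= M * Np u.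
Proof.
move=> Nu; have [Eu u0 _] := Nu; have N0 := energy_Lp_gt0 alpha hp Eu u0; split => //.
have [a [b [g [h [d1 d2]]]]] := energy_dec Eu w0.
have [_ S] := Sobolev hp w0 k0 d1 d2; move: S; rewrite -(quad_Aq Eu d1 d2) (nehari_quad Nu) -cab_md.
have [_ _ L] := energy_Lp alpha hp Eu; have p0 := p_gt0 hp; have M0 := MM_gt0 hp w0 k0.
rewrite -(Lpnorm_pow p0 L) => S; have MN : 0 < M * Np u by rewrite mulr_gt0.
have q0 : 0 <= 2 / p by rewrite divr_ge0// ltW.
have := ge0_ler_powR q0 (ltW N0) (powR_ge0 _ _) S.
have id2 (X : R) : 0 < X -> (X `^ (p / 2)) `^ (2 / p) = X.
  by move=> X0; rewrite -powRrM mulrA divfK// divff ?gt_eqF// powRr1// ltW.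
by rewrite (id2 _ MN).
Qed.

(* Both sides of the Sobolev inequality scale differently in [N], so [N^(2/p) <= M N]
   bounds [N] from below and equality holds exactly at the bound. *)
Lemma extremal_level (N N' : R) : 0 < N -> 0 < N' -> N `^ (2 / p) = M * N -> N' `^ (2 / p) <= M * N' ->
  N <= N' /\ (N' <= N -> N' `^ (2 / p) = M * N').
Proof.
move=> N0 N0' e h; have p0 := p_gt0 hp; have s0 : 0 < 1 - 2 / p by rewrite subr_gt0 ltr_pdivrMr// mul1r.
have sp (x : R) : 0 < x -> x = x `^ (2 / p) * x `^ (1 - 2 / p).
  by move=> x0; rewrite -powRD ?(gt_eqF x0) ?implybT// addrC subrK powRr1// ltW.
have e1 : M * N `^ (1 - 2 / p) = 1.
  have n0 : N `^ (2 / p) != 0 by rewrite gt_eqF// powR_gt0.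
  by apply: (mulfI n0); rewrite mulr1 mulrCA -sp.
have h1 : 1 <= M * N' `^ (1 - 2 / p).
  have n0 : 0 < N' `^ (2 / p) by rewrite powR_gt0.
  by rewrite -(ler_pM2l n0) mulr1 mulrCA -sp.
have M0 := MM_gt0 hp w0 k0; have NN' : N <= N'.
  rewrite leNgt; apply/negP => lt; have := gt0_ltr_powR s0 (ltW N0') (ltW N0) lt.
  by rewrite -(ltr_pM2l M0) e1 ltNge h1.
by split => // le; have -> : N' = N by apply/le_anti; rewrite le NN'.
Qed.

(** The trial function with density a maximizer [F] and charge [k^-1 * green_int w F] is [T F]. Its
    form equals [J F F = M] and its L^p norm is [M] by [NN_step], so its multiple on the Nehari
    manifold attains equality. *)
Lemma exists_extremal : exists z, nehari_manifold p alpha w z /\ Np z `^ (2 / p) = M * Np z.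
Proof.
have M0 := MM_gt0 hp w0 k0; have p0 := p_gt0 hp; have p20 : 0 < p - 2 by rewrite subr_gt0.
have [F [cF JF IF]] := max_exists hp w0 k0; have [pF sF _] := cF.
have pT := pw_TT hp w0 k0 pF (r_le_p hp); have [mT T0 LT] := pT.
have tvE : tv w F (k^-1 * green_int w F) = TT F by [].
have aE : Q alpha (trial w F (k^-1 * green_int w F)) + w * Lpnorm 2 (trial w F (k^-1 * green_int w F)) ^+ 2 = M.
  rewrite trial_Q// trial_L2// -JF /dual_form -/k.
  have alg (A B i : R) : A - w * B + k * (k^-1 * i) ^+ 2 + w * B = A + k^-1 * (i * i) by field; rewrite gt_eqF.
  exact: alg.
have JF0 : 0 < dual_form w k F F by rewrite JF.
have [h1 h2 _] := NN_step hp w0 k0 cF JF0.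
have NM : pnorm p (TT F) = M by apply/le_anti; rewrite h2 -{1}JF h1.
have nE : \int[mu2]_x (`|tv w F (k^-1 * green_int w F) x| `^ p) = M `^ p.
  transitivity (pnorm p (TT F) `^ p); last by rewrite NM.
  by rewrite (NN_pow hp); apply: eq_Rintegral => x _; exact: (congr1 (@powR R ^~ p) (ger0_norm (T0 x))).
have pv : pw mu2 p (fun x => `|tv w F (k^-1 * green_int w F) x|).
  by rewrite (_ : (fun x : pl => _) = TT F)//; apply/funext => x; rewrite tvE ger0_norm.
have n0 : 0 < \int[mu2]_x (`|tv w F (k^-1 * green_int w F) x| `^ p) by rewrite nE powR_gt0.
have a0 : 0 < Q alpha (trial w F (k^-1 * green_int w F)) + w * Lpnorm 2 (trial w F (k^-1 * green_int w F)) ^+ 2 by rewrite aE.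
have [z [Nz Sz]] := trial_nehari hp w0 sF pv n0 a0; exists z; split => //.
have c0 := half_sub_gt0 hp.
have -> : Np z = M `^ (- p / (p - 2)).
  move: Sz; rewrite (nehari_action Nz) aE nE => /(mulfI (lt0r_neq0 c0)) ->.
  have -> : M / M `^ p = M `^ (1 - p) by rewrite powRB ?(gt_eqF M0) ?implybT// powRr1// ltW.
  rewrite -powRrM -[X in _ * X](powRr1 (ltW M0)) -powRD ?(gt_eqF M0) ?implybT//; congr (_ `^ _).
  by field; rewrite gt_eqF.
rewrite -powRrM -[X in _ = X * _](powRr1 (ltW M0)) -powRD ?(gt_eqF M0) ?implybT//; congr (_ `^ _).
by field; rewrite !gt_eqF.
Qed.

Lemma exists_minimizer : exists u, action_minimizer p alpha w u.
Proof.
have [z [Nz ez]] := exists_extremal; have [N0 _] := nehari_lower Nz; exists z; split => //.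
apply/le_anti/andP; split; last by apply: ereal_inf_lbound; exists z.
apply: le_ereal_inf_tmp => _ [u Nu <-]; have [Nu0 hu] := nehari_lower Nu.
rewrite lee_fin !nehari_action//; apply: ler_wpM2l; first exact: ltW (half_sub_gt0 hp).
by have [] := extremal_level N0 Nu0 ez hu.
Qed.

Definition profile (a b : R) f := [/\ a ^+ 2 + b ^+ 2 = 1,
  [/\ pw mu2 r f, sq mu2 f, 0 < \int[mu2]_x (f x `^ r) & dual_form w k f f = M * (\int[mu2]_x (f x `^ r)) `^ (2 / r)] &
  forall x, f x = TT f x `^ (p - 1)].

Lemma minimizer_profile u : action_minimizer p alpha w u -> exists a b f, [/\ profile a b f,
  {ae mu2, forall x : pl, cre u x = a * TT f x} & {ae mu2, forall x : pl, cim u x = b * TT f x}].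
Proof.
move=> [Nu Su]; have [z [Nz ez]] := exists_extremal; have [Nz0 _] := nehari_lower Nz.
have [Nu0 hu] := nehari_lower Nu; have [_ H] := extremal_level Nz0 Nu0 ez hu.
have le : Np u <= Np z.
  have : (action_level p alpha w <= (action p alpha w z)%:E)%E by apply: ereal_inf_lbound; exists z.
  by rewrite -Su lee_fin !nehari_action// ler_pM2l// half_sub_gt0.
have NE := H le; have [Eu _ _] := Nu; have [c [d [g [h [d1 d2]]]]] := energy_dec Eu w0.
have [_ _ L] := energy_Lp alpha hp Eu.
have NI : \int[mu2]_x (md (cre u) (cim u) x `^ p) = Np u by rewrite -cab_md Lpnorm_pow// (p_gt0 hp).
have AN : Aq w k c (cre u) g + Aq w k d (cim u) h = \int[mu2]_x (md (cre u) (cim u) x `^ p).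
  by rewrite NI -(quad_Aq Eu d1 d2) nehari_quad.
have I0 : 0 < \int[mu2]_x (md (cre u) (cim u) x `^ p) by rewrite NI.
have NM : (\int[mu2]_x (md (cre u) (cim u) x `^ p)) `^ (2 / p) = M * \int[mu2]_x (md (cre u) (cim u) x `^ p).
  by rewrite NI.
have [a [b [f [h1 h2 h3 h4 h5]]]] := extremal_profile hp w0 k0 d1 d2 I0 AN NM.
by exists a, b, f.
Qed.

Section Profile.
Variables (a b : R) (f : pl -> R).
Hypothesis Pf : profile a b f.
Let q0 := k^-1 * green_int w f.

Let f0 x : 0 <= f x. Proof. by case: Pf => _ [[_ + _] _ _ _] _; exact. Qed.
Let sf : sq mu2 f. Proof. by case: Pf => _ []. Qed.

Lemma profile_iG : 0 < green_int w f.
Proof. by case: Pf => _ [pf _ If _] _; exact: green_int_gt0 pf sf If. Qed.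

Lemma profile_charge : 0 < q0. Proof. by rewrite mulr_gt0 ?invr_gt0// profile_iG. Qed.

Lemma profile_gt0 x : (x : R * R) != 0 -> 0 < TT f x.
Proof.
move=> x0; apply: ltr_wpDl; first exact: cG_ge0.
by apply: mulr_gt0; [exact: profile_charge|exact: Green_gt0].
Qed.

(** If the regular part vanished, then [T f = q0 G_l], and injectivity of the potential would give
    [f = q0 (w - l) G_l]. Compared with [f = (T f)^(p-1)], this makes [G_l^(p-2)] constant. *)
Lemma profile_neq l : 0 < l -> ~ {ae mu2, forall x : pl, TT f x = q0 * Gr l x}.
Proof.
move=> l0 hW; have sl := sq_Green l0; have q00 := profile_charge.
pose h x := f x - q0 * (w - l) * Gr l x; have sh : sq mu2 h by apply: sqB => //; exact: sqZ.
have hz : {ae mu2, forall x, cG w h x = 0}.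
  apply: filterS2 hW (green_diff w0 l0) => x e1 e2.
  have -> : cG w h x = cG w f x - q0 * (w - l) * cG w (Gr l) x.
    rewrite !cGE /conv -(IntZ _ (Lpt_sq w0 sl x)) -(IntB (Lpt_sq w0 sf x) (L1Z _ (Lpt_sq w0 sl x))).
    by apply: eq_Rintegral => y _; rewrite /h; ring.
  have e3 : cG w f x = q0 * Gr l x - q0 * Gr w x by rewrite -e1 /dual_op -/q0 addrK.
  by rewrite e3 -mulrBr -(opprB (Gr w x)) e2; ring.
have fE := cG_inj w0 sh hz; have p20 : 0 < p - 2 by rewrite subr_gt0.
have p10 : 0 < p - 1 by rewrite subr_gt0 (lt_trans _ hp)// ltr1n.
apply: (@Green_not_cst R l ((w - l) `^ (p - 2)^-1 / q0) l0).
apply: filterS2 hW (filterI fE (ae_neq0 R)) => x e1 [/subr0_eq e2 x0].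
have g0 : 0 < q0 * Gr l x by apply: mulr_gt0 => //; exact: Green_gt0.
have e3 : (q0 * Gr l x) `^ (p - 1) = q0 * (w - l) * Gr l x.
  by rewrite -e1 -e2; case: Pf => _ _ ->.
have e4 : (q0 * Gr l x) `^ (p - 2) = w - l.
  apply: (mulfI (lt0r_neq0 g0)); rewrite (mulrAC q0) in e3; rewrite -e3.
  by rewrite -(mulr_powRB1 (ltW g0) p10); congr (_ * _ `^ _); ring.
rewrite -e4 -powRrM divff ?gt_eqF// powRr1 ?ltW//.
by rewrite mulrC mulKf// gt_eqF.
Qed.

Section Function.
Variable v : R * R -> R[i].
Hypotheses (L2v : L2 v) (v1 : {ae mu2, forall x : pl, cre v x = a * TT f x})
  (v2 : {ae mu2, forall x : pl, cim v x = b * TT f x}).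

Lemma charge_profile l q : 0 < l -> H1 (regular_part l q v) -> q = (a * q0) +i* (b * q0).
Proof.
move=> l0 H; have sG := sq_Green w0; have [s1 s2] := (L2P v).1 L2v.
have rH c : rH1 (fun x : pl => 0 + c * cG w f x) (fun i x => 0 + c * ck i w f x).
  apply: rH1_lin (rH1_cG w0 sf); exact: rH1_0.
have D c (t : pl -> R) : sq mu2 t -> {ae mu2, forall x : pl, t x = c * TT f x} ->
    rdec w (c * q0) t (fun i x => 0 + c * ck i w f x).
  move=> st ht; apply: rH1_ae (rH c); first by apply: measurable_funB; [exact: st.1|apply: measurable_funM => //; exact: sG.1].
  by apply: filterS ht => x ->; rewrite /dual_op -/q0; ring.
exact: H1_charge l0 w0 H (D a _ s1 v1) (D b _ s2 v2).
Qed.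

Lemma profile_regular l q : 0 < l -> H1 (regular_part l q v) ->
  ~ eq_ae (regular_part l q v) (fun=> 0) /\ q <> 0.
Proof.
move=> l0 H; have qE := charge_profile l0 H; have q00 := profile_charge; have [ab _ _] := Pf.
split=> [z|q_0]; last first.
  have := congr1 (@complex.Re R) (etrans (esym qE) q_0); have := congr1 (@complex.Im R) (etrans (esym qE) q_0).
  move=> /= /eqP; rewrite mulf_eq0 (gt_eqF q00) orbF => /eqP b0 /eqP; rewrite mulf_eq0 (gt_eqF q00) orbF => /eqP a0.
  by move/eqP: ab; rewrite a0 b0 expr0n addr0 eq_sym oner_eq0.
have z' : {ae mu2, forall x : pl, regular_part l q v x = 0} by move: z; rewrite /eq_ae leb2E.
apply: (profile_neq l0); apply: filterS2 z' (filterI v1 v2) => x e [e1 e2].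
have er : cre (regular_part l q v) x = 0 by rewrite /cre e.
have ei : cim (regular_part l q v) x = 0 by rewrite /cim e.
move: er ei; rewrite regular_part_re regular_part_im e1 e2 qE /= -!mulrA -!mulrBr.
have [a0|an] := eqVneq a 0.
  have bn : b != 0 by apply: contra_eqN ab => /eqP ->; rewrite a0 expr0n addr0 eq_sym oner_eq0.
  by move=> _ /eqP; rewrite mulf_eq0 (negPf bn) /= subr_eq0 => /eqP.
by move=> /eqP; rewrite mulf_eq0 (negPf an) /= subr_eq0 => /eqP.
Qed.

End Function.

Let z0 : R[i] := a +i* b.
Let c0 : R[i] := a -i* b.
(** The representative of the minimizer for which positivity, symmetry and monotonicity hold
    pointwise off the origin. *)
Definition profile_fun : R * R -> R[i] := fun x => z0 * (TT f x)%:C.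

Let c0z0 : c0 * z0 = 1.
Proof.
have [ab _ _] := Pf; apply/eqP; rewrite eq_complex /=; apply/andP; split; apply/eqP.
  by rewrite -ab; ring.
by ring.
Qed.

Lemma profile_energy : energy_space profile_fun.
Proof.
have sT : sq mu2 (TT f) by apply: sqD; [exact: sq_cG|apply: sqZ; exact: sq_Green].
split.
  by apply/L2P; rewrite /profile_fun /cre /cim; split; under eq_fun do rewrite ?re_mulC ?im_mulC; exact: sqZ.
exists (z0 * q0%:C), w; split => //; apply: (@H1_cG R w z0 f) => // x.
rewrite /regular_part /profile_fun -GrE /dual_op -/q0 -mulrA -mulrBr; congr (_ * _).
by rewrite -rmorphM -rmorphB addrK.
Qed.

Lemma profile_main : [/\ cabs c0 = 1, energy_space profile_fun &
  [/\ positive_off0 (fun x => c0 * profile_fun x), radial (fun x => c0 * profile_fun x),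
      radially_decreasing (fun x => c0 * profile_fun x) &
      forall (l : R) (q : R[i]), 0 < l -> H1 (regular_part l q profile_fun) ->
        (l = w -> nonnegative_off0 (fun x => c0 * regular_part l q profile_fun x)) /\
        (w < l -> positive_off0 (fun x => c0 * regular_part l q profile_fun x))]].
Proof.
have [ab [pf _ If Jf] _] := Pf; have q00 := profile_charge.
have cW x : c0 * profile_fun x = (TT f x)%:C by rewrite /profile_fun mulrA c0z0 mul1r.
split; [by rewrite /cabs /= sqrrN ab sqrtr1|exact: profile_energy|split].
- by move=> x x0; rewrite cW ltcR; exact: profile_gt0.
- by move=> x y xy; rewrite !cW (TT_radial hp w0 k0 pf sf If Jf xy).
- by move=> x y x0 xy; rewrite !cW ltcR; exact: (TT_decreasing hp w0 k0 pf sf If Jf).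
move=> l q l0 H.
have L2w : L2 profile_fun by case: profile_energy.
have ae1 : {ae mu2, forall x : pl, cre profile_fun x = a * TT f x}.
  by apply: aeW => x; rewrite /cre /profile_fun re_mulC.
have ae2 : {ae mu2, forall x : pl, cim profile_fun x = b * TT f x}.
  by apply: aeW => x; rewrite /cim /profile_fun im_mulC.
have qE := charge_profile L2w ae1 ae2 l0 H.
(* After removing the phase, the regular part is the potential of [f] plus [q0 (G_w - G_l)]; as
   [q0 > 0], its sign is read off from the position of [l] with respect to [w]. *)
have cR x : c0 * regular_part l q profile_fun x = (cG w f x + q0 * (Gr w x - Gr l x))%:C.
  rewrite /regular_part mulrBr cW -GrE.
  have -> : q = z0 * q0%:C.
    by rewrite qE /z0; apply/eqP; rewrite eq_complex /=; apply/andP; split; apply/eqP; ring.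
  rewrite mulrA mulrA c0z0 mul1r -rmorphM -rmorphB; congr (_%:C); rewrite /dual_op -/q0; ring.
split=> [lw x x0|wl x x0].
  by rewrite (cR x) lecR lw subrr mulr0 addr0; exact: cG_ge0.
rewrite (cR x) ltcR; apply: ltr_wpDl; first exact: cG_ge0.
by apply: mulr_gt0 => //; rewrite subr_gt0; exact: Green_decl.
Qed.

Lemma profile_ae u : {ae mu2, forall x : pl, cre u x = a * TT f x} ->
  {ae mu2, forall x : pl, cim u x = b * TT f x} -> eq_ae profile_fun u.
Proof.
rewrite /eq_ae leb2E => h1 h2; apply: filterS2 h1 h2 => x; rewrite /cre /cim => e1 e2.
apply/eqP; rewrite eq_complex /profile_fun re_mulC im_mulC e1 e2; apply/andP; split; exact/eqP.
Qed.

End Profile.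

End Main.

Theorem theorem1p11 (R : realType) (p alpha : R) (hp : 2 < p) :
  (forall omega : R,
     (exists u : R * R -> R[i], action_minimizer p alpha omega u) <->
     omega0 alpha < omega) /\
  (forall (omega : R) (u : R * R -> R[i]),
     omega0 alpha < omega -> action_minimizer p alpha omega u ->
     (forall (lambda : R) (q : R[i]),
        0 < lambda -> H1 (regular_part lambda q u) ->
        ~ eq_ae (regular_part lambda q u) (fun=> 0) /\ q <> 0) /\
     (exists (c : R[i]) (w : R * R -> R[i]),
        [/\ cabs c = 1, eq_ae w u, energy_space w &
            [/\ positive_off0 (fun x => c * w x),
                radial (fun x => c * w x),
                radially_decreasing (fun x => c * w x) &
                forall (lambda : R) (q : R[i]),
                  0 < lambda -> H1 (regular_part lambda q w) ->
                  (lambda = omega ->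
                     nonnegative_off0 (fun x => c * regular_part lambda q w x)) /\
                  (omega < lambda ->
                     positive_off0 (fun x => c * regular_part lambda q w x))]])).
Proof.
split=> [omega|omega u hw Au].
  split=> [[u Au]|]; last exact: exists_minimizer.
  by rewrite ltNge; apply/negP => wl; exact: (no_minimizer hp wl Au).
have [a [b [f [Pf v1 v2]]]] := minimizer_profile hp hw Au.
have L2u : L2 u by case: Au => -[[]].
split=> [lambda q l0 H|]; first exact: (profile_regular hp hw Pf L2u v1 v2 l0 H).
have [c1 Ew Pw] := profile_main hp hw Pf.
by exists (a -i* b), (profile_fun alpha omega a b f); split => //; exact: profile_ae.
Qed.
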